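(* Let $1\le m<n$, $A\in\mathcal L(\mathbb R^n)$, $B\in\mathcal L(\mathbb R^m,\mathbb R^n)$ (time-independent) and $\sigma\in\mathcal L(\mathbb R^n)$ satisfy: (a) the Kalman rank condition $\operatorname{rank}\,[B,AB,\dots,A^{n-1}B]=n$; (b) for some $a\in\mathbb R$, $\sigma^k=a\,\sigma$ for all integers $k\ge2$; (c) $\sigma(\mathbb R^n)\subset B(\mathbb R^m)$. Let $T>0$ and $x\in\mathbb R^n$ be arbitrary. Then there is an $(\mathcal F_t)_{t\ge0}$-adapted controller $u\in L^2((0,T)\times\Omega;\mathbb R^m)$ which steers $x$ into the origin in time $T$ with probability one; that is, the solution $X$ of $$dX+AX\,dt=\sigma X\,d\beta+Bu\,dt,\quad t\in(0,T),\qquad X(0)=x,$$ satisfies $X(T)=0$ $\mathbb P$-a.s.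
   Context: $\beta$ is a real Brownian motion on a probability space $(\Omega,\mathcal F,\mathbb P)$ and $(\mathcal F_t)_{t\ge0}$ is the corresponding (augmented) filtration. $\mathcal L(\mathbb R^m,\mathbb R^n)$ denotes the linear maps from $\mathbb R^m$ to $\mathbb R^n$, $\mathcal L(\mathbb R^n)=\mathcal L(\mathbb R^n,\mathbb R^n)$, and $\sigma^k$ is the $k$-th power of the matrix $\sigma$. *)

(* Defs.v *)
From HB Require Import structures.
From mathcomp Require Export all_boot all_order all_algebra.
From mathcomp Require Export all_classical all_reals all_analysis.

Set Implicit Arguments.
Unset Strict Implicit.
Unset Printing Implicit Defensive.

Export Order.TTheory GRing.Theory Num.Theory.
Export numFieldNormedType.Exports.

#[global] Open Scope classical_set_scope.
#[global] Open Scope ring_scope.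

Definition L2_on {d : measure_display} {T : measurableType d} {R : realType}
    (mu : set T -> \bar R) (D : set T) (f : T -> R) : Prop :=
  measurable_fun D f /\ (\int[mu]_(z in D) (f z ^+ 2)%:E < +oo)%E.

Section stochastic.
Context {R : realType} {d : measure_display} {Omega : measurableType d}.
Variable P : probability Omega R.

Definition wrt_measurable (G : set (set Omega)) (f : Omega -> R) : Prop :=
  forall Y : set R, measurable Y -> G (f @^-1` Y).

(* The cylinder ]0, t[ x Omega. *)
Definition cylinder (t : R) : set (R * Omega) := `]0, t[ `*` [set: Omega].

Definition process_L2 (t : R) (f : R -> Omega -> R) : Prop :=
  L2_on (lebesgue_measure \x P)%E (cylinder t) (fun z => f z.1 z.2).

(* Processes indexed by nonnegative times are functions on all of R, whose
   values at negative times play no role. *)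
Definition natural_filtration (beta : R -> Omega -> R) (t : R) :
    set (set Omega) :=
  <<s \bigcup_(s in `[0, t]) preimage_set_system setT (beta s) measurable >>.

Definition augmented_filtration (beta : R -> Omega -> R) (t : R) :
    set (set Omega) :=
  <<s natural_filtration beta t `|` [set N | measurable N /\ P N = 0%E] >>.

(* The second argument of normal_prob is the standard deviation. *)
Record brownian_motion (beta : R -> {RV P >-> R}) : Prop := BrownianMotion {
  bm_start : {ae P, forall w, beta 0 w = 0} ;
  bm_increment_indep : forall s t : R, 0 <= s -> s <= t ->
    forall (E : set Omega) (Y : set R),
      natural_filtration (fun r => beta r) s E -> measurable Y ->
      (P (E `&` ((beta t \- beta s)%R @^-1` Y)) =
       P E * P ((beta t \- beta s)%R @^-1` Y))%E ;
  bm_increment_law : forall s t : R, 0 <= s -> s < t ->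
    forall Y : set R, measurable Y ->
      P ((beta t \- beta s) @^-1` Y) =
      normal_prob 0 (Num.sqrt (t - s)) Y ;
  bm_continuous : {ae P, forall w,
    {within [set t : R | 0 <= t], continuous (fun t => beta t w)}}
}.

Section ito.
Variable beta : R -> Omega -> R.

Local Notation F := (augmented_filtration beta).

(* The process \sum_(i < N) xi_i 1_{]t_i, t_{i+1}]}, with xi_i square
   integrable and F_{t_i}-measurable. *)
Record simple_process := SimpleProcess {
  sp_size : nat ;
  sp_time : nat -> R ;
  sp_coef : nat -> Omega -> R ;
  sp_time_ge0 : 0 <= sp_time 0%N ;
  sp_time_le : forall i : nat, sp_time i <= sp_time i.+1 ;
  sp_coef_adapted : forall i : nat, wrt_measurable (F (sp_time i)) (sp_coef i) ;
  sp_coef_L2 : forall i : nat, L2_on P setT (sp_coef i)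
}.

Definition sp_val (S : simple_process) (s : R) (w : Omega) : R :=
  \sum_(i < sp_size S)
    sp_coef S i w * \1_(`]sp_time S i, sp_time S i.+1]) s.

Definition sp_integral (S : simple_process) (t : R) (w : Omega) : R :=
  \sum_(i < sp_size S) sp_coef S i w *
    (beta (Num.min (sp_time S i.+1) t) w - beta (Num.min (sp_time S i) t) w).

(* I is (a version of) the Ito integral of f over (0, t) : the L2(P) limit of
   the integrals of simple processes that tend to f in L2((0, t) x Omega). *)
Definition is_ito_integral (t : R) (f : R -> Omega -> R) (I : Omega -> R) :
    Prop :=
  [/\ forall s, s \in `]0, t[ -> wrt_measurable (F s) (f s),
      process_L2 t f,
      L2_on P setT I &
      exists S : nat -> simple_process,
        (\int[(lebesgue_measure \x P)%E]_(z in cylinder t)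
           ((sp_val (S k) z.1 z.2 - f z.1 z.2) ^+ 2)%:E)%E
           @[k --> \oo] --> 0%E /\
        (\int[P]_w ((sp_integral (S k) t w - I w) ^+ 2)%:E)%E
           @[k --> \oo] --> 0%E].

Definition adapted_on {n : nat} (D : set R) (X : R -> Omega -> 'cV[R]_n) :
    Prop :=
  forall (t : R) (i : 'I_n), D t -> wrt_measurable (F t) (fun w => X t w i 0).

Definition square_integrable {n : nat} (T : R) (X : R -> Omega -> 'cV[R]_n) :
    Prop :=
  forall i : 'I_n, process_L2 T (fun t w => X t w i 0).

Definition admissible_control {m : nat} (T : R) (u : R -> Omega -> 'cV[R]_m) :
    Prop :=
  adapted_on `]0, T[ u /\ square_integrable T u.

Definition time_integral {n : nat} (t : R) (f : R -> 'cV[R]_n) : 'cV[R]_n :=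
  \col_i (\int[lebesgue_measure]_(s in `]0, t[) f s i 0).

(* dX + A X dt = sigma X dbeta + B u dt on (0, T), X(0) = x, in integral form;
   M t is the stochastic integral of sigma X over (0, t). *)
Definition sde_solution {m n : nat} (A : 'M[R]_n) (B : 'M[R]_(n, m))
    (sigma : 'M[R]_n) (T : R) (x : 'cV[R]_n) (u : R -> Omega -> 'cV[R]_m)
    (X : R -> Omega -> 'cV[R]_n) : Prop :=
  [/\ adapted_on `[0, T] X,
      square_integrable T X,
      {ae P, forall w, {within `[0, T], continuous (fun t => X t w)}},
      {ae P, forall w, X 0 w = x} &
      exists M : R -> Omega -> 'cV[R]_n,
        forall t : R, t \in `[0, T] ->
          (forall i : 'I_n, is_ito_integral t
             (fun s w => (sigma *m X s w) i 0) (fun w => M t w i 0)) /\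
          {ae P, forall w,
             X t w + time_integral t (fun s => A *m X s w) =
             x + M t w + time_integral t (fun s => B *m u s w)}].

End ito.
End stochastic.

(* The block matrix [B, AB, ..., A^{n-1}B]. *)
Definition kalman_matrix {R : realType} {m n : nat} (A : 'M[R]_n)
    (B : 'M[R]_(n, m)) : 'M[R]_(n, \sum_(k < n) m) :=
  \mxrow_(k < n) (A ^+ k *m B).

(* Main.v *)
Require Import Defs.
From mathcomp Require Import measurable_realfun ring lra.

(** Comparing [sigma ^+ 2 = a sigma] with [sigma ^+ 3 = a sigma] shows that [a] may be taken in {0,
    1}, and the range condition factors [sigma = B K] with [K B K = a K] ([power_eigen_bool],
    [range_factor]). The flow of dX = sigma X dbeta is then [1 + g sigma] with a scalar g: the
    increment of beta if a = 0, and exp(increment - h/2) - 1 over a time h if a = 1 ([gain]).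
    Writing X = Y + g sigma Y turns the stochastic equation into a random differential equation (1 +
    g sigma) Y' = -A X + B u. To return to Ito integrals only one product rule is needed, that the
    integral of e q dbeta is g q minus the time integral of g q', with e = 1 + a g; it is proved
    with Riemann sums ([ito_product]).

    One stage, of length dl. Kalman's condition gives coordinates Z of the state in which the
    deterministic system is a chain of integrators whose input is the derivative of column 0
    ([chain_lift_shift], [chain_lift_surj]). Polynomials from Hermite interpolation bring Z to 0 in
    time dl. Since the range of sigma lies in the range of B, the noise only asks for a correction
    [eta] of column 0; its effect on the other columns is an error W, which solves a linear integral
    equation with coefficients known at each time, so the control is adapted. At the end of the
    stage the polynomial part has vanished and only terms in W survive. As g is of order sqrt dl,
    the normalised coordinates U before and U' after the stage satisfy E|U'|^2 <= D dl E|U|^2, with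
    D the same for all stages ([stage_exists], [stage_moments]).

    The delicate point is integrability. The bound for W contains the exponential of the rate of its
    equation, and if that rate were a log-normal g, no moment would be finite. Shifting Y by a
    multiple of [K zeta] replaces the rate by [kap], which is -1 when a = 1 and Gaussian when a = 0
    ([st_liftE], [kap_exp]).

    Stages of lengths dl_k = T / 2^(k+1) are put end to end and accumulate at T. The contraction
    factor D dl_k tends to 0, hence E|U_k|^2 <= V dl_k^2 ([contraction_bound]). This pays for the
    cost 1 / dl_k of acting within stage k: state and control are bounded in mean square on (0, T),
    and the state at the stage times tends to 0, so X(T) = 0 by path continuity ([glue_solution],
    [glue_terminal]). Any other solution with the same control agrees almost surely, by a comparison
    of Ito integrals and Gronwall ([ito_difference], [sde_unique]). *)

Set Implicit Arguments.
Unset Strict Implicit.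
Unset Printing Implicit Defensive.
Local Open Scope ring_scope.

(** * Integrals of real-valued functions and a measurability tactic *)

Section RealIntegrands.
Context {d : measure_display} {T : measurableType d} {R : realType}.
Variables (mu : {measure set T -> \bar R}) (D : set T).
Hypothesis mD : measurable D.
Implicit Types f g : T -> R.

Lemma ge0_le_integral_EFin f g : measurable_fun D f -> measurable_fun D g ->
  (forall x, D x -> 0 <= f x) -> (forall x, D x -> f x <= g x) ->
  (\int[mu]_(x in D) (f x)%:E <= \int[mu]_(x in D) (g x)%:E)%E.
Proof.
move=> mf mg f0 fg; apply: ge0_le_integral => //.
- exact/measurable_EFinP.
- exact/measurable_EFinP.
Qed.

Lemma ge0_integralD_EFin f g : measurable_fun D f -> measurable_fun D g ->
  (forall x, D x -> 0 <= f x) -> (forall x, D x -> 0 <= g x) ->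
  (\int[mu]_(x in D) (f x + g x)%:E =
   \int[mu]_(x in D) (f x)%:E + \int[mu]_(x in D) (g x)%:E)%E.
Proof.
move=> mf mg f0 g0; under eq_integral do rewrite EFinD.
by rewrite ge0_integralD//; exact/measurable_EFinP.
Qed.

Lemma ge0_integralZ_EFin f (k : R) : measurable_fun D f -> 0 <= k ->
  (forall x, D x -> 0 <= f x) ->
  (\int[mu]_(x in D) (k * f x)%:E = k%:E * \int[mu]_(x in D) (f x)%:E)%E.
Proof.
move=> mf k0 f0; under eq_integral do rewrite EFinM.
by rewrite ge0_integralZl//; exact/measurable_EFinP.
Qed.

Lemma ge0_integral_sum_EFin (I : Type) (s : seq I) (f : I -> T -> R) :
  (forall i, measurable_fun D (f i)) -> (forall i x, D x -> 0 <= f i x) ->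
  (\int[mu]_(x in D) (\sum_(i <- s) f i x)%:E =
   \sum_(i <- s) \int[mu]_(x in D) (f i x)%:E)%E.
Proof.
move=> mf f0; under eq_integral do rewrite -sumEFin.
by rewrite ge0_integral_sum// => i; exact/measurable_EFinP.
Qed.

Lemma integral_ge0_EFin f : (forall x, D x -> 0 <= f x) ->
  (0 <= \int[mu]_(x in D) (f x)%:E)%E.
Proof. by move=> f0; apply: integral_ge0 => x Dx; rewrite lee_fin f0. Qed.

Lemma integrableZ_EFin (k : R) f : mu.-integrable D (fun x => (f x)%:E) ->
  mu.-integrable D (fun x => (k * f x)%:E).
Proof.
by move=> fi; under eq_fun do rewrite EFinM; exact: integrableZl.
Qed.

Lemma integrableD_EFin f g : mu.-integrable D (fun x => (f x)%:E) ->
  mu.-integrable D (fun x => (g x)%:E) -> mu.-integrable D (fun x => (f x + g x)%:E).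
Proof.
by move=> fi gi; under eq_fun do rewrite EFinD; exact: integrableD.
Qed.

Lemma integrableB_EFin f g : mu.-integrable D (fun x => (f x)%:E) ->
  mu.-integrable D (fun x => (g x)%:E) -> mu.-integrable D (fun x => (f x - g x)%:E).
Proof.
by move=> fi gi; under eq_fun do rewrite EFinB; exact: integrableB.
Qed.

Lemma integrable_sum_EFin (I : Type) (s : seq I) (f : I -> T -> R) :
  (forall i, mu.-integrable D (fun x => (f i x)%:E)) ->
  mu.-integrable D (fun x => (\sum_(i <- s) f i x)%:E).
Proof.
by move=> fi; under eq_fun do rewrite -sumEFin; exact: integrable_sum.
Qed.

Lemma Rintegral_sum (I : Type) (s : seq I) (f : I -> T -> R) :
  (forall i, mu.-integrable D (fun x => (f i x)%:E)) ->
  \int[mu]_(x in D) (\sum_(i <- s) f i x) = \sum_(i <- s) \int[mu]_(x in D) f i x.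
Proof.
move=> fi; elim: s => [|i s ih].
  rewrite big_nil; under eq_Rintegral do rewrite big_nil.
  by rewrite /Rintegral integral0.
rewrite big_cons -ih -RintegralD//; try by [exact: fi|exact: integrable_sum_EFin].
by under eq_Rintegral do rewrite big_cons.
Qed.

End RealIntegrands.

Lemma measurable_fun_norm {d} {T : measurableType d} {R : realType} (D : set T)
  (f : T -> R) : measurable_fun D f -> measurable_fun D (fun x => `|f x|).
Proof. by move=> mf; apply: measurableT_comp. Qed.

Lemma measurable_fun_expR {d} {T : measurableType d} {R : realType} (D : set T)
  (f : T -> R) : measurable_fun D f -> measurable_fun D (fun x => expR (f x)).
Proof. by move=> mf; apply: measurableT_comp. Qed.

Ltac meas := first [assumption | lazymatch goal with
| |- measurable_fun _ (fun w => EFin (@?f w)) => apply/measurable_EFinP; meas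
| |- measurable_fun ?D (fun w => @GRing.add _ (@?f w) (@GRing.opp _ (@?g w))) =>
    apply: (@measurable_funB _ _ _ D f g); meas
| |- measurable_fun ?D (fun w => @GRing.add _ (@?f w) (@?g w)) =>
    apply: (@measurable_funD _ _ _ D f g); meas
| |- measurable_fun ?D (fun w => @GRing.mul _ (@?f w) (@?g w)) =>
    apply: (@measurable_funM _ _ _ D f g); meas
| |- measurable_fun ?D (fun w => @GRing.opp _ (@?f w)) =>
    apply: (@measurable_funN _ _ _ D f); meas
| |- measurable_fun ?D (fun w => @GRing.exp _ (@?f w) ?n) =>
    apply: (@measurable_funX _ _ _ D f n); meas
| |- measurable_fun ?D (fun w => @Num.norm _ _ (@?f w)) =>
    apply: (@measurable_fun_norm _ _ _ D f); meas
| |- measurable_fun ?D (fun w => @expR _ (@?f w)) =>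
    apply: (@measurable_fun_expR _ _ _ D f); meas
| |- measurable_fun ?D (fun w => \sum_(i <- ?s) @?f w i) =>
    apply: measurable_sum => ? /=; meas
| |- _ => try first [exact: measurable_cst | done]
end].

(** * The augmented filtration and independence of increments *)

Section Filtration.
Context {R : realType} {d : measure_display} {Omega : measurableType d}.
Variables (P : probability Omega R) (beta : R -> {RV P >-> R}).

Local Notation Fgen t := (natural_filtration (fun r => beta r) t `|`
  [set N | measurable N /\ P N = 0%E]).
Local Notation FT t := (g_sigma_algebraType (Fgen t)).
Local Notation F := (augmented_filtration P (fun r => beta r)).

Lemma natural_filtration_measurable t :
  natural_filtration (fun r => beta r) t `<=` measurable.
Proof.
apply: smallest_sub; first exact: sigma_algebra_measurable.
move=> A [s _] [Y mY <-]; rewrite setTI; exact: measurable_funPTI.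
Qed.

Lemma natural_filtrationS s t : s <= t ->
  natural_filtration (fun r => beta r) s `<=`
  natural_filtration (fun r => beta r) t.
Proof.
move=> st; apply: sub_sigma_algebra2 => A [r /= rs hA]; exists r => //.
by move: rs; rewrite /= !in_itv/= => /andP[-> /le_trans ->].
Qed.

Lemma augmented_filtration_measurable t : F t `<=` measurable.
Proof.
apply: smallest_sub; first exact: sigma_algebra_measurable.
by move=> A [/(natural_filtration_measurable)|[]].
Qed.

Lemma augmented_filtrationS s t : s <= t -> F s `<=` F t.
Proof.
move=> st; apply: sub_sigma_algebra2 => A [|]; last by right.
by move=> ?; left; exact: natural_filtrationS st _ _.
Qed.

Lemma augmented_filtration_null t N : measurable N -> P N = 0%E -> F t N.
Proof. by move=> mN N0; apply: sub_sigma_algebra; right. Qed.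

Lemma wrt_measurableP t (f : Omega -> R) :
  wrt_measurable (F t) f <-> measurable_fun (setT : set (FT t)) f.
Proof.
split=> [mf _ Y mY|mf Y mY]; first by rewrite setTI; exact: mf.
by have := mf measurableT Y mY; rewrite setTI.
Qed.

Lemma wrt_measurableS s t (f : Omega -> R) : s <= t ->
  wrt_measurable (F s) f -> wrt_measurable (F t) f.
Proof. by move=> st mf Y mY; apply: augmented_filtrationS st _ (mf _ mY). Qed.

Lemma wrt_measurable_fun t (f : Omega -> R) : wrt_measurable (F t) f -> measurable_fun setT f.
Proof.
by move=> mf _ Y mY; rewrite setTI; exact: augmented_filtration_measurable (mf _ mY).
Qed.

Lemma wrt_measurable_beta s t : 0 <= s <= t -> wrt_measurable (F t) (beta s).
Proof.
move=> st Y mY; apply: sub_sigma_algebra; left.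
apply: sub_sigma_algebra; exists s; first by rewrite /= in_itv.
by exists Y => //; rewrite setTI.
Qed.

(* modification on a null set keeps adaptedness *)
Lemma wrt_measurable_null t N (f g : Omega -> R) : measurable N -> P N = 0%E ->
  (forall w, ~ N w -> f w = g w) -> measurable_fun setT g ->
  wrt_measurable (F t) f -> wrt_measurable (F t) g.
Proof.
move=> mN N0 fg mg mf Y mY.
have mgY : measurable (g @^-1` Y) by rewrite -[g @^-1` _]setTI; exact: mg.
have -> : g @^-1` Y = (f @^-1` Y `\` N) `|` (g @^-1` Y `&` N).
  apply/seteqP; split=> w /=.
    move=> gY; case: (pselect (N w)) => Nw; [by right|left; split=> //].
    by rewrite /= fg.
  by move=> [[]|[]]//= fY Nw; rewrite -fg.
apply: (@measurableU _ (FT t)).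
  apply: (@measurableD _ (FT t)); first exact: mf.
  exact: augmented_filtration_null.
apply: augmented_filtration_null; first exact: measurableI.
apply/eqP; rewrite eq_le measure_ge0 andbT -N0; apply: le_measure; rewrite ?inE//.
exact: measurableI.
Qed.

Hypothesis hbeta : brownian_motion beta.

(** Independence is given for the natural filtration only. Both sides, as functions of [A], are
    finite measures: a restriction of [P] and a multiple of [P]. They agree on natural events and on
    null sets, and these generators are stable under intersection, since an intersection with a null
    set is null. *)
Lemma increment_indep s t A Y : 0 <= s <= t -> F s A -> measurable Y ->
  P (A `&` ((beta t \- beta s)%R @^-1` Y)) =
  (P A * P ((beta t \- beta s)%R @^-1` Y))%E.
Proof.
move=> /andP[s0 st] FA mY; set D := _ @^-1` _.
have mD : measurable D.
  by rewrite /D -[_ @^-1` _]setTI; apply: measurable_funB => //.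
have PDfin : P D \is a fin_num by apply: fin_num_measure.
have e0 : 0 <= fine (P D) by rewrite fine_ge0.
pose m1 : {measure set Omega -> \bar R} := mrestr P mD.
pose m2 : {measure set Omega -> \bar R} := mscale (NngNum e0) P.
suff -> : P (A `&` D) = m2 A by rewrite /m2 /= /mscale /= fineK// muleC.
have -> : P (A `&` D) = m1 A by [].
apply: (@g_sigma_algebra_measure_unique _ R Omega (Fgen s) _ (fun=> setT)) => //.
- by move=> X [/(natural_filtration_measurable)|[]].
- move=> _; left; exact: (@measurableT _ (g_sigma_algebraType _)).
- by rewrite bigcup_const.
- move=> X Y'; case=> [nX|[mX X0]]; case=> [nY|[mY' Y0]].
  + left; exact: (@measurableI _ (g_sigma_algebraType _)).
  + right; have mX := natural_filtration_measurable nX.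
    split; first exact: measurableI.
    apply/eqP; rewrite eq_le measure_ge0 andbT -Y0.
    by apply: le_measure; rewrite ?inE//; exact: measurableI.
  + right; have mY' := natural_filtration_measurable nY.
    split; first exact: measurableI.
    apply/eqP; rewrite eq_le measure_ge0 andbT -X0.
    by apply: le_measure; rewrite ?inE//; exact: measurableI.
  + right; split; first exact: measurableI.
    apply/eqP; rewrite eq_le measure_ge0 andbT -X0.
    by apply: le_measure; rewrite ?inE//; exact: measurableI.
- move=> X [nX|[mX X0]].
    rewrite /m1 /m2 /= /mscale /mrestr /= fineK// muleC.
    by rewrite (bm_increment_indep hbeta s0 st nX mY).
  rewrite /m1 /m2 /= /mscale /mrestr /= X0 mule0.
  apply/eqP; rewrite eq_le measure_ge0 andbT -X0.
  by apply: le_measure; rewrite ?inE//; exact: measurableI.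
- by move=> _; rewrite /m1 /= /mrestr /= setTI; exact: le_lt_trans (probability_le1 _ mD) (ltry _).
Qed.

(** By [increment_indep] the joint law of [X] and the increment has the product value on rectangles,
    hence is the product of the two laws; Tonelli then separates the integrals. *)
Lemma expect_indep s t (f phi : R -> R) (X : Omega -> R) : 0 <= s <= t ->
  wrt_measurable (F s) X -> measurable_fun setT f -> measurable_fun setT phi ->
  (forall x, 0 <= f x) -> (forall x, 0 <= phi x) ->
  (\int[P]_w (f (X w) * phi (beta t w - beta s w))%:E =
   \int[P]_w (f (X w))%:E * \int[P]_w (phi (beta t w - beta s w))%:E)%E.
Proof.
move=> st mX mf mphi f0 phi0.
have mXT := wrt_measurable_fun mX.
have mI : measurable_fun setT (beta t \- beta s)%R by exact: measurable_funB.
pose X' : {mfun Omega >-> R} := mfun_Sub (mem_set mXT).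
pose I' : {mfun Omega >-> R} := mfun_Sub (mem_set mI).
pose Z w := (X' w, I' w).
have mZ : measurable_fun setT Z by exact: measurable_fun_pair.
pose Z' : {mfun Omega >-> (R * R)%type} := mfun_Sub (mem_set mZ).
pose m1 : probability _ R := distribution P X'.
pose m2 : probability _ R := distribution P I'.
pose m : probability _ R := distribution P Z'.
have mE (C : set (R * R)) : measurable C -> (m1 \x m2)%E C = m C.
  apply: product_measure_unique => A B mA mB.
  by apply: (increment_indep st _ mB); exact: mX.
pose h (z : R * R) := (f z.1 * phi z.2)%:E.
have mh : measurable_fun setT h.
  by apply/measurable_EFinP; apply: measurable_funM; exact: measurableT_comp.
have h0 z : (0 <= h z)%E by rewrite lee_fin mulr_ge0.
have -> : (\int[P]_w (f (X w) * phi (beta t w - beta s w))%:E =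
  \int[m]_z h z)%E.
  rewrite /m /distribution ge0_integral_pushforward//=.
have -> : (\int[m]_z h z = \int[(m1 \x m2)%E]_z h z)%E.
  apply: eq_measure_integral => C mC _; exact/esym/mE.
rewrite fubini_tonelli1//= /fubini_F.
have -> : (\int[P]_w (f (X w))%:E = \int[m1]_x (f x)%:E)%E.
  by rewrite /m1 /distribution ge0_integral_pushforward//=; [exact/measurable_EFinP|move=> x _; rewrite lee_fin].
have -> : (\int[P]_w (phi (beta t w - beta s w))%:E = \int[m2]_x (phi x)%:E)%E.
  by rewrite /m2 /distribution ge0_integral_pushforward//=; [exact/measurable_EFinP|move=> x _; rewrite lee_fin].
rewrite -ge0_integralZr//=; first last.
- by apply: integral_ge0 => x _; rewrite lee_fin.
- by move=> x _; rewrite lee_fin.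
- exact/measurable_EFinP.
apply: eq_integral => x _; rewrite /h /=.
under eq_integral do rewrite EFinM.
by rewrite ge0_integralZl//=; [exact/measurable_EFinP|move=> y _; rewrite lee_fin|rewrite lee_fin].
Qed.

End Filtration.

(** * Moments of Gaussian increments *)

Section GaussianMoments.
Context {R : realType}.
Local Notation mu := (@lebesgue_measure R).

(** The Radon-Nikodym derivative of the normal law and [normal_pdf] have the same integral over
    every measurable set, so they coincide almost everywhere and may be exchanged in the change of
    variables. *)
Lemma integral_normal_prob (m s : R) (f : R -> \bar R) :
  (forall x, 0 <= f x)%E -> measurable_fun setT f ->
  (\int[normal_prob m s]_x f x = \int[mu]_x (f x * (normal_pdf m s x)%:E))%E.
Proof.
move=> f0 mf.
have dom := normal_prob_dominates m s.
rewrite -(Radon_Nikodym_SigmaFinite.change_of_variables dom)//.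
have rn0 := Radon_Nikodym_SigmaFinite.f_ge0 dom.
have rni := Radon_Nikodym_SigmaFinite.f_integrable dom.
have mpdf : measurable_fun setT (fun x : R => (normal_pdf m s x)%:E).
  by apply/measurable_EFinP; exact: measurable_normal_pdf.
apply: ge0_ae_eq_integral => //=.
- by apply: emeasurable_funM => //; exact: measurable_int rni.
- exact: emeasurable_funM.
- by move=> x _; rewrite mule_ge0.
- by move=> x _; rewrite mule_ge0// lee_fin normal_pdf_ge0.
- apply: ae_eqe_mul2l.
  apply: integral_ae_eq => //= E _ mE.
  by rewrite -Radon_Nikodym_SigmaFinite.f_integral.
Qed.

(* Completing the square: [c x - (x / s)^2 / 2 = c^2 s^2 / 2 - ((x - c s^2) / s)^2 / 2]. *)
Lemma normal_prob_mgf (s c : R) : 0 < s ->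
  (\int[normal_prob 0 s]_x (expR (c * x))%:E = (expR (c ^+ 2 * s ^+ 2 / 2))%:E)%E.
Proof.
move=> s0; rewrite integral_normal_prob; first last.
- by apply/measurable_EFinP/measurableT_comp => //; exact: measurable_funM.
- by move=> x; rewrite lee_fin expR_ge0.
transitivity (\int[mu]_x ((expR (c ^+ 2 * s ^+ 2 / 2))%:E *
    (normal_pdf (c * s ^+ 2) s x)%:E))%E; last first.
  rewrite ge0_integralZl ?integral_normal_pdf ?mule1//.
  - by apply/measurable_EFinP; exact: measurable_normal_pdf.
  - by move=> x _; rewrite lee_fin normal_pdf_ge0.
apply: eq_integral => x _; rewrite -!EFinM; congr EFin.
rewrite !normal_pdfE ?gt_eqF// /normal_fun !(mulrCA _ (normal_peak s)).
congr (_ * _); rewrite -!expRD; congr expR.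
have : s != 0 by rewrite gt_eqF.
by move=> sn0; rewrite -(mulr_natr (s ^+ 2) 2); field.
Qed.

Lemma expn_le_expR n (x : R) : 0 <= x -> x ^+ n <= n`!%:R * expR x.
Proof.
move=> x0; case: n => [|n].
  by rewrite expr0 fact0 mul1r (le_trans _ (expR_ge1Dx x))// lerDl.
rewrite mulrC -ler_pdivrMr ?ltr0n ?fact_gt0//.
by rewrite (le_trans _ (expR_ge1Dxn n x0))// lerDr.
Qed.

Lemma expR_abs_le (x : R) : expR `|x| <= expR x + expR (- x).
Proof.
by case: (ger0P x) => _; rewrite (lerDl, lerDr) expR_ge0.
Qed.

(** With the factor [|x| ^+ n] taken out, the tail of the series from index [n] on is dominated
    termwise by the exponential series of [|x|], because [(i + n)! >= i!]. *)
Lemma expR_taylor_le n (x : R) :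
  `|expR x - \sum_(k < n) x ^+ k / k`!%:R| <= `|x| ^+ n * expR `|x|.
Proof.
have h : `|limn (series (exp_coeff x)) - \sum_(k < n) x ^+ k / k`!%:R| <=
    `|x| ^+ n * expR `|x|.
  have cv : (fun N => `|series (exp_coeff x) (N + n)%N - \sum_(k < n) x ^+ k / k`!%:R|)
     @ \oo --> `|limn (series (exp_coeff x)) - \sum_(k < n) x ^+ k / k`!%:R|.
    apply: cvg_norm; apply: cvgB; last exact: cvg_cst.
    by rewrite (cvg_shiftn n); exact: is_cvg_series_exp_coeff.
  apply: (cvgr_to_le cv); near=> N.
  rewrite seriesEnat /= addnC (@big_cat_nat _ _ _ n)/= ?leq_addr//.
  rewrite big_mkord addrAC subrr add0r.
  rewrite (le_trans (ler_norm_sum _ _ _))//.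
  rewrite -[X in \sum_(X <= _ < _) _](add0n n) big_addn addKn.
  apply: (@le_trans _ _ (\sum_(0 <= i < N) `|x| ^+ n * exp_coeff `|x| i)).
    apply: ler_sum => i _; rewrite /exp_coeff /= normrM normrX exprD.
    rewrite (mulrC (_ ^+ i)) -mulrA ler_wpM2l ?exprn_ge0// ler_wpM2l ?exprn_ge0//.
    rewrite ger0_norm ?invr_ge0 ?ler0n//.
    by rewrite lef_pV2 ?posrE ?ltr0n ?fact_gt0// ler_nat leq_fact ?leq_addr.
  rewrite -mulr_sumr ler_wpM2l ?exprn_ge0//.
  rewrite /expR; apply: nondecreasing_cvgn_le; last exact: is_cvg_series_exp_coeff.
  apply/nondecreasing_seqP => k; rewrite seriesSr lerDl.
  by rewrite exp_coeff_ge0.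
by [].
Unshelve. all: by end_near. Qed.

Lemma expR_taylor1 (x : R) : `|expR x - 1| <= `|x| * expR `|x|.
Proof.
have := expR_taylor_le 1 x.
by rewrite big_ord_recr big_ord0 /= add0r expr0 fact0 divr1 expr1.
Qed.

Lemma expR_taylor2 (x : R) : `|expR x - 1 - x| <= `|x| ^+ 2 * expR `|x|.
Proof.
have := expR_taylor_le 2 x.
rewrite 2!big_ord_recr big_ord0 /= add0r expr0 fact0 divr1 expr1.
by rewrite (_ : 1`! = 1)%N// divr1 opprD addrA.
Qed.

Lemma expR_taylor3 (x : R) :
  `|expR x - 1 - x - x ^+ 2 / 2| <= `|x| ^+ 3 * expR `|x|.
Proof.
have := expR_taylor_le 3 x.
rewrite 3!big_ord_recr big_ord0 /= add0r expr0 fact0 divr1 expr1.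
by rewrite (_ : 1`! = 1)%N// (_ : 2`! = 2)%N// divr1 !opprD !addrA.
Qed.

Lemma exprD_le n (a b : R) : 0 <= a -> 0 <= b ->
  (a + b) ^+ n <= 2 ^+ n * (a ^+ n + b ^+ n).
Proof.
move=> a0 b0; wlog ab : a b a0 b0 / a <= b.
  by move=> H; case: (leP a b) => [|/ltW] ?; [exact: H|rewrite addrC [X in _ * X]addrC; exact: H].
apply: (@le_trans _ _ ((2 * b) ^+ n)).
  by apply: lerXn2r; rewrite ?nnegrE ?addr_ge0 ?mulr_ge0//; lra.
by rewrite exprMn ler_wpM2l ?exprn_ge0// lerDr exprn_ge0.
Qed.

End GaussianMoments.

Section Increments.
Context {R : realType} {d : measure_display} {Omega : measurableType d}.
Variables (P : probability Omega R) (beta : R -> {RV P >-> R}).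
Hypothesis hbeta : brownian_motion beta.
Local Notation D s t := (fun w => beta t w - beta s w).

Lemma measurable_increment s t : measurable_fun setT (D s t).
Proof. exact: measurable_funB. Qed.

Lemma increment_mgf s t c : 0 <= s <= t ->
  (\int[P]_w (expR (c * (beta t w - beta s w)))%:E =
   (expR (c ^+ 2 * (t - s) / 2))%:E)%E.
Proof.
move=> /andP[s0]; rewrite le_eqVlt => /predU1P[<-|st].
  under eq_integral do rewrite subrr mulr0 expR0.
  by rewrite subrr mulr0 mul0r expR0 integral_cst//= probability_setT mule1.
pose f (x : R) := (expR (c * x))%:E.
have mf : measurable_fun setT f.
  by apply/measurable_EFinP/measurableT_comp => //; exact: measurable_funM.
have f0 x : (0 <= f x)%E by rewrite lee_fin expR_ge0.
have mD : @measurable_fun _ _ Omega (measurableTypeR R) setT (D s t).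
  exact: measurable_increment.
pose I' : {mfun Omega >-> measurableTypeR R} :=
  @mfun_Sub _ _ Omega (measurableTypeR R) (D s t) (mem_set mD).
pose m1 : probability (measurableTypeR R) R := distribution P I'.
pose m2 : probability (measurableTypeR R) R := normal_prob 0 (Num.sqrt (t - s)).
transitivity (\int[m1]_x f x)%E.
  by rewrite /m1 /distribution ge0_integral_pushforward.
have -> : (\int[m1]_x f x = \int[m2]_x f x)%E.
  apply: eq_measure_integral => A mA _.
  exact: (bm_increment_law hbeta s0 st mA).
by rewrite normal_prob_mgf ?sqrtr_gt0 ?subr_gt0// sqr_sqrtr// subr_ge0 ltW.
Qed.

Lemma increment_exp_abs s t c : 0 <= s <= t -> 0 <= c ->
  (\int[P]_w (expR (c * `|beta t w - beta s w|))%:E <=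
   (2 * expR (c ^+ 2 * (t - s) / 2))%:E)%E.
Proof.
move=> st c0.
have mD := measurable_increment s t.
apply: (@le_trans _ _ (\int[P]_w (expR (c * (beta t w - beta s w)) +
    expR (- c * (beta t w - beta s w)))%:E)%E).
  apply: ge0_le_integral_EFin => //; [by meas|by meas|move=> w _].
  by rewrite mulNr -{1}(ger0_norm c0) -normrM; exact: expR_abs_le.
rewrite ge0_integralD_EFin//; [|by meas|by meas].
by rewrite !increment_mgf// -EFinD lee_fin sqrrN mulr_natl mulr2n.
Qed.

(** The power is absorbed by an exponential at the scale of the increment: with [h = t - s], the
    number [x / sqrt h] to the power [2p] is at most [(2p)!] times its exponential. The resulting
    rate [c + 1 / sqrt h], multiplied by [sqrt h], is at most [c sqrt T + 1], so the exponential
    moment is bounded uniformly. *)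
Lemma increment_moment (p : nat) (c T : R) : 0 <= c -> 0 <= T ->
  exists2 C, 0 <= C & forall s t, 0 <= s <= t -> t - s <= T ->
  (\int[P]_w (`|beta t w - beta s w| ^+ p.*2 * expR (c * `|beta t w - beta s w|))%:E
   <= (C * (t - s) ^+ p)%:E)%E.
Proof.
move=> c0 T0; exists ((p.*2)`!%:R * (2 * expR ((c * Num.sqrt T + 1) ^+ 2 / 2))).
  by rewrite !mulr_ge0// expR_ge0.
move=> s t /[dup] sst /andP[s0]; rewrite le_eqVlt => /predU1P[<-|st] stT.
  rewrite subrr; under eq_integral do rewrite subrr normr0 mulr0 expR0 mulr1.
  rewrite integral_cst//= probability_setT mule1 lee_fin.
  case: p => [|p]; last by rewrite doubleS !expr0n mulr0.
  rewrite double0 !expr0 fact0 mul1r mulr1.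
  have : 1 <= expR ((c * Num.sqrt T + 1) ^+ 2 / 2).
    by rewrite (le_trans _ (expR_ge1Dx _))// lerDl divr_ge0// sqr_ge0.
  by lra.
set h := t - s; have h0 : 0 < h by rewrite subr_gt0.
have sh0 : 0 < Num.sqrt h by rewrite sqrtr_gt0.
pose K := (p.*2)`!%:R * h ^+ p.
have K0 : 0 <= K by rewrite mulr_ge0// exprn_ge0// ltW.
have mD := measurable_increment s t.
have c'0 : 0 <= c + (Num.sqrt h)^-1 by rewrite addr_ge0// invr_ge0 ltW.
apply: (@le_trans _ _ (\int[P]_w (K *
    expR ((c + (Num.sqrt h)^-1) * `|beta t w - beta s w|))%:E)%E).
  apply: ge0_le_integral_EFin => //; [by meas|by meas|].
  - move=> w _; set x := `|_|.
    have x0 : 0 <= x by exact: normr_ge0.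
    rewrite mulrDl expRD [X in K * X]mulrC mulrA ler_wpM2r ?expR_ge0//.
    have := @expn_le_expR R p.*2 (x / Num.sqrt h).
    rewrite divr_ge0 ?(ltW sh0)// => /(_ isT).
    rewrite exprMn -[p.*2]muln2 mulnC [(_^-1) ^+ _]exprM exprVn sqr_sqrtr ?(ltW h0)//.
    rewrite exprVn ler_pdivrMr ?exprn_gt0// /K mul2n => /le_trans; apply.
    by rewrite [_^-1 * x]mulrC mulrAC.
rewrite ge0_integralZ_EFin//; [|by meas].
apply: (le_trans (lee_wpmul2l _ (increment_exp_abs sst c'0))); first by rewrite lee_fin.
rewrite -EFinM lee_fin /K mulrAC ler_wpM2r ?exprn_ge0 ?(ltW h0)//.
rewrite ler_wpM2l// ler_wpM2l// ler_expR ler_pM2r//.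
rewrite -[X in _ * X <= _](@sqr_sqrtr _ (t - s)) ?(ltW h0)// -exprMn.
apply: lerXn2r; rewrite ?nnegrE ?mulr_ge0 ?addr_ge0 ?sqrtr_ge0 ?mulr_ge0 ?invr_ge0 ?sqrtr_ge0//.
by rewrite -/h mulrDl mulVf ?gt_eqF// lerD2r ler_wpM2l// ler_wsqrtr.
Qed.

End Increments.

Section IncrementMean.
Context {R : realType} {d : measure_display} {Omega : measurableType d}.
Variables (P : probability Omega R) (beta : R -> {RV P >-> R}).
Hypothesis hbeta : brownian_motion beta.
Local Notation D s t := (fun w => beta t w - beta s w).

Lemma Rintegral_prob_cst (r : R) : \int[P]_(w in setT) r = r.
Proof. by rewrite /Rintegral integral_cst//= probability_setT mule1. Qed.

(** Serves to read off Taylor coefficients of the moment generating function at [c = 0]: after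
    division by a power of [c] the remainder is of order [c]. *)
Lemma small_linear_bound_eq0 (x C : R) :
  (forall c, 0 < c <= 1 -> `|x| <= C * c) -> x = 0.
Proof.
move=> h; apply/eqP; rewrite -normr_le0; apply/ler_addgt0Pr => e e0; rewrite add0r.
have C0 : 0 <= C by have := h 1; rewrite ltr01 lexx mulr1 => /(_ isT); apply: le_trans.
have c0 : 0 < Num.min 1 (e / (C + 1)).
  by rewrite lt_min ltr01/= divr_gt0// ltr_wpDl.
have := h (Num.min 1 (e / (C + 1))); rewrite c0 ge_min lexx => /(_ isT)/le_trans; apply.
apply: (@le_trans _ _ (C * (e / (C + 1)))).
  by rewrite ler_wpM2l// ge_min lexx orbT.
rewrite mulrA ler_pdivrMr; last by rewrite ltr_wpDl.
by rewrite mulrC ler_pM2l// lerDl.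
Qed.

Lemma increment_integrable (f : R -> R) (K c : R) s t : 0 <= s <= t -> 0 <= c ->
  measurable_fun setT f -> (forall x, `|f x| <= K * expR (c * `|x|)) ->
  P.-integrable setT (fun w => (f (beta t w - beta s w))%:E).
Proof.
move=> st c0 mf fK; apply/integrableP; split.
  by apply/measurable_EFinP; apply: measurableT_comp => //; exact: measurable_increment.
have mD := measurable_increment beta s t.
have mfD : measurable_fun setT (fun w => f (beta t w - beta s w)) by exact: measurableT_comp.
under eq_integral do rewrite abse_EFin.
apply: (@le_lt_trans _ _ (\int[P]_w (`|K| * expR (c * `|beta t w - beta s w|))%:E)%E).
  apply: ge0_le_integral_EFin => //; [by meas|by meas|].
  by move=> w _; rewrite (le_trans (fK _))// ler_wpM2r ?expR_ge0// ler_norm.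
rewrite ge0_integralZ_EFin//; [|by meas].
apply: lte_mul_pinfty => //.
exact: le_lt_trans (increment_exp_abs hbeta st c0) (ltry _).
Qed.

Lemma Rincrement_bound (f : R -> R) (K c : R) s t : 0 <= s <= t -> 0 <= c -> 0 <= K ->
  measurable_fun setT f -> (forall x, `|f x| <= K * expR (c * `|x|)) ->
  `|\int[P]_w (f (beta t w - beta s w))| <= K * (2 * expR (c ^+ 2 * (t - s) / 2)).
Proof.
move=> st c0 K0 mf fK; have fi := increment_integrable st c0 mf fK.
apply: le_trans (le_normr_Rintegral _ fi) _ => //.
have mD := measurable_increment beta s t.
have mfD : measurable_fun setT (fun w => f (beta t w - beta s w)) by exact: measurableT_comp.
rewrite -lee_fin /Rintegral fineK; last first.
  by apply: integrable_fin_num => //; exact: integrable_norm fi.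
apply: (@le_trans _ _ (\int[P]_w (K * expR (c * `|beta t w - beta s w|))%:E)%E).
  by apply: ge0_le_integral_EFin => //; [by meas|by meas].
rewrite ge0_integralZ_EFin//; [|by meas].
rewrite EFinM; apply: lee_wpmul2l; first by rewrite lee_fin.
exact: increment_exp_abs.
Qed.

Lemma Rincrement_mgf s t c : 0 <= s <= t ->
  \int[P]_w (expR (c * (beta t w - beta s w))) = expR (c ^+ 2 * (t - s) / 2).
Proof. by move=> st; rewrite /Rintegral increment_mgf. Qed.

Lemma expR_scale_integrable s t c : 0 <= s <= t ->
  P.-integrable setT (fun w => (expR (c * (beta t w - beta s w)))%:E).
Proof.
move=> st; apply: (@increment_integrable (fun x => expR (c * x)) 1 `|c|) => //.
  by apply: measurableT_comp => //; exact: measurable_funM.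
by move=> x; rewrite mul1r ger0_norm ?expR_ge0// ler_expR -normrM ler_norm.
Qed.

Lemma increment_pow_integrable s t n : 0 <= s <= t ->
  P.-integrable setT (fun w => ((beta t w - beta s w) ^+ n)%:E).
Proof.
move=> st; apply: (@increment_integrable (fun x => x ^+ n) n`!%:R 1) => //.
by move=> x; rewrite normrX mul1r; exact: expn_le_expR.
Qed.

(** The mean is the first Taylor coefficient of the moment generating function. The expectation of
    [exp (c D) - 1 - c D] is of order [c ^+ 2], and so is [exp (c^2 h / 2) - 1]; hence [c] times the
    mean is of order [c ^+ 2]. *)
Lemma increment_mean s t : 0 <= s <= t ->
  (\int[P]_w (beta t w - beta s w)%:E = 0)%E.
Proof.
move=> st; have h0 : 0 <= t - s by case/andP: st => _; rewrite subr_ge0.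
have D1 : P.-integrable setT (fun w => (beta t w - beta s w)%:E).
  by have := @increment_pow_integrable s t 1 st.
rewrite -[LHS]fineK; last exact: integrable_fin_num.
congr EFin; rewrite -/(Rintegral _ _ _).
set m := Rintegral _ _ _.
pose C := 2 * (2 * expR (2 ^+ 2 * (t - s) / 2)) + (t - s) / 2 * expR ((t - s) / 2).
apply: (@small_linear_bound_eq0 _ C) => c /andP[c0 c1].
have cB : `|\int[P]_w (expR (c * (beta t w - beta s w)) - 1 - c * (beta t w - beta s w))|
    <= c ^+ 2 * 2 * (2 * expR (2 ^+ 2 * (t - s) / 2)).
  apply: (@Rincrement_bound (fun x => expR (c * x) - 1 - c * x)) => //.
  - by rewrite mulr_ge0// sqr_ge0.
  - apply: measurable_funB; last exact: measurable_funM.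
    by apply: measurable_funB => //; apply: measurableT_comp => //; exact: measurable_funM.
  - move=> x; have := expR_taylor2 (c * x).
    move=> /le_trans; apply.
    rewrite normrM (ger0_norm (ltW c0)) exprMn -(mulrA (c ^+ 2) (`|x| ^+ 2)) -(mulrA (c ^+ 2) 2) ler_wpM2l ?sqr_ge0//.
    have := @expn_le_expR R 2 `|x| (normr_ge0 _).
    rewrite (_ : 2`! = 2)// => x2.
   (* One of the two exponentials absorbs [|x| ^+ 2], the other bounds the Taylor factor, whose rate
      [c] is at most 1. *)
   have -> : 2 * `|x| = `|x| + `|x| by ring.
    rewrite expRD mulrA; apply: ler_pM => //; rewrite ?exprn_ge0 ?expR_ge0//.
    by rewrite ler_expR ler_piMl.
have Ei := expR_scale_integrable c st.
have cst1 : P.-integrable setT (fun w : Omega => (1 : R)%:E).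
  by apply: finite_measure_integrable_cst.
have D1c : P.-integrable setT (fun w => (c * (beta t w - beta s w))%:E).
  by apply: integrableZ_EFin.
rewrite RintegralB// in cB; last exact: (integrableB_EFin measurableT Ei cst1).
rewrite RintegralB// Rintegral_prob_cst in cB.
rewrite RintegralZl// -/m Rincrement_mgf// in cB.
set e := expR _ in cB.
have eb : 0 <= e - 1 <= c ^+ 2 * ((t - s) / 2 * expR ((t - s) / 2)).
  have u0 : 0 <= c ^+ 2 * (t - s) / 2 by rewrite divr_ge0// mulr_ge0// sqr_ge0.
  apply/andP; split; first by rewrite subr_ge0 (le_trans _ (expR_ge1Dx _))// lerDl.
  have := expR_taylor1 (c ^+ 2 * (t - s) / 2) => /(le_trans (ler_norm _)).
  move=> /le_trans; apply; rewrite ger0_norm//.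
  have -> : c ^+ 2 * (t - s) / 2 * expR (c ^+ 2 * (t - s) / 2) =
    c ^+ 2 * ((t - s) / 2 * expR (c ^+ 2 * (t - s) / 2)) by field.
  rewrite ler_wpM2l ?sqr_ge0// ler_wpM2l ?divr_ge0// ler_expR.
  by rewrite -mulrA ler_piMl ?divr_ge0// expr_le1// ltW.
rewrite -(ler_pM2l c0).
have -> : c * `|m| = `|c * m| by rewrite normrM (ger0_norm (ltW c0)).
have -> : c * m = (e - 1) - (e - 1 - c * m) by ring.
apply: le_trans (ler_normB _ _) _.
case/andP: eb => e0 eb; rewrite (ger0_norm e0).
apply: le_trans (lerD eb cB) _; rewrite /C; rewrite le_eqVlt; apply/orP; left.
by apply/eqP; ring.
Qed.

(** The second Taylor coefficient is read off in the same way. Adding the values at [c] and [- c]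
    cancels the odd terms, and the error is of order [c ^+ 3] against [c ^+ 2] times the
    variance. *)
Lemma increment_variance s t : 0 <= s <= t ->
  (\int[P]_w ((beta t w - beta s w) ^+ 2)%:E = (t - s)%:E)%E.
Proof.
move=> st; have h0 : 0 <= t - s by case/andP: st => _; rewrite subr_ge0.
have D2 := @increment_pow_integrable s t 2 st.
rewrite -[LHS]fineK; last exact: integrable_fin_num.
congr EFin; rewrite -/(Rintegral _ _ _).
set v := Rintegral _ _ _; apply/eqP; rewrite -subr_eq0; apply/eqP.
set h := t - s.
pose C := 12 * (2 * expR (2 ^+ 2 * h / 2)) + h ^+ 2 / 2 * expR (h / 2).
apply: (@small_linear_bound_eq0 _ C) => c /andP[c0 c1].
have cB : `|\int[P]_w (expR (c * (beta t w - beta s w)) + expR (- c * (beta t w - beta s w))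
       - 2 - c ^+ 2 * (beta t w - beta s w) ^+ 2)|
    <= c ^+ 3 * 12 * (2 * expR (2 ^+ 2 * h / 2)).
  apply: (@Rincrement_bound (fun x => expR (c * x) + expR (- c * x) - 2 - c ^+ 2 * x ^+ 2)) => //.
  - by rewrite mulr_ge0// exprn_ge0// ltW.
  - apply: measurable_funB; last by apply: measurable_funM => //; exact: measurable_funX.
    apply: measurable_funB => //; apply: measurable_funD;
      by apply: measurableT_comp => //; exact: measurable_funM.
  - move=> x.
    have H y : `|y| = `|c * x| -> `|expR y - 1 - y - y ^+ 2 / 2| <= c ^+ 3 * 6 * expR (2 * `|x|).
      move=> yE; have := expR_taylor3 y.
      move=> /le_trans; apply.
      rewrite yE normrM (ger0_norm (ltW c0)) exprMn -(mulrA (c ^+ 3) (`|x| ^+ 3)) -(mulrA (c ^+ 3) 6) ler_wpM2l ?exprn_ge0 ?(ltW c0)//.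
      have := @expn_le_expR R 3 `|x| (normr_ge0 _).
      rewrite (_ : 3`! = 6)// => x3.
      have -> : 2 * `|x| = `|x| + `|x| by ring.
      rewrite expRD mulrA; apply: ler_pM => //; rewrite ?exprn_ge0 ?expR_ge0//.
      by rewrite ler_expR ler_piMl.
    have -> : expR (c * x) + expR (- c * x) - 2 - c ^+ 2 * x ^+ 2 =
      (expR (c * x) - 1 - (c * x) - (c * x) ^+ 2 / 2) +
      (expR (- c * x) - 1 - (- c * x) - (- c * x) ^+ 2 / 2) by field.
    apply: le_trans (ler_normD _ _) _.
    have -> : c ^+ 3 * 12 * expR (2 * `|x|) = c ^+ 3 * 6 * expR (2 * `|x|) + c ^+ 3 * 6 * expR (2 * `|x|) by ring.
    by apply: lerD; apply: H => //; rewrite mulNr normrN.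
have Ei := expR_scale_integrable c st.
have Ei' := expR_scale_integrable (- c) st.
have cst1 : P.-integrable setT (fun w : Omega => (2 : R)%:E).
  by apply: finite_measure_integrable_cst.
have D1c : P.-integrable setT (fun w => (c ^+ 2 * (beta t w - beta s w) ^+ 2)%:E).
  by apply: integrableZ_EFin.
have ED : P.-integrable setT (fun w => (expR (c * (beta t w - beta s w)) + expR (- c * (beta t w - beta s w)))%:E) by exact: integrableD_EFin.
rewrite RintegralB// in cB; last exact: (integrableB_EFin measurableT ED cst1).
rewrite RintegralB// RintegralD// Rintegral_prob_cst in cB.
rewrite RintegralZl// -/v !Rincrement_mgf// sqrrN in cB.
rewrite -/h in cB.
set e := expR (c ^+ 2 * _ / _) in cB.
have eb : `|2 * (e - 1) - c ^+ 2 * h| <= c ^+ 3 * (h ^+ 2 / 2 * expR (h / 2)).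
  have u0 : 0 <= c ^+ 2 * h / 2 by rewrite divr_ge0// mulr_ge0// sqr_ge0.
  have := expR_taylor2 (c ^+ 2 * h / 2); rewrite -/e.
  rewrite (ger0_norm u0) => eb.
  have -> : 2 * (e - 1) - c ^+ 2 * h = 2 * (e - 1 - c ^+ 2 * h / 2) by field.
  rewrite normrM ger0_norm// (le_trans (ler_wpM2l _ eb))//.
  have -> : 2 * ((c ^+ 2 * h / 2) ^+ 2 * e) = c ^+ 4 * (h ^+ 2 / 2 * e) by field.
  have c43 : c ^+ 4 <= c ^+ 3 by rewrite exprS ler_piMl// exprn_ge0// ltW.
  have hh : 0 <= h ^+ 2 / 2 by rewrite divr_ge0// sqr_ge0.
  apply: ler_pM => //; [by rewrite exprn_ge0// ltW|by rewrite mulr_ge0// expR_ge0|].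
  rewrite ler_wpM2l// ler_expR -mulrA ler_piMl ?divr_ge0//.
  by rewrite expr_le1// ltW.
rewrite -(ler_pM2l (exprn_gt0 2 c0)).
have -> : c ^+ 2 * `|v - h| = `|c ^+ 2 * (v - h)| by rewrite normrM (ger0_norm (sqr_ge0 c)).
have -> : c ^+ 2 * (v - h) = (2 * (e - 1) - c ^+ 2 * h) - (e + e - 2 - c ^+ 2 * v) by ring.
apply: le_trans (ler_normB _ _) _.
apply: le_trans (lerD eb cB) _; rewrite /C; rewrite le_eqVlt; apply/orP; left.
by apply/eqP; ring.
Qed.

End IncrementMean.

(** * The scalar gain of the flow of dX = sigma X dbeta *)

Section Gain.
Context {R : realType}.
Implicit Types (a : bool) (h x : R).

(* If sigma^2 = a sigma with a in {0, 1}, then 1 + gain a t beta_t * sigma is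
   the flow of dX = sigma X dbeta. *)
Definition gain a h x : R := if a then expR (x - h / 2) - 1 else x.

(** On the range of [sigma] the flow [1 + gain sigma] acts as multiplication by this number, because
    [sigma ^+ 2 = a sigma]. *)
Definition egain a h x : R := 1 + a%:R * gain a h x.

Lemma egain_flow a h x k y :
  egain a (h + k) (x + y) = egain a h x * egain a k y.
Proof.
rewrite /egain /gain; case: a => /=; last by rewrite !mul0r addr0 mulr1.
rewrite !mul1r !(addrC 1) !subrK -expRD; congr expR; by field.
Qed.

(** The composition law of the flow: when [sigma ^+ 2 = a sigma], the product of [1 + g sigma] and
    [1 + g' sigma] is [1 + (g + (1 + a g) g') sigma]. *)
Lemma gain_flow a h x k y :
  gain a (h + k) (x + y) = gain a h x + egain a h x * gain a k y.
Proof.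
rewrite /egain /gain; case: a => /=; last by rewrite !mul0r addr0 mul1r.
rewrite !mul1r !(addrC 1) !subrK mulrBr -expRD mulr1 addrCA addrC.
have -> : x - h / 2 + (y - k / 2) = x + y - (h + k) / 2 by field.
by ring.
Qed.

Lemma egain_gt0 a h x : 0 < egain a h x.
Proof.
rewrite /egain /gain; case: a => /=; last by rewrite mul0r addr0.
by rewrite mul1r addrC subrK expR_gt0.
Qed.

Lemma gain0 a : gain a 0 0 = 0.
Proof. by rewrite /gain; case: a; rewrite // mul0r subrr expR0 subrr. Qed.

Lemma egain0 a : egain a 0 0 = 1.
Proof. by rewrite /egain gain0 mulr0 addr0. Qed.

Lemma egain_le a h x : egain a h x <= 1 + `|gain a h x|.
Proof.
rewrite /egain lerD2l; case: a => /=; last by rewrite mul0r.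
by rewrite mul1r ler_norm.
Qed.

Lemma gain_le a h x : 0 <= h ->
  `|gain a h x| <= (`|x| + h) * expR (`|x| + h).
Proof.
move=> h0; rewrite /gain; case: a.
  apply: le_trans (expR_taylor1 _) _.
  have H : `|x - h / 2| <= `|x| + h.
    rewrite (le_trans (ler_normB _ _))// lerD2l ger0_norm ?divr_ge0//.
    by rewrite ler_pdivrMr// ler_peMr// ler1n.
  by apply: ler_pM; rewrite ?expR_ge0 ?ler_expR.
have x0 := normr_ge0 x.
rewrite (@le_trans _ _ (`|x| + h)) ?lerDl// ler_peMr ?addr_ge0//.
by rewrite (le_trans _ (expR_ge1Dx _))// lerDl addr_ge0.
Qed.

(** The gain and the increment differ by a second-order Taylor remainder and by the correction
    [h / 2]. For Brownian increments both are of order [h], against [sqrt h] for the increment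
    itself. *)
Lemma gain_defect_le a h x : 0 <= h ->
  `|gain a h x - x| <= ((`|x| + h) ^+ 2 + h) * expR (`|x| + h).
Proof.
move=> h0; have xh0 : 0 <= `|x| + h by exact: addr_ge0.
have e1 : 1 <= expR (`|x| + h) by rewrite (le_trans _ (expR_ge1Dx _))// lerDl.
rewrite /gain; case: a; last first.
  by rewrite subrr normr0 mulr_ge0 ?expR_ge0// addr_ge0// sqr_ge0.
have -> : expR (x - h / 2) - 1 - x = (expR (x - h / 2) - 1 - (x - h / 2)) - h / 2 by ring.
rewrite (le_trans (ler_normB _ _))// mulrDl; apply: lerD.
  apply: le_trans (expR_taylor2 _) _.
  have H : `|x - h / 2| <= `|x| + h.
    rewrite (le_trans (ler_normB _ _))// lerD2l ger0_norm ?divr_ge0//.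
    by rewrite ler_pdivrMr// ler_peMr// ler1n.
  apply: ler_pM; rewrite ?sqr_ge0 ?expR_ge0 ?ler_expR//.
  by apply: lerXn2r; rewrite ?nnegrE.
by rewrite ger0_norm ?divr_ge0//; nra.
Qed.

Lemma measurable_gain a h : measurable_fun setT (gain a h).
Proof. by rewrite /gain; case: a => //; meas. Qed.

Lemma measurable_egain a h : measurable_fun setT (egain a h).
Proof. by rewrite /egain; have := measurable_gain a h => mg; meas. Qed.

Lemma continuous_gain a (f g : R -> R) : continuous f -> continuous g ->
  continuous (fun y => gain a (f y) (g y)).
Proof.
move=> cf cg z; rewrite /gain; case: a; last exact: cg.
apply: cvgB; last exact: cvg_cst.
apply: (@continuous_comp _ _ _ (fun y => g y - f y / 2) (@expR R)); last exact: continuous_expR.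
by apply: cvgB; [exact: cg|apply: cvgMl; exact: cf].
Qed.

(* The exponent of the linear equation of a stage; it is -1 when a = 1. *)
Definition kap a h x : R := if a then -1 else x.

(** One formula for both cases. The right-hand side is the coefficient that the algebra of a stage
    produces ([st_liftE]), and through it [kap] inherits continuity and adaptedness from the
    gain. *)
Lemma kapE a h x : kap a h x = - a%:R + (1 - a%:R) * gain a h x.
Proof. by rewrite /kap /gain; case: a => /=; ring. Qed.

Lemma kap_le a h x : `|kap a h x| <= 1 + `|gain a h x|.
Proof.
rewrite /kap /gain; case: a; first by rewrite normrN normr1 lerDl.
by rewrite lerDr.
Qed.

End Gain.

Section GainMoments.
Context {R : realType} {d : measure_display} {Omega : measurableType d}.
Variables (P : probability Omega R) (beta : R -> {RV P >-> R}).
Hypothesis hbeta : brownian_motion beta.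
Variable a : bool.
Local Notation g s t := (fun w => gain a (t - s) (beta t w - beta s w)).

Lemma gain_moment p (T : R) : 0 <= T -> exists2 C, 0 <= C &
  forall s t, 0 <= s <= t -> t - s <= T ->
  (\int[P]_w (`|gain a (t - s) (beta t w - beta s w)| ^+ p.*2)%:E
   <= (C * (t - s) ^+ p)%:E)%E.
Proof.
move=> T0.
have [C1 C10 H1] := increment_moment hbeta p (ler0n R p.*2) T0.
have [C2 C20 H2] := increment_moment hbeta 0 (ler0n R p.*2) T0.
pose K := 2 ^+ p.*2 * expR (p.*2%:R * T).
have K0 : 0 <= K by rewrite mulr_ge0// ?exprn_ge0// expR_ge0.
exists (K * (C1 + T ^+ p * C2)) => [|s t st stT].
  by rewrite mulr_ge0// addr_ge0// mulr_ge0// exprn_ge0.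
have h0 : 0 <= t - s by case/andP: st => _; rewrite subr_ge0.
set h := t - s in h0 stT *.
have mD := measurable_increment beta s t.
have mg : measurable_fun setT (g s t) by apply: measurableT_comp mD; exact: measurable_gain.
apply: (@le_trans _ _ (\int[P]_w (K *
   (`|beta t w - beta s w| ^+ p.*2 * expR (p.*2%:R * `|beta t w - beta s w|) +
    h ^+ p.*2 * expR (p.*2%:R * `|beta t w - beta s w|)))%:E)%E).
  apply: ge0_le_integral_EFin => //; [by meas|by meas|].
  move=> w _; set x := _ - _.
  have xh0 : 0 <= `|x| + h by exact: addr_ge0.
  apply: (@le_trans _ _ (((`|x| + h) * expR (`|x| + h)) ^+ p.*2)).
    by apply: lerXn2r; rewrite ?nnegrE ?(mulr_ge0 xh0) ?expR_ge0//; exact: gain_le.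
  rewrite exprMn -expRM_natl mulrDr expRD -mulrDl /K.
  rewrite [X in _ <= X](_ : _ = (2 ^+ p.*2 * (`|x| ^+ p.*2 + h ^+ p.*2)) *
    (expR (p.*2%:R * `|x|) * expR (p.*2%:R * T))); last by ring.
  apply: ler_pM; rewrite ?(exprn_ge0 _ xh0) ?(mulr_ge0 (expR_ge0 _)) ?expR_ge0//.
    exact: exprD_le.
  by rewrite ler_wpM2l ?expR_ge0// ler_expR ler_wpM2l.
rewrite ge0_integralZ_EFin//; first last.
- by move=> w _; rewrite addr_ge0// mulr_ge0 ?exprn_ge0 ?expR_ge0.
- by meas.
rewrite ge0_integralD_EFin//; first last.
- by move=> w _; rewrite mulr_ge0 ?exprn_ge0 ?expR_ge0.
- by meas.
- by meas.
rewrite ge0_integralZ_EFin//; first last.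
- by rewrite exprn_ge0.
- by meas.
rewrite -(mulrA K) (EFinM K); apply: lee_wpmul2l; first by rewrite lee_fin.
rewrite mulrDl EFinD; apply: leeD; first exact: H1.
have {H2} := H2 _ _ st stT.
rewrite double0 -/h expr0 mulr1; under [X in (X <= C2%:E)%E -> _]eq_integral do rewrite expr0 mul1r.
move=> H2.
apply: (@le_trans _ _ ((h ^+ p.*2)%:E * C2%:E)%E).
  by rewrite lee_wpmul2l// lee_fin exprn_ge0.
rewrite -EFinM lee_fin mulrAC ler_wpM2r// -addnn exprD ler_wpM2r ?exprn_ge0//.
by apply: lerXn2r; rewrite ?nnegrE.
Qed.

Lemma gain_defect_integrable s t : 0 <= s <= t ->
  P.-integrable setT (fun w =>
    (gain a (t - s) (beta t w - beta s w) - (beta t w - beta s w))%:E).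
Proof.
move=> st; have h0 : 0 <= t - s by case/andP: st => _; rewrite subr_ge0.
apply: integrableB_EFin => //; last first.
  by have := @increment_pow_integrable _ _ _ _ _ hbeta s t 1 st.
rewrite /gain; case: a; last first.
  by have := @increment_pow_integrable _ _ _ _ _ hbeta s t 1 st.
apply: (@increment_integrable _ _ _ _ _ hbeta
  (fun x => expR (x - (t - s) / 2) - 1) 2 1) => //; first by meas.
move=> x; rewrite mul1r (le_trans (ler_normB _ _))// normr1 (ger0_norm (expR_ge0 _)).
have e1 : 1 <= expR `|x| by rewrite (le_trans _ (expR_ge1Dx _))// lerDl.
have : expR (x - (t - s) / 2) <= expR `|x|.
  by rewrite ler_expR (le_trans _ (ler_norm _))// gerBl divr_ge0.
by lra.
Qed.

(** The gain is centred like the increment [D]: [exp D] has mean [exp (h / 2)], which the correction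
    [- h / 2] in the exponent cancels. This makes the defects martingale differences. *)
Lemma gain_defect_mean s t : 0 <= s <= t ->
  (\int[P]_w
    (gain a (t - s) (beta t w - beta s w) - (beta t w - beta s w))%:E = 0)%E.
Proof.
move=> st; have h0 : 0 <= t - s by case/andP: st => _; rewrite subr_ge0.
rewrite /gain; case: a; last first.
  by under eq_integral do rewrite subrr; rewrite integral0_eq.
have Ei := expR_scale_integrable hbeta 1 st.
have D1 : P.-integrable setT (fun w => (beta t w - beta s w)%:E).
  by have := @increment_pow_integrable _ _ _ _ _ hbeta s t 1 st.
pose k := expR (- ((t - s) / 2)).
have Ek : P.-integrable setT (fun w => (k * expR (1 * (beta t w - beta s w)))%:E).
  exact: integrableZ_EFin.
have c1 : P.-integrable setT (fun w : Omega => (1 : R)%:E).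
  by apply: finite_measure_integrable_cst.
have Ek1 := integrableB_EFin measurableT Ek c1.
transitivity (\int[P]_w
  (k * expR (1 * (beta t w - beta s w)) - 1 - (beta t w - beta s w)))%:E.
  rewrite /Rintegral fineK; last first.
    by apply: integrable_fin_num => //; exact: integrableB_EFin.
  apply: eq_integral => w _; congr EFin; congr (_ - _ - _).
  by rewrite /k mul1r -expRD addrC.
rewrite RintegralB// [X in _ - X](_ : _ = 0); last by rewrite /Rintegral increment_mean.
rewrite RintegralB//.
rewrite (@RintegralZl _ _ _ P setT (fun w => expR (1 * (beta t w - beta s w))) k)//.
rewrite Rincrement_mgf//.
rewrite Rintegral_prob_cst expr1n mul1r /k -expRD.
by rewrite addNr expR0 subrr subr0.
Qed.

(** The bound of [gain_defect_le], squared, involves a fourth moment of the increment, of order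
    [h ^+ 2]. A sum of about [1 / h] orthogonal defects therefore has a second moment of order [h],
    which drives the Riemann sums of [ito_product]. *)
Lemma gain_defect_sqr (T : R) : 0 <= T -> exists2 C, 0 <= C &
  forall s t, 0 <= s <= t -> t - s <= T ->
  (\int[P]_w ((gain a (t - s) (beta t w - beta s w) - (beta t w - beta s w)) ^+ 2)%:E
   <= (C * (t - s) ^+ 2)%:E)%E.
Proof.
move=> T0.
have [C1 C10 H1] := increment_moment hbeta 2 (ler0n R 2) T0.
have [C2 C20 H2] := increment_moment hbeta 0 (ler0n R 2) T0.
(* Two uses of [exprD_le], for a square and a fourth power, give at most [4 * 16], and 128 leaves
   room; the exponential comes from [h <= T]. *)
pose K := 128 * expR (2 * T).
have K0 : 0 <= K by rewrite mulr_ge0// expR_ge0.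
exists (K * (C1 + (T ^+ 2 + 1) * C2)) => [|s t st stT].
  by rewrite mulr_ge0// addr_ge0// mulr_ge0// addr_ge0// sqr_ge0.
have h0 : 0 <= t - s by case/andP: st => _; rewrite subr_ge0.
set h := t - s in h0 stT *.
have mD := measurable_increment beta s t.
have mg : measurable_fun setT (fun w => gain a h (beta t w - beta s w)).
  by apply: measurableT_comp mD; exact: measurable_gain.
have T2 : 0 <= T ^+ 2 + 1 by rewrite addr_ge0// sqr_ge0.
apply: (@le_trans _ _ (\int[P]_w (K *
   (`|beta t w - beta s w| ^+ 4 * expR (2 * `|beta t w - beta s w|) +
    ((T ^+ 2 + 1) * h ^+ 2) * expR (2 * `|beta t w - beta s w|)))%:E)%E).
  apply: ge0_le_integral_EFin => //; [by meas|by meas| |].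
    by move=> w _; rewrite sqr_ge0.
  move=> w _; set x := (X in gain _ _ X).
  have x0 := normr_ge0 x.
  have xh0 : 0 <= `|x| + h by exact: addr_ge0.
  rewrite -real_normK ?num_real//.
  apply: (@le_trans _ _ ((((`|x| + h) ^+ 2 + h) * expR (`|x| + h)) ^+ 2)).
    apply: lerXn2r; [by rewrite nnegrE|rewrite nnegrE|exact: gain_defect_le].
    by rewrite mulr_ge0 ?expR_ge0// addr_ge0// sqr_ge0.
  rewrite exprMn -expRM_natl mulrDr expRD /K.
  rewrite [X in _ <= X](_ : _ = (128 * (`|x| ^+ 4 + (T ^+ 2 + 1) * h ^+ 2)) *
    (expR (2 * `|x|) * expR (2 * T))); last by ring.
  apply: ler_pM; rewrite ?sqr_ge0 ?mulr_ge0 ?expR_ge0//.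
    have u4 : (`|x| + h) ^+ 4 <= 16 * (`|x| ^+ 4 + h ^+ 4).
      by apply: le_trans (exprD_le 4 x0 h0) _; rewrite -natrX.
    have u2 : ((`|x| + h) ^+ 2 + h) ^+ 2 <= 4 * (((`|x| + h) ^+ 2) ^+ 2 + h ^+ 2).
      by apply: le_trans (exprD_le 2 (sqr_ge0 (`|x| + h)) h0) _; rewrite -natrX.
    rewrite -exprM in u2.
    have hT : h ^+ 4 <= T ^+ 2 * h ^+ 2.
      by rewrite -[4%N]/(2 + 2)%N exprD ler_wpM2r ?sqr_ge0//; apply: lerXn2r; rewrite ?nnegrE.
    have xx : 0 <= `|x| ^+ 4 by rewrite exprn_ge0.
    have hh : 0 <= h ^+ 2 by rewrite exprn_ge0.
    have Th : 0 <= T ^+ 2 * h ^+ 2 by rewrite mulr_ge0 ?sqr_ge0.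
    by clear -u4 u2 hT xx hh Th; rewrite (_ : (2 * 2 = 4)%N)// in u2; lra.
  by rewrite ler_wpM2l ?expR_ge0// ler_expR ler_wpM2l.
rewrite ge0_integralZ_EFin//; first last.
- by move=> w _; rewrite addr_ge0// mulr_ge0 ?exprn_ge0 ?expR_ge0// mulr_ge0// sqr_ge0.
- by meas.
rewrite ge0_integralD_EFin//; first last.
- by move=> w _; rewrite mulr_ge0 ?exprn_ge0 ?expR_ge0// mulr_ge0// sqr_ge0.
- by meas.
- by meas.
rewrite ge0_integralZ_EFin//; first last.
- by rewrite mulr_ge0// sqr_ge0.
- by meas.
rewrite -(mulrA K) (EFinM K); apply: lee_wpmul2l; first by rewrite lee_fin.
rewrite (mulrDl C1) EFinD; apply: leeD; first exact: H1.
have {H2} := H2 _ _ st stT.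
rewrite double0 -/h expr0 mulr1; under [X in (X <= C2%:E)%E -> _]eq_integral do rewrite expr0 mul1r.
move=> H2.
apply: (@le_trans _ _ (((T ^+ 2 + 1) * h ^+ 2)%:E * C2%:E)%E).
  by rewrite lee_wpmul2l// lee_fin mulr_ge0// sqr_ge0.
by rewrite -EFinM lee_fin mulrAC.
Qed.

(** The reason for working with [kap]: when [a] is true the gain is a shifted log-normal variable
    and exponentials of its absolute value have no finite mean, whereas [kap] is constant; when [a]
    is false, [kap] is the Gaussian increment. *)
Lemma kap_exp (T c : R) : 0 <= T -> 0 <= c -> exists2 C, 0 <= C &
  forall s t, 0 <= s <= t -> t - s <= T ->
  (\int[P]_w (expR (c * `|kap a (t - s) (beta t w - beta s w)|))%:E <= C%:E)%E.
Proof.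
move=> T0 c0; rewrite /kap; case: a.
  exists (expR c); first exact: expR_ge0.
  move=> s t st _; under eq_integral do rewrite normrN normr1 mulr1.
  by rewrite integral_cst//= probability_setT mule1.
exists (2 * expR (c ^+ 2 * T / 2)); first by rewrite mulr_ge0// expR_ge0.
move=> s t st stT; apply: le_trans (increment_exp_abs hbeta st c0) _.
by rewrite lee_fin ler_wpM2l// ler_expR ler_wpM2r// ler_wpM2l// sqr_ge0.
Qed.

End GainMoments.

(** * Cauchy-Schwarz, Tonelli on cylinders and joint measurability *)

Section SquareIntegral.
Context {d : measure_display} {T : measurableType d} {R : realType}.
Variables (mu : {measure set T -> \bar R}) (D : set T) (M : R).
Hypotheses (mD : measurable D) (muD : mu D = M%:E) (M0 : 0 <= M).

Lemma sqr_integrable (f : T -> R) : measurable_fun D f ->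
  (\int[mu]_(x in D) (f x ^+ 2)%:E < +oo)%E ->
  mu.-integrable D (fun x => (f x)%:E).
Proof.
move=> mf fi; apply/integrableP; split; first exact/measurable_EFinP.
apply: (@le_lt_trans _ _ (\int[mu]_(x in D) (1 + f x ^+ 2)%:E)%E).
  under eq_integral do rewrite abse_EFin.
  apply: ge0_le_integral_EFin => //; [by meas|by meas|move=> x _].
  have H (y : R) : y <= 1 + y ^+ 2 by have := sqr_ge0 (y - 1); have := sqr_ge0 y; lra.
  by rewrite -[in leRHS](real_normK (num_real _)).
rewrite ge0_integralD_EFin//; [|by meas|by move=> x _; rewrite sqr_ge0].
by rewrite lte_add_pinfty// integral_cst//= mul1e muD ltry.
Qed.

(** The variance of [f] under the normalised measure is nonnegative: [(f - m / M) ^+ 2] is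
    integrated, with [m] the integral of [f]. A null domain and an infinite right-hand side are
    settled apart. *)
Lemma sqr_Rintegral_le (f : T -> R) : measurable_fun D f ->
  (((\int[mu]_(x in D) f x) ^+ 2)%:E <= M%:E * \int[mu]_(x in D) (f x ^+ 2)%:E)%E.
Proof.
move=> mf.
have f2ge0 : (0 <= \int[mu]_(x in D) (f x ^+ 2)%:E)%E.
  by apply: integral_ge0_EFin => x _; exact: sqr_ge0.
move: M0; rewrite le_eqVlt => /predU1P[M00|Mgt0].
  rewrite -M00 mul0e /Rintegral.
  have -> : (\int[mu]_(x in D) (f x)%:E = 0)%E.
    by apply: null_set_integral => //; [exact/measurable_EFinP|rewrite muD -M00].
  by rewrite expr0n.
have [f2oo|] := ltP (\int[mu]_(x in D) (f x ^+ 2)%:E)%E +oo%E; last first.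
  by rewrite leye_eq => /eqP ->; rewrite gt0_muley ?lte_fin// leey.
have fi := sqr_integrable mf f2oo.
have f2i : mu.-integrable D (fun x => (f x ^+ 2)%:E).
  apply/integrableP; split; first by meas.
  by under eq_integral do rewrite abse_EFin ger0_norm ?sqr_ge0//.
pose m := \int[mu]_(x in D) f x.
pose v := \int[mu]_(x in D) (f x ^+ 2).
have vE : (\int[mu]_(x in D) (f x ^+ 2)%:E = v%:E)%E.
  by rewrite /v /Rintegral fineK//; exact: integrable_fin_num.
rewrite vE -EFinM lee_fin -/m.
have ci k : mu.-integrable D (fun=> k%:E).
  apply/integrableP; split; first exact: measurable_cst.
  by rewrite integral_cst//= muD -EFinM ltry.
have : 0 <= \int[mu]_(x in D) (f x ^+ 2 - ((2 * (m / M)) * f x - (m / M) ^+ 2)).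
  apply: Rintegral_ge0 => x _.
  have -> : f x ^+ 2 - (2 * (m / M) * f x - (m / M) ^+ 2) = (f x - m / M) ^+ 2 by ring.
  exact: sqr_ge0.
have fi2 := integrableZ_EFin mD (2 * (m / M)) fi.
have fi3 := integrableB_EFin mD fi2 (ci ((m / M) ^+ 2)).
rewrite RintegralB// (@RintegralB _ _ _ _ _ (fun x => 2 * (m / M) * f x) (fun=> (m / M) ^+ 2))//; last exact: ci.
rewrite (@RintegralZl _ _ _ _ _ f (2 * (m / M)))// Rintegral_cst// muD /= -/m -/v.
have Mn0 : M != 0 by rewrite gt_eqF.
have -> : v - (2 * (m / M) * m - (m / M) ^+ 2 * M) = (M * v - m ^+ 2) / M by field.
by rewrite pmulr_lge0 ?invr_gt0// subr_ge0.
Qed.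

End SquareIntegral.

Section Tonelli.
Context {R : realType} {d : measure_display} {Omega : measurableType d}.
Variable P : probability Omega R.
Local Notation RT := (measurableTypeR R).
Local Notation mu := (@lebesgue_measure R).
Variables (D : set RT) (f : RT -> Omega -> R).
Hypotheses (mD : measurable D)
  (mf : measurable_fun (D `*` [set: Omega]) (fun z : RT * Omega => f z.1 z.2))
  (f0 : forall s w, D s -> 0 <= f s w).

(** Extension by zero off the cylinder, so that the Fubini-Tonelli theorems on the whole product
    space apply. *)
Let F (z : RT * Omega) : \bar R :=
  ((fun z => (f z.1 z.2)%:E) \_ (D `*` [set: Omega])) z.

Let mF : measurable_fun setT F.
Proof.
apply/(measurable_restrictT _ _).1 => //; first exact: measurableX.
exact/measurable_EFinP.
Qed.

Let F0 z : (0 <= F z)%E.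
Proof.
rewrite /F patchE; case: ifPn => // /set_mem[/= Dz _].
by rewrite lee_fin f0.
Qed.

Let FE s w : F (s, w) = ((fun s => (f s w)%:E) \_ D) s.
Proof.
rewrite /F !patchE; congr (if _ then _ else _).
by apply/idP/idP; rewrite !inE => //= -[].
Qed.

Lemma integral_cylinder1 :
  (\int[(mu \x P)%E]_(z in D `*` [set: Omega]) (f z.1 z.2)%:E =
   \int[mu]_(s in D) \int[P]_w (f s w)%:E)%E.
Proof.
transitivity (\int[(mu \x P)%E]_z F z)%E; first by rewrite integral_mkcond.
rewrite (@fubini_tonelli1 _ _ _ _ _ mu P F mF F0) [RHS]integral_mkcond.
apply: eq_integral => s _.
transitivity (\int[P]_w (((fun s => (f s w)%:E) \_ D) s))%E.
  by apply: eq_integral => w _; rewrite -FE.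
rewrite patchE; under eq_integral do rewrite patchE.
by case: ifPn => // _; rewrite integral0.
Qed.

Lemma integral_cylinder2 :
  (\int[(mu \x P)%E]_(z in D `*` [set: Omega]) (f z.1 z.2)%:E =
   \int[P]_w \int[mu]_(s in D) (f s w)%:E)%E.
Proof.
transitivity (\int[(mu \x P)%E]_z F z)%E; first by rewrite integral_mkcond.
rewrite (@fubini_tonelli2 _ _ _ _ _ mu P F mF F0).
apply: eq_integral => w _; rewrite [RHS]integral_mkcond.
by apply: eq_integral => s _; rewrite -FE.
Qed.

Lemma tonelli_cylinder :
  (\int[mu]_(s in D) \int[P]_w (f s w)%:E =
   \int[P]_w \int[mu]_(s in D) (f s w)%:E)%E.
Proof. by rewrite -integral_cylinder1 integral_cylinder2. Qed.

Lemma measurable_section_integral :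
  measurable_fun D (fun s => (\int[P]_w (f s w)%:E)%E).
Proof.
have := @measurable_fun_fubini_tonelli_F _ _ _ _ R P F mF F0.
move=> /(measurable_funTS (D := D)) h.
apply: eq_measurable_fun h => s /[!inE] Ds.
apply: eq_integral => w _; transitivity (F (s, w)) => //.
by rewrite FE patchE mem_set.
Qed.

Lemma measurable_path_integral :
  measurable_fun setT (fun w => (\int[mu]_(s in D) (f s w)%:E)%E).
Proof.
have := @measurable_fun_fubini_tonelli_G _ _ _ _ R mu F mF F0.
apply: eq_measurable_fun => w _.
rewrite [RHS]integral_mkcond; apply: eq_integral => s _.
by rewrite -FE.
Qed.

End Tonelli.

Section JointMeasurability.
Context {R : realType} {d : measure_display} {T : measurableType d}.
Local Notation RT := (measurableTypeR R).
Local Notation mu := (@lebesgue_measure R).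

(** Rounding the time down to a grid of mesh [1 / (N + 1)] gives maps whose preimages are countable
    unions of measurable rectangles; by path continuity they converge to the process. *)
Lemma measurable_continuous_process (f : R -> T -> R) :
  (forall w, continuous (fun s => f s w)) ->
  (forall s, measurable_fun setT (f s)) ->
  measurable_fun setT (fun z : RT * T => f z.1 z.2).
Proof.
move=> cf mf.
pose r (N : nat) (s : R) : R := (Num.floor (N.+1%:R * s))%:~R / N.+1%:R.
have cr s : r N s @[N --> \oo] --> s.
  apply/cvgrPdist_le => e e0.
  have := cvg_harmonic (R := R) => /cvgrPdist_le/(_ _ e0) he.
  near=> N.
  have : `|0 - (harmonic N : R)| <= e by near: N.
  rewrite sub0r normrN ger0_norm; last by rewrite invr_ge0.
  rewrite /harmonic /= => hN; apply: le_trans hN.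
  have N0 : 0 < N.+1%:R :> R by [].
  have -> : s - r N s = (N.+1%:R * s - (Num.floor (N.+1%:R * s))%:~R) / N.+1%:R.
    by rewrite /r; field; rewrite gt_eqF.
  rewrite normrM (ger0_norm (x := _^-1)) ?invr_ge0//.
  rewrite -[leRHS]mul1r ler_wpM2r ?invr_ge0//.
  have fl := floor_le_tmp (N.+1%:R * s); have fg := floorD1_gt (N.+1%:R * s).
  rewrite ger0_norm ?subr_ge0// lerBlDr ltW//.
  by rewrite intrD1 addrC in fg *.
apply: (@measurable_fun_cvg _ _ _ setT (fun N (z : RT * T) => f (r N z.1) z.2)).
- move=> N _ Y mY; rewrite setTI.
  have -> : (fun z : RT * T => f (r N z.1) z.2) @^-1` Y =
    \bigcup_(k : int) (((fun s : RT => Num.floor (N.+1%:R * s)) @^-1` [set k]) `*`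
       (f (k%:~R / N.+1%:R) @^-1` Y)).
    apply/seteqP; split => [[s w] /= Yw|[s w] [k _ [/= <-]]//].
    by exists (Num.floor (N.+1%:R * s)).
  apply: countable_bigcupT_measurable; first exact: countableP.
  move=> k; apply: measurableX; last by rewrite -[_ @^-1` _]setTI; exact: mf.
  have -> : (fun s : RT => Num.floor (N.+1%:R * s)) @^-1` [set k] =
     `[k%:~R / N.+1%:R, (k + 1)%:~R / N.+1%:R[%classic.
    have N0 : 0 < N.+1%:R :> R by [].
    apply/seteqP; split => s /=.
      move=> <-; rewrite in_itv/= ler_pdivrMr// ltr_pdivlMr// [s * _]mulrC.
      by rewrite floor_le_tmp floorD1_gt.
    rewrite in_itv/= ler_pdivrMr// ltr_pdivlMr// [s * _]mulrC => h.
    exact: floor_def.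
  exact: measurable_itv.
- move=> [s w] _ /=; exact: (@continuous_cvg _ R R \oo _ (fun N => r N s) (fun s => f s w) s (cf w s) (cr s)).
Unshelve. all: by end_near. Qed.

(** Positive and negative parts have integrals measurable in [w] by Tonelli, and the real integral
    is [fine] of their difference. The default value 0 that [fine] gives to infinite integrals does
    not disturb measurability. *)
Lemma measurable_Rintegral (D : set RT) (f : RT -> T -> R) :
  measurable D ->
  measurable_fun setT (fun z : RT * T => f z.1 z.2) ->
  measurable_fun setT (fun w => \int[mu]_(s in D) (f s w)).
Proof.
move=> mD mf.
have mfD : measurable_fun setT
    (fun z : RT * T => (f z.1 z.2 * \1_D z.1)%:E).
  apply/measurable_EFinP/measurable_funM => //.
  by apply: measurableT_comp => //; exact: measurable_indic.
apply: measurableT_comp; first exact: measurable_realfun.fine_measurable.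
have -> : (fun w => (\int[mu]_(s in D) (f s w)%:E)%E) =
  fun w => (\int[mu]_s (((fun z : RT * T => (f z.1 z.2 * \1_D z.1)%:E)^\+ (s, w))%E) -
            \int[mu]_s (((fun z : RT * T => (f z.1 z.2 * \1_D z.1)%:E)^\- (s, w))%E))%E.
  apply/funext => w; rewrite integral_mkcond integralE.
  by congr (_ - _)%E; apply: eq_integral => s _;
    rewrite !(funeposE, funenegE) /= patchE indicE; case: ifPn => _;
    rewrite ?mulr1 ?mulr0.
apply: emeasurable_funB.
- by apply: (@measurable_fun_fubini_tonelli_G _ _ _ _ R mu) => //; exact: measurable_funepos.
- by apply: (@measurable_fun_fubini_tonelli_G _ _ _ _ R mu) => //; exact: measurable_funeneg.
Qed.

End JointMeasurability.

(** * An everywhere continuous version of the Brownian motion *)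

Section Modification.
Context {R : realType} {d : measure_display} {Omega : measurableType d}.
Variables (P : probability Omega R) (beta : R -> {RV P >-> R}).
Hypothesis hbeta : brownian_motion beta.
Local Notation F := (augmented_filtration P (fun r => beta r)).

Lemma within_continuous_clamp (D : set R) (f g : R -> R) :
  {within D, continuous f} -> continuous g -> (forall x, D (g x)) ->
  continuous (f \o g).
Proof.
move=> /subspace_continuousP cf cg Dg x.
apply: (@cvg_comp _ _ _ g f (nbhs x) (within D (nbhs (g x))) (nbhs (f (g x)))).
  move=> A /= wA; have h := cg x _ wA.
  by apply: (@filterS _ (nbhs x) _ _ _ _ h) => y; apply; exact: Dg.
exact: cf.
Qed.

Lemma ae_probability_preimage (X Y : Omega -> R) (A : set Omega) (B : set R) :
  measurable A -> measurable B -> measurable_fun setT X -> measurable_fun setT Y ->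
  {ae P, forall w, X w = Y w} -> P (A `&` X @^-1` B) = P (A `&` Y @^-1` B).
Proof.
move=> mA mB mX mY [N [mN N0 XY]].
have mXB : measurable (X @^-1` B) by rewrite -[_ @^-1` _]setTI; exact: mX.
have mYB : measurable (Y @^-1` B) by rewrite -[_ @^-1` _]setTI; exact: mY.
have XYN w : ~ N w -> X w = Y w by move=> Nw; apply: contrapT => /(XY w).
have key (C : set Omega) : measurable C -> P C = P (C `\` N).
  move=> mC; have := measureDI P mC mN; rewrite [X in _ = (_ + X)%E -> _](_ : _ = 0%E).
    by rewrite adde0.
  apply/eqP; rewrite eq_le measure_ge0 andbT -N0.
  by apply: le_measure; rewrite ?inE//; exact: measurableI.
rewrite (key _ (measurableI _ _ mA mXB)) (key _ (measurableI _ _ mA mYB)).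
congr (P _); apply/seteqP; split => w /= [[Aw] + Nw] => Bw;
  by split=> //; split=> //; move: Bw; rewrite XYN.
Qed.

(** Off the null set where [beta] does not start at 0 or has a discontinuous path, [b] follows
    [beta] with the time clamped to be nonnegative; on that null set it is 0. It stays adapted to
    the filtration of [beta] because null sets belong to every [F s]. *)
Lemma continuous_modification : exists b : R -> {RV P >-> R},
  [/\ forall w, continuous (fun s => b s w),
      forall s w, s <= 0 -> b s w = 0,
      forall s, 0 <= s -> wrt_measurable (F s) (b s),
      exists N, [/\ measurable N, P N = 0%E &
        forall s w, 0 <= s -> ~ N w -> b s w = beta s w] &
      brownian_motion b].
Proof.
have [N1 [mN1 N10 H1]] := bm_start hbeta.
have [N2 [mN2 N20 H2]] := bm_continuous hbeta.
pose N := N1 `|` N2.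
have mN : measurable N by exact: measurableU.
have N0 : P N = 0%E.
  apply/eqP; rewrite eq_le measure_ge0 andbT.
  by have := measureU2 P mN1 mN2; rewrite /= [X in (_ <= X + _)%E]N10 [X in (_ <= _ + X)%E]N20 adde0.
pose b0 s w : R := beta (Num.max 0 s) w * \1_(~` N) w.
have mb0 s : measurable_fun setT (b0 s).
  by apply: measurable_funM => //; apply: measurable_indic; exact: measurableC.
pose b s : {RV P >-> R} := mfun_Sub (mem_set (mb0 s)).
have bE s w : b s w = beta (Num.max 0 s) w * \1_(~` N) w by [].
have bN s w : ~ N w -> b s w = beta (Num.max 0 s) w.
  by move=> Nw; rewrite bE indicE mem_set// mulr1.
have bN0 s w : N w -> b s w = 0.
  by move=> Nw; rewrite bE indicE memNset ?mulr0//; exact.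
have cb w : continuous (fun s => b s w).
  have [Nw|Nw] := pselect (N w).
    have -> : (fun s => b s w) = cst 0 by apply/funext => s; rewrite bN0.
    by move=> x; exact: cvg_cst.
  have -> : (fun s => b s w) = (fun t => beta t w) \o (fun s => Num.max 0 s).
    by apply/funext => s; rewrite bN.
  apply: (@within_continuous_clamp [set t : R | 0 <= t]).
  - by apply: contrapT => /(H2 w) N2w; apply: Nw; right.
  - by move=> x; apply: continuous_max; [exact: cvg_cst|exact: cvg_id].
  - by move=> x /=; rewrite le_max lexx.
have b00 s w : s <= 0 -> b s w = 0.
  move=> s0; have [Nw|Nw] := pselect (N w); first exact: bN0.
  rewrite bN// (max_idPl s0).
  by apply: contrapT => /(H1 w) N1w; apply: Nw; left.
have bb s w : 0 <= s -> ~ N w -> b s w = beta s w.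
  by move=> s0 Nw; rewrite bN// (max_idPr s0).
have adb s : 0 <= s -> wrt_measurable (F s) (b s).
  move=> s0; apply: (@wrt_measurable_null _ _ _ _ beta s N (beta s)) => //.
    by move=> w Nw; rewrite bb.
  by apply: wrt_measurable_beta; rewrite s0 lexx.
have aeb s t : 0 <= s -> 0 <= t ->
    {ae P, forall w, (b t \- b s)%R w = (beta t \- beta s)%R w}.
  move=> s0 t0; exists N; split=> // w /=; apply: contra_notP => Nw.
  by change (b t w - b s w = beta t w - beta s w); rewrite !bb.
exists b; split=> //; first by exists N.
split.
- by apply: aeW => w; exact: b00.
- move=> s t s0 st E Y nE mY.
  have t0 := le_trans s0 st.
  (* An event of the past of [b] belongs to the augmented past of [beta], to which [increment_indep]
     applies. *)
  have FE : F s E.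
    move: nE; apply: smallest_sub; first exact: smallest_sigma_algebra.
    move=> A [r /=]; rewrite in_itv/= => /andP[r0 rs] [B mB <-]; rewrite setTI.
    by apply: (augmented_filtrationS rs); exact: adb.
  have mE := augmented_filtration_measurable FE.
  have mbd (c : R -> {RV P >-> R}) : measurable_fun setT (c t \- c s)%R.
    exact: measurable_funB.
  rewrite (ae_probability_preimage mE mY (mbd b) (mbd beta)); last exact: aeb.
  have := ae_probability_preimage measurableT mY (mbd b) (mbd beta) (aeb _ _ s0 t0).
  rewrite !setTI => ->.
  by apply: increment_indep => //; rewrite s0.
- move=> s t s0 st Y mY; have t0 := le_trans s0 (ltW st).
  have mbd (c : R -> {RV P >-> R}) : measurable_fun setT (c t \- c s)%R.
    exact: measurable_funB.
  have := ae_probability_preimage measurableT mY (mbd b) (mbd beta) (aeb _ _ s0 t0).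
  by rewrite !setTI => ->; exact: bm_increment_law.
- apply: aeW => w; exact: continuous_subspaceT.
Qed.

End Modification.

Section ModificationIndep.
Context {R : realType} {d : measure_display} {Omega : measurableType d}.
Variables (P : probability Omega R) (beta b : R -> {RV P >-> R}) (N : set Omega).
Hypotheses (hbeta : brownian_motion beta) (mN : measurable N) (N0 : P N = 0%E)
  (bbeta : forall s w, 0 <= s -> ~ N w -> b s w = beta s w).
Local Notation F := (augmented_filtration P (fun r => beta r)).

Lemma expect_indep_modification s t (f phi : R -> R) (X : Omega -> R) :
  0 <= s <= t ->
  wrt_measurable (F s) X -> measurable_fun setT f -> measurable_fun setT phi ->
  (forall x, 0 <= f x) -> (forall x, 0 <= phi x) ->
  (\int[P]_w (f (X w) * phi (b t w - b s w))%:E =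
   \int[P]_w (f (X w))%:E * \int[P]_w (phi (b t w - b s w))%:E)%E.
Proof.
move=> /[dup] st /andP[s0 s_t] mX mf mphi f0 phi0.
have t0 := le_trans s0 s_t.
have mXT := wrt_measurable_fun mX.
have mfX : measurable_fun setT (fun w => f (X w)) by exact: measurableT_comp.
have mphib (c : R -> {RV P >-> R}) : measurable_fun setT (fun w => phi (c t w - c s w)).
  by apply: measurableT_comp => //; exact: measurable_increment.
have bE w : ~ N w -> b t w - b s w = beta t w - beta s w by move=> Nw; rewrite !bbeta.
rewrite (@ge0_ae_eq_integral _ _ _ P setT _ (fun w => (f (X w) * phi (beta t w - beta s w))%:E))//;
  first last.
- exists N; split=> // w /= ; apply: contra_notP => Nw _; by rewrite bE.
- by move=> w _; rewrite lee_fin mulr_ge0.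
- by move=> w _; rewrite lee_fin mulr_ge0.
- by have := mphib beta => mb; meas.
- by have := mphib b => mb; meas.
rewrite (expect_indep hbeta)//; congr (_ * _)%E.
apply: ge0_ae_eq_integral => //.
- by have := mphib beta => mb; meas.
- by have := mphib b => mb; meas.
- by move=> w _; rewrite lee_fin.
- by move=> w _; rewrite lee_fin.
- exists N; split=> // w /=; apply: contra_notP => Nw _; by rewrite bE.
Qed.

End ModificationIndep.

(** * Square integrable functions and orthogonality of increments *)

Section L2.
Context {d : measure_display} {T : measurableType d} {R : realType}.
Variables (mu : {measure set T -> \bar R}) (D : set T).
Hypothesis mD : measurable D.
Implicit Types f g : T -> R.

Lemma L2_integrable_sqr f : L2_on mu D f -> mu.-integrable D (fun x => (f x ^+ 2)%:E).
Proof.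
move=> [mf fi]; apply/integrableP; split; first by meas.
by under eq_integral do rewrite abse_EFin ger0_norm ?sqr_ge0//.
Qed.

Lemma sqrD_le (x y : R) : (x + y) ^+ 2 <= 2 * x ^+ 2 + 2 * y ^+ 2.
Proof. by have := sqr_ge0 (x - y); nra. Qed.

Lemma sqrD_integral_le f g : measurable_fun D f -> measurable_fun D g ->
  (\int[mu]_(x in D) ((f x + g x) ^+ 2)%:E <=
   2%:E * \int[mu]_(x in D) (f x ^+ 2)%:E + 2%:E * \int[mu]_(x in D) (g x ^+ 2)%:E)%E.
Proof.
move=> mf mg.
rewrite -!ge0_integralZ_EFin//; first last.
- by move=> x _; exact: sqr_ge0.
- by meas.
- by move=> x _; exact: sqr_ge0.
- by meas.
rewrite -ge0_integralD_EFin//; first last.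
- by move=> x _; rewrite mulr_ge0// sqr_ge0.
- by move=> x _; rewrite mulr_ge0// sqr_ge0.
- by meas.
- by meas.
apply: ge0_le_integral_EFin => //; [by meas|by meas| |].
  by move=> x _; rewrite sqr_ge0.
by move=> x _; exact: sqrD_le.
Qed.

Lemma L2_onD f g : L2_on mu D f -> L2_on mu D g -> L2_on mu D (fun x => f x + g x).
Proof.
move=> [mf fi] [mg gi]; split; first by meas.
apply: le_lt_trans (sqrD_integral_le mf mg) _.
by apply: lte_add_pinfty; apply: lte_mul_pinfty.
Qed.

Lemma L2_onZ (k : R) f : L2_on mu D f -> L2_on mu D (fun x => k * f x).
Proof.
move=> [mf fi]; split; first by meas.
under eq_integral do rewrite exprMn.
rewrite ge0_integralZ_EFin//; [|by meas|by rewrite sqr_ge0|by move=> x _; rewrite sqr_ge0].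
by apply: lte_mul_pinfty => //; rewrite lee_fin sqr_ge0.
Qed.

Lemma L2_onB f g : L2_on mu D f -> L2_on mu D g -> L2_on mu D (fun x => f x - g x).
Proof.
move=> hf /(L2_onZ (- 1)) hg; have := L2_onD hf hg.
by under eq_fun do rewrite mulN1r.
Qed.

Lemma L2_on0 : L2_on mu D (fun=> 0).
Proof.
split; first exact: measurable_cst.
by under eq_integral do rewrite expr0n/=; rewrite integral0.
Qed.

Lemma L2_on_sum (I : Type) (s : seq I) (f : I -> T -> R) :
  (forall i, L2_on mu D (f i)) -> L2_on mu D (fun x => \sum_(i <- s) f i x).
Proof.
move=> hf; elim: s => [|i s ih].
  by under eq_fun do rewrite big_nil; exact: L2_on0.
by under eq_fun do rewrite big_cons; exact: L2_onD.
Qed.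

Lemma L2_le f g : measurable_fun D f -> L2_on mu D g ->
  (forall x, D x -> `|f x| <= `|g x|) -> L2_on mu D f.
Proof.
move=> mf [mg gi] fg; split=> //; apply: le_lt_trans gi.
apply: ge0_le_integral_EFin => //; [by meas|by meas| |].
  by move=> x _; rewrite sqr_ge0.
move=> x Dx; rewrite -(real_normK (num_real (f x))) -(real_normK (num_real (g x))).
by apply: lerXn2r; rewrite ?nnegrE//; exact: fg.
Qed.

Lemma L2M_integrable f g : L2_on mu D f -> L2_on mu D g ->
  mu.-integrable D (fun x => (f x * g x)%:E).
Proof.
move=> [mf fi] [mg gi]; apply/integrableP; split; first by meas.
apply: (@le_lt_trans _ _ (\int[mu]_(x in D) (f x ^+ 2 + g x ^+ 2)%:E)%E).
  under eq_integral do rewrite abse_EFin.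
  apply: ge0_le_integral_EFin => //; [by meas|by meas|].
  move=> x _; rewrite normrM -(real_normK (num_real (f x))) -(real_normK (num_real (g x))).
  by have := sqr_ge0 (`|f x| - `|g x|); have := sqr_ge0 `|f x|; have := sqr_ge0 `|g x|; nra.
rewrite ge0_integralD_EFin//; [|by meas|by meas|by move=> x _; exact: sqr_ge0
  |by move=> x _; exact: sqr_ge0].
exact: lte_add_pinfty.
Qed.

Lemma Rintegral_EFin f : mu.-integrable D (fun x => (f x)%:E) ->
  (\int[mu]_(x in D) (f x)%:E = (\int[mu]_(x in D) f x)%:E)%E.
Proof. by move=> fi; rewrite /Rintegral fineK//; exact: integrable_fin_num. Qed.

End L2.

(** Adaptedness refers to the filtration of [beta], in which the control has to live, while the
    paths are those of [b], continuous for every [w]. Differential equations can then be solved path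
    by path without exceptional sets. *)
Record regular_modification {R : realType} {d : measure_display}
  {Omega : measurableType d} (P : probability Omega R)
  (beta b : R -> {RV P >-> R}) : Prop := RegularModification {
  rm_bm : brownian_motion b ;
  rm_continuous : forall w, continuous (fun s => b s w) ;
  rm_start : forall s w, s <= 0 -> b s w = 0 ;
  rm_adapted : forall s, 0 <= s ->
    wrt_measurable (augmented_filtration P (fun r => beta r) s) (b s) ;
  rm_null : exists N, [/\ measurable N, P N = 0%E &
    forall s w, 0 <= s -> ~ N w -> b s w = beta s w] }.

Section Orthogonality.
Context {R : realType} {d : measure_display} {Omega : measurableType d}.
Variables (P : probability Omega R) (beta b : R -> {RV P >-> R}).
Hypotheses (hbeta : brownian_motion beta) (hb : regular_modification beta b).
Local Notation F := (augmented_filtration P (fun r => beta r)).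

Lemma expect_indep_rm s t (f phi : R -> R) (X : Omega -> R) :
  0 <= s <= t ->
  wrt_measurable (F s) X -> measurable_fun setT f -> measurable_fun setT phi ->
  (forall x, 0 <= f x) -> (forall x, 0 <= phi x) ->
  (\int[P]_w (f (X w) * phi (b t w - b s w))%:E =
   \int[P]_w (f (X w))%:E * \int[P]_w (phi (b t w - b s w))%:E)%E.
Proof.
have [N [mN N0 bN]] := rm_null hb.
exact: (expect_indep_modification hbeta mN N0 bN).
Qed.

(** Both variables are split into positive and negative parts, and the nonnegative case applies to
    the four products. *)
Lemma expect_indep_signed s t (phi : R -> R) (X : Omega -> R) :
  0 <= s <= t -> wrt_measurable (F s) X -> measurable_fun setT phi ->
  P.-integrable setT (fun w => (X w)%:E) ->
  P.-integrable setT (fun w => (phi (b t w - b s w))%:E) ->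
  P.-integrable setT (fun w => (X w * phi (b t w - b s w))%:E) /\
  \int[P]_w (X w * phi (b t w - b s w)) =
  (\int[P]_w (X w)) * \int[P]_w (phi (b t w - b s w)).
Proof.
move=> st mX mphi Xi phii.
have mXT := wrt_measurable_fun mX.
have mD := measurable_increment b s t.
have mphiD : measurable_fun setT (fun w => phi (b t w - b s w)) by exact: measurableT_comp.
pose pp (x : R) : R := Num.max x 0.
pose pn (x : R) : R := Num.max (- x) 0.
have mpp : measurable_fun setT pp by exact: measurable_maxr.
have mpn : measurable_fun setT pn.
  by apply: measurable_maxr => //; meas.
have pp0 x : 0 <= pp x by rewrite /pp le_max lexx orbT.
have pn0 x : 0 <= pn x by rewrite /pn le_max lexx orbT.
have pE x : x = pp x - pn x.
  rewrite /pp /pn; case/orP: (le_total 0 x) => x0.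
    by rewrite (max_idPl x0) (max_idPr _) ?oppr_le0// subr0.
  by rewrite (max_idPr x0) (max_idPl _) ?oppr_ge0// sub0r opprK.
have ppl x : pp x <= `|x| by rewrite /pp ge_max ler_norm normr_ge0.
have pnl x : pn x <= `|x| by rewrite /pn ge_max -normrN ler_norm normr_ge0.
have dom (f : R -> R) (Y : Omega -> R) : measurable_fun setT f -> measurable_fun setT Y ->
    (forall x, 0 <= f x) -> (forall x, f x <= `|x|) ->
    P.-integrable setT (fun w => (Y w)%:E) -> P.-integrable setT (fun w => (f (Y w))%:E).
  move=> mf mY f0 fl Yi; apply: le_integrable Yi => //.
    by apply/measurable_EFinP; exact: measurableT_comp.
  by move=> w _; rewrite lee_fin ger0_norm.
have key (f g : R -> R) : measurable_fun setT f -> measurable_fun setT g ->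
    (forall x, 0 <= f x) -> (forall x, 0 <= g x) ->
    (forall x, f x <= `|x|) -> (forall x, g x <= `|x|) ->
    P.-integrable setT (fun w => (f (X w) * g (phi (b t w - b s w)))%:E) /\
    \int[P]_w (f (X w) * g (phi (b t w - b s w))) =
      (\int[P]_w (f (X w))) * \int[P]_w (g (phi (b t w - b s w))).
  move=> mf mg f0 g0 fl gl.
  have fi := dom f X mf mXT f0 fl Xi.
  have gi := dom g _ mg mphiD g0 gl phii.
  have E := @expect_indep_rm s t f (fun x => g (phi x)) X st mX mf
    (measurableT_comp mg mphi) f0 (fun x => g0 _).
  have fin1 := integrable_fin_num measurableT fi.
  have fin2 := integrable_fin_num measurableT gi.
  split; last by rewrite /Rintegral E fineM.
  apply/integrableP; split.
    apply/measurable_EFinP/measurable_funM; first exact: measurableT_comp.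
    by apply: measurableT_comp => //; exact: measurableT_comp.
  under eq_integral do rewrite abse_EFin ger0_norm ?mulr_ge0//.
  by rewrite E -(fineK fin1) -(fineK fin2) -EFinM ltry.
have [i1 e1] := key pp pp mpp mpp pp0 pp0 ppl ppl.
have [i2 e2] := key pp pn mpp mpn pp0 pn0 ppl pnl.
have [i3 e3] := key pn pp mpn mpp pn0 pp0 pnl ppl.
have [i4 e4] := key pn pn mpn mpn pn0 pn0 pnl pnl.
have i12 := integrableB_EFin measurableT i1 i2.
have i34 := integrableB_EFin measurableT i3 i4.
have i1234 := integrableB_EFin measurableT i12 i34.
have prodE w : X w * phi (b t w - b s w) =
    (pp (X w) * pp (phi (b t w - b s w)) - pp (X w) * pn (phi (b t w - b s w))) -
    (pn (X w) * pp (phi (b t w - b s w)) - pn (X w) * pn (phi (b t w - b s w))).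
  by rewrite {1}(pE (X w)) {1}(pE (phi _)); ring.
split; first by under eq_fun do rewrite prodE.
have XE : \int[P]_w (X w) = \int[P]_w (pp (X w)) - \int[P]_w (pn (X w)).
  rewrite -RintegralB//; [|exact: (dom pp)|exact: (dom pn)].
  by apply: eq_Rintegral => w _; rewrite -pE.
have phiE : \int[P]_w (phi (b t w - b s w)) =
    \int[P]_w (pp (phi (b t w - b s w))) - \int[P]_w (pn (phi (b t w - b s w))).
  rewrite -RintegralB//; [|exact: (dom pp)|exact: (dom pn)].
  by apply: eq_Rintegral => w _; rewrite -pE.
under eq_Rintegral do rewrite prodE.
rewrite RintegralB// RintegralB// RintegralB// e1 e2 e3 e4 XE phiE.
by ring.
Qed.

Lemma wrt_measurable_cst s (c : R) : wrt_measurable (F s) (fun=> c).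
Proof. by apply/wrt_measurableP; exact: measurable_cst. Qed.

Lemma wrt_measurableD s (X Y : Omega -> R) : wrt_measurable (F s) X ->
  wrt_measurable (F s) Y -> wrt_measurable (F s) (fun w => X w + Y w).
Proof.
by move=> /wrt_measurableP hX /wrt_measurableP hY; apply/wrt_measurableP; meas.
Qed.

Lemma wrt_measurableM s (X Y : Omega -> R) : wrt_measurable (F s) X ->
  wrt_measurable (F s) Y -> wrt_measurable (F s) (fun w => X w * Y w).
Proof.
by move=> /wrt_measurableP hX /wrt_measurableP hY; apply/wrt_measurableP; meas.
Qed.

Lemma wrt_measurable_comp s (f : R -> R) (X : Omega -> R) : wrt_measurable (F s) X ->
  measurable_fun setT f -> wrt_measurable (F s) (fun w => f (X w)).
Proof.
move=> /wrt_measurableP hX mf; apply/wrt_measurableP.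
exact: measurableT_comp.
Qed.

Lemma wrt_measurable_increment r s t : 0 <= r -> 0 <= s -> r <= t -> s <= t ->
  wrt_measurable (F t) (fun w => b s w - b r w).
Proof.
move=> r0 s0 rt st.
have hr := wrt_measurableS rt (rm_adapted hb r0).
have hs := wrt_measurableS st (rm_adapted hb s0).
move: hr hs => /wrt_measurableP hr /wrt_measurableP hs.
by apply/wrt_measurableP; meas.
Qed.

Lemma L2_indep s t (phi : R -> R) (X : Omega -> R) : 0 <= s <= t ->
  wrt_measurable (F s) X -> measurable_fun setT phi -> L2_on P setT X ->
  (\int[P]_w (phi (b t w - b s w) ^+ 2)%:E < +oo)%E ->
  L2_on P setT (fun w => X w * phi (b t w - b s w)) /\
  (\int[P]_w ((X w * phi (b t w - b s w)) ^+ 2)%:E =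
   \int[P]_w (X w ^+ 2)%:E * \int[P]_w (phi (b t w - b s w) ^+ 2)%:E)%E.
Proof.
move=> st mX mphi [mXT XL] pL.
have E : (\int[P]_w ((X w * phi (b t w - b s w)) ^+ 2)%:E =
   \int[P]_w (X w ^+ 2)%:E * \int[P]_w (phi (b t w - b s w) ^+ 2)%:E)%E.
  under eq_integral do rewrite exprMn.
  apply: (@expect_indep_rm s t (fun x => x ^+ 2) (fun x => phi x ^+ 2)) => //.
  - exact: measurable_funX.
  - by move=> x; exact: sqr_ge0.
  - by move=> x; exact: sqr_ge0.
split=> //; split.
  apply: measurable_funM => //; apply: measurableT_comp => //.
  exact: measurable_increment.
rewrite E; apply: lte_mul_pinfty => //.
- by apply: integral_ge0_EFin => w _; exact: sqr_ge0.
- by rewrite ge0_fin_numE//; apply: integral_ge0_EFin => w _; exact: sqr_ge0.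
Qed.

(* S and xi are known at time s while phi(b_t - b_s) is centered and
   independent of the past, so that the cross term vanishes. *)
Lemma martingale_step s t (phi : R -> R) (S xi : Omega -> R) : 0 <= s <= t ->
  wrt_measurable (F s) S -> wrt_measurable (F s) xi -> measurable_fun setT phi ->
  L2_on P setT S -> L2_on P setT xi ->
  (\int[P]_w (phi (b t w - b s w) ^+ 2)%:E < +oo)%E ->
  (\int[P]_w (phi (b t w - b s w))%:E = 0)%E ->
  P.-integrable setT (fun w => (phi (b t w - b s w))%:E) ->
  (\int[P]_w ((S w + xi w * phi (b t w - b s w)) ^+ 2)%:E =
   \int[P]_w (S w ^+ 2)%:E +
   \int[P]_w (xi w ^+ 2)%:E * \int[P]_w (phi (b t w - b s w) ^+ 2)%:E)%E.
Proof.
move=> st mS mxi mphi LS Lxi pL p0 pint.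
have [L2p E2] := L2_indep st mxi mphi Lxi pL.
have Sxi := L2M_integrable measurableT LS Lxi.
have [ci cE] := expect_indep_signed st (wrt_measurableM mS mxi) mphi Sxi pint.
have LSp := L2_onD measurableT LS L2p.
have i1 := L2_integrable_sqr LSp.
have iS := L2_integrable_sqr LS.
have ip := L2_integrable_sqr L2p.
have ci2 := integrableZ_EFin measurableT 2 ci.
rewrite -E2 (Rintegral_EFin measurableT i1) (Rintegral_EFin measurableT iS).
rewrite (Rintegral_EFin measurableT ip) -EFinD; congr EFin.
have -> : (fun w => (S w + xi w * phi (b t w - b s w)) ^+ 2) =
  (fun w => S w ^+ 2 + (2 * (S w * xi w * phi (b t w - b s w)) +
    (xi w * phi (b t w - b s w)) ^+ 2)) by apply/funext => w; ring.
have i3 := integrableD_EFin measurableT ci2 ip.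
rewrite RintegralD// RintegralD//.
rewrite (@RintegralZl _ _ _ P setT (fun w => S w * xi w * phi (b t w - b s w)) 2)//.
rewrite cE [X in 2 * (_ * X)](_ : _ = 0); last by rewrite /Rintegral p0.
by rewrite !mulr0 add0r.
Qed.

End Orthogonality.

(** * Path integrals and gain processes *)

Section PathIntegral.
Context {R : realType}.
Local Notation mu := (@lebesgue_measure R).

Lemma lebesgue_measure_oo (r s : R) : r <= s -> mu `]r, s[%classic = (s - r)%:E.
Proof.
move=> rs; rewrite lebesgue_measure_itv/=; case: ifPn => //.
rewrite lte_fin -leNgt => sr; have -> : s = r by apply/eqP; rewrite eq_le sr.
by rewrite subrr.
Qed.

Lemma continuous_integrable (r s : R) (f : R -> R) : continuous f ->
  mu.-integrable `]r, s[ (fun v => (f v)%:E).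
Proof.
move=> cf; apply: (@integrableS _ _ _ mu `[r, s]%classic) => //.
  by apply: subset_itvW; rewrite bnd_simp.
by apply: continuous_compact_integrable;
  [exact: segment_compact|exact: continuous_subspaceT].
Qed.

Lemma continuous_mul_integrable (r s : R) (f g : R -> R) : continuous f ->
  mu.-integrable `]r, s[ (fun v => (g v)%:E) ->
  mu.-integrable `]r, s[ (fun v => (f v * g v)%:E).
Proof.
move=> cf gi.
have mf : measurable_fun `]r, s[%classic f.
  by apply: measurable_funTS; exact: continuous_measurable_fun.
have mg : measurable_fun `]r, s[%classic g by apply/measurable_EFinP; exact: measurable_int gi.
have [M HM] : exists M, forall v, v \in `]r, s[%classic -> `|f v| <= M.
  have cs := @segment_compact R r s.
  have : bounded_set (f @` `[r, s]).
    apply: compact_bounded; apply: continuous_compact => //.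
    exact: continuous_subspaceT.
  move=> [M [_ HM]]; exists (M + 1) => v /[!inE] vrs.
  apply: (HM (M + 1)); first by rewrite ltrDl.
  exists v => //=; move: vrs; rewrite /= !in_itv /= => /andP[/ltW -> /ltW ->//].
apply: (@le_integrable _ _ _ mu `]r, s[%classic _ _ (fun v => (M * g v)%:E)) => //.
- by meas.
- move=> v vrs; rewrite lee_fin !normrM ler_wpM2r//.
  by rewrite (le_trans (HM v _)) ?ler_norm// inE.
- exact: integrableZ_EFin.
Qed.

Lemma Rintegral_cat (r s t : R) (f : R -> R) : r <= s -> s <= t ->
  mu.-integrable `]r, t[ (fun v => (f v)%:E) ->
  \int[mu]_(v in `]r, t[) f v =
  \int[mu]_(v in `]r, s[) f v + \int[mu]_(v in `]s, t[) f v.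
Proof.
move=> rs st fi.
have mf : measurable_fun `]r, t[%classic f by apply/measurable_EFinP; exact: measurable_int fi.
have fi2 : mu.-integrable `]s, t[ (EFin \o f).
  apply: integrableS fi => //; by apply: subset_itvW => //.
move: rs; rewrite le_eqVlt => /predU1P[->|rs].
  by rewrite set_itvoo0// Rintegral_set0 add0r.
move: st; rewrite le_eqVlt => /predU1P[<-|st].
  by rewrite (set_itvoo0 s)// Rintegral_set0 addr0.
have := @Rintegral_itvB _ f (BRight r) (BLeft t) s fi.
rewrite !bnd_simp (ltW rs) st => /(_ isT isT) <-.
rewrite (@Rintegral_itv_bndo_bndc _ (BRight r) s); first by rewrite addrC subrK.
by apply: integrableS fi => //; apply: subset_itvl; rewrite bnd_simp ltW.
Qed.

Lemma Rintegral_partition (n : nat) (tau : nat -> R) (f : R -> R) :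
  (forall i, tau i <= tau i.+1) ->
  mu.-integrable `]tau 0%N, tau n[ (fun v => (f v)%:E) ->
  \int[mu]_(v in `]tau 0%N, tau n[) f v =
  \sum_(i < n) \int[mu]_(v in `]tau i, tau i.+1[) f v.
Proof.
move=> tauS; elim: n => [|n ih] fi.
  by rewrite big_ord0 set_itvoo0// Rintegral_set0.
have t0n : tau 0%N <= tau n by apply: (@homo_leq _ tau (<=%R)) => //; exact: le_trans.
rewrite big_ord_recr/= -ih; first exact: Rintegral_cat.
by apply: integrableS fi => //; apply: subset_itvl; rewrite bnd_simp.
Qed.

Lemma ge0_integral_partition (n : nat) (tau : nat -> R) (f : R -> \bar R) :
  (forall i, tau i <= tau i.+1) -> measurable_fun `]tau 0%N, tau n[ f ->
  (forall v, 0 <= f v)%E ->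
  (\sum_(i < n) \int[mu]_(v in `]tau i, tau i.+1[) f v <=
   \int[mu]_(v in `]tau 0%N, tau n[) f v)%E.
Proof.
move=> tauS; elim: n => [|n ih] mf f0.
  by rewrite big_ord0; exact: integral_ge0.
have t0n : tau 0%N <= tau n by apply: (@homo_leq _ tau (<=%R)) => //; exact: le_trans.
have sub1 : `]tau 0%N, tau n[ `<=` `]tau 0%N, tau n.+1[.
  by apply: subset_itvl; rewrite bnd_simp.
have sub2 : `]tau n, tau n.+1[ `<=` `]tau 0%N, tau n.+1[.
  by apply: subset_itvr; rewrite bnd_simp.
rewrite big_ord_recr/=.
have := ih (measurable_funS (measurable_itv _) sub1 mf) f0.
move=> /(leeD2r (\int[mu]_(v in `]tau n, tau n.+1[) f v)%E) /le_trans; apply.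
rewrite -ge0_integral_setU//=.
- apply: ge0_subset_integral => //; first exact: measurableU.
  by move=> v [/sub1|/sub2].
- apply: measurable_funS mf => //; by move=> v [/sub1|/sub2].
- apply/disj_setPLR => v /=; rewrite !in_itv/= => /andP[_ vn] /andP[nv _].
  by have := lt_trans vn nv; rewrite ltxx.
Qed.

End PathIntegral.

Section Gains.
Context {R : realType} {d : measure_display} {Omega : measurableType d}.
Variables (P : probability Omega R) (beta b : R -> {RV P >-> R}).
Hypotheses (hbeta : brownian_motion beta) (hb : regular_modification beta b).
Variable a : bool.
Local Notation F := (augmented_filtration P (fun r => beta r)).

Definition pgain (s t : R) (w : Omega) : R := gain a (t - s) (b t w - b s w).
Definition pegain (s t : R) (w : Omega) : R := egain a (t - s) (b t w - b s w).

Lemma pegain_flow r s t w : pegain r t w = pegain r s w * pegain s t w.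
Proof. by rewrite /pegain -egain_flow; congr (egain a _ _); ring. Qed.

Lemma pgain_flow r s t w : pgain r t w = pgain r s w + pegain r s w * pgain s t w.
Proof. by rewrite /pgain /pegain -gain_flow; congr (gain a _ _); ring. Qed.

Lemma pegainE s t w : pegain s t w = 1 + a%:R * pgain s t w.
Proof. by []. Qed.

Lemma pegain_gt0 s t w : 0 < pegain s t w.
Proof. exact: egain_gt0. Qed.

Lemma pgain_refl s w : pgain s s w = 0.
Proof. by rewrite /pgain !subrr gain0. Qed.

Lemma pegain_refl s w : pegain s s w = 1.
Proof. by rewrite /pegain !subrr egain0. Qed.

Lemma continuous_pgain_r s w : continuous (fun t => pgain s t w).
Proof.
apply: continuous_gain => t; apply: cvgB;
  [exact: cvg_id|exact: cvg_cst|exact: (rm_continuous hb)|exact: cvg_cst].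
Qed.

Lemma continuous_pgain_l t w : continuous (fun s => pgain s t w).
Proof.
apply: continuous_gain => s; apply: cvgB;
  [exact: cvg_cst|exact: cvg_id|exact: cvg_cst|exact: (rm_continuous hb)].
Qed.

Lemma continuous_pegain_r s w : continuous (fun t => pegain s t w).
Proof.
move=> t; apply: cvgD; first exact: cvg_cst.
by apply: cvgM; [exact: cvg_cst|exact: continuous_pgain_r].
Qed.

Lemma continuous_pegain_l t w : continuous (fun s => pegain s t w).
Proof.
move=> s; apply: cvgD; first exact: cvg_cst.
by apply: cvgM; [exact: cvg_cst|exact: continuous_pgain_l].
Qed.

Lemma wrt_measurable_pgain r s t : 0 <= r -> 0 <= s -> r <= t -> s <= t ->
  wrt_measurable (F t) (pgain r s).
Proof.
move=> r0 s0 rt st; apply: (@wrt_measurable_comp _ _ _ _ _ _ (gain a (s - r))).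
  exact: wrt_measurable_increment.
exact: measurable_gain.
Qed.

Lemma wrt_measurable_pegain r s t : 0 <= r -> 0 <= s -> r <= t -> s <= t ->
  wrt_measurable (F t) (pegain r s).
Proof.
move=> r0 s0 rt st; apply: (@wrt_measurable_comp _ _ _ _ _ _ (egain a (s - r))).
  exact: wrt_measurable_increment.
exact: measurable_egain.
Qed.

Lemma measurable_pgain s t : measurable_fun setT (pgain s t).
Proof.
by apply: measurableT_comp; [exact: measurable_gain|exact: measurable_increment].
Qed.

Lemma measurable_pegain s t : measurable_fun setT (pegain s t).
Proof.
by apply: measurableT_comp; [exact: measurable_egain|exact: measurable_increment].
Qed.

Lemma pgain_sqr (T : R) : 0 <= T -> exists2 C, 0 <= C & forall s t,
  0 <= s <= t -> t - s <= T ->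
  (\int[P]_w (pgain s t w ^+ 2)%:E <= (C * (t - s))%:E)%E.
Proof.
move=> T0; have [C C0 H] := gain_moment (rm_bm hb) a 1 T0.
exists C => // s t st stT; have := H s t st stT; rewrite expr1.
by under eq_integral do rewrite (real_normK (num_real _)).
Qed.

Lemma pegain_sqr (T : R) : 0 <= T -> exists2 C, 0 <= C & forall s t,
  0 <= s <= t -> t - s <= T ->
  (\int[P]_w (pegain s t w ^+ 2)%:E <= C%:E)%E.
Proof.
move=> T0; have [C C0 H] := pgain_sqr T0.
exists (2 + 2 * (C * T)) => [|s t st stT]; first by rewrite addr_ge0// !mulr_ge0.
have mg := measurable_pgain s t; have mag : measurable_fun setT (fun w => a%:R * pgain s t w) by meas.
have m1 : measurable_fun setT (fun _ : Omega => 1 : R) by exact: measurable_cst.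
apply: le_trans (sqrD_integral_le P measurableT m1 mag) _.
rewrite (EFinD 2); apply: leeD.
  under eq_integral do rewrite expr1n.
  by rewrite integral_cst//= probability_setT !mule1.
rewrite (EFinM 2); apply: lee_wpmul2l => //.
apply: (@le_trans _ _ (\int[P]_w (pgain s t w ^+ 2)%:E)%E).
  apply: ge0_le_integral_EFin => //; [by meas|by meas| |].
    by move=> w _; rewrite sqr_ge0.
  move=> w _; case: a; first by rewrite mul1r.
  by rewrite mul0r expr0n sqr_ge0.
apply: le_trans (H s t st stT) _; rewrite lee_fin ler_wpM2l//.
Qed.

End Gains.

(** * The Ito product rule through Riemann sums *)

Section ItoProduct.
Context {R : realType} {d : measure_display} {Omega : measurableType d}.
Variables (P : probability Omega R) (beta b : R -> {RV P >-> R}).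
Hypotheses (hbeta : brownian_motion beta) (hb : regular_modification beta b).
Variable a : bool.
Local Notation F := (augmented_filtration P (fun r => beta r)).
Local Notation RT := (measurableTypeR R).
Local Notation mu := (@lebesgue_measure R).
Local Notation e s w := (pegain b a 0 s w).
Local Notation g s w := (pgain b a 0 s w).
Variables (T : R) (phi q : R -> Omega -> R).
Hypotheses (T0 : 0 <= T)
  (mphi : measurable_fun setT (fun z : RT * Omega => phi z.1 z.2))
  (aphi : forall r, 0 < r < T -> wrt_measurable (F r) (phi r))
  (iphi : forall w, mu.-integrable `]0, T[ (fun v => (phi v w)%:E))
  (mq : measurable_fun setT (fun z : RT * Omega => q z.1 z.2))
  (aq : forall s, 0 <= s <= T -> wrt_measurable (F s) (q s))
  (qE : forall s w, 0 <= s <= T ->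
     q s w = q 0 w + \int[mu]_(v in `]0, s[) phi v w)
  (q0L : L2_on P setT (q 0)).

Definition ephi_sqr v : \bar R := (\int[P]_w ((e v w * phi v w) ^+ 2)%:E)%E.
Local Notation Lam := ephi_sqr.
Hypothesis Lam_fin : (\int[mu]_(v in `]0%R, T[) Lam v < +oo)%E.

Lemma measurable_egain_process :
  measurable_fun setT (fun z : RT * Omega => e z.1 z.2).
Proof.
apply: measurable_continuous_process => [w|s].
  exact: (continuous_pegain_r hb).
exact: measurable_pegain.
Qed.

Lemma measurable_ephi :
  measurable_fun setT (fun z : RT * Omega => e z.1 z.2 * phi z.1 z.2).
Proof. by have := measurable_egain_process => me; meas. Qed.

Lemma Lam_ge0 v : (0 <= Lam v)%E.
Proof. by apply: integral_ge0_EFin => w _; exact: sqr_ge0. Qed.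

Lemma measurable_Lam (D : set RT) : measurable D -> measurable_fun D Lam.
Proof.
move=> mD.
apply: (@measurable_section_integral _ _ _ P D (fun v w => (e v w * phi v w) ^+ 2)) => //.
  by apply: measurable_funTS => /=; have := measurable_ephi => m; meas.
by move=> *; exact: sqr_ge0.
Qed.

Lemma adapted_ephi r : 0 < r < T -> wrt_measurable (F r) (fun w => e r w * phi r w).
Proof.
move=> /[dup] rT /andP[r0 _].
apply: wrt_measurableM; last exact: aphi.
by apply: (wrt_measurable_pegain hb) => //; exact: ltW.
Qed.

(** Cauchy-Schwarz in [v] and Tonelli reduce the claim to a fixed [v]. There the kernel depends on
    the increment after [v], while [e v * phi v] is known at time [v], so the second moment of the
    product factors and is at most [C] times [Lam v]. *)
Lemma kernel_integral_le (K : R -> R -> R) (C r s : R) :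
  0 <= r -> r <= s -> s <= T -> 0 <= C ->
  (forall h, measurable_fun setT (K h)) ->
  (forall w, continuous (fun v => K (s - v) (b s w - b v w))) ->
  (forall v, r < v < s -> (\int[P]_w (K (s - v) (b s w - b v w) ^+ 2)%:E <= C%:E)%E) ->
  (\int[P]_w ((\int[mu]_(v in `]r, s[) (K (s - v) (b s w - b v w) * (e v w * phi v w))) ^+ 2)%:E
   <= ((s - r) * C)%:E * \int[mu]_(v in `]r, s[) Lam v)%E.
Proof.
move=> r0 rs sT C0 mK cK KC.
have sr0 : 0 <= s - r by rewrite subr_ge0.
have mKb v : measurable_fun setT (fun w => K (s - v) (b s w - b v w)).
  by apply: measurableT_comp => //; exact: measurable_increment.
have mKp : measurable_fun setT (fun z : RT * Omega => K (s - z.1) (b s z.2 - b z.1 z.2)).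
  exact: (measurable_continuous_process (f := fun v w => K (s - v) (b s w - b v w))).
have mep := measurable_ephi.
pose f v w := K (s - v) (b s w - b v w) * (e v w * phi v w).
have mf : measurable_fun setT (fun z : RT * Omega => f z.1 z.2) by rewrite /f; meas.
have mfw w : measurable_fun setT (fun v : RT => f v w).
  have mp : measurable_fun setT (fun v : RT => (v, w)) by exact: measurable_fun_pair.
  exact: (measurableT_comp mf mp).
have mfD D : measurable_fun D (fun z : RT * Omega => f z.1 z.2 ^+ 2).
  by apply: measurable_funTS; meas.
have mD : measurable (`]r, s[%classic : set RT) by exact: measurable_itv.
have mint := @measurable_path_integral _ _ _ _ (fun v w => f v w ^+ 2) mD (mfD _)
  (fun _ _ _ => sqr_ge0 _).
apply: (@le_trans _ _ (\int[P]_w ((s - r)%:E * \int[mu]_(v in `]r, s[) (f v w ^+ 2)%:E))%E).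
  apply: ge0_le_integral => //.
  - by move=> w _; rewrite lee_fin sqr_ge0.
  - by have := measurable_Rintegral mD mf => m; meas.
  - exact: measurable_funeM.
  - move=> w _; apply: sqr_Rintegral_le => //.
    + exact: lebesgue_measure_oo.
    + apply: measurable_funTS; exact: mfw.
rewrite ge0_integralZl//; first last.
- by move=> w _; apply: integral_ge0_EFin => v _; exact: sqr_ge0.
rewrite -(@tonelli_cylinder _ _ _ P _ (fun v w => f v w ^+ 2) mD (mfD _)); last first.
  by move=> *; exact: sqr_ge0.
rewrite EFinM -muleA; apply: lee_wpmul2l; first by rewrite lee_fin.
rewrite -ge0_integralZl//; first last.
- by move=> v _; exact: Lam_ge0.
- exact: measurable_Lam.
apply: ge0_le_integral => //.
- by move=> v _; apply: integral_ge0_EFin => w _; exact: sqr_ge0.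
- exact: (@measurable_section_integral _ _ _ P _ (fun v w => f v w ^+ 2) mD (mfD _) (fun _ _ _ => sqr_ge0 _)).
- by apply: measurable_funeM; exact: measurable_Lam.
move=> v; rewrite /= in_itv/= => /andP[rv vs].
have v0 := le_lt_trans r0 rv.
have vT := lt_le_trans vs sT.
rewrite /f; under eq_integral do rewrite mulrC exprMn.
rewrite (@expect_indep_rm _ _ _ _ _ _ hbeta hb v s (fun x => x ^+ 2)
  (fun x => K (s - v) x ^+ 2) (fun w => e v w * phi v w))//.
- by rewrite muleC; apply: lee_wpmul2r; [exact: Lam_ge0|exact: KC (introT andP (conj rv vs))].
- by rewrite (ltW v0) ltW.
- by apply: adapted_ephi; rewrite v0.
- exact: measurable_funX.
- by move=> x; exact: sqr_ge0.
- by move=> x; exact: sqr_ge0.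
Qed.

Lemma q_increment r s w : 0 <= r -> r <= s -> s <= T ->
  q s w = q r w + \int[mu]_(v in `]r, s[) phi v w.
Proof.
move=> r0 rs sT; rewrite (qE w (s := s)) ?(le_trans r0 rs)//.
rewrite (qE w (s := r)) ?r0 ?(le_trans rs sT)// -addrA; congr (_ + _).
apply: Rintegral_cat => //; apply: integrableS (iphi w) => //.
by apply: subset_itvl; rewrite bnd_simp.
Qed.

Lemma iphiS r s w : 0 <= r -> s <= T -> mu.-integrable `]r, s[ (fun v => (phi v w)%:E).
Proof.
move=> r0 sT; apply: integrableS (iphi w) => //.
by apply: subset_itv; rewrite bnd_simp.
Qed.

Lemma measurable_phi_integral r s :
  measurable_fun setT (fun w => \int[mu]_(v in `]r, s[) phi v w).
Proof. by apply: measurable_Rintegral => //; exact: measurable_itv. Qed.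

Lemma ephi_increment_sqr : exists2 C, 0 <= C & forall r s, 0 <= r -> r <= s -> s <= T ->
  (\int[P]_w ((e s w * \int[mu]_(v in `]r, s[) phi v w) ^+ 2)%:E
   <= ((s - r) * C)%:E)%E.
Proof.
have [CE CE0 HE] := pegain_sqr hb a T0.
pose L := fine (\int[mu]_(v in `]0%R, T[) Lam v)%E.
have L0 : 0 <= L by rewrite fine_ge0//; apply: integral_ge0 => v _; exact: Lam_ge0.
have LE : (\int[mu]_(v in `]0%R, T[) Lam v = L%:E)%E.
  by rewrite fineK// ge0_fin_numE//; apply: integral_ge0 => v _; exact: Lam_ge0.
exists (CE * L) => [|r s r0 rs sT]; first exact: mulr_ge0.
(* The factor at the later time splits as [e s = e v * pegain v s], a quantity known at time [v]
   times a function of the increment after [v]. *)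
have -> : (\int[P]_w ((e s w * \int[mu]_(v in `]r, s[) phi v w) ^+ 2)%:E =
  \int[P]_w ((\int[mu]_(v in `]r, s[) (egain a (s - v) (b s w - b v w) * (e v w * phi v w))) ^+ 2)%:E)%E.
  apply: eq_integral => w _; congr (EFin (_ ^+ 2)).
  rewrite -RintegralZl//; last exact: iphiS.
  by apply: eq_Rintegral => v _; rewrite mulrA [_ * e v w]mulrC -pegain_flow.
apply: le_trans (kernel_integral_le r0 rs sT CE0 _ _ _) _.
- exact: measurable_egain.
- by move=> w; exact: (continuous_pegain_l hb).
- move=> v /andP[rv vs]; apply: HE.
    by rewrite (le_trans r0 (ltW rv)) ltW.
  by rewrite lerBlDr (le_trans sT)// lerDl (le_trans r0 (ltW rv)).
rewrite mulrA (EFinM _ L) -LE; apply: lee_wpmul2l.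
  by rewrite lee_fin mulr_ge0// subr_ge0.
apply: ge0_subset_integral => //; first exact: measurable_Lam.
  by move=> v _; exact: Lam_ge0.
by apply: subset_itv; rewrite bnd_simp.
Qed.

Lemma adapted_eq s : 0 <= s <= T -> wrt_measurable (F s) (fun w => e s w * q s w).
Proof.
move=> /[dup] sT /andP[s0 _]; apply: wrt_measurableM; last exact: aq.
exact: (wrt_measurable_pegain hb).
Qed.

Lemma eq_sqr_bound : exists2 C, 0 <= C & forall s, 0 <= s <= T ->
  (\int[P]_w ((e s w * q s w) ^+ 2)%:E <= C%:E)%E.
Proof.
have [CE CE0 HE] := pegain_sqr hb a T0.
have [C C0 HC] := ephi_increment_sqr.
pose L := fine (\int[P]_w (q 0%R w ^+ 2)%:E)%E.
have q02 : (0 <= \int[P]_w (q 0%R w ^+ 2)%:E)%E.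
  by apply: integral_ge0_EFin => v _; exact: sqr_ge0.
have L0 : 0 <= L by rewrite fine_ge0.
have LE : (\int[P]_w (q 0%R w ^+ 2)%:E = L%:E)%E.
  by rewrite fineK// ge0_fin_numE//; case: q0L.
exists (2 * (L * CE) + 2 * (T * C)) => [|s /andP[s0 sT]].
  by rewrite addr_ge0// !mulr_ge0.
have me := measurable_pegain b a 0 s.
have mi := measurable_phi_integral 0 s.
have mq0 := q0L.1.
have -> : (\int[P]_w ((e s w * q s w) ^+ 2)%:E = \int[P]_w ((e s w * q 0%R w +
    e s w * \int[mu]_(v in `]0, s[) phi v w) ^+ 2)%:E)%E.
  by apply: eq_integral => w _; rewrite (qE w (s := s)) ?s0// mulrDr.
apply: le_trans (sqrD_integral_le P measurableT _ _) _; [by meas|by meas|].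
rewrite (EFinD (2 * _)) (EFinM 2 (L * CE)) (EFinM 2 (T * C)); apply: leeD; apply: lee_wpmul2l => //.
  under eq_integral do rewrite mulrC exprMn /pegain.
  rewrite (@expect_indep_rm _ _ _ _ _ _ hbeta hb 0 s (fun x => x ^+ 2)
    (fun x => egain a (s - 0) x ^+ 2) (q 0))//.
  - rewrite LE EFinM; apply: lee_wpmul2l; first by rewrite lee_fin.
    by apply: HE; rewrite ?lexx ?s0// subr0.
  - by rewrite lexx s0.
  - by apply: aq; rewrite lexx.
  - by have := @measurable_egain R a (s - 0) => m; meas.
  - by move=> x; exact: sqr_ge0.
  - by move=> x; exact: sqr_ge0.
apply: le_trans (HC 0 s _ s0 sT) _ => //.
by rewrite lee_fin subr0 ler_wpM2r.
Qed.

Lemma eq_L2 s : 0 <= s <= T -> L2_on P setT (fun w => e s w * q s w).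
Proof.
move=> sT; split; first exact: wrt_measurable_fun (adapted_eq sT).
have [C C0 HC] := eq_sqr_bound.
exact: le_lt_trans (HC s sT) (ltry _).
Qed.

(** The flow law writes the difference as [- a e_r q_r g(r, s)] minus [e_s] times the integral of
    [phi]. The first term has second moment of order [s - r] by independence, the second by
    [ephi_increment_sqr]. *)
Lemma eq_increment_sqr : exists2 C, 0 <= C & forall r s, 0 <= r -> r <= s -> s <= T ->
  (\int[P]_w ((e r w * q r w - e s w * q s w) ^+ 2)%:E <= (C * (s - r))%:E)%E.
Proof.
have [CG CG0 HG] := pgain_sqr hb a T0.
have [C C0 HC] := ephi_increment_sqr.
have [Cq Cq0 HCq] := eq_sqr_bound.
exists (2 * (Cq * CG) + 2 * C) => [|r s r0 rs sT].
  by rewrite addr_ge0// !mulr_ge0.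
have rT := le_trans rs sT; have s0 := le_trans r0 rs.
have me := measurable_pegain b a 0 s; have mer := measurable_pegain b a 0 r.
have mi := measurable_phi_integral r s.
have mqr : measurable_fun setT (q r).
  by apply: wrt_measurable_fun (aq _); rewrite r0.
have mg := measurable_pgain b a r s.
have -> : (\int[P]_w ((e r w * q r w - e s w * q s w) ^+ 2)%:E =
    \int[P]_w ((- (a%:R * ((e r w * q r w) * pgain b a r s w)) +
     - (e s w * \int[mu]_(v in `]r, s[) phi v w)) ^+ 2)%:E)%E.
  apply: eq_integral => w _; congr (EFin (_ ^+ 2)).
  rewrite (q_increment w r0 rs sT) mulrDr (pegain_flow b a 0 r s w) (pegainE b a r s w).
  by ring.
apply: le_trans (sqrD_integral_le P measurableT _ _) _; [by meas|by meas|].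
rewrite (mulrDl (2 * _)) (EFinD (2 * _ * _)) -!(mulrA 2) (EFinM 2 (_ * _)) (EFinM 2 (C * _)).
under [X in (_ + 2%:E * X)%E]eq_integral do rewrite sqrrN.
apply: leeD; apply: lee_wpmul2l => //; last first.
  by apply: le_trans (HC r s _ _ _) _; rewrite // lee_fin mulrC.
apply: (@le_trans _ _ (\int[P]_w (((e r w * q r w) * pgain b a r s w) ^+ 2)%:E)%E).
  apply: ge0_le_integral_EFin => //; [by meas|by meas| |].
    by move=> w _; rewrite sqr_ge0.
  move=> w _; rewrite sqrrN; case: (a); first by rewrite mul1r.
  by rewrite mul0r expr0n sqr_ge0.
under eq_integral do rewrite exprMn /pgain.
rewrite (@expect_indep_rm _ _ _ _ _ _ hbeta hb r s (fun x => x ^+ 2)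
    (fun x => gain a (s - r) x ^+ 2) (fun w => e r w * q r w))//.
- rewrite -mulrA EFinM; apply: lee_pmul.
  + by apply: integral_ge0_EFin => w _; exact: sqr_ge0.
  + by apply: integral_ge0_EFin => w _; exact: sqr_ge0.
  + by apply: HCq; rewrite r0.
  + apply: HG; first by rewrite r0.
    by rewrite lerBlDr (le_trans sT)// lerDl.
- by rewrite r0.
- by apply: adapted_eq; rewrite r0.
- by have := @measurable_gain R a (s - r) => m; meas.
- by move=> x; exact: sqr_ge0.
- by move=> x; exact: sqr_ge0.
Qed.


Definition grid k i : R := i%:R * (T / k.+1%:R).

Lemma grid_step k i : grid k i.+1 - grid k i = T / k.+1%:R.
Proof. by rewrite /grid -mulrBl -natrB// subSnn mul1r. Qed.

Lemma step_ge0 k : 0 <= T / k.+1%:R.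
Proof. exact: divr_ge0. Qed.

Lemma gridS k i : grid k i <= grid k i.+1.
Proof. by rewrite -subr_ge0 grid_step step_ge0. Qed.

Lemma grid_ge0 k i : 0 <= grid k i.
Proof. by rewrite mulr_ge0// step_ge0. Qed.

Lemma grid0 k : grid k 0 = 0. Proof. by rewrite /grid mul0r. Qed.

Lemma grid_last k : grid k k.+1 = T.
Proof. by rewrite /grid mulrC divfK. Qed.

Lemma grid_le k i j : (i <= j)%N -> grid k i <= grid k j.
Proof. by move=> ij; rewrite /grid ler_wpM2r ?step_ge0// ler_nat. Qed.

Lemma grid_leT k i : (i <= k.+1)%N -> grid k i <= T.
Proof. by move=> /(grid_le k); rewrite grid_last. Qed.

Definition grid_coef k i (w : Omega) : R :=
  if (i < k.+1)%N then e (grid k i) w * q (grid k i) w else 0.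

Lemma grid_coef_adapted k i : wrt_measurable (F (grid k i)) (grid_coef k i).
Proof.
rewrite /grid_coef; case: (ltnP i k.+1) => ik; last first.
  exact: wrt_measurable_cst.
by apply: adapted_eq; rewrite grid_ge0 grid_leT// ltnW.
Qed.

Lemma grid_coef_L2 k i : L2_on P setT (grid_coef k i).
Proof.
rewrite /grid_coef; case: (ltnP i k.+1) => ik; last exact: L2_on0.
by apply: eq_L2; rewrite grid_ge0 grid_leT// ltnW.
Qed.

Definition grid_process k : simple_process P (fun r => beta r) :=
  @SimpleProcess _ _ _ P (fun r => beta r) k.+1 (grid k) (grid_coef k)
    (grid_ge0 k 0) (gridS k) (@grid_coef_adapted k) (grid_coef_L2 k).

Lemma grid_locate k s : 0 < s < T ->
  exists2 i, (i < k.+1)%N & grid k i < s <= grid k i.+1.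
Proof.
move=> /andP[s0 sT].
have ex : exists j, s <= grid k j by exists k.+1; rewrite grid_last ltW.
case: (ex_minnP ex) => -[|i] si imin.
  by move: si; rewrite grid0 leNgt s0.
exists i; first by rewrite ltnS -ltnS; apply: imin; rewrite grid_last ltW.
rewrite si andbT ltNge; apply/negP => /imin; by rewrite ltnn.
Qed.

Lemma grid_val k s i w : (i < k.+1)%N -> grid k i < s <= grid k i.+1 ->
  sp_val (grid_process k) s w = e (grid k i) w * q (grid k i) w.
Proof.
move=> ik /andP[si is_]; rewrite /sp_val /= (bigD1 (Ordinal ik))//= big1 ?addr0.
  by rewrite indicE mem_set ?mulr1 /grid_coef ?ik// /= in_itv /= si.
move=> j ji; rewrite indicE memNset ?mulr0// /= in_itv /= => /andP[js sj].
move/negP: ji; apply; apply/eqP/val_inj => /=; apply/eqP.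
rewrite eqn_leq; apply/andP; split; rewrite leqNgt; apply/negP => ij.
  by have := le_lt_trans (le_trans is_ (grid_le k ij)) js; rewrite ltxx.
by have := le_lt_trans (le_trans sj (grid_le k ij)) si; rewrite ltxx.
Qed.

Lemma measurable_sp_val (S : simple_process P (fun r => beta r)) D :
  measurable_fun D (fun z : RT * Omega => sp_val S z.1 z.2).
Proof.
apply: measurable_funTS; apply: measurable_sum => i.
apply: measurable_funM.
  by apply: (measurableT_comp (sp_coef_L2 S i).1); exact: measurable_snd.
by apply: measurableT_comp => //; exact: measurable_indic.
Qed.

Lemma measurable_eq_process D :
  measurable_fun D (fun z : RT * Omega => e z.1 z.2 * q z.1 z.2).
Proof. by apply: measurable_funTS; have := measurable_egain_process => me; meas. Qed.

Lemma grid_val_error : exists2 C, 0 <= C & forall k,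
  (\int[(mu \x P)%E]_(z in cylinder T)
     ((sp_val (grid_process k) z.1 z.2 - e z.1 z.2 * q z.1 z.2) ^+ 2)%:E
   <= (C / k.+1%:R)%:E)%E.
Proof.
have [C C0 HC] := eq_increment_sqr.
exists (C * T * T) => [|k]; first by rewrite !mulr_ge0.
have mD : measurable (`]0, T[%classic : set RT) by exact: measurable_itv.
pose D := (`]0, T[%classic : set RT) `*` [set: Omega].
have m1 : measurable_fun D (fun z : RT * Omega =>
    (sp_val (grid_process k) z.1 z.2 - e z.1 z.2 * q z.1 z.2) ^+ 2).
  have ms := @measurable_sp_val (grid_process k) D.
  by have mq2 := @measurable_eq_process D; meas.
rewrite /cylinder (@integral_cylinder1 _ _ _ P _ (fun s w =>
  (sp_val (grid_process k) s w - e s w * q s w) ^+ 2) mD m1); last first.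
  by move=> *; exact: sqr_ge0.
apply: (@le_trans _ _ (\int[mu]_(s in `]0%R, T[) (C * (T / k.+1%:R))%:E)%E); last first.
  rewrite integral_cst//= lebesgue_measure_oo// subr0 -EFinM lee_fin.
  by rewrite le_eqVlt; apply/orP; left; apply/eqP; ring.
apply: ge0_le_integral => //.
- by move=> s _; apply: integral_ge0_EFin => w _; exact: sqr_ge0.
- by apply: (@measurable_section_integral _ _ _ P _ (fun s w =>
    (sp_val (grid_process k) s w - e s w * q s w) ^+ 2) mD m1) => *; exact: sqr_ge0.
- move=> s; rewrite /= in_itv /= => /[dup] sT /andP[s0 s_T].
  have [i ik /[dup] si /andP[si1 si2]] := grid_locate k sT.
  under eq_integral do rewrite (grid_val _ ik si).
  apply: le_trans (HC _ _ (grid_ge0 k i) (ltW si1) (ltW s_T)) _.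
  by rewrite lee_fin ler_wpM2l// -(grid_step k i) lerD2r.
Qed.

Lemma sqr_sum_le n (x : nat -> R) :
  (\sum_(i < n) x i) ^+ 2 <= n%:R * \sum_(i < n) x i ^+ 2.
Proof.
have key (m S Q y : R) : 0 <= m -> 0 <= Q -> S ^+ 2 <= m * Q ->
    (S + y) ^+ 2 <= (m + 1) * (Q + y ^+ 2).
  move=> + Q0; rewrite le_eqVlt => /predU1P[<-|m0] SQ.
    have /eqP : S ^+ 2 = 0 by apply/eqP; rewrite eq_le sqr_ge0 andbT (le_trans SQ)// mul0r.
    by rewrite sqrf_eq0 => /eqP ->; rewrite !add0r mul1r lerDr.
  (* This expression is [m] times the gap between the two sides of the goal. *)
  have : 0 <= (m * Q - S ^+ 2) * (m + 1) + (S - m * y) ^+ 2.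
    by rewrite addr_ge0 ?sqr_ge0// mulr_ge0 ?subr_ge0// addr_ge0// ltW.
  have -> : (m * Q - S ^+ 2) * (m + 1) + (S - m * y) ^+ 2 =
    m * ((m + 1) * (Q + y ^+ 2) - (S + y) ^+ 2) by ring.
  by rewrite pmulr_rge0// subr_ge0.
elim: n => [|n ih]; first by rewrite !big_ord0 expr0n mulr0.
rewrite !big_ord_recr /= -natr1; apply: key => //.
by apply: sumr_ge0 => i _; exact: sqr_ge0.
Qed.

(** The error of one cell from replacing the gain by the Brownian increment, with the coefficient
    frozen at the left end: a martingale difference. *)
Definition grid_defect k i (w : Omega) : R :=
  (e (grid k i) w * q (grid k i) w) *
  (pgain b a (grid k i) (grid k i.+1) w - (b (grid k i.+1) w - b (grid k i) w)).

(** The error of one cell from the variation of [q] inside it: [e v] times the gain from [v] to the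
    right end is the difference between [g] at that end and [g v]. *)
Definition grid_remainder k i (w : Omega) : R :=
  \int[mu]_(v in `]grid k i, grid k i.+1[)
    (pgain b a v (grid k i.+1) w * (e v w * phi v w)).

Lemma continuous_gphi_integrable r s w : 0 <= r -> s <= T ->
  mu.-integrable `]r, s[ (fun v => (g v w * phi v w)%:E).
Proof.
move=> r0 sT; apply: continuous_mul_integrable; last exact: iphiS.
exact: (continuous_pgain_r hb).
Qed.

(** A discrete product rule. On a cell from [r] to [s] the increment of [g q] is [e_r q_r g(r, s)]
    plus [g_s] times the integral of [phi], and under that integral [g_s - g_v = e_v g(v, s)]. The
    sum over the cells telescopes. *)
Lemma grid_sum k w :
  \sum_(i < k.+1) (e (grid k i) w * q (grid k i) w) *
     (b (grid k i.+1) w - b (grid k i) w) -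
  (g T w * q T w - \int[mu]_(v in `]0, T[) (g v w * phi v w)) =
  - \sum_(i < k.+1) grid_defect k i w - \sum_(i < k.+1) grid_remainder k i w.
Proof.
have Epart : \int[mu]_(v in `]0, T[) (g v w * phi v w) =
    \sum_(i < k.+1) \int[mu]_(v in `]grid k i, grid k i.+1[) (g v w * phi v w).
  rewrite -(Rintegral_partition (gridS k)) ?grid0 ?grid_last//.
  exact: continuous_gphi_integrable.
have Etel : g T w * q T w = \sum_(i < k.+1)
    (g (grid k i.+1) w * q (grid k i.+1) w - g (grid k i) w * q (grid k i) w).
  rewrite -[RHS](big_mkord xpredT (fun i =>
    g (grid k i.+1) w * q (grid k i.+1) w - g (grid k i) w * q (grid k i) w)).
  rewrite (telescope_sumr (fun i => g (grid k i) w * q (grid k i) w))//.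
  by rewrite grid_last grid0 pgain_refl mul0r subr0.
rewrite Epart Etel -!sumrB -sumrN -sumrB; apply: eq_bigr => i _.
have ik := ltn_ord i.
set r := grid k i; set s := grid k i.+1.
have r0 : 0 <= r by exact: grid_ge0.
have rs : r <= s by exact: gridS.
have sT : s <= T by exact: grid_leT.
have qi := q_increment w r0 rs sT.
have rem : grid_remainder k i w = g s w * \int[mu]_(v in `]r, s[) phi v w -
    \int[mu]_(v in `]r, s[) (g v w * phi v w).
  rewrite -RintegralZl//; last exact: iphiS.
  rewrite -RintegralB//; first last.
  - exact: continuous_gphi_integrable.
  - by apply: integrableZ_EFin => //; exact: iphiS.
  apply: eq_Rintegral => v _; rewrite -/s (pgain_flow b a 0 v s w); ring.
rewrite rem /grid_defect -/r -/s qi (pgain_flow b a 0 r s w).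
by ring.
Qed.

(** Each defect is centred given the past of its cell, so the defects are orthogonal
    ([martingale_step]) and their [k + 1] variances, each of order [1 / (k + 1) ^ 2], add up. *)
Lemma grid_defect_sum_sqr : exists2 C, 0 <= C & forall k,
  (\int[P]_w ((\sum_(i < k.+1) grid_defect k i w) ^+ 2)%:E <= (C / k.+1%:R)%:E)%E.
Proof.
have [Cd Cd0 HCd] := gain_defect_sqr (rm_bm hb) a T0.
have [Cq Cq0 HCq] := eq_sqr_bound.
exists (Cq * Cd * T ^+ 2) => [|k]; first by rewrite !mulr_ge0.
pose h := T / k.+1%:R.
have hT : h <= T by rewrite ler_pdivrMr// ler_peMr// ler1n.
(* Adaptedness and square integrability of the partial sums are carried through the induction
   because [martingale_step] asks for them. *)
have H j : (j <= k.+1)%N ->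
  [/\ wrt_measurable (F (grid k j)) (fun w => \sum_(i < j) grid_defect k i w),
      L2_on P setT (fun w => \sum_(i < j) grid_defect k i w) &
   (\int[P]_w ((\sum_(i < j) grid_defect k i w) ^+ 2)%:E <= (j%:R * (Cq * (Cd * h ^+ 2)))%:E)%E].
  elim: j => [_|j ih jk].
    split.
    - rewrite (_ : (fun w : Omega => \sum_(i < 0) grid_defect k i w) = fun=> 0).
        exact: wrt_measurable_cst.
      by apply/funext => w; rewrite big_ord0.
    - by under eq_fun do rewrite big_ord0; exact: L2_on0.
    - by under eq_integral do rewrite big_ord0 expr0n /=; rewrite integral0 mul0r.
  have [mS LS bS] := ih (ltnW jk).
  have jT : 0 <= grid k j <= T by rewrite grid_ge0 grid_leT// ltnW.
  have jj : 0 <= grid k j <= grid k j.+1 by rewrite grid_ge0 gridS.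
  pose ph x := gain a (grid k j.+1 - grid k j) x - x.
  have mph : measurable_fun setT ph.
    by have := @measurable_gain R a (grid k j.+1 - grid k j) => mg; rewrite /ph; meas.
  have phL : (\int[P]_w (ph (b (grid k j.+1) w - b (grid k j) w) ^+ 2)%:E <= (Cd * h ^+ 2)%:E)%E.
    apply: le_trans (HCd _ _ jj _) _; first by rewrite grid_step.
    by rewrite grid_step.
  have mxi := adapted_eq jT.
  have Lxi := eq_L2 jT.
  have ph0 := gain_defect_mean (rm_bm hb) a jj.
  have phi' := gain_defect_integrable (rm_bm hb) a jj.
  have := martingale_step hbeta hb jj mS mxi mph LS Lxi (le_lt_trans phL (ltry _)) ph0 phi'.
  have [L2n _] := L2_indep hbeta hb jj mxi mph Lxi (le_lt_trans phL (ltry _)).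
  have defE w : e (grid k j) w * q (grid k j) w * ph (b (grid k j.+1) w - b (grid k j) w) =
    grid_defect k j w by [].
  move=> E; split.
  - rewrite (_ : (fun w : Omega => \sum_(i < j.+1) grid_defect k i w) =
      fun w => \sum_(i < j) grid_defect k i w + grid_defect k j w); last first.
      by apply/funext => w; rewrite big_ord_recr.
    apply: wrt_measurableD; first exact: wrt_measurableS (gridS k j) mS.
    apply: wrt_measurableM; first exact: wrt_measurableS (gridS k j) mxi.
    apply: (wrt_measurable_comp (f := ph)) mph.
    by apply: (wrt_measurable_increment hb) => //; rewrite ?grid_ge0 ?gridS.
  - by under eq_fun do rewrite big_ord_recr /=; exact: L2_onD.
  - under eq_integral do rewrite big_ord_recr /=.
    rewrite E -natr1 mulrDl mul1r EFinD; apply: leeD => //.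
    rewrite EFinM; apply: lee_pmul => //.
    + by apply: integral_ge0_EFin => w _; exact: sqr_ge0.
    + by apply: integral_ge0_EFin => w _; exact: sqr_ge0.
    + exact: HCq.
have [_ _ /le_trans] := H k.+1 (leqnn _); apply.
rewrite lee_fin /h le_eqVlt; apply/orP; left; apply/eqP.
have : k.+1%:R != 0 :> R by rewrite pnatr_eq0.
by move=> k0; field.
Qed.

Lemma measurable_grid_defect k (i : 'I_k.+1) : measurable_fun setT (grid_defect k i).
Proof.
have ik := ltn_ord i.
apply: measurable_funM.
  by apply: wrt_measurable_fun (adapted_eq _); rewrite grid_ge0 grid_leT// ltnW.
by apply: measurable_funB; [exact: measurable_pgain|exact: measurable_increment].
Qed.

Lemma measurable_grid_remainder k i : measurable_fun setT (grid_remainder k i).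
Proof.
apply: (measurable_Rintegral (f := fun v w => pgain b a v (grid k i.+1) w * (e v w * phi v w))).
  exact: measurable_itv.
have mg : measurable_fun setT (fun z : RT * Omega => pgain b a z.1 (grid k i.+1) z.2).
  apply: (measurable_continuous_process (f := fun v w => pgain b a v (grid k i.+1) w)).
    by move=> w; exact: (continuous_pgain_l hb).
  by move=> v; exact: measurable_pgain.
by have := measurable_ephi => m; meas.
Qed.

(** Here Cauchy-Schwarz replaces orthogonality, at the cost of a factor [k + 1]. By
    [kernel_integral_le] each cell contributes at most a constant times the squared mesh times the
    integral of [Lam] over the cell, and these integrals sum to a finite one. *)
Lemma grid_remainder_sum_sqr : exists2 C, 0 <= C & forall k,
  (\int[P]_w ((\sum_(i < k.+1) grid_remainder k i w) ^+ 2)%:E <= (C / k.+1%:R)%:E)%E.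
Proof.
have [CG CG0 HG] := pgain_sqr hb a T0.
have Lam0 : (0 <= \int[mu]_(v in `]0%R, T[) Lam v)%E.
  by apply: integral_ge0 => v _; exact: Lam_ge0.
pose L := fine (\int[mu]_(v in `]0%R, T[) Lam v)%E.
have L0 : 0 <= L by rewrite fine_ge0.
have LE : (\int[mu]_(v in `]0%R, T[) Lam v = L%:E)%E.
  by rewrite fineK// ge0_fin_numE.
exists (CG * T ^+ 2 * L) => [|k]; first by rewrite !mulr_ge0.
pose h := T / k.+1%:R.
have h0 : 0 <= h by exact: step_ge0.
have hT : h <= T by rewrite ler_pdivrMr// ler_peMr// ler1n.
have mr i := measurable_grid_remainder k i.
apply: (@le_trans _ _ (\int[P]_w (k.+1%:R * \sum_(i < k.+1) grid_remainder k i w ^+ 2)%:E)%E).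
  apply: ge0_le_integral_EFin => //; [by meas|by meas| |].
    by move=> w _; exact: sqr_ge0.
  by move=> w _; exact: (sqr_sum_le _ (fun i => grid_remainder k i w)).
rewrite ge0_integralZ_EFin//; [|by meas|by move=> w _; apply: sumr_ge0 => i _; exact: sqr_ge0].
rewrite ge0_integral_sum_EFin//; [|by move=> i; meas|by move=> *; exact: sqr_ge0].
apply: (@le_trans _ _ (k.+1%:R%:E * \sum_(i < k.+1) ((h * (CG * h))%:E *
    \int[mu]_(v in `]grid k i, grid k i.+1[) Lam v))%E).
  apply: lee_wpmul2l; first by rewrite lee_fin.
  apply: lee_sum => i _.
  have ik := ltn_ord i.
  have iT : grid k i.+1 <= T by exact: grid_leT.
  rewrite /h -[in X in (_ <= X * _)%E](grid_step k i).
  apply: (kernel_integral_le (K := gain a)) => //.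
  - exact: grid_ge0.
  - exact: gridS.
  - by rewrite mulr_ge0// grid_step.
  - exact: measurable_gain.
  - by move=> w; exact: (continuous_pgain_l hb).
  - move=> v /andP[v1 v2]; have v0 := le_trans (grid_ge0 k i) (ltW v1).
    have vv : grid k i.+1 - v <= grid k i.+1 - grid k i by rewrite lerD2l lerN2 ltW.
    apply: le_trans (HG _ _ _ _) _.
    + by rewrite v0 ltW.
    + by rewrite (le_trans vv)// grid_step.
    + by rewrite lee_fin ler_wpM2l.
rewrite -ge0_sume_distrr; last by move=> i _; apply: integral_ge0 => v _; exact: Lam_ge0.
apply: (@le_trans _ _ (k.+1%:R%:E * ((h * (CG * h))%:E * L%:E))%E).
  apply: lee_wpmul2l; first by rewrite lee_fin.
  apply: lee_wpmul2l; first by rewrite lee_fin !mulr_ge0.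
  have := ge0_integral_partition (n := k.+1) (gridS k).
  rewrite grid0 grid_last -LE; apply; last exact: Lam_ge0.
  by apply: measurable_Lam; exact: measurable_itv.
rewrite -!EFinM lee_fin /h le_eqVlt; apply/orP; left; apply/eqP.
have : k.+1%:R != 0 :> R by rewrite pnatr_eq0.
by move=> k0; field.
Qed.

Lemma grid_integral_error : exists2 C, 0 <= C & forall k,
  (\int[P]_w ((\sum_(i < k.+1) (e (grid k i) w * q (grid k i) w) *
     (b (grid k i.+1) w - b (grid k i) w) -
  (g T w * q T w - \int[mu]_(v in `]0, T[) (g v w * phi v w))) ^+ 2)%:E
   <= (C / k.+1%:R)%:E)%E.
Proof.
have [C1 C10 H1] := grid_defect_sum_sqr.
have [C2 C20 H2] := grid_remainder_sum_sqr.
exists (2 * C1 + 2 * C2) => [|k]; first by rewrite addr_ge0// mulr_ge0.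
under eq_integral do rewrite grid_sum -opprD sqrrN.
have m2 i := measurable_grid_remainder k i.
have m1 : measurable_fun setT (fun w => \sum_(i < k.+1) grid_defect k i w).
  apply: measurable_sum => i; exact: measurable_grid_defect.
apply: le_trans (sqrD_integral_le P measurableT m1 _) _; first by meas.
rewrite (mulrDl (2 * C1)) (EFinD (_ / _)) -!(mulrA 2) (EFinM 2 (C1 / _)) (EFinM 2 (C2 / _)).
by apply: leeD; apply: lee_wpmul2l.
Qed.

Local Notation ito_value w :=
  (g T w * q T w - \int[mu]_(v in `]0, T[) (g v w * phi v w)).

Lemma measurable_ito_value : measurable_fun setT (fun w => ito_value w).
Proof.
have mqT : measurable_fun setT (q T) by apply: wrt_measurable_fun (aq _); rewrite T0 lexx.
have mgT := measurable_pgain b a 0 T.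
have mi : measurable_fun setT (fun w => \int[mu]_(v in `]0, T[) (g v w * phi v w)).
  apply: (measurable_Rintegral (f := fun v w => g v w * phi v w)); first exact: measurable_itv.
  have mg : measurable_fun setT (fun z : RT * Omega => g z.1 z.2).
    apply: (measurable_continuous_process (f := fun v w => g v w)).
      by move=> w; exact: (continuous_pgain_r hb).
    by move=> v; exact: measurable_pgain.
  by meas.
by meas.
Qed.

Lemma grid_sum_L2 k : L2_on P setT (fun w => \sum_(i < k.+1)
  (e (grid k i) w * q (grid k i) w) * (b (grid k i.+1) w - b (grid k i) w)).
Proof.
apply: L2_on_sum => // i; have ik := ltn_ord i.
have jj : 0 <= grid k i <= grid k i.+1 by rewrite grid_ge0 gridS.
have iT : 0 <= grid k i <= T by rewrite grid_ge0 grid_leT// ltnW.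
have fin : (\int[P]_w (id (b (grid k i.+1) w - b (grid k i) w) ^+ 2)%:E < +oo)%E.
  by rewrite (increment_variance (rm_bm hb) jj) ltry.
by have [] := L2_indep hbeta hb jj (adapted_eq iT) (@measurable_id _ _ _) (eq_L2 iT) fin.
Qed.

(** The Riemann sum of the coarsest grid is square integrable, and so is its distance to the limit
    by [grid_integral_error]. *)
Lemma ito_value_L2 : L2_on P setT (fun w => ito_value w).
Proof.
have LS := grid_sum_L2 0.
have mv := measurable_ito_value.
have [C _ HC] := grid_integral_error.
have L : L2_on P setT (fun w => \sum_(i < 1)
  (e (grid 0 i) w * q (grid 0 i) w) * (b (grid 0 i.+1) w - b (grid 0 i) w) - ito_value w).
  split; last exact: le_lt_trans (HC 0%N) (ltry _).
  by apply: measurable_funB => //; exact: LS.1.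
have := L2_onB measurableT LS L.
by under eq_fun do rewrite opprB addrC subrK.
Qed.

Lemma cvge_div_nat (C : R) (u : nat -> \bar R) :
  (forall k, 0 <= u k <= (C / k.+1%:R)%:E)%E -> u k @[k --> \oo] --> 0%E.
Proof.
move=> H; apply: (@squeeze_cvge _ _ _ _ (fun=> 0%E) u (fun k => (C / k.+1%:R)%:E)).
- by apply: nearW => k; exact: H.
- exact: cvg_cst.
- apply: cvg_EFin; first exact: nearW.
  rewrite -[X in _ --> X](mulr0 C); apply: cvgM; first exact: cvg_cst.
  exact: cvg_harmonic.
Qed.

(** The product rule d(g q) = e q dbeta + g phi dt, where dg = e dbeta and [q] has rate [phi]. Step
    processes frozen at left endpoints approximate the integrand and their integrals approximate
    [ito_value], both with squared error of order [1 / (k + 1)]. The construction of the solution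
    computes no other stochastic integral. *)
Theorem ito_product :
  is_ito_integral P (fun r => beta r) T (fun s w => e s w * q s w)
    (fun w => ito_value w).
Proof.
split.
- move=> s; rewrite in_itv /= => /andP[s0 sT].
  by apply: adapted_eq; rewrite !ltW.
- split; first exact: measurable_eq_process.
  have [C C0 HC] := eq_sqr_bound.
  have mD : measurable (`]0, T[%classic : set RT) by exact: measurable_itv.
  pose D := (`]0, T[%classic : set RT) `*` [set: Omega].
  have m1 : measurable_fun D (fun z : RT * Omega => (e z.1 z.2 * q z.1 z.2) ^+ 2).
    by have mq2 := @measurable_eq_process D; meas.
  rewrite /cylinder (@integral_cylinder1 _ _ _ P _ (fun s w =>
    (e s w * q s w) ^+ 2) mD m1); last by move=> *; exact: sqr_ge0.
  apply: (@le_lt_trans _ _ (\int[mu]_(s in `]0%R, T[) C%:E)%E); last first.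
    by rewrite integral_cst//= lebesgue_measure_oo// -EFinM ltry.
  apply: ge0_le_integral => //.
  + by move=> s _; apply: integral_ge0_EFin => w _; exact: sqr_ge0.
  + by apply: (@measurable_section_integral _ _ _ P _ (fun s w =>
      (e s w * q s w) ^+ 2) mD m1) => *; exact: sqr_ge0.
  + by move=> s; rewrite /= in_itv /= => /andP[s0 sT]; apply: HC; rewrite !ltW.
- exact: ito_value_L2.
- exists grid_process; split.
    have [C C0 HC] := grid_val_error.
    apply: (@cvge_div_nat C) => k; rewrite HC andbT.
    by apply: integral_ge0_EFin => z _; exact: sqr_ge0.
  have [C C0 HC] := grid_integral_error.
  apply: (@cvge_div_nat C) => k; rewrite integral_ge0_EFin/=; last first.
    by move=> z _; exact: sqr_ge0.
  apply: le_trans (HC k); rewrite le_eqVlt; apply/orP; left; apply/eqP.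
  have mv := measurable_ito_value.
  have mS (c : R -> {RV P >-> R}) : measurable_fun setT (fun w => \sum_(i < k.+1)
      (e (grid k i) w * q (grid k i) w) * (c (grid k i.+1) w - c (grid k i) w)).
    apply: measurable_sum => i; apply: measurable_funM; last exact: measurable_increment.
    have ik := ltn_ord i.
    by apply: wrt_measurable_fun (adapted_eq _); rewrite grid_ge0 grid_leT// ltnW.
  (* The simple integral is taken against [beta] while the error estimate concerns [b]; the two sums
     differ only on a null set. *)
  have spE w : sp_integral (grid_process k) T w = \sum_(i < k.+1)
      (e (grid k i) w * q (grid k i) w) * (beta (grid k i.+1) w - beta (grid k i) w).
    rewrite /sp_integral; apply: eq_bigr => i _; have ik := ltn_ord i.
    by rewrite /= /grid_coef ik (min_idPl (grid_leT ik)) (min_idPl (grid_leT (ltnW ik))).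
  under eq_integral do rewrite spE.
  have [N [mN N0 bN]] := rm_null hb.
  have mb1 := mS beta; have mb2 := mS b.
  apply: ge0_ae_eq_integral => //.
  + by meas.
  + by meas.
  + by move=> w _; rewrite lee_fin sqr_ge0.
  + by move=> w _; rewrite lee_fin sqr_ge0.
  + exists N; split=> // w /=; apply: contra_notP => Nw _.
    congr (EFin (_ ^+ 2)); congr (_ - _); apply: eq_bigr => i _.
    by rewrite !bN ?grid_ge0.
Qed.

End ItoProduct.

(** * Ito isometry for families of overlapping intervals *)

Section Overlap.
Context {R : realType}.
Local Notation mu := (@lebesgue_measure R).

(** The length of the common part of the two intervals within []0, T[], written with indicators so
    that it is visibly additive in each interval. *)
Definition overlap (T s1 t1 s2 t2 : R) : R :=
  \int[mu]_(v in `]0, T[) ((\1_(`]s1, t1]) v : R) * \1_(`]s2, t2]) v).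

Lemma overlapC T s1 t1 s2 t2 : overlap T s1 t1 s2 t2 = overlap T s2 t2 s1 t1.
Proof. by apply: eq_Rintegral => v _; rewrite mulrC. Qed.

Lemma indic_itv_cat (s r t v : R) : s <= r -> r <= t ->
  \1_(`]s, t]) v = \1_(`]s, r]) v + \1_(`]r, t]) v :> R.
Proof.
move=> sr rt; rewrite !indicE !mem_setE !in_itv /=.
case: (leP v r) => vr.
  by rewrite (le_trans vr rt) ?andbT /= addr0.
by rewrite (le_lt_trans sr vr) ?andbF /= add0r.
Qed.

Lemma overlap_integrable T s1 t1 s2 t2 : mu.-integrable `]0, T[
  (fun v => ((\1_(`]s1, t1]) v : R) * \1_(`]s2, t2]) v)%:E).
Proof.
have m (s t : R) : measurable_fun (`]0, T[%classic : set R) (\1_(`]s, t]) : R -> R).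
  by apply: measurable_funTS; exact: measurable_indic.
apply: measurable_bounded_integrable => //.
- have := lebesgue_measure_itv `]0, T[ => /= E.
  suff : (mu `]0%R, T[%classic < +oo)%E by [].
  by rewrite E; case: ifP => // _; rewrite -EFinB ltry.
- exact: measurable_funM.
- exists 1; split=> // M M1 v _ /=; rewrite (le_trans _ (ltW M1))//.
  rewrite !indicE; case: (_ \in _); case: (_ \in _);
    by rewrite ?mulr1 ?mulr0 ?normr1 ?normr0.
Qed.

Lemma overlap_cat T s r t s2 t2 : s <= r -> r <= t ->
  overlap T s t s2 t2 = overlap T s r s2 t2 + overlap T r t s2 t2.
Proof.
move=> sr rt; rewrite /overlap -RintegralD//; last 2 first.
- exact: overlap_integrable.
- exact: overlap_integrable.
by apply: eq_Rintegral => v _; rewrite (indic_itv_cat v sr rt) mulrDl.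
Qed.

Lemma overlap_disjoint T s1 t1 s2 t2 : t1 <= s2 -> overlap T s1 t1 s2 t2 = 0.
Proof.
move=> ts; rewrite /overlap /Rintegral integral0_eq// => v _.
rewrite !indicE !mem_setE !in_itv /=.
case: (ltP s2 v) => sv; last by rewrite mulr0.
by rewrite (leNgt v) (le_lt_trans ts sv) andbF mul0r.
Qed.

Lemma overlap_same T s t : 0 <= s -> s <= t -> t <= T -> overlap T s t s t = t - s.
Proof.
move=> s0 st tT; rewrite /overlap /Rintegral.
have -> : (\int[mu]_(v in `]0%R, T[) ((\1_(`]s, t]) v : R) * \1_(`]s, t]) v)%:E =
    \int[mu]_(v in `]0%R, T[) (\1_(`]s, t]) v)%:E)%E.
  apply: eq_integral => v _; congr EFin; rewrite indicE.
  by case: (_ \in _); rewrite ?mulr1 ?mulr0.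
rewrite integral_indic//=.
move: st; rewrite le_eqVlt => /predU1P[<-|st].
  by rewrite set_itvoc0 set0I measure0 subrr.
have stS : `]s, t[ `<=` `]s, t] `&` `]0, T[.
  move=> v /=; rewrite !in_itv /= => /andP[sv vt].
  by rewrite sv ltW// (le_lt_trans s0 sv) (lt_le_trans vt tT).
have Sst : `]s, t] `&` `]0, T[ `<=` `]s, t] by move=> v [].
have := lebesgue_measure_itv `]s, t[; rewrite /= lte_fin st => m1.
have := lebesgue_measure_itv `]s, t]; rewrite /= lte_fin st => m2.
have mI : measurable (`]s, t] `&` `]0, T[ : set R) by exact: measurableI.
suff -> : mu (`]s, t] `&` `]0, T[) = (t - s)%:E by [].
apply/eqP; rewrite eq_le; apply/andP; split.
  by rewrite EFinB -[leRHS]m2; apply: le_measure; rewrite ?inE.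
by rewrite EFinB -[leLHS]m1; apply: le_measure; rewrite ?inE.
Qed.

End Overlap.

Section Isometry.
Context {R : realType} {d : measure_display} {Omega : measurableType d}.
Variables (P : probability Omega R) (beta b : R -> {RV P >-> R}).
Hypotheses (hbeta : brownian_motion beta) (hb : regular_modification beta b).
Local Notation F := (augmented_filtration P (fun r => beta r)).
Local Notation RT := (measurableTypeR R).
Local Notation mu := (@lebesgue_measure R).

Lemma increment_L2 (xi : Omega -> R) s r t : 0 <= s -> s <= r -> r <= t ->
  wrt_measurable (F s) xi -> L2_on P setT xi ->
  L2_on P setT (fun w => xi w * (b t w - b r w)).
Proof.
move=> s0 sr rt mxi Lxi; have r0 := le_trans s0 sr.
have jj : 0 <= r <= t by rewrite r0.
have fin : (\int[P]_w (id (b t w - b r w) ^+ 2)%:E < +oo)%E.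
  by rewrite (increment_variance (rm_bm hb) jj) ltry.
by have [] := L2_indep hbeta hb jj (wrt_measurableS sr mxi) (@measurable_id _ _ _) Lxi fin.
Qed.

Section Pair.
Variables (T : R) (x1 x2 : Omega -> R) (u1 u2 : R).
Hypotheses (u10 : 0 <= u1) (u20 : 0 <= u2)
  (m1 : wrt_measurable (F u1) x1) (m2 : wrt_measurable (F u2) x2)
  (L1 : L2_on P setT x1) (L2 : L2_on P setT x2).

Definition cov s1 t1 s2 t2 : R :=
  \int[P]_w ((x1 w * (b t1 w - b s1 w)) * (x2 w * (b t2 w - b s2 w))).

Lemma cov_integrable s1 t1 s2 t2 : u1 <= s1 -> s1 <= t1 -> u2 <= s2 -> s2 <= t2 ->
  P.-integrable setT (fun w =>
    ((x1 w * (b t1 w - b s1 w)) * (x2 w * (b t2 w - b s2 w)))%:E).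
Proof.
move=> us1 st1 us2 st2; apply: L2M_integrable => //.
- exact: increment_L2 m1 L1.
- exact: increment_L2 m2 L2.
Qed.

Lemma cov_catl s r t s2 t2 : u1 <= s -> s <= r -> r <= t -> u2 <= s2 -> s2 <= t2 ->
  cov s t s2 t2 = cov s r s2 t2 + cov r t s2 t2.
Proof.
move=> us sr rt us2 st2; rewrite /cov -RintegralD//; last 2 first.
- exact: cov_integrable.
- by apply: cov_integrable => //; exact: le_trans us sr.
by apply: eq_Rintegral => w _; ring.
Qed.

Lemma cov_catr s1 t1 s r t : u1 <= s1 -> s1 <= t1 -> u2 <= s -> s <= r -> r <= t ->
  cov s1 t1 s t = cov s1 t1 s r + cov s1 t1 r t.
Proof.
move=> us1 st1 us sr rt; rewrite /cov -RintegralD//; last 2 first.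
- exact: cov_integrable.
- by apply: cov_integrable => //; exact: le_trans us sr.
by apply: eq_Rintegral => w _; ring.
Qed.

Lemma cov_disjoint s1 t1 s2 t2 : u1 <= s1 -> s1 <= t1 -> u2 <= s2 -> s2 <= t2 ->
  t1 <= s2 -> cov s1 t1 s2 t2 = 0.
Proof.
move=> us1 st1 us2 st2 ts.
have s10 := le_trans u10 us1; have s20 := le_trans u20 us2.
have jj : 0 <= s2 <= t2 by rewrite s20.
have LX := increment_L2 u10 us1 st1 m1 L1.
have mX : wrt_measurable (F s2) (fun w => x1 w * (b t1 w - b s1 w) * x2 w).
  apply: wrt_measurableM; last exact: wrt_measurableS us2 m2.
  apply: wrt_measurableM.
    exact: wrt_measurableS (le_trans us1 (le_trans st1 ts)) m1.
  apply: (wrt_measurable_increment hb) => //; [exact: le_trans s10 st1|exact: le_trans st1 ts].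
have bi : P.-integrable setT (fun w => (id (b t2 w - b s2 w))%:E).
  by have := increment_pow_integrable (rm_bm hb) 1 jj.
have [_] := expect_indep_signed hbeta hb jj mX (@measurable_id _ _ _)
  (L2M_integrable measurableT LX L2) bi.
rewrite [X in _ = _ * X -> _](_ : _ = 0) ?mulr0; last first.
  by rewrite /Rintegral (increment_mean (rm_bm hb) jj).
by move=> <-; apply: eq_Rintegral => w _; rewrite mulrA.
Qed.

Lemma cov_same s t : u1 <= s -> u2 <= s -> s <= t ->
  cov s t s t = (\int[P]_w (x1 w * x2 w)) * (t - s).
Proof.
move=> us1 us2 st; have s0 := le_trans u10 us1.
have jj : 0 <= s <= t by rewrite s0.
have mX : wrt_measurable (F s) (fun w => x1 w * x2 w).
  by apply: wrt_measurableM; [exact: wrt_measurableS us1 m1|exact: wrt_measurableS us2 m2].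
have bi : P.-integrable setT (fun w => ((b t w - b s w) ^+ 2)%:E).
  by have := increment_pow_integrable (rm_bm hb) 2 jj.
have m2' : measurable_fun setT (fun x : R => x ^+ 2) by exact: measurable_funX.
have [_] := expect_indep_signed hbeta hb jj mX m2' (L2M_integrable measurableT L1 L2) bi.
rewrite [X in _ = _ * X -> _](_ : _ = t - s); last first.
  by rewrite /Rintegral (increment_variance (rm_bm hb) jj).
by move=> <-; apply: eq_Rintegral => w _; ring.
Qed.

Lemma cov_degenerate_l s s2 t2 : cov s s s2 t2 = 0.
Proof.
by rewrite /cov /Rintegral integral0_eq// => w _; rewrite subrr mulr0 mul0r.
Qed.

Lemma cov_degenerate_r s1 t1 s : cov s1 t1 s s = 0.
Proof.
by rewrite /cov /Rintegral integral0_eq// => w _; rewrite subrr !mulr0.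
Qed.

End Pair.

Lemma covC x1 x2 s1 t1 s2 t2 : cov x1 x2 s1 t1 s2 t2 = cov x2 x1 s2 t2 s1 t1.
Proof. by apply: eq_Rintegral => w _; rewrite mulrC. Qed.

(** Both sides are additive when an interval is cut. Cutting leaves pairs of intervals that are
    disjoint, where the later increment is centred given the rest, or equal, where the variance is
    the length. *)
Lemma cov_overlap (T : R) (x1 x2 : Omega -> R) s1 t1 s2 t2 :
  0 <= s1 -> 0 <= s2 -> s1 <= t1 -> s2 <= t2 -> t1 <= T -> t2 <= T ->
  wrt_measurable (F s1) x1 -> wrt_measurable (F s2) x2 ->
  L2_on P setT x1 -> L2_on P setT x2 ->
  cov x1 x2 s1 t1 s2 t2 = (\int[P]_w (x1 w * x2 w)) * overlap T s1 t1 s2 t2.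
Proof.
wlog s12 : x1 x2 s1 t1 s2 t2 / s1 <= s2.
  move=> H s10 s20 st1 st2 tT1 tT2 m1 m2 L1 L2.
  case/orP: (le_total s1 s2) => s12; first exact: H.
  rewrite covC overlapC (H x2 x1)//; congr (_ * _).
  by apply: eq_Rintegral => w _; rewrite mulrC.
move=> s10 s20 st1 st2 tT1 tT2 m1 m2 L1 L2.
have [t1s2|s2t1] := leP t1 s2.
  rewrite overlap_disjoint// mulr0.
  exact: (cov_disjoint s10 s20 m1 m2 L1 L2).
have {}s2t1 := ltW s2t1.
rewrite (cov_catl s10 s20 m1 m2 L1 L2 _ s12 s2t1)// (cov_disjoint s10 s20 m1 m2 L1 L2)// add0r.
rewrite (overlap_cat T s2 t2 s12 s2t1) overlap_disjoint// add0r.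
have cc := cov_same s10 m1 m2 L1 L2 s12 (lexx s2).
case/orP: (le_total t1 t2) => t12.
  rewrite (cov_catr s10 s20 m1 m2 L1 L2 s12 s2t1 _ s2t1 t12)// cc//.
  rewrite (cov_disjoint s10 s20 m1 m2 L1 L2)// addr0.
  rewrite overlapC (overlap_cat T s2 t1 s2t1 t12) overlap_same//.
  by rewrite overlapC overlap_disjoint// addr0.
rewrite (cov_catl s10 s20 m1 m2 L1 L2 s12 st2 t12)// cc//.
rewrite (overlap_cat T s2 t2 st2 t12) overlap_same//.
rewrite [overlap T t2 t1 s2 t2]overlapC overlap_disjoint// addr0.
rewrite [X in _ + X](_ : _ = 0) ?addr0// covC.
by apply: (cov_disjoint s20 s10 m2 m1 L2 L1) => //; exact: le_trans s12 st2.
Qed.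

Section Family.
Variables (I : finType) (T : R) (xi : I -> Omega -> R) (s t : I -> R).
Hypotheses (s0 : forall i, 0 <= s i) (st : forall i, s i <= t i)
  (tT : forall i, t i <= T) (mxi : forall i, wrt_measurable (F (s i)) (xi i))
  (Lxi : forall i, L2_on P setT (xi i)).

(** Both squares expand into double sums, compared pair by pair through [cov_overlap]. Overlaps are
    allowed so that two simple processes on different grids can be treated together without a common
    refinement. *)
Lemma ito_isometry :
  (\int[P]_w ((\sum_i xi i w * (b (t i) w - b (s i) w)) ^+ 2)%:E =
   \int[mu]_(v in `]0%R, T[) \int[P]_w
     ((\sum_i xi i w * \1_(`]s i, t i]) v) ^+ 2)%:E)%E.
Proof.
have Lb i : L2_on P setT (fun w => xi i w * (b (t i) w - b (s i) w)).
  exact: (increment_L2 (s0 i) (lexx _) (st i) (@mxi i) (Lxi i)).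
have sqrS (x : I -> R) : (\sum_i x i) ^+ 2 = \sum_i \sum_j x i * x j.
  by rewrite expr2 big_distrlr.
have LS : L2_on P setT (fun w => \sum_i xi i w * (b (t i) w - b (s i) w)) by exact: L2_on_sum.
rewrite (Rintegral_EFin measurableT (L2_integrable_sqr LS)).
have Rsum (G : I -> I -> Omega -> R) :
    (forall i j, P.-integrable setT (fun w => (G i j w)%:E)) ->
    \int[P]_w (\sum_i \sum_j G i j w) = \sum_i \sum_j \int[P]_w G i j w.
  move=> Gi.
  have Gi' i : P.-integrable setT (fun w => (\sum_j G i j w)%:E) by exact: integrable_sum_EFin.
  rewrite Rintegral_sum//; apply: eq_bigr => i _.
  by rewrite Rintegral_sum.
under eq_Rintegral do rewrite sqrS.
rewrite Rsum; last by move=> i j; exact: L2M_integrable.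
transitivity (\int[mu]_(v in `]0%R, T[) (\sum_i \sum_j (\int[P]_w (xi i w * xi j w)) *
    ((\1_(`]s i, t i]) v : R) * \1_(`]s j, t j]) v))%:E)%E; last first.
  apply: eq_integral => v _.
  have LS' : L2_on P setT (fun w => \sum_i xi i w * \1_(`]s i, t i]) v).
    apply: L2_on_sum => // i; under eq_fun do rewrite mulrC; exact: L2_onZ.
  rewrite (Rintegral_EFin measurableT (L2_integrable_sqr LS')); congr EFin.
  under eq_Rintegral do rewrite sqrS.
  have LL i : L2_on P setT (fun w => xi i w * \1_(`]s i, t i]) v).
    by under eq_fun do rewrite mulrC; exact: L2_onZ.
  rewrite Rsum; last by move=> i j; exact: L2M_integrable.
  apply: eq_bigr => i _; apply: eq_bigr => j _.
  rewrite mulrC -RintegralZl//; last exact: L2M_integrable.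
  by apply: eq_Rintegral => w _; ring.
have oi i j : mu.-integrable `]0, T[ (fun v => ((\int[P]_w (xi i w * xi j w)) *
    ((\1_(`]s i, t i]) v : R) * \1_(`]s j, t j]) v))%:E).
  by apply: integrableZ_EFin => //; exact: overlap_integrable.
have oi' i : mu.-integrable `]0, T[ (fun v => (\sum_j (\int[P]_w (xi i w * xi j w)) *
    ((\1_(`]s i, t i]) v : R) * \1_(`]s j, t j]) v))%:E).
  by apply: integrable_sum_EFin.
rewrite Rintegral_EFin//; last exact: integrable_sum_EFin.
congr EFin; rewrite Rintegral_sum//; apply: eq_bigr => i _.
rewrite Rintegral_sum//; apply: eq_bigr => j _.
rewrite RintegralZl//; last exact: overlap_integrable.
exact: (cov_overlap (s0 i) (s0 j) (st i) (st j) (tT i) (tT j) (@mxi i) (@mxi j) (Lxi i) (Lxi j)).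
Qed.

End Family.

End Isometry.

(** * Fundamental theorem of calculus and Gronwall's lemma *)

Section FTC.
Context {R : realType}.
Local Notation mu := (@lebesgue_measure R).
Implicit Types (f F : R -> R) (c t : R).

Lemma Rintegral_oo_oc c t f : mu.-integrable `]c, t[ (fun v => (f v)%:E) ->
  \int[mu]_(v in `]c, t[) f v = \int[mu]_(v in `]c, t]) f v.
Proof. by move=> fi; rewrite (@Rintegral_itv_bndo_bndc _ (BRight c) t). Qed.

Lemma Rintegral_oo_cc c t f : continuous f -> c <= t ->
  \int[mu]_(v in `]c, t[) f v = \int[mu]_(v in `[c, t]) f v.
Proof.
move=> cf ct; rewrite Rintegral_oo_oc; last exact: continuous_integrable.
rewrite Rintegral_itv_obnd_cbnd//.
apply: (@integrableS _ _ _ mu `[c, t]%classic) => //.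
  by apply: subset_itv; rewrite bnd_simp.
by apply: continuous_compact_integrable;
  [exact: segment_compact|exact: continuous_subspaceT].
Qed.

Lemma Rintegral_oo_ge c t f : t <= c -> \int[mu]_(v in `]c, t[) f v = 0.
Proof. by move=> tc; rewrite set_itv_ge ?Rintegral_set0// bnd_simp -leNgt. Qed.

Lemma continuous_path_integral c f : continuous f ->
  continuous (fun t => \int[mu]_(v in `]c, t[) f v).
Proof.
move=> cf t; pose u := Num.max c t + 1.
have cu : c <= u by rewrite /u (@le_trans _ _ (Num.max c t)) ?le_max ?lexx// lerDl.
have tu : t < u by rewrite /u (@le_lt_trans _ _ (Num.max c t)) ?le_max ?lexx ?orbT// ltrDl.
(* The endpoint is clamped to [[c, u]], where the parametrised integral is continuous; near [t] the
   clamp acts only on [s <= c], where both integrals vanish. *)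
pose g (s : R) : R := Num.min u (Num.max c s).
have cg : continuous g.
  have cm : continuous (fun s : R => Num.max c s).
    by move=> s; apply: continuous_max; [exact: cvg_cst|exact: cvg_id].
  move=> s; apply: (@continuous_min _ _ (fun=> u) (fun s => Num.max c s)).
    exact: cvg_cst.
  exact: cm.
have fi : mu.-integrable `[c, u] (EFin \o f).
  by apply: continuous_compact_integrable;
    [exact: segment_compact|exact: continuous_subspaceT].
have cG := within_continuous_clamp (parameterized_integral_continuous cu fi) cg.
have eqG s : s < u -> \int[mu]_(v in `]c, s[) f v =
    ((parameterized_integral mu c)^~ f \o g) s.
  move=> su; rewrite /= /g /parameterized_integral.
  case/orP: (le_total c s) => cs.
    by rewrite (max_idPr cs) (min_idPr (ltW su)) Rintegral_oo_cc.
  by rewrite (max_idPl cs) (min_idPr cu) Rintegral_oo_ge// set_itv1 Rintegral_set1.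
have /cG h : forall s, g s \in `[c, u].
  move=> s; rewrite in_itv /= /g le_min cu ge_min lexx !le_max lexx /=.
  by [].
rewrite /continuous_at (eqG t tu).
apply: cvg_trans (h t); apply: near_eq_cvg; near=> s.
by rewrite eqG//; near: s; exact: lt_nbhsl.
Unshelve. all: by end_near. Qed.

Lemma derive_path_integral c t f : continuous f -> c < t ->
  is_derive t 1 (fun t => \int[mu]_(v in `]c, t[) f v) (f t).
Proof.
move=> cf ct.
have -> : (fun t => \int[mu]_(v in `]c, t[) f v) =
    (fun t => \int[mu]_(v in [set` Interval (BRight c) (BRight t)]) f v).
  by apply/funext => s; rewrite Rintegral_oo_oc//; exact: continuous_integrable.
have ii : mu.-integrable [set` Interval (BRight c) (BRight (t + 1))] (EFin \o f).
  apply: (@integrableS _ _ _ mu `[c, t + 1]%classic) => //.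
    by apply: subset_itv; rewrite bnd_simp.
  by apply: continuous_compact_integrable;
    [exact: segment_compact|exact: continuous_subspaceT].
have tt : t < t + 1 by rewrite ltrDl.
have bct : (BRight c < BRight t)%O by rewrite bnd_simp.
have [dF dFE] := @continuous_FTC1 _ f (BRight c) t (t + 1) tt ii bct (cf t).
apply: (DeriveDef dF); rewrite -derive1E; exact: dFE.
Qed.

Lemma integral_derive c t f F : c <= t -> continuous f -> continuous F ->
  (forall v, c < v < t -> is_derive v 1 F (f v)) ->
  \int[mu]_(v in `]c, t[) f v = F t - F c.
Proof.
move=> + cf cF dF; rewrite le_eqVlt => /predU1P[->|ct].
  by rewrite Rintegral_oo_ge// subrr.
rewrite Rintegral_oo_cc//; last exact: ltW.
have := @continuous_FTC2 _ f F c t ct (continuous_subspaceT cf).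
rewrite /Rintegral => -> //.
- split; first by move=> v; rewrite in_itv /= => /dF[].
  + by apply: cvg_at_right_filter; exact: cF.
  + by apply: cvg_at_left_filter; exact: cF.
- by move=> v; rewrite in_itv /= => /dF[dv <-]; rewrite derive1E.
Qed.

Lemma integral_power_path c t f (j : nat) : c <= t -> continuous f ->
  \int[mu]_(v in `]c, t[) (f v * (\int[mu]_(u in `]c, v[) f u) ^+ j / j`!%:R) =
  (\int[mu]_(u in `]c, t[) f u) ^+ j.+1 / j.+1`!%:R.
Proof.
move=> ct cf; pose A v := \int[mu]_(u in `]c, v[) f u.
have cA : continuous A by exact: continuous_path_integral.
pose G v := A v ^+ j.+1 / j.+1`!%:R.
have -> : A t ^+ j.+1 / j.+1`!%:R = G t - G c.
  have -> : G c = 0 by rewrite /G /A Rintegral_oo_ge// expr0n /= mul0r.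
  by rewrite subr0.
apply: integral_derive => //.
- move=> v; apply: cvgM; last exact: cvg_cst.
  apply: cvgM; first exact: cf.
  by apply: (@continuous_comp _ _ _ A (fun x => x ^+ j)); [exact: cA|exact: exprn_continuous].
- move=> v; apply: cvgM; last exact: cvg_cst.
  by apply: (@continuous_comp _ _ _ A (fun x => x ^+ j.+1)); [exact: cA|exact: exprn_continuous].
- move=> v /andP[cv vt].
  have dA : is_derive v 1 A (f v) by exact: derive_path_integral.
  have -> : G = (j.+1`!%:R^-1 : R) \*: (A ^+ j.+1).
    by apply/funext => x; rewrite /G mulrC /= exprfctE.
  apply: is_derive_eq.
  rewrite /GRing.scale /= -scaler_nat /GRing.scale /= factS natrM.
  have jn : j.+1%:R != 0 :> R by rewrite pnatr_eq0.
  have fn : j`!%:R != 0 :> R by rewrite pnatr_eq0 -lt0n fact_gt0.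
  move: jn fn; move: (j.+1%:R : R) (j`!%:R : R) => x y x0 y0.
  by field; rewrite x0 y0.
Qed.

End FTC.

Section Gronwall.
Context {R : realType}.
Local Notation mu := (@lebesgue_measure R).

(** Iterating the integral inequality bounds [v t] by [C L (C t) ^ j / j!] for every [j], with [L]
    the total integral. Only measurability of [v] and extended values are at hand, as for second
    moments along a solution, so the inequality is never differentiated. *)
Lemma gronwall0 (T C : R) (v : R -> \bar R) : 0 <= C ->
  measurable_fun `]0, T[ v -> (forall t, 0 <= v t)%E ->
  (\int[mu]_(s in `]0%R, T[) v s < +oo)%E ->
  (forall t, 0 <= t <= T -> (v t <= C%:E * \int[mu]_(s in `]0%R, t[) v s)%E) ->
  forall t, 0 <= t <= T -> v t = 0%E.
Proof.
move=> C0 mv v0 vfin vC.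
pose L := fine (\int[mu]_(s in `]0%R, T[) v s)%E.
have LE : (\int[mu]_(s in `]0%R, T[) v s = L%:E)%E.
  by rewrite fineK// ge0_fin_numE// integral_ge0.
have L0 : 0 <= L by rewrite fine_ge0// integral_ge0.
have subT t : t <= T -> `]0, t[ `<=` `]0, T[ by move=> tT; apply: subset_itv; rewrite bnd_simp.
have mvt t : t <= T -> measurable_fun `]0, t[ v.
  by move=> /subT tT; apply: measurable_funS mv.
have H j : forall t, 0 <= t <= T ->
    (v t <= (C * L * ((C * t) ^+ j / j`!%:R))%:E)%E.
  elim: j => [t /[dup] tT /andP[t0 tT']|j ih t /[dup] tT /andP[t0 tT']];
    apply: (le_trans (vC t tT)).
    rewrite expr0 fact0 divr1 mulr1 EFinM -LE; apply: lee_wpmul2l; first by rewrite lee_fin.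
    by apply: ge0_subset_integral => //; exact: subT.
  have cC : continuous (fun _ : R => C) by move=> x; exact: cvg_cst.
  have CE s : 0 <= s -> \int[mu]_(u in `]0, s[) C = C * s.
    by move=> s0; rewrite Rintegral_cst//= lebesgue_measure_oo//= subr0.
  pose G (s : R) : R := C * (\int[mu]_(u in `]0, s[) C) ^+ j / j`!%:R.
  have cG : continuous G.
    move=> s; apply: cvgM; last exact: cvg_cst.
    apply: cvgM; first exact: cvg_cst.
    apply: (@continuous_comp _ _ _ (fun s : R => \int[mu]_(u in `]0, s[) C : R) (fun x : R => x ^+ j)).
      exact: continuous_path_integral.
    exact: exprn_continuous.
  have Gi : mu.-integrable `]0, t[ (fun s => (G s)%:E) by exact: continuous_integrable.
  apply: (@le_trans _ _ ((C * L)%:E * \int[mu]_(s in `]0%R, t[) (G s)%:E)%E).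
    rewrite -ge0_integralZl//; last exact: mvt.
    rewrite -ge0_integralZl//; first last.
    - by rewrite lee_fin mulr_ge0.
    - move=> s; rewrite /= in_itv /= => /andP[s0 _].
      by rewrite lee_fin /G CE ?(ltW s0)// divr_ge0// mulr_ge0// exprn_ge0// mulr_ge0// ltW.
    - by apply: measurable_int Gi.
    apply: ge0_le_integral => //.
    - by move=> s _; rewrite mule_ge0// lee_fin.
    - by apply: measurable_funeM; exact: mvt.
    - by apply: measurable_funeM; apply: measurable_int Gi.
    - move=> s; rewrite /= in_itv /= => /andP[s0 st].
      have sT : 0 <= s <= T by rewrite (ltW s0) (le_trans (ltW st)).
      apply: (@le_trans _ _ (C%:E * (C * L * ((C * s) ^+ j / j`!%:R))%:E)%E).
        by apply: lee_wpmul2l; [rewrite lee_fin|exact: ih].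
      rewrite -!EFinM lee_fin /G CE ?(ltW s0)// le_eqVlt; apply/orP; left; apply/eqP.
      by ring.
  by rewrite Rintegral_EFin// integral_power_path// CE.
move=> t tT; apply/eqP; rewrite eq_le v0 andbT.
have cv : (C * L * ((C * t) ^+ j / j`!%:R))%:E @[j --> \oo] --> 0%E.
  apply: cvg_EFin; first exact: nearW.
  rewrite -[X in _ --> X](mulr0 (C * L)); apply: cvgM; first exact: cvg_cst.
  exact: cvg_exp_coeff.
by apply: cvge_ge cv; apply: nearW => j; exact: H.
Qed.

End Gronwall.

(** * Comparison of Ito integrals and uniqueness of solutions *)

Section ItoDifference.
Context {R : realType} {d : measure_display} {Omega : measurableType d}.
Variables (P : probability Omega R) (beta b : R -> {RV P >-> R}).
Hypotheses (hbeta : brownian_motion beta) (hb : regular_modification beta b).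
Local Notation F := (augmented_filtration P (fun r => beta r)).
Local Notation RT := (measurableTypeR R).
Local Notation mu := (@lebesgue_measure R).
Local Notation simple := (simple_process P (fun r => beta r)).

Section Stopped.
Variables (S : simple) (t : R).
Hypothesis t0 : 0 <= t.

(** A coefficient whose interval starts at or after [t] is dropped: it multiplies an empty
    increment, and it might not be measurable at the stopped time [min (sp_time S i) t]. *)
Definition stopped_coef i (w : Omega) : R :=
  if sp_time S i < t then sp_coef S i w else 0.

Lemma sp_time_ge0' i : 0 <= sp_time S i.
Proof.
elim: i => [|i ih]; first exact: sp_time_ge0.
exact: le_trans ih (sp_time_le S i).
Qed.

Lemma sp_integral_stopped (c : R -> Omega -> R) w :
  \sum_(i < sp_size S) sp_coef S i w *
    (c (Num.min (sp_time S i.+1) t) w - c (Num.min (sp_time S i) t) w) =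
  \sum_(i < sp_size S) stopped_coef i w *
    (c (Num.min (sp_time S i.+1) t) w - c (Num.min (sp_time S i) t) w).
Proof.
apply: eq_bigr => i _; rewrite /stopped_coef; case: (ltP (sp_time S i) t) => // ti.
by rewrite (min_idPr (le_trans ti (sp_time_le S i))) subrr !mulr0.
Qed.

Lemma sp_val_stopped v w : 0 < v < t -> sp_val S v w =
  \sum_(i < sp_size S) stopped_coef i w *
    \1_(`]Num.min (sp_time S i) t, Num.min (sp_time S i.+1) t]) v.
Proof.
move=> /andP[_ vt]; apply: eq_bigr => i _; rewrite /stopped_coef !indicE !mem_setE !in_itv /=.
rewrite le_min (ltW vt) andbT; case: (ltP (sp_time S i) t) => // ti.
by rewrite mul0r (ltNge _ v) (le_trans (ltW vt) ti) /= mulr0.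
Qed.

Lemma stopped_coef_adapted i :
  wrt_measurable (F (Num.min (sp_time S i) t)) (stopped_coef i).
Proof.
rewrite /stopped_coef; case: (ltP (sp_time S i) t) => ti; last exact: wrt_measurable_cst.
exact: sp_coef_adapted.
Qed.

Lemma stopped_coef_L2 i : L2_on P setT (stopped_coef i).
Proof.
rewrite /stopped_coef; case: (ltP (sp_time S i) t) => ti; last exact: L2_on0.
exact: sp_coef_L2.
Qed.

End Stopped.

Lemma measurable_sp_integral (S : simple) t : measurable_fun setT (sp_integral S t).
Proof.
apply: measurable_sum => i; apply: measurable_funM; first exact: (sp_coef_L2 S i).1.
exact: measurable_increment.
Qed.

(** The isometry is applied to the disjoint union of the two families of stopped intervals, the
    second family with opposite sign. *)
Lemma sp_difference (S S' : simple) t : 0 <= t ->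
  (\int[P]_w ((sp_integral S t w - sp_integral S' t w) ^+ 2)%:E =
   \int[(mu \x P)%E]_(z in cylinder t) ((sp_val S z.1 z.2 - sp_val S' z.1 z.2) ^+ 2)%:E)%E.
Proof.
move=> t0.
pose I : finType := ('I_(sp_size S) + 'I_(sp_size S'))%type.
pose xi (i : I) w : R := match i with
  inl i => stopped_coef S t i w | inr i => - stopped_coef S' t i w end.
pose u (i : I) : R := match i with
  inl i => Num.min (sp_time S i) t | inr i => Num.min (sp_time S' i) t end.
pose u' (i : I) : R := match i with
  inl i => Num.min (sp_time S i.+1) t | inr i => Num.min (sp_time S' i.+1) t end.
have u0 i : 0 <= u i by case: i => i /=; rewrite le_min t0 sp_time_ge0'.
have uu i : u i <= u' i.
  by case: i => i /=; rewrite le_min !ge_min lexx orbT sp_time_le.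
have uT i : u' i <= t by case: i => i /=; rewrite ge_min lexx orbT.
have mxi i : wrt_measurable (F (u i)) (xi i).
  case: i => i /=; first exact: stopped_coef_adapted.
  by apply: (wrt_measurable_comp (f := fun x => - x)); [exact: stopped_coef_adapted|meas].
have Lxi i : L2_on P setT (xi i).
  case: i => i /=; first exact: stopped_coef_L2.
  by have := L2_onZ measurableT (-1) (stopped_coef_L2 S' t i); under eq_fun do rewrite mulN1r.
have := ito_isometry hbeta hb u0 uu uT mxi Lxi.
have [N [mN N0 bN]] := rm_null hb.
have m1 := measurable_sp_integral S t; have m2 := measurable_sp_integral S' t.
have -> : (\int[P]_w ((\sum_i xi i w * (b (u' i) w - b (u i) w)) ^+ 2)%:E =
    \int[P]_w ((sp_integral S t w - sp_integral S' t w) ^+ 2)%:E)%E.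
  have mS : measurable_fun setT (fun w => \sum_i xi i w * (b (u' i) w - b (u i) w)).
    apply: measurable_sum => i; apply: measurable_funM; first exact: (Lxi i).1.
    exact: measurable_increment.
  apply: ge0_ae_eq_integral => //.
  - by meas.
  - by meas.
  - by move=> w _; rewrite lee_fin sqr_ge0.
  - by move=> w _; rewrite lee_fin sqr_ge0.
  - exists N; split=> // w /=; apply: contra_notP => Nw _; congr (EFin (_ ^+ 2)).
    rewrite /sp_integral !(sp_integral_stopped _ _ (fun r => beta r)) big_sumType /=.
    rewrite -sumrN; congr (_ + _); apply: eq_bigr => i _.
      by rewrite !bN// le_min t0 sp_time_ge0'.
    by rewrite !bN ?mulNr// le_min t0 sp_time_ge0'.
move=> ->.
have mD : measurable (`]0, t[%classic : set RT) by exact: measurable_itv.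
pose D := (`]0, t[%classic : set RT) `*` [set: Omega].
have m3 : measurable_fun D (fun z : RT * Omega =>
    (sp_val S z.1 z.2 - sp_val S' z.1 z.2) ^+ 2).
  have h1 := @measurable_sp_val _ _ _ _ _ S D.
  by have h2 := @measurable_sp_val _ _ _ _ _ S' D; meas.
rewrite /cylinder (@integral_cylinder1 _ _ _ P _ (fun s w =>
  (sp_val S s w - sp_val S' s w) ^+ 2) mD m3); last by move=> *; exact: sqr_ge0.
apply: eq_integral => v; rewrite inE /= in_itv /= => vt.
apply: eq_integral => w _; congr (EFin (_ ^+ 2)).
rewrite !(sp_val_stopped _ _ vt) big_sumType /= -sumrN; congr (_ + _).
by apply: eq_bigr => i _; rewrite mulNr.
Qed.

Lemma sqr3_integral_le (d' : measure_display) (T' : measurableType d')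
    (m : {measure set T' -> \bar R}) (D : set T') (f g h : T' -> R) :
  measurable D -> measurable_fun D f -> measurable_fun D g -> measurable_fun D h ->
  (\int[m]_(x in D) ((f x + g x + h x) ^+ 2)%:E <=
   3%:E * (\int[m]_(x in D) (f x ^+ 2)%:E + \int[m]_(x in D) (g x ^+ 2)%:E +
    \int[m]_(x in D) (h x ^+ 2)%:E))%E.
Proof.
move=> mD mf mg mh.
have s0 (k : T' -> R) x : D x -> 0 <= k x ^+ 2 by move=> _; exact: sqr_ge0.
rewrite -ge0_integralD_EFin//; try by [meas|exact: s0].
rewrite -ge0_integralD_EFin//; try by [meas|exact: s0|move=> x _; rewrite addr_ge0 ?sqr_ge0].
rewrite -ge0_integralZ_EFin//; try by [meas|move=> x _; rewrite !addr_ge0 ?sqr_ge0].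
apply: ge0_le_integral_EFin => //; try by [meas|move=> x _; exact: sqr_ge0].
move=> x _; have := sqr_ge0 (f x - g x); have := sqr_ge0 (f x - h x).
by have := sqr_ge0 (g x - h x); nra.
Qed.

Lemma ereal_triangle (A A' Q B B' Y : \bar R) : (0 <= A)%E -> (0 <= A')%E ->
  (0 <= Q)%E -> (0 <= B)%E -> (0 <= B')%E -> (0 <= Y)%E ->
  (Q <= 3%:E * (B + Y + B'))%E ->
  (3%:E * (A + A' + Q) <= 3%:E * A + 3%:E * A' + (9%:E * B + 9%:E * B') + 9%:E * Y)%E.
Proof.
move=> A0 A'0 Q0 B0 B'0 Y0 QB.
rewrite ge0_muleDr ?adde_ge0// ge0_muleDr// -!addeA; apply: leeD => //; apply: leeD => //.
apply: (@le_trans _ _ (3%:E * (3%:E * (B + Y + B')))%E); first by apply: lee_wpmul2l.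
rewrite muleA -EFinM (_ : 3 * 3 = 9 :> R); last by ring.
by rewrite ge0_muleDr ?adde_ge0// ge0_muleDr// addeAC addeA.
Qed.

(** The inequality [(x + y + z)^2 <= 3 (x^2 + y^2 + z^2)] is used twice, around the integrals and
    around the integrands, with the isometry of simple processes in between; hence the 9. A constant
    factor is harmless for Gronwall. *)
Lemma ito_difference t f f' I I' : 0 <= t ->
  is_ito_integral P (fun r => beta r) t f I ->
  is_ito_integral P (fun r => beta r) t f' I' ->
  (\int[P]_w ((I w - I' w) ^+ 2)%:E <=
   9%:E * \int[(mu \x P)%E]_(z in cylinder t) ((f z.1 z.2 - f' z.1 z.2) ^+ 2)%:E)%E.
Proof.
move=> t0 [_ [mf _] [mI _] [S [S1 S2]]] [_ [mf' _] [mI' _] [S' [S1' S2']]].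
set Y := (X in (_ <= 9%:E * X)%E).
have mC : measurable (cylinder t : set (RT * Omega)) by apply: measurableX => //; exact: measurable_itv.
have c (k : R) (x : nat -> \bar R) : x n @[n --> \oo] --> 0%E ->
    (k%:E * x n)%E @[n --> \oo] --> 0%E.
  by move=> /(cvgeZl (y := k%:E) isT); rewrite mule0.
pose e k := (3%:E * (\int[P]_w ((sp_integral (S k) t w - I w) ^+ 2)%:E) +
  3%:E * (\int[P]_w ((sp_integral (S' k) t w - I' w) ^+ 2)%:E) +
  (9%:E * (\int[(mu \x P)%E]_(z in cylinder t) ((sp_val (S k) z.1 z.2 - f z.1 z.2) ^+ 2)%:E) +
  9%:E * (\int[(mu \x P)%E]_(z in cylinder t) ((sp_val (S' k) z.1 z.2 - f' z.1 z.2) ^+ 2)%:E)))%E.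
have ce : (e k + 9%:E * Y)%E @[k --> \oo] --> (9%:E * Y)%E.
  rewrite -[X in _ --> X]add0e; apply: cvgeD; [by []| |exact: cvg_cst].
  rewrite -[X in _ --> X](adde0 0%E); apply: cvgeD => //.
    rewrite -[X in _ --> X](adde0 0%E); apply: cvgeD => //; exact: c.
  rewrite -[X in _ --> X](adde0 0%E); apply: cvgeD => //; exact: c.
apply: cvge_ge ce; apply: nearW => k.
have mS := measurable_sp_integral (S k) t; have mS' := measurable_sp_integral (S' k) t.
have mV := @measurable_sp_val _ _ _ _ _ (S k) (cylinder t).
have mV' := @measurable_sp_val _ _ _ _ _ (S' k) (cylinder t).
have -> : (\int[P]_w ((I w - I' w) ^+ 2)%:E = \int[P]_w (((- (sp_integral (S k) t w - I w)) +
   (sp_integral (S' k) t w - I' w) + (sp_integral (S k) t w - sp_integral (S' k) t w)) ^+ 2)%:E)%E.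
  by apply: eq_integral => w _; congr EFin; ring.
apply: le_trans (sqr3_integral_le _ measurableT _ _ _) _; [by meas|by meas|by meas|].
rewrite sp_difference//; under eq_integral do rewrite sqrrN.
have s0 d' (T' : measurableType d') (m : {measure set T' -> \bar R}) D (h : T' -> R) :
    (0 <= \int[m]_(x in D) (h x ^+ 2)%:E)%E.
  by apply: integral_ge0_EFin => z _; exact: sqr_ge0.
apply: ereal_triangle; try exact: s0.
have -> : (\int[(mu \x P)%E]_(z in cylinder t) ((sp_val (S k) z.1 z.2 - sp_val (S' k) z.1 z.2) ^+ 2)%:E =
  \int[(mu \x P)%E]_(z in cylinder t) (((sp_val (S k) z.1 z.2 - f z.1 z.2) +
    (f z.1 z.2 - f' z.1 z.2) + (- (sp_val (S' k) z.1 z.2 - f' z.1 z.2))) ^+ 2)%:E)%E.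
  by apply: eq_integral => z _; congr EFin; ring.
apply: le_trans (sqr3_integral_le _ mC _ _ _) _; [by meas|by meas|by meas|].
by under [X in (_ * (_ + _ + X) <= _)%E]eq_integral do rewrite sqrrN.
Qed.

End ItoDifference.

Section Uniqueness.
Context {R : realType} {d : measure_display} {Omega : measurableType d}.
Variables (P : probability Omega R) (beta b : R -> {RV P >-> R}).
Hypotheses (hbeta : brownian_motion beta) (hb : regular_modification beta b).
Local Notation F := (augmented_filtration P (fun r => beta r)).
Local Notation RT := (measurableTypeR R).
Local Notation mu := (@lebesgue_measure R).
Variables (m n : nat) (A : 'M[R]_n) (B : 'M[R]_(n, m)) (sigma : 'M[R]_n) (T : R)
  (x : 'cV[R]_n) (u : R -> Omega -> 'cV[R]_m).
Hypothesis T0 : 0 <= T.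

Lemma sum_mulr_sqr_le (c y : 'I_n -> R) :
  (\sum_j c j * y j) ^+ 2 <= n%:R * \sum_j (c j ^+ 2 * y j ^+ 2).
Proof.
(* [sqr_sum_le] speaks of sequences indexed by natural numbers; [insub] extends a family on ['I_n]
   by zero. *)
have := sqr_sum_le n (fun i => if (insub i : option 'I_n) is Some j then c j * y j else 0).
under eq_bigr do rewrite valK.
under [in X in _ <= _ * X -> _]eq_bigr do rewrite valK exprMn.
by [].
Qed.

Definition entry_bound (M : 'M[R]_n) : R := n%:R * \sum_i \sum_j M i j ^+ 2.

Lemma entry_bound_ge0 M : 0 <= entry_bound M.
Proof. by rewrite mulr_ge0// !sumr_ge0// => i _; rewrite sumr_ge0// => j _; exact: sqr_ge0. Qed.

Lemma mulmx_sqr_le (M : 'M[R]_n) (y : 'cV[R]_n) i :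
  (M *m y) i 0 ^+ 2 <= entry_bound M * \sum_j y j 0 ^+ 2.
Proof.
rewrite mxE; apply: le_trans (sum_mulr_sqr_le _ _) _.
rewrite /entry_bound -mulrA ler_wpM2l// mulr_sumr ler_sum// => j _.
rewrite ler_wpM2r ?sqr_ge0// (bigD1 i)//= (bigD1 j)//= -addrA lerDl addr_ge0//.
  by rewrite sumr_ge0// => k _; exact: sqr_ge0.
by rewrite sumr_ge0// => k _; rewrite sumr_ge0// => l _; exact: sqr_ge0.
Qed.

Lemma within_coord_integrable (f : R -> 'cV[R]_n) t i : 0 <= t <= T ->
  {within `[0, T], continuous f} -> mu.-integrable `]0, t[ (fun s => (f s i 0)%:E).
Proof.
move=> /andP[t0 tT] cf.
apply: (@integrableS _ _ _ mu `[0, T]%classic) => //.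
  by apply: subset_itv; rewrite bnd_simp.
apply: continuous_compact_integrable; first exact: segment_compact.
by move=> s; exact: (continuous_comp (cf s) (@coord_continuous R n 1 i 0 (f s))).
Qed.

(** The control term is common to both equations, so the difference solves a homogeneous linear
    equation. Its second moment is bounded by a multiple of its time integral, using
    [ito_difference] for the noise and Cauchy-Schwarz for the drift, and [gronwall0] applies. *)
Lemma sde_unique X X' :
  sde_solution P beta A B sigma T x u X -> sde_solution P beta A B sigma T x u X' ->
  forall t, 0 <= t <= T -> {ae P, forall w, X t w = X' t w}.
Proof.
move=> [aX sX cX iX [M HM]] [aX' sX' cX' iX' [M' HM']].
pose D s w i : R := X s w i 0 - X' s w i 0.
pose v t : \bar R := (\sum_i \int[P]_w (D t w i ^+ 2)%:E)%E.
have v0 t : (0 <= v t)%E.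
  by apply: sume_ge0 => i _; apply: integral_ge0_EFin => w _; exact: sqr_ge0.
pose DC t := (`]0, t[%classic : set RT) `*` [set: Omega].
have mD t : measurable (`]0, t[%classic : set RT) by exact: measurable_itv.
have mDC t i : t <= T -> measurable_fun (DC t) (fun z : RT * Omega => D z.1 z.2 i).
  move=> tT; have sub : DC t `<=` DC T.
    by move=> [s w] [/= st _]; split=> //=; move: st; rewrite !in_itv /= => /andP[-> /lt_le_trans ->].
  have mDT : measurable (DC T) by exact: measurableX.
  have [h1 _] := sX i; have [h2 _] := sX' i.
  apply: measurable_funB; [exact: measurable_funS mDT sub h1|exact: measurable_funS mDT sub h2].
have mDt t i : 0 <= t <= T -> measurable_fun setT (fun w => D t w i).
  move=> tT; have tT' : `[0, T]%classic t by rewrite /= in_itv.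
  by apply: measurable_funB; [exact: wrt_measurable_fun (aX t i tT')|exact: wrt_measurable_fun (aX' t i tT')].
have mD2 t i : t <= T -> measurable_fun (DC t) (fun z : RT * Omega => D z.1 z.2 i ^+ 2).
  by move=> /(mDC _ i) h; meas.
have mv t i : t <= T -> measurable_fun `]0, t[ (fun s => \int[P]_w (D s w i ^+ 2)%:E)%E.
  move=> tT; apply: (@measurable_section_integral _ _ _ P _ (fun s w => D s w i ^+ 2) (mD t) (mD2 _ _ tT)).
  by move=> *; exact: sqr_ge0.
have vE t : t <= T -> (\int[mu]_(s in `]0%R, t[) v s =
    \sum_i \int[(mu \x P)%E]_(z in DC t) (D z.1 z.2 i ^+ 2)%:E)%E.
  move=> tT; rewrite ge0_integral_sum//; first last.
  - by move=> i s _; apply: integral_ge0_EFin => w _; exact: sqr_ge0.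
  - by move=> i; exact: mv.
  apply: eq_bigr => i _.
  by rewrite (@integral_cylinder1 _ _ _ P _ (fun s w => D s w i ^+ 2) (mD t) (mD2 _ _ tT))// => *; exact: sqr_ge0.
have lin (N : 'M[R]_n) t i : t <= T ->
    (\int[(mu \x P)%E]_(z in DC t) ((\sum_j N i j * D z.1 z.2 j) ^+ 2)%:E <=
     (entry_bound N)%:E * \int[mu]_(s in `]0%R, t[) v s)%E.
  move=> tT; have mDCt : measurable (DC t) by exact: measurableX.
  have mh j := mDC t j tT; have mh2 j := mD2 t j tT.
  rewrite vE// -ge0_integral_sum_EFin//; last by move=> *; exact: sqr_ge0.
  rewrite -ge0_integralZ_EFin//; first last.
  - by move=> z _; rewrite sumr_ge0// => j _; exact: sqr_ge0.
  - exact: entry_bound_ge0.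
  - by meas.
  apply: ge0_le_integral_EFin => //; [|by meas|by move=> z _; exact: sqr_ge0|].
    by apply: measurable_funX; apply: measurable_sum => j; apply: measurable_funM.
  move=> z _; have := mulmx_sqr_le N (\col_j D z.1 z.2 j) i.
  by rewrite mxE; under eq_bigr do rewrite mxE; under [in X in _ <= _ * X -> _]eq_bigr do rewrite mxE.
(* [18 = 2 * 9]: the 2 separates noise from drift, the 9 comes from [ito_difference]. The factor [T]
   is Cauchy-Schwarz in time, and [n] counts the coordinates. *)
pose C := n%:R * (18 * entry_bound sigma + 2 * (T * entry_bound A)).
have S0 : 0 <= 18 * entry_bound sigma by exact: mulr_ge0 (entry_bound_ge0 _).
have A0 : 0 <= 2 * (T * entry_bound A).
  by apply: mulr_ge0 => //; exact: mulr_ge0 (entry_bound_ge0 _).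
have K0 : 0 <= 18 * entry_bound sigma + 2 * (T * entry_bound A) by exact: addr_ge0.
have C0 : 0 <= C by exact: mulr_ge0.
have main t : 0 <= t <= T -> (v t <= C%:E * \int[mu]_(s in `]0%R, t[) v s)%E.
  move=> /[dup] tT /andP[t0 tT'].
  have iv0 : (0 <= \int[mu]_(s in `]0%R, t[) v s)%E by exact: integral_ge0.
  suff H i : (\int[P]_w (D t w i ^+ 2)%:E <=
      (18 * entry_bound sigma + 2 * (T * entry_bound A))%:E * \int[mu]_(s in `]0%R, t[) v s)%E.
    apply: (@le_trans _ _ (\sum_(i < n) (18 * entry_bound sigma + 2 * (T * entry_bound A))%:E * \int[mu]_(s in `]0%R, t[) v s)%E).
      exact: lee_sum.
    rewrite -ge0_sume_distrl; last by move=> j _; rewrite lee_fin.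
    by rewrite sumEFin sumr_const card_ord /C [n%:R * _]mulr_natl.
  have t01 : t \in `[0, T] by rewrite in_itv.
  have [It XE] := HM t t01; have [It' XE'] := HM' t t01.
  (* The drift integrand is cut off outside the cylinder to be jointly measurable on the whole
     product space. *)
  pose h : RT * Omega -> R := (fun z => \sum_j A i j * D z.1 z.2 j) \_ (DC t).
  have mDCt : measurable (DC t) by exact: measurableX.
  have mh : measurable_fun setT h.
    have mh0 : measurable_fun (DC t) (fun z : RT * Omega => \sum_j A i j * D z.1 z.2 j).
      by apply: measurable_sum => j; apply: measurable_funM => //; exact: mDC.
    exact: (measurable_restrictT _ mDCt).1 mh0.
  have mh' : measurable_fun setT (fun z : RT * Omega => h (z.1, z.2)).
    by have -> : (fun z : RT * Omega => h (z.1, z.2)) = h by apply/funext => -[].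
  have hE s w : s \in `]0, t[%classic -> h (s, w) = \sum_j A i j * D s w j.
    by move=> /set_mem st; rewrite /h patchE mem_set.
  have mJ : measurable_fun setT (fun w => \int[mu]_(s in `]0, t[) h (s, w)).
    exact: (@measurable_Rintegral _ _ _ _ (fun s w => h (s, w)) (mD t) mh').
  have mM : measurable_fun setT (fun w => M t w i 0) by have [_ _ []] := It i.
  have mM' : measurable_fun setT (fun w => M' t w i 0) by have [_ _ []] := It' i.
  have mDi := mDt t i tT.
  (* Almost surely the two integral equations may be subtracted; path continuity makes the drift
     integrands integrable. *)
  have -> : (\int[P]_w (D t w i ^+ 2)%:E = \int[P]_w (((M t w i 0 - M' t w i 0) +
      - \int[mu]_(s in `]0, t[) h (s, w)) ^+ 2)%:E)%E.
    apply: ge0_ae_eq_integral => //.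
    - by meas.
    - by meas.
    - by move=> w _; rewrite lee_fin sqr_ge0.
    - by move=> w _; rewrite lee_fin sqr_ge0.
    - near=> w => _; congr (EFin (_ ^+ 2)).
      have e1 : X t w + time_integral t (fun s => A *m X s w) =
        x + M t w + time_integral t (fun s => B *m u s w) by near: w; exact: XE.
      have e2 : X' t w + time_integral t (fun s => A *m X' s w) =
        x + M' t w + time_integral t (fun s => B *m u s w) by near: w; exact: XE'.
      have c1 : {within `[0, T], continuous (fun t => X t w)} by near: w; exact: cX.
      have c2 : {within `[0, T], continuous (fun t => X' t w)} by near: w; exact: cX'.
      have i1 : mu.-integrable `]0, t[ (fun s => ((A *m X s w) i 0)%:E).
        have -> : (fun s => ((A *m X s w) i 0)%:E) = (fun s => (\sum_j A i j * X s w j 0)%:E).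
          by apply/funext => s; rewrite mxE.
        apply: integrable_sum_EFin => // j; apply: integrableZ_EFin => //.
        exact: (within_coord_integrable j tT c1).
      have i2 : mu.-integrable `]0, t[ (fun s => ((A *m X' s w) i 0)%:E).
        have -> : (fun s => ((A *m X' s w) i 0)%:E) = (fun s => (\sum_j A i j * X' s w j 0)%:E).
          by apply/funext => s; rewrite mxE.
        apply: integrable_sum_EFin => // j; apply: integrableZ_EFin => //.
        exact: (within_coord_integrable j tT c2).
      have -> : \int[mu]_(s in `]0, t[) h (s, w) =
          \int[mu]_(s in `]0, t[) (A *m X s w) i 0 - \int[mu]_(s in `]0, t[) (A *m X' s w) i 0.
        rewrite -RintegralB//; apply: eq_Rintegral => s st.
        by rewrite hE// !mxE -sumrB; apply: eq_bigr => j _; rewrite mulrBr.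
      have /(congr1 (fun y : 'cV[R]_n => y i 0)) := e1.
      have /(congr1 (fun y : 'cV[R]_n => y i 0)) := e2.
      rewrite /D !mxE => {}e2 {}e1.
      move: e1 e2; move: (X t w i 0) (X' t w i 0) (M t w i 0) (M' t w i 0).
      move: (\int[mu]_(s in `]0, t[) _) (\int[mu]_(s in `]0, t[) _) (\int[mu]_(s in `]0, t[) _).
      by move=> *; lra.
  have mMM : measurable_fun setT (fun w => M t w i 0 - M' t w i 0) by meas.
  have mNJ : measurable_fun setT (fun w => - \int[mu]_(s in `]0, t[) h (s, w)) by meas.
  apply: le_trans (sqrD_integral_le P measurableT mMM mNJ) _.
  rewrite [((18 * _ + _)%:E)%E]EFinD ge0_muleDl; last 2 first.
  - by rewrite lee_fin.
  - by rewrite lee_fin.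
  have linE (N : 'M[R]_n) : (\int[(mu \x P)%E]_(z in DC t) (((N *m X z.1 z.2) i 0 - (N *m X' z.1 z.2) i 0) ^+ 2)%:E =
     \int[(mu \x P)%E]_(z in DC t) ((\sum_j N i j * D z.1 z.2 j) ^+ 2)%:E)%E.
    apply: eq_integral => z _; congr (EFin (_ ^+ 2)); rewrite !mxE -sumrB.
    by apply: eq_bigr => j _; rewrite mulrBr.
  apply: leeD.
    have -> : 18 * entry_bound sigma = 2 * (9 * entry_bound sigma) by ring.
    rewrite (EFinM 2) -muleA; apply: lee_wpmul2l => //.
    apply: le_trans (ito_difference hbeta hb t0 (It i) (It' i)) _.
    rewrite EFinM -muleA; apply: lee_wpmul2l => //.
    by rewrite /cylinder linE; exact: lin.
  rewrite (EFinM 2) -muleA; apply: lee_wpmul2l => //.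
  under eq_integral do rewrite sqrrN.
  have mh2 D' : measurable_fun D' (fun z : RT * Omega => h (z.1, z.2) ^+ 2).
    by apply: measurable_funTS; apply: measurable_funX.
  have mint := @measurable_path_integral _ _ _ _ (fun s w => h (s, w) ^+ 2) (mD t) (mh2 _)
    (fun _ _ _ => sqr_ge0 _).
  apply: (@le_trans _ _ (\int[P]_w (t%:E * \int[mu]_(s in `]0%R, t[) (h (s, w) ^+ 2)%:E))%E).
    apply: ge0_le_integral => //.
    - by move=> w _; rewrite lee_fin sqr_ge0.
    - by meas.
    - exact: measurable_funeM.
    - move=> w _; apply: sqr_Rintegral_le => //.
      + by rewrite -[in RHS](subr0 t); exact: lebesgue_measure_oo.
      + have mp : measurable_fun setT (fun s : RT => (s, w)) by exact: measurable_fun_pair.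
        by apply: measurable_funTS; exact: (measurableT_comp mh mp).
  rewrite ge0_integralZl//; last by move=> w _; apply: integral_ge0_EFin => s _; exact: sqr_ge0.
  rewrite -(@integral_cylinder2 _ _ _ P _ (fun s w => h (s, w) ^+ 2) (mD t) (mh2 _)); last first.
    by move=> *; exact: sqr_ge0.
  rewrite EFinM -muleA; apply: lee_pmul => //.
    by apply: integral_ge0_EFin => z _; exact: sqr_ge0.
  apply: le_trans (lin A t i tT'); rewrite le_eqVlt; apply/orP; left; apply/eqP.
  apply: eq_integral => -[s w] /set_mem[/= st _]; congr (EFin (_ ^+ 2)).
  by rewrite hE// mem_set.
have vfin : (\int[mu]_(s in `]0%R, T[) v s < +oo)%E.
  rewrite vE//; apply: lte_sum_pinfty => i _.
  have [h1 h2] := L2_onB (measurableX (mD T) measurableT) (sX i) (sX' i).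
  exact: h2.
have mvT : measurable_fun `]0, T[ v.
  by apply: emeasurable_sum => i; exact: mv.
move=> t tT; have vt := gronwall0 C0 mvT v0 vfin main tT.
have De i : {ae P, forall w, D t w i = 0}.
  have : (\int[P]_w (D t w i ^+ 2)%:E = 0)%E.
    apply/eqP; rewrite eq_le; apply/andP; split; last first.
      by apply: integral_ge0_EFin => w _; exact: sqr_ge0.
    rewrite -vt /v (bigD1 i)//= leeDl// sume_ge0// => j _.
    by apply: integral_ge0_EFin => w _; exact: sqr_ge0.
  have mDi := mDt t i tT.
  have -> : (\int[P]_w (D t w i ^+ 2)%:E = \int[P]_w `|(D t w i ^+ 2)%:E|)%E.
    by apply: eq_integral => w _; rewrite gee0_abs// lee_fin sqr_ge0.
  have m2 : measurable_fun setT (fun w => (D t w i ^+ 2)%:E) by meas.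
  move=> /(ae_eq_integral_abs P measurableT m2); apply: filterS => w /(_ Logic.I) /= /eqP.
  by rewrite eqe sqrf_eq0 => /eqP.
have : {ae P, forall w, forall i, D t w i = 0} by exact: filter_forall.
apply: filterS => w Dw; apply/matrixP => i j; rewrite ord1; apply/eqP.
by rewrite -subr_eq0; apply/eqP; exact: Dw.
Unshelve. all: by end_near. Qed.

End Uniqueness.

(** * Matrix norms, regular processes and matrix integrals *)

Section MatrixNorm.
Context {R : realType}.

(** The entrywise l1 norm is submultiplicative, and as a finite sum of absolute values it inherits
    measurability and continuity from the entries. *)
Definition mx1norm {p q} (M : 'M[R]_(p, q)) : R := \sum_i \sum_j `|M i j|.

Lemma mx1norm_ge0 p q (M : 'M[R]_(p, q)) : 0 <= mx1norm M.
Proof. by rewrite sumr_ge0// => i _; exact: sumr_ge0. Qed.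

Lemma mx1norm0 p q : mx1norm (0 : 'M[R]_(p, q)) = 0.
Proof. by rewrite /mx1norm big1// => i _; rewrite big1// => j _; rewrite mxE normr0. Qed.

Lemma mx1normD p q (M N : 'M[R]_(p, q)) : mx1norm (M + N) <= mx1norm M + mx1norm N.
Proof.
rewrite -big_split ler_sum// => i _; rewrite -big_split ler_sum// => j _.
by rewrite mxE ler_normD.
Qed.

Lemma mx1norm_sum p q (I : Type) (s : seq I) (Q : pred I) (M : I -> 'M[R]_(p, q)) :
  mx1norm (\sum_(i <- s | Q i) M i) <= \sum_(i <- s | Q i) mx1norm (M i).
Proof.
elim/big_ind2 : _ => // [|x1 x2 y1 y2 h1 h2]; first by rewrite mx1norm0.
by apply: le_trans (mx1normD _ _) _; exact: lerD.
Qed.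

Lemma mx1normZ p q a (M : 'M[R]_(p, q)) : mx1norm (a *: M) = `|a| * mx1norm M.
Proof.
rewrite /mx1norm mulr_sumr; apply: eq_bigr => i _; rewrite mulr_sumr.
by apply: eq_bigr => j _; rewrite mxE normrM.
Qed.

Lemma mx1norm_entry p q (M : 'M[R]_(p, q)) i j : `|M i j| <= mx1norm M.
Proof.
rewrite /mx1norm (bigD1 i)//= (bigD1 j)//= -addrA lerDl addr_ge0//.
  exact: sumr_ge0.
by apply: sumr_ge0 => k _; exact: sumr_ge0.
Qed.

Lemma mx1normM p q r (M : 'M[R]_(p, q)) (N : 'M[R]_(q, r)) :
  mx1norm (M *m N) <= mx1norm M * mx1norm N.
Proof.
rewrite /mx1norm mulr_suml ler_sum// => i _.
apply: (@le_trans _ _ (\sum_j \sum_k `|M i k| * `|N k j|)).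
  apply: ler_sum => j _; rewrite mxE; apply: le_trans (ler_norm_sum _ _ _) _.
  by apply: ler_sum => k _; rewrite normrM.
rewrite exchange_big /= mulr_suml; apply: ler_sum => k _; rewrite -mulr_sumr.
rewrite ler_wpM2l// (bigD1 k)//= lerDl.
by apply: sumr_ge0 => l _; exact: sumr_ge0.
Qed.

Lemma mx1norm_eq0 p q (M : 'M[R]_(p, q)) : mx1norm M = 0 -> M = 0.
Proof.
move=> M0; apply/matrixP => i j; rewrite mxE; apply/normr0_eq0/eqP.
by rewrite eq_le normr_ge0 andbT -M0 mx1norm_entry.
Qed.

End MatrixNorm.

Section Regular.
Context {R : realType} {d : measure_display} {Omega : measurableType d}.
Variables (P : probability Omega R) (beta b : R -> {RV P >-> R}).
Hypotheses (hbeta : brownian_motion beta) (hb : regular_modification beta b).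
Local Notation F := (augmented_filtration P (fun r => beta r)).
Local Notation FT t := (g_sigma_algebraType
  (natural_filtration (fun r => beta r) t `|` [set N | measurable N /\ P N = 0%E])).
Local Notation RT := (measurableTypeR R).
Local Notation mu := (@lebesgue_measure R).

(** The class in which a stage starting at time [c] is solved: it is stable under sums, products,
    time integrals from [c] and Picard limits. Continuity is asked on the whole line, adaptedness
    only from [c] on. *)
Definition regular_process (c : R) (f : R -> Omega -> R) : Prop :=
  (forall w, continuous (fun s => f s w)) /\
  (forall s, c <= s -> wrt_measurable (F s) (f s)).

Lemma regularS c c' f : c <= c' -> regular_process c f -> regular_process c' f.
Proof. by move=> cc' [cf af]; split=> // s cs; apply: af; exact: le_trans cs. Qed.

Lemma regular_det c (f : R -> R) : continuous f -> regular_process c (fun s _ => f s).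
Proof. by move=> cf; split=> // s _; exact: wrt_measurable_cst. Qed.

Lemma regular_cst c x : regular_process c (fun _ _ => x).
Proof. by apply: regular_det => s; exact: cvg_cst. Qed.

Lemma regular_init c (X : Omega -> R) : wrt_measurable (F c) X ->
  regular_process c (fun _ => X).
Proof.
by move=> aX; split=> [w s|s cs]; [exact: cvg_cst|exact: wrt_measurableS aX].
Qed.

Lemma regularD c f g : regular_process c f -> regular_process c g ->
  regular_process c (fun s w => f s w + g s w).
Proof.
move=> [cf af] [cg ag]; split=> [w s|s cs]; first by apply: cvgD; [exact: cf|exact: cg].
by apply: wrt_measurableD; [exact: af|exact: ag].
Qed.

Lemma regularM c f g : regular_process c f -> regular_process c g ->
  regular_process c (fun s w => f s w * g s w).
Proof.
move=> [cf af] [cg ag]; split=> [w s|s cs]; first by apply: cvgM; [exact: cf|exact: cg].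
by apply: wrt_measurableM; [exact: af|exact: ag].
Qed.

Lemma regular_sum c (I : Type) (r : seq I) (Q : pred I) (f : I -> R -> Omega -> R) :
  (forall i, regular_process c (f i)) ->
  regular_process c (fun s w => \sum_(i <- r | Q i) f i s w).
Proof.
move=> rf; elim: r => [|i r IH].
  by have -> : (fun s w => \sum_(i <- [::] | Q i) f i s w) = (fun _ _ => 0);
    [apply/funext => s; apply/funext => w; rewrite big_nil|exact: regular_cst].
have -> : (fun s w => \sum_(i <- i :: r | Q i) f i s w) =
    (fun s w => (if Q i then f i s w else 0) + \sum_(i <- r | Q i) f i s w).
  by apply/funext => s; apply/funext => w; rewrite big_cons; case: ifP => // _; rewrite add0r.
apply: regularD => //.
by have [?|?] := boolP (Q i); [exact: rf|exact: regular_cst].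
Qed.

Lemma regular_pgain a c : 0 <= c -> regular_process c (pgain b a c).
Proof.
move=> c0; split=> [w|s cs]; first exact: (continuous_pgain_r hb).
by apply: (wrt_measurable_pgain hb) => //; exact: le_trans cs.
Qed.

Lemma clamp_continuous (c s : R) (f : R -> R) : continuous f ->
  continuous (fun r => f (Num.max c (Num.min r s))).
Proof.
move=> cf r; apply: (@continuous_comp _ _ _ (fun r => Num.max c (Num.min r s)) f).
  apply: (@continuous_comp _ _ _ (fun r => Num.min r s) (fun r => Num.max c r)).
    by apply: continuous_min; [exact: cvg_id|exact: cvg_cst].
  by apply: continuous_max; [exact: cvg_cst|exact: cvg_id].
exact: cf.
Qed.

(** Clamping the time to [[c, s]] leaves continuous paths and makes every value [F s]-measurable, so
    [measurable_continuous_process] applies with the sigma-algebra [FT s] on [Omega]. *)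
Lemma regular_progressive c s f (A : set RT) : c <= s -> A `<=` `[c, s]%classic ->
  regular_process c f ->
  measurable_fun (A `*` [set: FT s]) (fun z : RT * FT s => f z.1 z.2).
Proof.
move=> cs sA [cf af]; pose h r := f (Num.max c (Num.min r s)).
have mh : measurable_fun setT (fun z : RT * FT s => h z.1 z.2).
  apply: (@measurable_continuous_process _ _ _ (h : R -> FT s -> R)) => [w|r].
    exact: (@clamp_continuous c s (fun r => f r w) (cf w)).
  have cm : c <= Num.max c (Num.min r s) by rewrite le_max lexx.
  have ms : Num.max c (Num.min r s) <= s by rewrite ge_max cs ge_min lexx orbT.
  by apply/wrt_measurableP; exact: wrt_measurableS ms (af _ cm).
have : measurable_fun (A `*` [set: FT s]) (fun z : RT * FT s => h z.1 z.2).
  exact: measurable_funTS.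
apply: eq_measurable_fun => -[r w] /set_mem[/= /sA /=].
by rewrite in_itv/= /h => /andP[cr rs] _; rewrite (min_idPl rs) (max_idPr cr).
Qed.

Lemma regular_measurable c s f (A : set RT) : c <= s -> A `<=` `[c, s]%classic ->
  regular_process c f ->
  measurable_fun (A `*` [set: Omega]) (fun z : RT * Omega => f z.1 z.2).
Proof.
move=> cs sA [cf af]; pose h r := f (Num.max c (Num.min r s)).
have mh : measurable_fun setT (fun z : RT * Omega => h z.1 z.2).
  apply: (@measurable_continuous_process _ _ _ h) => [w|r]; first exact: (@clamp_continuous c s (fun r => f r w) (cf w)).
  by apply: (@wrt_measurable_fun _ _ _ _ beta); apply: af; rewrite le_max lexx.
have : measurable_fun (A `*` [set: Omega]) (fun z : RT * Omega => h z.1 z.2).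
  exact: measurable_funTS.
apply: eq_measurable_fun => -[r w] /set_mem[/= /sA /=].
by rewrite in_itv/= /h => /andP[cr rs] _; rewrite (min_idPl rs) (max_idPr cr).
Qed.

Lemma regular_integral c f : regular_process c f ->
  regular_process c (fun s w => \int[mu]_(r in `]c, s[) f r w).
Proof.
move=> rf; have [cf af] := rf; split=> [w|s cs]; first exact: continuous_path_integral.
pose h r := f (Num.max c (Num.min r s)).
apply/wrt_measurableP.
have -> : (fun w => \int[mu]_(r in `]c, s[) f r w) =
    (fun w : FT s => \int[mu]_(r in `]c, s[) h r w).
  apply/funext => w; apply: eq_Rintegral => r /set_mem; rewrite /= in_itv/= /h => /andP[cr rs].
  by rewrite (min_idPl (ltW rs)) (max_idPr (ltW cr)).
apply: (@measurable_Rintegral _ _ _ _ (h : R -> FT s -> R)); first exact: measurable_itv.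
apply: (@measurable_continuous_process _ _ _ (h : R -> FT s -> R)) => [w|r].
  exact: (@clamp_continuous c s (fun r => f r w) (cf w)).
have cm : c <= Num.max c (Num.min r s) by rewrite le_max lexx.
have ms : Num.max c (Num.min r s) <= s by rewrite ge_max cs ge_min lexx orbT.
by apply/wrt_measurableP; exact: wrt_measurableS ms (af _ cm).
Qed.

Definition regular_matrix {p q} (c : R) (X : R -> Omega -> 'M[R]_(p, q)) : Prop :=
  forall i j, regular_process c (fun s w => X s w i j).

Lemma regular_eq c f g : (forall s w, f s w = g s w) -> regular_process c f ->
  regular_process c g.
Proof. by move=> fg; have -> : f = g by apply/funext => s; apply/funext => w. Qed.

Lemma rmx_cst p q c (M : 'M[R]_(p, q)) : regular_matrix c (fun _ _ => M).
Proof. by move=> i j; exact: regular_cst. Qed.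

Lemma rmxD p q c (X Y : R -> Omega -> 'M[R]_(p, q)) : regular_matrix c X ->
  regular_matrix c Y -> regular_matrix c (fun s w => X s w + Y s w).
Proof.
move=> rX rY i j; apply: (@regular_eq _ (fun s w => X s w i j + Y s w i j)).
  by move=> s w; rewrite mxE.
exact: regularD.
Qed.

Lemma rmxZ p q c f (X : R -> Omega -> 'M[R]_(p, q)) : regular_process c f ->
  regular_matrix c X -> regular_matrix c (fun s w => f s w *: X s w).
Proof.
move=> rf rX i j; apply: (@regular_eq _ (fun s w => f s w * X s w i j)).
  by move=> s w; rewrite mxE.
exact: regularM.
Qed.

Lemma rmxM p q r c (X : R -> Omega -> 'M[R]_(p, q)) (Y : R -> Omega -> 'M[R]_(q, r)) :
  regular_matrix c X -> regular_matrix c Y -> regular_matrix c (fun s w => X s w *m Y s w).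
Proof.
move=> rX rY i j; apply: (@regular_eq _ (fun s w => \sum_k X s w i k * Y s w k j)).
  by move=> s w; rewrite mxE.
by apply: regular_sum => k; exact: regularM.
Qed.

Lemma rmx_sum p q c (I : Type) (r : seq I) (Q : pred I) (X : I -> R -> Omega -> 'M[R]_(p, q)) :
  (forall i, regular_matrix c (X i)) ->
  regular_matrix c (fun s w => \sum_(i <- r | Q i) X i s w).
Proof.
move=> rX i j; apply: (@regular_eq _ (fun s w => \sum_(k <- r | Q k) X k s w i j)).
  by move=> s w; rewrite summxE.
by apply: regular_sum => k; exact: rX.
Qed.

Lemma regular_norm c f : regular_process c f -> regular_process c (fun s w => `|f s w|).
Proof.
move=> [cf af]; split=> [w s|s cs]; first exact: (cvg_norm (cf w s)).
by apply: (@wrt_measurable_comp _ _ _ _ _ _ (fun x => `|x|)); [exact: af|].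
Qed.

Lemma rmx_norm p q c (X : R -> Omega -> 'M[R]_(p, q)) : regular_matrix c X ->
  regular_process c (fun s w => mx1norm (X s w)).
Proof.
move=> rX; apply: regular_sum => i; apply: regular_sum => j; exact: regular_norm.
Qed.

End Regular.

Section MatrixIntegral.
Context {R : realType}.
Local Notation mu := (@lebesgue_measure R).

Definition mx_integral {p q} (c s : R) (f : R -> 'M[R]_(p, q)) : 'M[R]_(p, q) :=
  \matrix_(i, j) \int[mu]_(r in `]c, s[) f r i j.

Lemma continuous_sum (I : Type) (r : seq I) (f : I -> R -> R) :
  (forall i, continuous (f i)) -> continuous (fun s => \sum_(i <- r) f i s).
Proof.
move=> cf; elim: r => [|i r IH].
  by have -> : (fun s => \sum_(i <- [::]) f i s) = (fun=> 0);
    [apply/funext => s; rewrite big_nil|move=> s; exact: cvg_cst].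
have -> : (fun s => \sum_(i <- i :: r) f i s) = (fun s => f i s + \sum_(i <- r) f i s).
  by apply/funext => s; rewrite big_cons.
by move=> s; apply: cvgD; [exact: cf|exact: IH].
Qed.

Lemma cvg_sum (I : Type) (r : seq I) (u : I -> nat -> R) (l : I -> R) :
  (forall i, u i k @[k --> \oo] --> l i) ->
  \sum_(i <- r) u i k @[k --> \oo] --> \sum_(i <- r) l i.
Proof.
move=> ul; elim: r => [|i r IH].
  by rewrite big_nil; under eq_cvg do rewrite big_nil; exact: cvg_cst.
by rewrite big_cons; under eq_cvg do rewrite big_cons; apply: cvgD; [exact: ul|exact: IH].
Qed.

Lemma cvg_mx1norm p q (M : nat -> 'M[R]_(p, q)) (N : 'M[R]_(p, q)) :
  (forall i j, M k i j @[k --> \oo] --> N i j) ->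
  mx1norm (M k) @[k --> \oo] --> mx1norm N.
Proof.
move=> MN; apply: cvg_sum => i; apply: cvg_sum => j.
exact: (cvg_norm (MN i j)).
Qed.

Lemma continuous_mx1norm p q (f : R -> 'M[R]_(p, q)) :
  (forall i j, continuous (fun s => f s i j)) -> continuous (fun s => mx1norm (f s)).
Proof.
move=> cf; apply: continuous_sum => i; apply: continuous_sum => j s.
exact: (cvg_norm (cf i j s)).
Qed.

Lemma continuous_mxB p q (f g : R -> 'M[R]_(p, q)) :
  (forall i j, continuous (fun s => f s i j)) -> (forall i j, continuous (fun s => g s i j)) ->
  forall i j, continuous (fun s => (f s - g s) i j).
Proof.
move=> cf cg i j; have -> : (fun s => (f s - g s) i j) = (fun s => f s i j - g s i j).
  by apply/funext => s; rewrite !mxE.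
by move=> s; apply: cvgB; [exact: cf|exact: cg].
Qed.

Lemma mx_integral_norm p q c s (f : R -> 'M[R]_(p, q)) :
  (forall i j, continuous (fun s => f s i j)) ->
  mx1norm (mx_integral c s f) <= \int[mu]_(r in `]c, s[) mx1norm (f r).
Proof.
move=> cf; rewrite /mx1norm [leRHS]Rintegral_sum//; last first.
  move=> i; apply: integrable_sum_EFin => // j; apply: continuous_integrable => r.
  exact: (cvg_norm (cf i j r)).
apply: ler_sum => i _; rewrite [leRHS]Rintegral_sum//; last first.
  by move=> j; apply: continuous_integrable => r; exact: (cvg_norm (cf i j r)).
apply: ler_sum => j _; rewrite mxE; apply: le_normr_Rintegral => //.
exact: continuous_integrable (cf i j).
Qed.

Lemma mx_integralB p q c s (f g : R -> 'M[R]_(p, q)) :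
  (forall i j, continuous (fun s => f s i j)) -> (forall i j, continuous (fun s => g s i j)) ->
  mx_integral c s f - mx_integral c s g = mx_integral c s (fun r => f r - g r).
Proof.
move=> cf cg; apply/matrixP => i j; rewrite !mxE -RintegralB//; last 2 first.
- exact: continuous_integrable (cf i j).
- exact: continuous_integrable (cg i j).
by apply: eq_Rintegral => r _; rewrite !mxE.
Qed.

Lemma continuous_le_Rintegral c s (f g : R -> R) : continuous f -> continuous g ->
  (forall r, c < r < s -> f r <= g r) ->
  \int[mu]_(r in `]c, s[) f r <= \int[mu]_(r in `]c, s[) g r.
Proof.
move=> cf cg fg; apply: le_Rintegral => //.
- exact: continuous_integrable cf.
- exact: continuous_integrable cg.
Qed.

Lemma continuous_RintegralZ c s (f : R -> R) (k : R) : continuous f ->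
  \int[mu]_(r in `]c, s[) (k * f r) = k * \int[mu]_(r in `]c, s[) f r.
Proof. by move=> cf; rewrite RintegralZl//; exact: continuous_integrable. Qed.

Lemma path_integral_homo c r s (f : R -> R) : continuous f -> (forall v, 0 <= f v) ->
  r <= s -> \int[mu]_(v in `]c, r[) f v <= \int[mu]_(v in `]c, s[) f v.
Proof.
move=> cf f0 rs; have [rc|cr] := leP r c.
  by rewrite Rintegral_oo_ge//; exact: Rintegral_ge0.
rewrite (@Rintegral_cat _ c r s)//; [|exact: ltW|exact: continuous_integrable].
by rewrite lerDl; exact: Rintegral_ge0.
Qed.

End MatrixIntegral.

(** * Picard iteration with random Lipschitz coefficients *)

Section Picard.
Context {R : realType} {d : measure_display} {Omega : measurableType d}.
Variables (P : probability Omega R) (beta b : R -> {RV P >-> R}).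
Hypotheses (hbeta : brownian_motion beta) (hb : regular_modification beta b).
Local Notation F := (augmented_filtration P (fun r => beta r)).
Local Notation FT t := (g_sigma_algebraType
  (natural_filtration (fun r => beta r) t `|` [set N | measurable N /\ P N = 0%E])).
Local Notation RT := (measurableTypeR R).
Local Notation mu := (@lebesgue_measure R).
Local Notation regular := (regular_process (P := P) beta).
Local Notation regular_mx := (regular_matrix (P := P) beta).
Variables (p q : nat) (c : R) (lam : R -> Omega -> R)
  (Phi : R -> Omega -> 'M[R]_(p, q) -> 'M[R]_(p, q)).
Hypotheses (clam : forall w, continuous (fun s => lam s w))
  (lam0 : forall s w, 0 <= lam s w)
  (Phi_lip : forall s w x y, mx1norm (Phi s w x - Phi s w y) <= lam s w * mx1norm (x - y))
  (Phi_regular : forall W, regular_mx c W -> regular_mx c (fun s w => Phi s w (W s w))).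

Fixpoint picard k : R -> Omega -> 'M[R]_(p, q) := if k is k'.+1 then
  fun s w => mx_integral c s (fun r => Phi r w (picard k' r w)) else fun _ _ => 0.

Definition picard_src s w : R := \int[mu]_(r in `]c, s[) mx1norm (Phi r w 0).
Definition picard_lip s w : R := \int[mu]_(r in `]c, s[) lam r w.

Lemma regular_mx_integral (f : R -> Omega -> 'M[R]_(p, q)) : regular_mx c f ->
  regular_mx c (fun s w => mx_integral c s (fun r => f r w)).
Proof.
move=> rf i j; apply: (@regular_eq _ _ _ _ _ _ (fun s w => \int[mu]_(r in `]c, s[) f r w i j)).
  by move=> s w; rewrite mxE.
exact: regular_integral.
Qed.

Lemma picard_regular k : regular_mx c (picard k).
Proof.
elim: k => [|k IH]; first exact: rmx_cst.
by apply: regular_mx_integral; exact: Phi_regular.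
Qed.

Let cphi k w i j : continuous (fun r => Phi r w (picard k r w) i j).
Proof. exact: (Phi_regular (picard_regular k) i j).1. Qed.

Let csrc w : continuous (fun r => mx1norm (Phi r w 0)).
Proof. by apply: continuous_mx1norm => i j; exact: (@cphi 0%N w i j). Qed.

Lemma picard_src_ge0 s w : 0 <= picard_src s w.
Proof. by apply: Rintegral_ge0 => r _; exact: mx1norm_ge0. Qed.

Lemma picard_lip_ge0 s w : 0 <= picard_lip s w.
Proof. exact: Rintegral_ge0. Qed.

Lemma picard_before k s w : s <= c -> picard k s w = 0.
Proof.
case: k => // k sc; apply/matrixP => i j.
by rewrite mxE Rintegral_oo_ge// mxE.
Qed.

(** With [L] the integral of [lam], integrating the Lipschitz bound turns [lam L ^ k / k!] into
    [L ^ (k + 1) / (k + 1)!], and the source integral at the final time bounds the earlier ones. The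
    coefficient [lam] is random and enters only through its path integral. *)
Lemma picard_step k s w :
  mx1norm (picard k.+1 s w - picard k s w) <=
  picard_src s w * exp_coeff (picard_lip s w) k.
Proof.
have [sc|cs] := leP s c.
  rewrite !picard_before// subr0 mx1norm0 mulr_ge0// ?picard_src_ge0//.
  by rewrite exp_coeff_ge0// picard_lip_ge0.
elim: k s cs => [|k IH] s cs.
  rewrite subr0 /exp_coeff /= expr0 divr1 mulr1.
  by apply: mx_integral_norm => i j; exact: (@cphi 0%N w i j).
have -> : picard k.+2 s w - picard k.+1 s w = mx_integral c s
    (fun r => Phi r w (picard k.+1 r w) - Phi r w (picard k r w)).
  exact: (mx_integralB _ _ (@cphi k.+1 w) (@cphi k w)).
apply: (le_trans (mx_integral_norm _ _ _)).
  exact: (continuous_mxB (@cphi k.+1 w) (@cphi k w)).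
have cL : continuous (fun r => \int[mu]_(v in `]c, r[) lam v w).
  exact: continuous_path_integral.
have cexp : continuous (fun r => lam r w * (picard_lip r w ^+ k / k`!%:R)).
  move=> r; apply: cvgM; first exact: clam.
  by apply: cvgMl; apply: (@continuous_comp _ _ _ (fun r => picard_lip r w) (fun x => x ^+ k));
    [exact: cL|exact: exprn_continuous].
apply: (@le_trans _ _ (\int[mu]_(r in `]c, s[)
    (picard_src s w * (lam r w * (picard_lip r w ^+ k / k`!%:R))))).
  apply: continuous_le_Rintegral.
  - apply: continuous_mx1norm; exact: (continuous_mxB (@cphi k.+1 w) (@cphi k w)).
  - by move=> r; apply: cvgMr; exact: cexp.
  - move=> r /andP[cr rs]; apply: le_trans (Phi_lip _ _ _ _) _.
    rewrite mulrCA ler_wpM2l//; apply: le_trans (IH r cr) _.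
    rewrite ler_wpM2r ?exp_coeff_ge0 ?picard_lip_ge0//.
    by apply: path_integral_homo => //; [move=> v; exact: mx1norm_ge0|exact: ltW].
rewrite continuous_RintegralZ// ler_wpM2l ?picard_src_ge0//.
under eq_Rintegral do rewrite mulrA.
by rewrite integral_power_path// ltW.
Qed.


Definition exp_tail k (x : R) : R := expR x - series (exp_coeff x) k.

Lemma cvg_exp_tail x : exp_tail k x @[k --> \oo] --> 0.
Proof.
rewrite -[X in _ --> X](subrr (expR x)); apply: cvgB; first exact: cvg_cst.
exact: is_cvg_series_exp_coeff.
Qed.

Lemma cvg_scaled_tail C x : C * exp_tail k x @[k --> \oo] --> 0.
Proof.
rewrite -[X in _ --> X](mulr0 C); apply: cvgM; [exact: cvg_cst|exact: cvg_exp_tail].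
Qed.

Lemma exp_tail_ge k l x : 0 <= x -> (k <= l)%N ->
  \sum_(k <= j < l) exp_coeff x j <= exp_tail k x.
Proof.
move=> x0 kl; rewrite lerBrDl /series /= -big_cat_nat//=.
apply: (@nondecreasing_cvgn_le _ (series (exp_coeff x))); last exact: is_cvg_series_exp_coeff.
by apply: nondecreasing_series => n _ _; exact: exp_coeff_ge0.
Qed.

Lemma picard_cauchy k l r s w : (k <= l)%N -> r <= s ->
  mx1norm (picard l r w - picard k r w) <= picard_src s w * exp_tail k (picard_lip s w).
Proof.
move=> kl rs; rewrite -(telescope_sumr (fun j => picard j r w))//; apply: (le_trans (mx1norm_sum _ _ _)).
apply: le_trans (ler_wpM2l (picard_src_ge0 s w) (exp_tail_ge (picard_lip_ge0 s w) kl)).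
rewrite mulr_sumr; apply: ler_sum => j _; apply: le_trans (picard_step j r w) _.
apply: ler_pM.
- exact: picard_src_ge0.
- exact: exp_coeff_ge0 (picard_lip_ge0 _ _).
- by apply: path_integral_homo => // v; exact: mx1norm_ge0.
- rewrite /exp_coeff /= ler_pM2r ?invr_gt0 ?ltr0n ?fact_gt0//.
  by apply: lerXn2r; rewrite ?nnegrE ?picard_lip_ge0//; exact: path_integral_homo.
Qed.

Definition picard_limit s w : 'M[R]_(p, q) :=
  \matrix_(i, j) limn (fun k => picard k s w i j).

Lemma cvg_picard s w i j : picard k s w i j @[k --> \oo] --> picard_limit s w i j.
Proof.
rewrite mxE; apply: (@cauchy_cvg R); apply/cauchy_ballP => _ /posnumP[e].
have t0 := @cvg_scaled_tail (picard_src s w) (picard_lip s w).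
have e20 : 0 < e%:num / 2 by [].
have /cvgrPdist_lt /(_ _ e20) [k _ /(_ k (leqnn k))] := t0.
rewrite sub0r normrN => hk.
have bd l : (k <= l)%N -> `|picard l s w i j - picard k s w i j| < e%:num / 2.
  move=> kl; apply: le_lt_trans (le_lt_trans (ler_norm _) hk).
  apply: le_trans (picard_cauchy w kl (lexx s)).
  by have := mx1norm_entry (picard l s w - picard k s w) i j; rewrite !mxE.
pose U := [set x : R | `|x - picard k s w i j| < e%:num / 2].
exists (U, U); first by split; exists k => // l; exact: bd.
move=> [x y] [/= h1 h2]; rewrite /ball/= -(subrKA (picard k s w i j)).
rewrite (splitr e%:num); apply: (le_lt_trans (ler_normD _ _)); apply: ltrD => //.
by rewrite distrC.
Qed.

Lemma picard_limit_tail k r s w : r <= s ->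
  mx1norm (picard_limit r w - picard k r w) <= picard_src s w * exp_tail k (picard_lip s w).
Proof.
move=> rs; have hl : mx1norm (picard l r w - picard k r w) @[l --> \oo] -->
    mx1norm (picard_limit r w - picard k r w).
  apply: cvg_mx1norm => i j.
  have -> : (fun l => (picard l r w - picard k r w) i j) =
    (fun l => picard l r w i j - picard k r w i j) by apply/funext => l; rewrite !mxE.
  by rewrite !mxE; apply: cvgB; [have := @cvg_picard r w i j; rewrite mxE|exact: cvg_cst].
apply: (ler_cvg_to hl (cvg_cst _)); exists k => // l /= kl; exact: picard_cauchy.
Qed.

(** The tail bound is taken at the zeroth iterate, which is 0. The size of the error of a stage
    comes from here. *)
Lemma picard_limit_le s w :
  mx1norm (picard_limit s w) <= picard_src s w * expR (picard_lip s w).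
Proof.
have := @picard_limit_tail 0%N s s w (lexx s).
by rewrite subr0 /exp_tail /series /= big_geq// subr0.
Qed.

(** Uniform convergence on times up to [s + 1] gives continuity at [s]; adaptedness passes to the
    pointwise limit of the iterates. *)
Lemma picard_limit_regular : regular_mx c picard_limit.
Proof.
move=> i j; split=> [w s|s cs].
  apply/cvgrPdist_lt => e e0.
  have t0 := @cvg_scaled_tail (picard_src (s + 1) w) (picard_lip (s + 1) w).
  have e30 : 0 < e / 3 by rewrite divr_gt0.
  have /cvgrPdist_lt /(_ _ e30) [k _ /(_ k (leqnn k))] := t0.
  rewrite sub0r normrN => /(le_lt_trans (ler_norm _)) hk.
  have bd r : r <= s + 1 -> `|picard_limit r w i j - picard k r w i j| < e / 3.
    move=> /(picard_limit_tail k w) h; apply: le_lt_trans hk; apply: le_trans h.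
    by have := mx1norm_entry (picard_limit r w - picard k r w) i j; rewrite !mxE.
  have ns : \forall r \near nbhs s, r <= s + 1.
    by exists 1 => //= r; rewrite /= ltr_norml => /andP[h _]; lra.
  have /cvgrPdist_lt /(_ _ e30) := (picard_regular k i j).1 w s; apply: filter_app.
  apply: filterS ns => r rs h; have := bd s; rewrite lerDl ler01 => /(_ isT) h1.
  have h2 := bd r rs.
  have -> : picard_limit s w i j - picard_limit r w i j =
    (picard_limit s w i j - picard k s w i j) + (picard k s w i j - picard k r w i j) -
    (picard_limit r w i j - picard k r w i j) by ring.
  move: h h1 h2; rewrite !ltr_norml; lra.
apply/wrt_measurableP.
apply: (@measurable_fun_cvg _ _ _ setT (fun k (w : FT s) => picard k s w i j)).
  by move=> k; apply/wrt_measurableP; exact: (picard_regular k i j).2.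
by move=> w _; exact: cvg_picard.
Unshelve. all: by end_near. Qed.

Lemma picard_limitE s w :
  picard_limit s w = mx_integral c s (fun r => Phi r w (picard_limit r w)).
Proof.
have [sc|cs] := leP s c.
  apply/matrixP => i j; rewrite [RHS]mxE Rintegral_oo_ge//.
  rewrite mxE; have -> : (fun k => picard k s w i j) = (fun=> 0).
    by apply/funext => k; rewrite picard_before// mxE.
  exact: lim_cst.
have cW := fun i j => (Phi_regular picard_limit_regular i j).1 w.
have cl := fun i j => (picard_limit_regular i j).1 w.
have main k : mx1norm (picard k.+1 s w - mx_integral c s (fun r => Phi r w (picard_limit r w)))
    <= picard_lip s w * (picard_src s w * exp_tail k (picard_lip s w)).
  have -> : picard k.+1 s w - mx_integral c s (fun r => Phi r w (picard_limit r w)) =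
      mx_integral c s (fun r => Phi r w (picard k r w) - Phi r w (picard_limit r w)).
    exact: (mx_integralB _ _ (@cphi k w) cW).
  apply: (le_trans (mx_integral_norm _ _ _)); first exact: (continuous_mxB (@cphi k w) cW).
  rewrite mulrC -continuous_RintegralZ//; apply: continuous_le_Rintegral.
  - by apply: continuous_mx1norm; exact: (continuous_mxB (@cphi k w) cW).
  - by move=> r; apply: cvgMr; exact: clam.
  - move=> r /andP[cr rs]; apply: le_trans (Phi_lip _ _ _ _) _.
    rewrite mulrC ler_wpM2r// -opprB -scaleN1r mx1normZ normrN1 mul1r.
    by apply: picard_limit_tail; exact: ltW.
apply/eqP; rewrite -subr_eq0; apply/eqP/mx1norm_eq0/eqP.
rewrite eq_le mx1norm_ge0 andbT.
have h1 : mx1norm (picard k.+1 s w - mx_integral c s (fun r => Phi r w (picard_limit r w)))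
   @[k --> \oo] --> mx1norm (picard_limit s w - mx_integral c s (fun r => Phi r w (picard_limit r w))).
  apply: cvg_mx1norm => i j; have := @cvg_picard s w i j.
  rewrite -(cvg_shiftn 1) /= => h.
  have -> : (fun k => (picard k.+1 s w - mx_integral c s (fun r => Phi r w (picard_limit r w))) i j) =
    (fun k => picard (k + 1) s w i j - mx_integral c s (fun r => Phi r w (picard_limit r w)) i j).
    by apply/funext => k; rewrite addn1 !mxE.
  rewrite [X in _ --> X]mxE [X in _ --> _ + X]mxE; apply: cvgB; [exact: h|exact: cvg_cst].
have h2 := @cvg_scaled_tail (picard_lip s w * picard_src s w) (picard_lip s w).
by apply: (ler_cvg_to h1 h2); near=> k; rewrite -mulrA; exact: main.
Unshelve. all: by end_near. Qed.

End Picard.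

(** * Factorisation of sigma and chain coordinates *)

Section LinearAlgebra.
Context {R : realType}.

(** From [sigma ^+ 2 = a sigma] the cube is [a ^+ 2 sigma], while the hypothesis makes it [a sigma];
    so [a = a ^+ 2] unless [sigma = 0], a case covered by [false]. *)
Lemma power_eigen_bool n (sigma : 'M[R]_n) :
  (exists a : R, forall k : nat, (2 <= k)%N -> sigma ^+ k = a *: sigma) ->
  exists a : bool, sigma *m sigma = a%:R *: sigma.
Proof.
move=> [a sa]; have s2 : sigma *m sigma = a *: sigma by rewrite -(sa 2%N)// expr2.
have s3 : a *: sigma = (a * a) *: sigma.
  by rewrite -(sa 3%N)// exprS expr2 [X in sigma * X]s2 -[LHS]/(sigma *m (a *: sigma)) -scalemxAr s2 scalerA.
have [->|s0] := eqVneq sigma 0; first by exists false; rewrite mul0mx scaler0.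
have : (a - a * a) *: sigma = 0 by rewrite scalerBl -s3 subrr.
move=> /eqP; rewrite scaler_eq0 (negPf s0) orbF -[X in X - _]mulr1 -mulrBr mulf_eq0.
move=> /orP[/eqP a0|]; first by exists false; rewrite s2 a0.
by rewrite subr_eq0 => /eqP a1; exists true; rewrite s2 -a1.
Qed.

(** [K] is a pseudo-inverse of [B] applied to [sigma]; then [K B K] is the same pseudo-inverse
    applied to [sigma ^+ 2]. *)
Lemma range_factor m n (B : 'M[R]_(n, m)) (sigma : 'M[R]_n) (a : R) :
  (forall y : 'cV[R]_n, exists v : 'cV[R]_m, sigma *m y = B *m v) ->
  sigma *m sigma = a *: sigma ->
  exists K : 'M[R]_(m, n), B *m K = sigma /\ K *m B *m K = a *: K.
Proof.
move=> sB s2.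
have le : (sigma^T <= B^T)%MS.
  apply/row_subP => i; have [v vE] := sB (delta_mx i 0).
  apply/submxP; exists v^T; rewrite -trmx_mul -vE -colE.
  by apply/rowP => j; rewrite !mxE.
have GE : B *m ((pinvmx B^T)^T *m sigma) = sigma.
  by have /(congr1 trmx) := mulmxKpV le; rewrite !trmx_mul !trmxK.
exists ((pinvmx B^T)^T *m sigma); split => //.
by rewrite -mulmxA GE -mulmxA s2 -scalemxAr.
Qed.

Section Chain.
Variables (m N : nat) (A : 'M[R]_N.+1) (B : 'M[R]_(N.+1, m)).
Local Notation n := N.+1.

Definition chain_coef (k : nat) : R := (-1) ^+ k.+1 * (char_poly A)`_(N - k).

(* Horner's scheme for the characteristic polynomial, up to signs: the last matrix is p(A) B. *)
Fixpoint chain_mx (k : nat) : 'M[R]_(n, m) := if k is k'.+1 then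
  chain_coef k' *: B - A *m chain_mx k' else B.

Lemma chain_mxE k : (k <= n)%N ->
  chain_mx k = (-1) ^+ k *: ((\sum_(j < k.+1) (char_poly A)`_(n - k + j) *: A ^+ j) *m B).
Proof.
elim: k => [_|k IH kn].
  rewrite big_ord1 subn0 addn0 expr0 scale1r expr0.
  have /monicP := char_poly_monic A; rewrite /lead_coef size_char_poly /= => ->.
  by rewrite scale1r mul1mx.
rewrite /= IH ?(ltnW kn)// [in RHS]big_ord_recl addn0 expr0 mulmxDl scalerDr.
congr (_ + _).
  by rewrite /chain_coef subSS -scalemxAl mul1mx scalerA.
rewrite -scalemxAr mulmxA exprS mulN1r scaleNr; congr (- (_ *: (_ *m _))).
rewrite mulmx_sumr; apply: eq_bigr => i _; rewrite -scalemxAr exprS; congr (_`__ *: _).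
by rewrite lift0 addnS -addSn subnSK.
Qed.

Lemma chain_mx_last : chain_mx n = 0.
Proof.
rewrite chain_mxE// subnn.
suff -> : \sum_(j < n.+1) (char_poly A)`_(0 + j) *: A ^+ j = 0 by rewrite mul0mx scaler0.
rewrite -[RHS](Cayley_Hamilton A).
have -> : horner_mx A (char_poly A) = horner_mx A (\poly_(j < n.+1) (char_poly A)`_j).
  by rewrite -[n.+1](size_char_poly A) coefK.
rewrite poly_def rmorph_sum /=; apply: eq_bigr => j _.
by rewrite linearZ /= rmorphXn /= horner_mx_X.
Qed.

(** Chain coordinates of a state, redundant in general. The construction moves [Z] and reads off the
    state, so no basis has to be selected among the Kalman columns. *)
Definition chain_lift (Z : 'M[R]_(m, n)) : 'cV[R]_n := \sum_(i < n) chain_mx i *m col i Z.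

Lemma chain_liftD Z Z' : chain_lift (Z + Z') = chain_lift Z + chain_lift Z'.
Proof.
rewrite -big_split; apply: eq_bigr => i _ /=; rewrite -mulmxDr; congr (_ *m _).
by apply/colP => j; rewrite !mxE.
Qed.

Lemma chain_liftZ a Z : chain_lift (a *: Z) = a *: chain_lift Z.
Proof.
rewrite scaler_sumr; apply: eq_bigr => i _ /=; rewrite scalemxAr; congr (_ *m _).
by apply/colP => j; rewrite !mxE.
Qed.

Definition shift_mx : 'M[R]_n := \matrix_(i, j) (i.+1 == j :> nat)%:R.

Lemma col_shift0 (Z : 'M[R]_(m, n)) : col ord0 (Z *m shift_mx) = 0.
Proof.
apply/colP => i; rewrite !mxE big1// => j _.
by rewrite !mxE /= mulr0.
Qed.

Lemma col_shiftS (Z : 'M[R]_(m, n)) (i j : 'I_n) : i.+1 = j :> nat ->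
  col j (Z *m shift_mx) = col i Z.
Proof.
move=> ij; apply/colP => k; rewrite !mxE (bigD1 i)//= !mxE ij eqxx mulr1.
rewrite big1 ?addr0// => l li; rewrite !mxE -ij.
have -> : (l.+1 == i.+1) = false by apply: negbTE; move: li; rewrite -val_eqE.
by rewrite mulr0.
Qed.

Definition chain_ctrl : 'cV[R]_n := \col_i chain_coef i.

(** The recursion for [chain_mx] telescopes, and the last term dies by Cayley-Hamilton. Hence, if
    each column of [Z] is the derivative of the next one, the lifted state obeys x' + A x = B u,
    where u is the derivative of column 0 plus [Z *m chain_ctrl]. *)
Lemma chain_lift_shift (Z : 'M[R]_(m, n)) :
  A *m chain_lift Z + chain_lift (Z *m shift_mx) = B *m (Z *m chain_ctrl).
Proof.
have AQ k : A *m chain_mx k = chain_coef k *: B - chain_mx k.+1.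
  by rewrite /= opprB addrC subrK.
have -> : B *m (Z *m chain_ctrl) = \sum_(i < n) chain_coef i *: (B *m col i Z).
  rewrite mulmxA; apply/colP => j; rewrite mxE summxE; apply: eq_bigr => i _.
  rewrite !mxE mulrC; congr (_ * _); apply: eq_bigr => k _; by rewrite !mxE.
rewrite {1}/chain_lift mulmx_sumr.
under eq_bigr do rewrite mulmxA AQ mulmxBl -scalemxAl.
rewrite sumrB -addrA -[RHS]addr0; congr (_ + _); apply/eqP; rewrite addrC subr_eq0; apply/eqP.
rewrite /chain_lift big_ord_recl col_shift0 mulmx0 add0r.
rewrite [RHS]big_ord_recr /= -/(chain_mx n) chain_mx_last mul0mx addr0.
by apply: eq_bigr => i _; rewrite (@col_shiftS _ (widen_ord (leqnSn N) i)).
Qed.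

Lemma chain_lift_B (v : 'cV[R]_m) : chain_lift (v *m delta_mx 0 ord0) = B *m v.
Proof.
rewrite /chain_lift big_ord_recl [X in _ + X]big1 ?addr0.
  rewrite -[X in chain_mx _ *m X]/(col ord0 (v *m delta_mx 0 ord0)) /=; congr (_ *m _).
  by apply/colP => i; rewrite !mxE big_ord1 !mxE !eqxx mulr1.
move=> i _; have -> : col (lift ord0 i) (v *m delta_mx 0 ord0) = 0; last by rewrite mulmx0.
by apply/colP => j; rewrite !mxE big_ord1 !mxE /= mulr0.
Qed.

(** By [chain_lift_shift] the image is stable under [A], and column 0 puts the range of [B] into it;
    so it contains all columns of the Kalman matrix. *)
Lemma chain_lift_surj (x : 'cV[R]_n) : \rank (kalman_matrix A B) = n ->
  exists Z, chain_lift Z = x.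
Proof.
move=> rk; have /row_freeP[C CE] : row_free (kalman_matrix A B) by rewrite /row_free rk.
have AS Z : exists Z', chain_lift Z' = A *m chain_lift Z.
  exists ((Z *m chain_ctrl) *m delta_mx 0 ord0 - Z *m shift_mx).
  rewrite -scaleN1r chain_liftD chain_liftZ scaleN1r chain_lift_B.
  by rewrite -chain_lift_shift addrK.
have PS k v : exists Z, chain_lift Z = A ^+ k *m B *m v.
  elim: k => [|k [Z ZE]]; first by exists (v *m delta_mx 0 ord0); rewrite chain_lift_B mul1mx.
  by have [Z' Z'E] := AS Z; exists Z'; rewrite Z'E ZE exprS !mulmxA.
have SS (I : Type) (r : seq I) (v : I -> 'cV[R]_n) : (forall i, exists Z, chain_lift Z = v i) ->
    exists Z, chain_lift Z = \sum_(i <- r) v i.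
  move=> hv; elim: r => [|i r [Z ZE]].
    by exists 0; rewrite big_nil; have := chain_liftZ 0 0; rewrite !scale0r.
  by have [Z' Z'E] := hv i; exists (Z' + Z); rewrite chain_liftD big_cons ZE Z'E.
have -> : x = \sum_(k < n) A ^+ k *m B *m submxcol (C *m x) k.
  by rewrite -mul_mxrow_mxcol submxcolK mulmxA CE mul1mx.
by apply: SS => k; exact: PS.
Qed.

End Chain.
End LinearAlgebra.

(** * Steering polynomials by Hermite interpolation *)

Section Hermite.
Context {R : realType}.
Local Notation mu := (@lebesgue_measure R).
Implicit Types p : {poly R}.

Lemma derivn_root_power n p i : (i <= n)%N ->
  exists q, (('X - 1%:P) ^+ n * p)^`(i) = ('X - 1%:P) ^+ (n - i) * q.
Proof.
elim: i => [_|i IH in_]; first by exists p; rewrite subn0.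
have [q qE] := IH (ltnW in_); rewrite derivnS qE -(subnSK in_).
exists (q *+ (n - i.+1).+1 + ('X - 1%:P) * q^`()).
rewrite derivM deriv_exp derivXsubC mul1r /= mulrDr; congr (_ + _).
  by rewrite mulrnAr mulrnAl.
by rewrite mulrA exprSr.
Qed.

(** A Bezout relation between the [n]-th powers of [X] and [X - 1] gives [chi] congruent to 1 modulo
    the first and to 0 modulo the second. Then [X ^ j chi / j!] has the prescribed derivatives at
    both ends. *)
Lemma steering_poly n (j : nat) : exists p : {poly R},
  (forall i, (i < n)%N -> p^`(i).[0] = (i == j)%:R) /\
  (forall i, (i < n)%N -> p^`(i).[1] = 0).
Proof.
have /Bezout_coprimepP[[u v] /= ] : coprimep ('X ^+ n : {poly R}) (('X - 1%:P) ^+ n).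
  apply: coprimep_expl; apply: coprimep_expr.
  by rewrite -[X in coprimep X]subr0 -polyC0; apply: coprimep_XsubC2; rewrite subr0 oner_eq0.
move=> /eqp_size/esym; rewrite size_poly1 => /esym/eqP/size_poly1P[c c0 uv].
pose chi : {poly R} := c^-1 *: (v * ('X - 1%:P) ^+ n).
have chiE : chi = 1 - c^-1 *: (u * 'X^n).
  apply/eqP; rewrite eq_sym subr_eq /chi -scalerDr addrC uv -mul_polyC -polyCM.
  by rewrite mulVf.
exists ((j`!%:R)^-1 *: ('X^j * chi)); split=> i ilt.
  rewrite horner_coef0 coef_derivn addn0 coefZ chiE mulrBr mulr1 coefB coefXn.
  rewrite -scalerAr coefZ mulrA coefMXn ilt mulr0 subr0.
  have [->|ij] := eqVneq i j; last by rewrite mulr0 mul0rn.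
  by rewrite mulr1 ffactnn -[LHS]mulr_natr mulVf// pnatr_eq0 -lt0n fact_gt0.
have -> : (j`!%:R)^-1 *: ('X^j * chi) =
    ('X - 1%:P) ^+ n * ((j`!%:R)^-1 *: ('X^j * (c^-1 *: v))).
  by rewrite /chi -!mul_polyC; ring.
have [q ->] := derivn_root_power ((j`!%:R)^-1 *: ('X^j * (c^-1 *: v))) (ltnW ilt).
rewrite hornerM horner_exp hornerXsubC subrr expr0n.
by rewrite subn_eq0 leqNgt ilt mul0r.
Qed.

Lemma integral_poly p c s del : 0 < del -> c <= s ->
  \int[mu]_(v in `]c, s[) (del^-1 * p^`().[(v - c) / del]) = p.[(s - c) / del] - p.[0].
Proof.
move=> d0 cs; have cl : continuous (fun v : R => (v - c) / del).
  by move=> v; apply: cvgM; [apply: cvgB; [exact: cvg_id|exact: cvg_cst]|exact: cvg_cst].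
have cp (q : {poly R}) : continuous (fun v => q.[(v - c) / del]).
  by move=> v; apply: (@continuous_comp _ _ _ (fun v => (v - c) / del) (horner q));
    [exact: cl|exact: continuous_horner].
have dF (v : R) : is_derive v (1 : R) (fun v : R => p.[(v - c) / del]) (del^-1 * p^`().[(v - c) / del]).
  have dl : is_derive v 1 (fun v : R => (v - c) / del) del^-1.
    have -> : (fun v : R => (v - c) / del) = del^-1 \*: (fun v => v - c).
      by apply/funext => y; rewrite mulrC.
    by apply: is_derive_eq; rewrite subr0 /GRing.scale /= mulr1.
  by rewrite mulrC; exact: is_derive1_comp.
have cF : continuous (fun v => del^-1 * p^`().[(v - c) / del]).
  by move=> v; apply: cvgM; [exact: cvg_cst|exact: cp].
rewrite (integral_derive cs cF (cp p) (fun v _ => dF v)).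
by rewrite subrr mul0r.
Qed.

End Hermite.

(** * Curves with a continuous rate *)

Section HasRate.
Context {R : realType}.
Local Notation mu := (@lebesgue_measure R).

(** A derivative in integrated form. It says nothing of [f] before [c], where the processes of a
    stage have no meaning, and it is stable under linear maps. *)
Definition has_rate {p q} (c : R) (f f' : R -> 'M[R]_(p, q)) : Prop :=
  (forall i j, continuous (fun s => f' s i j)) /\
  (forall s, c <= s -> f s = f c + mx_integral c s f').

Lemma has_rateD p q c (f f' g g' : R -> 'M[R]_(p, q)) : has_rate c f f' ->
  has_rate c g g' -> has_rate c (fun s => f s + g s) (fun s => f' s + g' s).
Proof.
move=> [cf hf] [cg hg]; split=> [i j|s cs].
  have -> : (fun s => (f' s + g' s) i j) = (fun s => f' s i j + g' s i j).
    by apply/funext => s; rewrite mxE.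
  by move=> s; apply: cvgD; [exact: cf|exact: cg].
rewrite hf// hg// addrACA; congr (_ + _); apply/matrixP => i j; rewrite !mxE -RintegralD//.
- by apply: eq_Rintegral => r _; rewrite mxE.
- exact: continuous_integrable (cf i j).
- exact: continuous_integrable (cg i j).
Qed.

Lemma has_rate_mul p q r t c (M : 'M[R]_(r, p)) (M' : 'M[R]_(q, t)) (f f' : R -> 'M[R]_(p, q)) :
  has_rate c f f' -> has_rate c (fun s => M *m f s *m M') (fun s => M *m f' s *m M').
Proof.
move=> [cf hf].
have E (g : 'M[R]_(p, q)) i j : (M *m g *m M') i j = \sum_k \sum_l (M i l * M' k j) * g l k.
  rewrite mxE; apply: eq_bigr => k _; rewrite mxE mulr_suml; apply: eq_bigr => l _.
  by rewrite mulrAC.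
have cE i j k l : continuous (fun s => (M i l * M' k j) * f' s l k).
  by move=> s; apply: cvgM; [exact: cvg_cst|exact: cf].
split=> [i j|s cs].
  have -> : (fun s => (M *m f' s *m M') i j) =
      (fun s => \sum_k \sum_l (M i l * M' k j) * f' s l k).
    by apply/funext => s; exact: E.
  by apply: continuous_sum => k; apply: continuous_sum.
rewrite hf// mulmxDr mulmxDl; congr (_ + _); apply/matrixP => i j; rewrite E mxE.
under [RHS]eq_Rintegral do rewrite E.
rewrite Rintegral_sum//; last first.
  by move=> k; apply: integrable_sum_EFin => // l; exact: continuous_integrable.
apply: eq_bigr => k _; rewrite Rintegral_sum//; last first.
  by move=> l; exact: continuous_integrable.
by apply: eq_bigr => l _; rewrite mxE continuous_RintegralZ.
Qed.

Lemma has_rate_eq p q c (f f' g g' : R -> 'M[R]_(p, q)) : (forall s, f s = g s) ->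
  (forall s, f' s = g' s) -> has_rate c f f' -> has_rate c g g'.
Proof. by move=> fg fg'; rewrite (funext fg) (funext fg'). Qed.

Lemma has_rate_mull p q r c (M : 'M[R]_(r, p)) (f f' : R -> 'M[R]_(p, q)) :
  has_rate c f f' -> has_rate c (fun s => M *m f s) (fun s => M *m f' s).
Proof.
by move=> /(has_rate_mul M 1%:M); apply: has_rate_eq => s; rewrite mulmx1.
Qed.

Lemma has_rate_mulr p q r c (M : 'M[R]_(q, r)) (f f' : R -> 'M[R]_(p, q)) :
  has_rate c f f' -> has_rate c (fun s => f s *m M) (fun s => f' s *m M).
Proof.
by move=> /(has_rate_mul 1%:M M); apply: has_rate_eq => s; rewrite mul1mx.
Qed.

Lemma has_rate_sum p q c (I : Type) (r : seq I) (f f' : I -> R -> 'M[R]_(p, q)) :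
  (forall i, has_rate c (f i) (f' i)) ->
  has_rate c (fun s => \sum_(i <- r) f i s) (fun s => \sum_(i <- r) f' i s).
Proof.
move=> hf; elim: r => [|i r IH].
  apply: (@has_rate_eq _ _ _ (fun=> 0) (fun=> 0)) => [s|s|]; rewrite ?big_nil//.
  split=> [i j s|s cs]; first exact: cvg_cst.
  rewrite add0r; apply/matrixP => i j; rewrite [RHS]mxE.
  by rewrite Rintegral_cst// mxE mul0r.
apply: (@has_rate_eq _ _ _ (fun s => f i s + \sum_(j <- r) f j s)
  (fun s => f' i s + \sum_(j <- r) f' j s)) => [s|s|]; rewrite ?big_cons//.
exact: has_rateD.
Qed.

Lemma has_rate_lift m N A B c (f f' : R -> 'M[R]_(m, N.+1)) : has_rate c f f' ->
  has_rate c (fun s => chain_lift A B (f s)) (fun s => chain_lift A B (f' s)).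
Proof.
move=> hf; apply: has_rate_sum => i.
apply: (has_rate_eq _ _ (has_rate_mul (chain_mx A B i) (delta_mx i 0) hf)) => s;
  by rewrite -mulmxA -colE.
Qed.

End HasRate.

(** * Algebra of scalings and shifts of the chain coordinates *)

Section ShiftAlgebra.
Context {R : realType}.
Variable N : nat.
Local Notation n := N.+2.
Local Notation S := (@shift_mx R N.+1).

(** Weights of the chain coordinates when a stage of length [e] is rescaled to unit length: each
    integration along the chain contributes a factor [e]. *)
Definition scale_mx (e : R) : 'M[R]_n := diag_mx (\row_i e ^+ i).
Definition row0 : 'rV[R]_n := delta_mx 0 ord0.
Definition row1 : 'rV[R]_n := delta_mx 0 (lift ord0 ord0).
Definition col0 : 'cV[R]_n := delta_mx ord0 0.
Definition kill0 : 'M[R]_n := 1%:M - col0 *m row0.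

Lemma scale_mxM e f : scale_mx e *m scale_mx f = scale_mx (e * f).
Proof.
rewrite /scale_mx mulmx_diag; congr diag_mx; apply/rowP => i; rewrite !mxE.
by rewrite exprMn.
Qed.

Lemma shift_scale e : S *m scale_mx e = e *: (scale_mx e *m S).
Proof.
apply/matrixP => i j; rewrite mul_mx_diag mxE mul_diag_mx !mxE.
case: eqP => [ij|_]; last by rewrite !(mul0r, mulr0).
by rewrite mul1r mulr1 -ij exprS.
Qed.

Lemma row0_scale e : row0 *m scale_mx e = row0.
Proof.
apply/rowP => j; rewrite mul_mx_diag !mxE eqxx /=.
by case: eqP => [->|]; rewrite ?mul0r// mul1r.
Qed.

Lemma scale_col0 e : scale_mx e *m col0 = col0.
Proof.
apply/colP => j; rewrite mul_diag_mx !mxE.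
by case: eqP => [->|]; rewrite ?mulr0// mul1r.
Qed.

Lemma row0_shift : row0 *m S = row1.
Proof.
by apply/rowP => j; rewrite -rowE !mxE -val_eqE /= eq_sym.
Qed.

Lemma row0_col0 : row0 *m col0 = 1%:M.
Proof. by rewrite mul_delta_mx; apply/matrixP => i j; rewrite !ord1 !mxE. Qed.

Lemma row0_kill : row0 *m kill0 = 0.
Proof. by rewrite mulmxBr mulmx1 mulmxA row0_col0 mul1mx subrr. Qed.

Lemma row1_kill : row1 *m kill0 = row1.
Proof.
rewrite mulmxBr mulmx1 mulmxA.
have -> : row1 *m col0 = 0; last by rewrite mul0mx subr0.
by rewrite mul_delta_mx_0.
Qed.

Lemma shift_kill : S *m kill0 = S.
Proof.
rewrite mulmxBr mulmx1 mulmxA; have -> : S *m col0 = 0; last by rewrite mul0mx subr0.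
by rewrite -colE; apply/colP => j; rewrite !mxE.
Qed.

Lemma scale_kill e : scale_mx e *m kill0 = kill0 *m scale_mx e.
Proof.
by rewrite mulmxBr mulmxBl mulmx1 mul1mx mulmxA scale_col0 -mulmxA row0_scale.
Qed.

Lemma kill0E m (Z : 'M[R]_(m, n)) : Z = (Z *m col0) *m row0 + Z *m kill0.
Proof. by rewrite mulmxBr mulmx1 -mulmxA addrC subrK. Qed.

End ShiftAlgebra.
Arguments scale_mx {R N}.
Arguments row0 {R N}.
Arguments row1 {R N}.
Arguments col0 {R N}.
Arguments kill0 {R N}.

(** * Steering matrices and uniform constants *)

Section Stage.
Context {R : realType} {d : measure_display} {Omega : measurableType d}.
Variables (P : probability Omega R) (beta b : R -> {RV P >-> R}).
Hypotheses (hbeta : brownian_motion beta) (hb : regular_modification beta b).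
Local Notation F := (augmented_filtration P (fun r => beta r)).
Local Notation mu := (@lebesgue_measure R).
Local Notation regular := (regular_process (P := P) beta).
Local Notation regular_mx := (regular_matrix (P := P) beta).
Variables (a : bool) (m N : nat).
Local Notation n := N.+2.
Variables (A : 'M[R]_n) (B : 'M[R]_(n, m)) (K : 'M[R]_(m, n)).
Hypothesis KBK : K *m B *m K = a%:R *: K.
Local Notation sigma := (B *m K).
Local Notation S := (@shift_mx R N.+1).
Local Notation clift Z := (chain_lift A B Z).
Variable p : 'I_n -> {poly R}.
Hypotheses (p0 : forall l i, (i < n)%N -> (p l)^`(i).[0] = (i == N.+1 - l)%N%:R)
  (p1 : forall l i, (i < n)%N -> (p l)^`(i).[1] = 0).

(** Each column is the derivative of the next one, so every row is a trajectory of the chain of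
    integrators; row [l] goes from the [l]-th basis vector at time 0 to 0 at time 1. [steer'] is the
    derivative of column 0, the input of the chain. *)
Definition steer (t : R) : 'M[R]_n := \matrix_(l, i) (p l)^`(N.+1 - i).[t].
Definition steer' (t : R) : 'cV[R]_n := \col_l (p l)^`(n).[t].

Lemma steer0 : steer 0 = 1%:M.
Proof.
apply/matrixP => l i; rewrite !mxE p0 ?ltnS ?leq_subr//; congr (_%:R).
have li := ltn_ord l; have ii := ltn_ord i; rewrite -val_eqE /=.
by rewrite -(eqn_add2r (l + i)) addnCA subnK// [(l + i)%N]addnC addnCA subnK//
  ![(_ + N.+1)%N]addnC eqn_add2l.
Qed.

Lemma steer1 : steer 1 = 0.
Proof. by apply/matrixP => l i; rewrite !mxE p1 ?ltnS ?leq_subr. Qed.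

Variables (c dl : R) (U : Omega -> 'M[R]_(m, n)).
Hypotheses (c0 : 0 <= c) (dl0 : 0 < dl).
Hypothesis aU : forall i j, wrt_measurable (F c) (fun w => U w i j).

Let tau s : R := (s - c) / dl.
Let ctau : continuous tau.
Proof.
by move=> s; apply: cvgM; [apply: cvgB; [exact: cvg_id|exact: cvg_cst]|exact: cvg_cst].
Qed.

Let ctaup (q : {poly R}) : continuous (fun v => q.[tau v]).
Proof.
move=> v; apply: (@continuous_comp _ _ _ tau (horner q)); first exact: ctau.
exact: continuous_horner.
Qed.

Lemma steer_rate : has_rate c (fun s => steer (tau s) *m kill0)
  (fun s => dl^-1 *: (steer (tau s) *m S)).
Proof.
have E s l j : (dl^-1 *: (steer (tau s) *m S)) l j =
    if j == ord0 then 0 else dl^-1 * ((p l)^`(N.+1 - j))^`().[tau s].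
  case: (unliftP ord0 j) => [i ->|->]; rewrite ?eqxx.
    rewrite eq_sym (negPf (neq_lift _ _)) mxE; congr (_ * _).
    have /(congr1 (fun v : 'cV[R]_n => v l 0)) :=
      @col_shiftS R n N.+1 (steer (tau s)) (widen_ord (leqnSn _) i) (lift ord0 i) erefl.
    rewrite mxE => ->; rewrite !mxE -derivnS; congr (_^`(_).[_]).
    by rewrite lift0 /= subSS subSn// -ltnS.
  have /(congr1 (fun v : 'cV[R]_n => v l 0)) := col_shift0 (steer (tau s)).
  by rewrite mxE [X in _ = X -> _]mxE [X in _ -> X = _]mxE => ->; rewrite mulr0.
have Ek s l j : (steer (tau s) *m kill0) l j =
    if j == ord0 then 0 else (p l)^`(N.+1 - j).[tau s].
  rewrite mulmxBr mulmx1 mxE [X in _ + X]mxE mulmxA -colE.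
  rewrite [X in _ - X]mxE big_ord1 !mxE eqxx /=.
  by case: eqP => [->|_]; rewrite ?mulr1 ?subrr// mulr0 subr0.
split=> [l j|s cs].
  have -> : (fun s => (dl^-1 *: (steer (tau s) *m S)) l j) = (fun s =>
      if j == ord0 then 0 else dl^-1 * ((p l)^`(N.+1 - j))^`().[tau s]).
    by apply/funext => s; exact: E.
  by case: eqP => _ s; [exact: cvg_cst|apply: cvgM; [exact: cvg_cst|exact: ctaup]].
apply/matrixP => l j; rewrite Ek mxE Ek mxE.
under eq_Rintegral do rewrite E.
case: eqP => _; first by rewrite Rintegral_cst// mul0r addr0.
by rewrite integral_poly// /tau subrr mul0r addrC subrK.
Qed.

Lemma steer_col0_rate : has_rate c (fun s => steer (tau s) *m col0)
  (fun s => dl^-1 *: steer' (tau s)).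
Proof.
have E s l j : (dl^-1 *: steer' (tau s)) l j = dl^-1 * ((p l)^`(N.+1))^`().[tau s].
  by rewrite !mxE.
have Ek s l j : (steer (tau s) *m col0) l j = (p l)^`(N.+1).[tau s].
  by rewrite -colE !mxE subn0.
split=> [l j|s cs].
  have -> : (fun s => (dl^-1 *: steer' (tau s)) l j) =
      (fun s => dl^-1 * ((p l)^`(N.+1))^`().[tau s]).
    by apply/funext => s; exact: E.
  by move=> s; apply: cvgM; [exact: cvg_cst|exact: ctaup].
apply/matrixP => l j; rewrite Ek mxE Ek mxE.
under eq_Rintegral do rewrite E.
by rewrite integral_poly// /tau subrr mul0r addrC subrK.
Qed.

End Stage.

Section Constants.
Context {R : realType}.

Lemma chain_lift_norm m N A B (Z : 'M[R]_(m, N.+1)) :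
  mx1norm (chain_lift A B Z) <= (\sum_(i < N.+1) mx1norm (chain_mx A B i)) * mx1norm Z.
Proof.
apply: (le_trans (mx1norm_sum _ _ _)); rewrite mulr_suml; apply: ler_sum => i _.
apply: (le_trans (mx1normM _ _)); rewrite ler_wpM2l ?mx1norm_ge0//.
rewrite /mx1norm; apply: ler_sum => j _; rewrite big_ord1 mxE (bigD1 i)//= lerDl.
exact: sumr_ge0.
Qed.

Lemma scale_mx_norm N (T e : R) : 0 <= e <= T ->
  mx1norm (@scale_mx R N e) <= \sum_(i < N.+2) T ^+ i.
Proof.
move=> /andP[e0 eT]; apply: ler_sum => i _; rewrite (bigD1 i)//= [X in _ + X]big1.
  rewrite !mxE eqxx mulr1n addr0 ger0_norm ?exprn_ge0//.
  by rewrite lerXn2r// nnegrE// (le_trans e0).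
by move=> j ji; rewrite !mxE eq_sym (negPf ji) mulr0n normr0.
Qed.

Lemma kill0_shift N : (@kill0 R N) = (@shift_mx R N.+1)^T *m @shift_mx R N.+1.
Proof.
apply/matrixP => i j; rewrite /kill0 mul_delta_mx !mxE.
case: (unliftP ord0 j) => [k ->|->].
  have jk : (lift ord0 k == ord0 :> 'I_N.+2) = false by rewrite eq_sym (negPf (neq_lift _ _)).
  rewrite jk andbF subr0 (bigD1 (widen_ord (leqnSn _) k))//= !mxE lift0 eqxx mulr1.
  rewrite big1 ?addr0 => [|l lk]; last first.
    rewrite !mxE lift0 eqSS; have -> : (l == k :> nat) = false.
      by apply: negbTE; move: lk; rewrite -val_eqE.
    by rewrite mulr0.
  by rewrite -val_eqE /= /bump leq0n add1n eq_sym.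
rewrite big1 => [|l _]; last by rewrite !mxE mulr0.
by rewrite andbT subrr.
Qed.

(** [kill0] factors through the shift ([kill0_shift]), and moving the scaling across a shift
    releases a factor [e]: all columns but column 0 carry a positive power of [e]. *)
Lemma scale_kill_norm N (T e : R) : 0 <= e <= T ->
  mx1norm (@scale_mx R N e *m kill0) <= e * (mx1norm (@shift_mx R N.+1)^T *
    ((\sum_(i < N.+2) T ^+ i) * mx1norm (@shift_mx R N.+1))).
Proof.
move=> /[dup] eT /andP[e0 _]; rewrite scale_kill kill0_shift -mulmxA shift_scale -scalemxAr.
rewrite mx1normZ ger0_norm// ler_wpM2l//; apply: (le_trans (mx1normM _ _)).
rewrite ler_wpM2l ?mx1norm_ge0//; apply: (le_trans (mx1normM _ _)).
by rewrite ler_wpM2r ?mx1norm_ge0// scale_mx_norm.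
Qed.

Definition poly_bound (q : {poly R}) : R := \sum_(i < size q) `|q`_i|.

Lemma poly_bound_le q t : 0 <= t <= 1 -> `|q.[t]| <= poly_bound q.
Proof.
move=> /andP[t0 t1]; rewrite horner_coef; apply: (le_trans (ler_norm_sum _ _ _)).
apply: ler_sum => i _; rewrite normrM ler_piMr// normrX exprn_ile1//.
by rewrite ger0_norm.
Qed.

End Constants.

(** * Pointwise algebra and estimates of a stage *)

Section StagePoint.
Context {R : realType}.
Variables (a : bool) (m N : nat).
Local Notation n := N.+2.
Variables (A : 'M[R]_n) (B : 'M[R]_(n, m)) (K : 'M[R]_(m, n)) (p : 'I_n -> {poly R}).
Local Notation sigma := (B *m K).
Local Notation S := (@shift_mx R N.+1).
Local Notation clift Z := (chain_lift A B Z).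

(** The data of a stage at one instant: length, initial coordinates, rescaled time, gain, [kap] and
    error. With these frozen, the identities and estimates of a stage are deterministic statements
    about matrices. *)
Record stage_point := StagePoint {
  sp_dl : R ; sp_U : 'M[R]_(m, n) ; sp_t : R ; sp_g : R ; sp_k : R ; sp_W : 'M[R]_(m, n) }.
Implicit Types x : stage_point.

Definition st_zin x := clift (sp_U x *m (scale_mx (sp_dl x) *m kill0)).
(** The extra column 0 compensates the term [- a K zeta] of [st_y], so that [Y] starts at the lift
    of the scaled [U] ([stage_Y_start]). *)
Definition st_rho x := sp_U x + (a%:R *: (K *m st_zin x)) *m row0.
Definition st_R x := st_rho x *m steer p (sp_t x).
Definition st_V x := st_R x + sp_W x.
Definition st_zeta x := clift (st_V x *m (scale_mx (sp_dl x) *m kill0)).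
(** The correction of column 0 imposed by the noise: what [1 + g sigma] adds to the steered
    trajectory, expressed as an input through [K]. *)
Definition st_eta x := sp_g x *: (K *m B *m (st_R x *m col0)) + sp_k x *: (K *m st_zeta x).
Definition st_Z x := (st_V x + st_eta x *m row0) *m scale_mx (sp_dl x).
(** Subtracting [a K zeta] is the decisive choice: once [1 + g sigma] is applied, the coefficient of
    [K zeta] becomes [kap], so the linear equation for the error never has a log-normal rate. *)
Definition st_y x := st_R x *m col0 - a%:R *: (K *m st_zeta x).
Definition st_Y x := B *m st_y x + st_zeta x.
Definition st_dy x := (sp_dl x)^-1 *: (st_rho x *m steer' p (sp_t x))
  - a%:R *: (K *m clift (st_Z x *m S)).
Definition st_psi x := B *m st_dy x + clift (st_Z x *m S).
Definition st_u x := st_dy x + sp_g x *: (K *m st_psi x) + st_Z x *m chain_ctrl A.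
(** The rate of the error [W]: each column drives the next, and the correction [eta] of column 0
    enters column 1. *)
Definition st_Phi x := (sp_dl x)^-1 *: (sp_W x *m S + st_eta x *m row1).
(** The coordinates left once the steering part has vanished; [scale_mx 2] renormalises them for the
    next stage, which is half as long. *)
Definition st_out x := (sp_W x + st_eta x *m row0) *m scale_mx 2.

Hypothesis KBK : K *m B *m K = a%:R *: K.

Lemma st_Z_kill x : st_Z x *m kill0 = st_V x *m (scale_mx (sp_dl x) *m kill0).
Proof.
rewrite /st_Z -mulmxA mulmxDl -[st_eta x *m row0 *m _]mulmxA [row0 *m _]mulmxA.
by rewrite row0_scale row0_kill mulmx0 addr0.
Qed.

Lemma st_shift_scale x : sp_dl x != 0 ->
  (sp_dl x)^-1 *: ((st_V x *m S + st_eta x *m row1) *m scale_mx (sp_dl x)) = st_Z x *m S.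
Proof.
move=> d0; rewrite -row0_shift mulmxA -mulmxDl -mulmxA shift_scale -scalemxAr scalerA.
by rewrite mulVf// scale1r mulmxA.
Qed.

(** Comparison of coefficients in the range of [B]: [K B K = a K] and [a ^+ 2 = a] collect the terms
    in [K zeta] with exactly the coefficient [sp_k]. *)
Lemma st_liftE x : sp_k x = - a%:R + (1 - a%:R) * sp_g x -> sp_W x *m col0 = 0 ->
  clift (st_Z x) = st_Y x + sp_g x *: (sigma *m st_Y x).
Proof.
move=> kE W0.
have e1 : clift (st_Z x) = B *m (st_R x *m col0 + st_eta x) + st_zeta x.
  rewrite {1}(kill0E (st_Z x)) chain_liftD chain_lift_B st_Z_kill; congr (B *m _ + _).
  rewrite /st_Z -mulmxA scale_col0 mulmxDl -mulmxA row0_col0 mulmx1; congr (_ + _).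
  by rewrite /st_V mulmxDl W0 addr0.
rewrite {}e1 /st_Y [RHS]addrAC; congr (_ + _).
rewrite -[B *m K *m _]mulmxA scalemxAr -mulmxDr; congr (B *m _).
rewrite /st_y /st_eta !mulmxDr !mulmxN -!scalemxAr !mulmxA KBK -!scalemxAl !scalerA.
rewrite kE; set X := K *m st_zeta x; set Y := K *m B *m st_R x *m col0.
set Y0 := st_R x *m col0; apply/matrixP => i j; rewrite !mxE.
by case: a => /=; ring.
Qed.

(** By [chain_lift_shift] the drift and the input [Z *m chain_ctrl] combine into the lift of the
    shifted coordinates. The term [g sigma psi] lies in the range of [B], and the control produces
    it through [K]. *)
Lemma st_driftE x :
  st_psi x + sp_g x *: (sigma *m st_psi x) = - (A *m clift (st_Z x)) + B *m st_u x.
Proof.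
have -> : B *m st_u x = B *m st_dy x + sp_g x *: (B *m (K *m st_psi x)) +
    B *m (st_Z x *m chain_ctrl A).
  by rewrite {1}/st_u mulmxDr [B *m (_ + _)]mulmxDr -scalemxAr.
rewrite -chain_lift_shift -[B *m K *m _]mulmxA.
have -> : st_psi x = B *m st_dy x + clift (st_Z x *m S) by [].
move: (B *m st_dy x) (A *m clift (st_Z x)) (clift (st_Z x *m S)) (B *m (K *m _)) => v1 v2 v3 v4.
apply/matrixP => i j; rewrite !mxE; ring.
Qed.

Variable T : R.
Hypothesis T0 : 0 <= T.

Definition st_ok x := 0 < sp_dl x <= T /\ 0 <= sp_t x <= 1 /\ `|sp_k x| <= 1 + `|sp_g x|.

(** A calculus of estimates whose constants are uniform over the admissible points, hence
    independent of the stage length and of the path. *)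
Definition dom p q (f : stage_point -> 'M[R]_(p, q)) (g : stage_point -> R) :=
  exists2 C, 0 <= C & forall x, st_ok x -> mx1norm (f x) <= C * g x.

Lemma domD q r (f f' : stage_point -> 'M[R]_(q, r)) g : dom f g -> dom f' g ->
  dom (fun x => f x + f' x) g.
Proof.
move=> [C C0 hC] [D D0 hD]; exists (C + D); first exact: addr_ge0.
move=> x ok; apply: (le_trans (mx1normD _ _)).
by rewrite mulrDl; apply: lerD; [exact: hC|exact: hD].
Qed.

Lemma domM q r t (f : stage_point -> 'M[R]_(q, r)) (h : stage_point -> 'M[R]_(r, t)) g k :
  dom f g -> dom h k -> dom (fun x => f x *m h x) (fun x => g x * k x).
Proof.
move=> [C C0 hC] [D D0 hD]; exists (C * D); first exact: mulr_ge0.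
move=> x ok; apply: (le_trans (mx1normM _ _)).
by rewrite mulrACA; apply: ler_pM; rewrite ?mx1norm_ge0//; [exact: hC|exact: hD].
Qed.

Lemma dom_cst q r (M : 'M[R]_(q, r)) : dom (fun=> M) (fun=> 1).
Proof. by exists (mx1norm M); [exact: mx1norm_ge0|move=> x _; rewrite mulr1]. Qed.

Lemma dom_le q r (f : stage_point -> 'M[R]_(q, r)) g g' C : dom f g -> 0 <= C ->
  (forall x, st_ok x -> g x <= C * g' x) -> dom f g'.
Proof.
move=> [D D0 hD] C0 gg; exists (D * C); first exact: mulr_ge0.
move=> x ok; apply: (le_trans (hD x ok)).
by rewrite -mulrA ler_wpM2l// gg.
Qed.

Lemma domZ q r (s : stage_point -> R) (f : stage_point -> 'M[R]_(q, r)) g k :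
  (forall x, st_ok x -> `|s x| <= k x) -> dom f g -> dom (fun x => s x *: f x) (fun x => k x * g x).
Proof.
move=> sk [C C0 hC]; exists C => // x ok; rewrite mx1normZ mulrCA.
by apply: ler_pM; rewrite ?mx1norm_ge0//; [exact: sk|exact: hC].
Qed.

Lemma dom_lift (f : stage_point -> 'M[R]_(m, n)) g : dom f g -> dom (fun x => clift (f x)) g.
Proof.
move=> [C C0 hC]; exists ((\sum_(i < n) mx1norm (chain_mx A B i)) * C).
  by rewrite mulr_ge0// sumr_ge0// => i _; exact: mx1norm_ge0.
move=> x ok; apply: (le_trans (chain_lift_norm _ _ _)); rewrite -mulrA ler_wpM2l ?hC//.
by apply: sumr_ge0 => i _; exact: mx1norm_ge0.
Qed.

Lemma dom_eq q r (f : stage_point -> 'M[R]_(q, r)) g g' : dom f g -> g =1 g' -> dom f g'.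
Proof. by move=> h gg; rewrite -(funext gg). Qed.

Lemma dom_mull q r t (M : 'M[R]_(q, r)) (f : stage_point -> 'M[R]_(r, t)) g :
  dom f g -> dom (fun x => M *m f x) g.
Proof. by move=> h; apply: dom_eq (domM (dom_cst M) h) _ => x; rewrite mul1r. Qed.

Lemma dom_mulr q r t (M : 'M[R]_(r, t)) (f : stage_point -> 'M[R]_(q, r)) g :
  dom f g -> dom (fun x => f x *m M) g.
Proof. by move=> h; apply: dom_eq (domM h (dom_cst M)) _ => x; rewrite mulr1. Qed.

Lemma domZc q r (s : R) (f : stage_point -> 'M[R]_(q, r)) g : dom f g -> dom (fun x => s *: f x) g.
Proof.
move=> h; have := domZ (s := fun=> s) (fun x _ => lexx `|s|) h => h'.
by apply: dom_le h' (normr_ge0 s) _.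
Qed.

Lemma domN q r (f : stage_point -> 'M[R]_(q, r)) g : dom f g -> dom (fun x => - f x) g.
Proof. by move=> h; rewrite -[fun x => _]/(fun x => - f x); have := domZc (-1) h;
  under eq_fun do rewrite scaleN1r. Qed.

Lemma dom_scale : dom (fun x => @scale_mx R N (sp_dl x)) (fun=> 1).
Proof.
exists (\sum_(i < n) T ^+ i); first by rewrite sumr_ge0// => i _; exact: exprn_ge0.
by move=> x [/andP[d0 dT] _]; rewrite mulr1; apply: scale_mx_norm; rewrite ltW.
Qed.

Lemma dom_scale_kill : dom (fun x => @scale_mx R N (sp_dl x) *m kill0) sp_dl.
Proof.
exists (mx1norm S^T * ((\sum_(i < n) T ^+ i) * mx1norm S)).
  rewrite !mulr_ge0 ?mx1norm_ge0// sumr_ge0// => i _; exact: exprn_ge0.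
by move=> x [/andP[d0 dT] _]; rewrite mulrC; apply: scale_kill_norm; rewrite ltW.
Qed.

Lemma dom_steer : dom (fun x => steer p (sp_t x)) (fun=> 1).
Proof.
exists (\sum_l \sum_(i < n) poly_bound (p l)^`(N.+1 - i)).
  by do 2 (apply: sumr_ge0 => ? _); exact: sumr_ge0.
move=> x [_ [t01 _]]; rewrite mulr1; apply: ler_sum => l _; apply: ler_sum => i _.
by rewrite mxE; exact: poly_bound_le.
Qed.

Lemma dom_steer' : dom (fun x => steer' p (sp_t x)) (fun=> 1).
Proof.
exists (\sum_l poly_bound (p l)^`(n)).
  by apply: sumr_ge0 => ? _; exact: sumr_ge0.
move=> x [_ [t01 _]]; rewrite mulr1; apply: ler_sum => l _.
by rewrite big_ord1 mxE; exact: poly_bound_le.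
Qed.

Local Notation nU := (fun x => mx1norm (sp_U x)).
Local Notation nW := (fun x => mx1norm (sp_W x)).
Local Notation nUW := (fun x => mx1norm (sp_U x) + mx1norm (sp_W x)).
Local Notation nG := (fun x => (1 + `|sp_g x|) * (mx1norm (sp_U x) + mx1norm (sp_W x))).

Lemma dom_U : dom sp_U nU.
Proof. by exists 1 => // x _; rewrite mul1r. Qed.

Lemma dom_U_UW q r (f : stage_point -> 'M[R]_(q, r)) : dom f nU -> dom f nUW.
Proof. by move=> h; apply: dom_le h ler01 _ => x _; rewrite mul1r lerDl mx1norm_ge0. Qed.

Lemma dom_UW_G q r (f : stage_point -> 'M[R]_(q, r)) : dom f nUW -> dom f nG.
Proof.
move=> h; apply: dom_le h ler01 _ => x _; rewrite mul1r ler_peMl ?addr_ge0 ?mx1norm_ge0//.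
by rewrite lerDl.
Qed.

Lemma dom_rho : dom st_rho nU.
Proof.
apply: domD dom_U _; apply: dom_mulr; apply: domZc; apply: dom_mull; apply: dom_lift.
apply: dom_le (domM dom_U dom_scale_kill) T0 _ => x [/andP[_ dT] _].
by rewrite mulrC ler_wpM2r// mx1norm_ge0.
Qed.

Lemma dom_R : dom st_R nU.
Proof. by apply: dom_eq (domM dom_rho dom_steer) _ => x; rewrite mulr1. Qed.

Lemma dom_V : dom st_V nUW.
Proof.
apply: domD; first exact: dom_U_UW dom_R.
by exists 1 => // x _; rewrite mul1r lerDr mx1norm_ge0.
Qed.

Lemma dom_zeta : dom st_zeta (fun x => sp_dl x * nUW x).
Proof.
apply: dom_lift; apply: dom_eq (domM dom_V dom_scale_kill) _ => x.
by rewrite mulrC.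
Qed.

Lemma dom_zeta_UW : dom st_zeta nUW.
Proof.
apply: dom_le dom_zeta T0 _ => x [/andP[_ dT] _].
by rewrite ler_wpM2r// addr_ge0// mx1norm_ge0.
Qed.

Lemma dom_eta : dom st_eta nG.
Proof.
apply: domD.
  apply: (domZ (k := fun x => 1 + `|sp_g x|)); first by move=> x _; rewrite lerDr.
  by apply: dom_mull; apply: dom_mulr; exact: dom_U_UW dom_R.
apply: (domZ (k := fun x => 1 + `|sp_g x|)); first by move=> x [_ []].
by apply: dom_mull; exact: dom_zeta_UW.
Qed.

Lemma dom_Z : dom st_Z nG.
Proof.
have h : dom (fun x => st_V x + st_eta x *m row0) nG.
  by apply: domD; [exact: dom_UW_G dom_V|apply: dom_mulr; exact: dom_eta].
by apply: dom_eq (domM h dom_scale) _ => x; rewrite mulr1.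
Qed.

Lemma dom_dl q r (f : stage_point -> 'M[R]_(q, r)) g : (forall x, 0 <= g x) -> dom f g ->
  dom f (fun x => (sp_dl x)^-1 * g x).
Proof.
move=> g0 h; apply: dom_le h T0 _ => x [/andP[d0 dT] _].
by rewrite mulrA ler_peMl// -[leLHS](divff (lt0r_neq0 d0)) ler_pM2r// invr_gt0.
Qed.

Let nG0 x : 0 <= nG x.
Proof. by rewrite mulr_ge0 ?addr_ge0 ?mx1norm_ge0. Qed.

Lemma dom_dy : dom st_dy (fun x => (sp_dl x)^-1 * nG x).
Proof.
apply: domD.
  apply: (domZ (k := fun x => (sp_dl x)^-1)).
    by move=> x [/andP[d0 _] _]; rewrite ger0_norm// invr_ge0 ltW.
  apply: dom_UW_G; apply: dom_U_UW.
  by apply: dom_eq (domM dom_rho dom_steer') _ => x; rewrite mulr1.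
apply: dom_dl => //; apply: domN; apply: domZc; apply: dom_mull; apply: dom_lift.
by apply: dom_mulr; exact: dom_Z.
Qed.

Lemma dom_psi : dom st_psi (fun x => (sp_dl x)^-1 * nG x).
Proof.
apply: domD; first by apply: dom_mull; exact: dom_dy.
by apply: dom_dl => //; apply: dom_lift; apply: dom_mulr; exact: dom_Z.
Qed.

Local Notation nGG := (fun x => (sp_dl x)^-1 * (1 + `|sp_g x|) ^+ 2 * nUW x).

Lemma dom_GG q r (f : stage_point -> 'M[R]_(q, r)) :
  dom f (fun x => (sp_dl x)^-1 * nG x) -> dom f nGG.
Proof.
move=> h; apply: dom_le h ler01 _ => x [/andP[d0 dT] _].
rewrite mul1r -mulrA ler_wpM2l ?invr_ge0 ?(ltW d0)// ler_wpM2r ?addr_ge0 ?mx1norm_ge0//.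
by rewrite expr2 ler_peMl ?addr_ge0// lerDl.
Qed.

Lemma dom_gpsi : dom (fun x => (1 + `|sp_g x|) *: st_psi x) nGG.
Proof.
apply: dom_eq (domZ (k := fun x => 1 + `|sp_g x|) _ dom_psi) _.
  by move=> x _; rewrite ger0_norm// addr_ge0.
by move=> x /=; ring.
Qed.

Lemma dom_lift_Z : dom (fun x => clift (st_Z x)) nGG.
Proof. by apply: dom_GG; apply: dom_dl => //; apply: dom_lift; exact: dom_Z. Qed.

Lemma dom_u : dom st_u nGG.
Proof.
apply: domD; last by apply: dom_GG; apply: dom_dl => //; apply: dom_mulr; exact: dom_Z.
apply: domD; first by apply: dom_GG; exact: dom_dy.
apply: dom_eq (domZ (k := fun x => 1 + `|sp_g x|) _ (dom_mull K dom_psi)) _.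
  by move=> x _; rewrite lerDr.
by move=> x /=; ring.
Qed.

(* At the end of a stage the steering polynomials vanish, so only the error W survives. *)
Lemma st_out_bound : exists2 C, 0 <= C & forall x, st_ok x -> steer p (sp_t x) = 0 ->
  mx1norm (st_out x) <= C * (1 + `|sp_g x|) * mx1norm (sp_W x).
Proof.
have [C C0 hC] : dom st_out nG.
  apply: dom_mulr; apply: domD; last by apply: dom_mulr; exact: dom_eta.
  by apply: dom_UW_G; exists 1 => // x _; rewrite mul1r lerDr mx1norm_ge0.
exists C => // x ok s0.
(* Where the steering matrix vanishes the output does not depend on [U], so the general bound may be
   read at [U = 0]. *)
pose x0 := StagePoint (sp_dl x) 0 (sp_t x) (sp_g x) (sp_k x) (sp_W x).
have R0 y : sp_t y = sp_t x -> st_R y = 0 by move=> yx; rewrite /st_R yx s0 mulmx0.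
have E : st_out x0 = st_out x.
  by rewrite /st_out /st_eta /st_zeta /st_V !R0.
rewrite -E; apply: le_trans (hC x0 ok) _.
by rewrite /x0 /= mx1norm0 add0r mulrA.
Qed.

(** [W] enters affinely in two ways: through the shift, with factor [1 / dl], and through
    [kap K zeta], where [kill0] supplies a factor [dl] that cancels [1 / dl]. *)
Lemma st_Phi_lipschitz : exists2 C, 0 <= C & forall dl U t g k W W',
  0 < dl <= T ->
  mx1norm (st_Phi (StagePoint dl U t g k W) - st_Phi (StagePoint dl U t g k W')) <=
  C * (dl^-1 + `|k|) * mx1norm (W - W').
Proof.
have [C C0 hC] : dom (fun x => (sp_dl x)^-1 *: (sp_W x *m S +
    (sp_k x *: (K *m clift (sp_W x *m (scale_mx (sp_dl x) *m kill0)))) *m row1))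
    (fun x => ((sp_dl x)^-1 + `|sp_k x|) * mx1norm (sp_W x)).
  have dW : dom sp_W nW by exists 1 => // x _; rewrite mul1r.
  pose f1 x : 'M[R]_(m, n) := (sp_dl x)^-1 *: (sp_W x *m S).
  pose f2 x : 'M[R]_(m, n) := ((sp_dl x)^-1 * sp_k x) *:
    ((K *m clift (sp_W x *m (scale_mx (sp_dl x) *m kill0))) *m row1).
  have -> : (fun x => (sp_dl x)^-1 *: (sp_W x *m S +
    (sp_k x *: (K *m clift (sp_W x *m (scale_mx (sp_dl x) *m kill0)))) *m row1)) =
    (fun x => f1 x + f2 x).
    by apply/funext => x; rewrite /f1 /f2 scalerDr -scalemxAl scalerA.
  have d1 : dom f1 (fun x => (sp_dl x)^-1 * nW x).
    apply: (domZ (k := fun x => (sp_dl x)^-1)); last exact: dom_mulr.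
    by move=> x [/andP[d0 _] _]; rewrite ger0_norm// invr_ge0 ltW.
  have d2 : dom f2 (fun x => (sp_dl x)^-1 * `|sp_k x| * (nW x * sp_dl x)).
    apply: (domZ (k := fun x => (sp_dl x)^-1 * `|sp_k x|)).
      by move=> x [/andP[d0 _] _]; rewrite normrM ger0_norm// invr_ge0 ltW.
    apply: dom_mulr; apply: dom_mull; apply: dom_lift; exact: domM dW dom_scale_kill.
  apply: domD.
    apply: dom_le d1 ler01 _ => x _; rewrite mul1r ler_wpM2r ?mx1norm_ge0// lerDl//.
  apply: dom_le d2 ler01 _ => x [/andP[d0 _] _].
  rewrite mul1r [nW x * _]mulrC mulrA [_ * sp_dl x]mulrAC mulVf ?gt_eqF// mul1r.
  by rewrite ler_wpM2r ?mx1norm_ge0// lerDr invr_ge0 ltW.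
exists C => // dl U t g k W W' ok.
pose x := StagePoint dl U t g k W; pose x' := StagePoint dl U t g k W'.
have Rx : st_R x' = st_R x by [].
have zE : st_zeta x - st_zeta x' = clift ((W - W') *m (scale_mx dl *m kill0)).
  rewrite /st_zeta -scaleN1r -chain_liftZ -chain_liftD scaleN1r -mulmxBl.
  by rewrite /st_V Rx /= opprD addrACA subrr add0r.
have eE : st_eta x - st_eta x' = k *: (K *m clift ((W - W') *m (scale_mx dl *m kill0))).
  by rewrite /st_eta Rx /= opprD addrACA subrr add0r -scalerBr -mulmxBr zE.
have -> : st_Phi x - st_Phi x' = dl^-1 *: ((W - W') *m S +
    (k *: (K *m clift ((W - W') *m (scale_mx dl *m kill0)))) *m row1).
  by rewrite /st_Phi /= -scalerBr opprD addrACA -!mulmxBl eE.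
have := hC (StagePoint dl U 0 k k (W - W')); rewrite /= mulrA; apply.
by rewrite /st_ok /= ok lexx ler01 lerDr.
Qed.

(** Without error only [eta] remains: the gain multiplies the steered column 0, and [kap] multiplies
    [zeta], which is of order [dl]. Integrated over a stage this is of order [sqrt dl] in mean
    square, relative to [U]. *)
Lemma st_Phi_source : exists2 C, 0 <= C & forall x, st_ok x -> sp_W x = 0 ->
  mx1norm (st_Phi x) <= C * ((sp_dl x)^-1 * (`|sp_g x| + sp_dl x * `|sp_k x|)) * mx1norm (sp_U x).
Proof.
have d1 : dom (fun x => sp_g x *: (K *m B *m (st_R x *m col0))) (fun x => `|sp_g x| * nUW x).
  by apply: domZ => //; apply: dom_mull; apply: dom_mulr; exact: dom_U_UW dom_R.
have d2 : dom (fun x => sp_k x *: (K *m st_zeta x)) (fun x => `|sp_k x| * (sp_dl x * nUW x)).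
  by apply: domZ => //; apply: dom_mull; exact: dom_zeta.
have [C C0 hC] : dom (fun x => (sp_dl x)^-1 *: (st_eta x *m row1) : 'M[R]_(m, n))
    (fun x => (sp_dl x)^-1 * ((`|sp_g x| + sp_dl x * `|sp_k x|) * nUW x)).
  apply: (domZ (k := fun x => (sp_dl x)^-1)).
    by move=> x [/andP[d0 _] _]; rewrite ger0_norm// invr_ge0 ltW.
  apply: dom_mulr; apply: domD.
    apply: dom_le d1 ler01 _ => x [/andP[d0 _] _].
    rewrite mul1r ler_wpM2r ?addr_ge0 ?mx1norm_ge0// lerDl.
    by rewrite mulr_ge0// ltW.
  apply: dom_le d2 ler01 _ => x _.
  by rewrite mul1r mulrA [`|_| * sp_dl x]mulrC ler_wpM2r ?addr_ge0 ?mx1norm_ge0// lerDr.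
exists C => // x ok W0.
have -> : st_Phi x = (sp_dl x)^-1 *: (st_eta x *m row1) by rewrite /st_Phi W0 mul0mx add0r.
by apply: le_trans (hC x ok) _; rewrite W0 mx1norm0 addr0 !mulrA.
Qed.

End StagePoint.

(** * A stage as an adapted random differential equation *)

Section StageProcess.
Context {R : realType} {d : measure_display} {Omega : measurableType d}.
Variables (P : probability Omega R) (beta b : R -> {RV P >-> R}).
Hypotheses (hbeta : brownian_motion beta) (hb : regular_modification beta b).
Local Notation F := (augmented_filtration P (fun r => beta r)).
Local Notation mu := (@lebesgue_measure R).
Local Notation regular := (regular_process (P := P) beta).
Local Notation regular_mx := (regular_matrix (P := P) beta).
Variables (a : bool) (m N : nat).
Local Notation n := N.+2.
Variables (A : 'M[R]_n) (B : 'M[R]_(n, m)) (K : 'M[R]_(m, n)).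
Hypothesis KBK : K *m B *m K = a%:R *: K.
Local Notation sigma := (B *m K).
Local Notation S := (@shift_mx R N.+1).
Local Notation clift Z := (chain_lift A B Z).
Variable p : 'I_n -> {poly R}.
Hypotheses (p0 : forall l i, (i < n)%N -> (p l)^`(i).[0] = (i == N.+1 - l)%N%:R)
  (p1 : forall l i, (i < n)%N -> (p l)^`(i).[1] = 0).
Variable T : R.
Hypothesis T0 : 0 <= T.

Definition pkap (c s : R) (w : Omega) : R := kap a (s - c) (b s w - b c w).
Local Notation g c s w := (pgain b a c s w).

(** The Picard bound for the error relative to the starting coordinates: the averaged source times
    the exponential of the integrated rate. It is of order [sqrt dl] in mean square. *)
Definition stage_size (C c dl : R) (w : Omega) : R :=
  (\int[mu]_(r in `]c, (c + dl)%R[) (dl^-1 * (`|g c r w| + dl * `|pkap c r w|))) *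
  expR (C * \int[mu]_(r in `]c, (c + dl)%R[) `|pkap c r w|).

(** All that is later used of a stage. States are lifts of coordinates scaled by [dl], and at the
    end by [dl / 2] in view of the next stage; the state itself is [Y + g sigma Y]. The factor
    [1 / dl] in the bounds is the price of acting within a short time. *)
Record stage_solution (C c dl : R) (U U' : Omega -> 'M[R]_(m, n))
    (Y psi : R -> Omega -> 'cV[R]_n) (u : R -> Omega -> 'cV[R]_m) : Prop := StageSolution {
  stage_Y_regular : regular_mx c Y ;
  stage_psi_regular : regular_mx c psi ;
  stage_u_regular : regular_mx c u ;
  stage_out_measurable : forall i j, wrt_measurable (F (c + dl)) (fun w => U' w i j) ;
  stage_rate : forall w, has_rate c (Y^~ w) (psi^~ w) ;
  stage_start : forall w, Y c w = clift (U w *m scale_mx dl) ;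
  stage_end : forall w, Y (c + dl) w + g c (c + dl) w *: (sigma *m Y (c + dl) w) =
     clift (U' w *m scale_mx (dl / 2)) ;
  stage_drift : forall s w, psi s w + g c s w *: (sigma *m psi s w) =
     - (A *m (Y s w + g c s w *: (sigma *m Y s w))) + B *m u s w ;
  stage_bound : forall s w, c <= s <= c + dl ->
     [/\ mx1norm (Y s w + g c s w *: (sigma *m Y s w)) <=
           C * (dl^-1 * (1 + `|g c s w|) ^+ 2 * (mx1norm (U w) * (1 + stage_size C c dl w))),
         mx1norm (u s w) <=
           C * (dl^-1 * (1 + `|g c s w|) ^+ 2 * (mx1norm (U w) * (1 + stage_size C c dl w))) &
         (1 + `|g c s w|) * mx1norm (psi s w) <=
           C * (dl^-1 * (1 + `|g c s w|) ^+ 2 * (mx1norm (U w) * (1 + stage_size C c dl w)))] ;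
  stage_out_bound : forall w, mx1norm (U' w) <=
     C * (1 + `|g c (c + dl) w|) * (mx1norm (U w) * stage_size C c dl w) }.

Lemma continuous_pkap c w : continuous (fun s => pkap c s w).
Proof.
move=> s; have -> : (fun s => pkap c s w) = (fun s => - a%:R + (1 - a%:R) * g c s w).
  by apply/funext => r; rewrite /pkap kapE.
apply: cvgD; first exact: cvg_cst.
by apply: cvgM; [exact: cvg_cst|exact: (continuous_pgain_r hb)].
Qed.

Lemma regular_pkap c : 0 <= c -> regular c (pkap c).
Proof.
move=> c0; apply: (regular_eq (f := fun s w => - a%:R + (1 - a%:R) * g c s w)).
  by move=> s w; rewrite /pkap kapE.
apply: regularD; first exact: regular_cst.
by apply: regularM; [exact: regular_cst|exact: regular_pgain].
Qed.

Lemma rmx_lift c (X : R -> Omega -> 'M[R]_(m, n)) : regular_mx c X ->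
  regular_mx c (fun s w => clift (X s w)).
Proof.
move=> rX; apply: rmx_sum => i.
have -> : (fun s w => chain_mx A B i *m col i (X s w)) =
    (fun s w => chain_mx A B i *m (X s w *m delta_mx i 0)).
  by apply/funext => s; apply/funext => w; rewrite -colE.
by apply: rmxM; [exact: rmx_cst|apply: rmxM; [|exact: rmx_cst]].
Qed.

Section OneStage.
Variables (c dl : R) (U : Omega -> 'M[R]_(m, n)).
Hypotheses (c0 : 0 <= c) (dl0 : 0 < dl) (dlT : dl <= T).
Hypothesis aU : forall i j, wrt_measurable (F c) (fun w => U w i j).
Variables (CL : R).
Hypotheses (CL0 : 0 <= CL) (hCL : forall dl U t g k W W', 0 < dl <= T ->
  mx1norm (st_Phi a A B K p (StagePoint dl U t g k W) - st_Phi a A B K p (StagePoint dl U t g k W')) <=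
  CL * (dl^-1 + `|k|) * mx1norm (W - W')).

Let pt s w W := StagePoint dl (U w) ((s - c) / dl) (g c s w) (pkap c s w) W.
Let Phi s w W := st_Phi a A B K p (pt s w W).
Let lam s w := CL * (dl^-1 + `|pkap c s w|).

Let rU : regular_mx c (fun _ => U).
Proof. by move=> i j; apply: regular_init. Qed.

Let rsteer : regular_mx c (fun s _ => steer p ((s - c) / dl)).
Proof.
move=> l i; apply: (regular_eq (f := fun s _ => (p l)^`(N.+1 - i).[(s - c) / dl])).
  by move=> s w; rewrite mxE.
apply: regular_det => s.
apply: (@continuous_comp _ _ _ (fun s => (s - c) / dl) (horner _)); last exact: continuous_horner.
by apply: cvgM; [apply: cvgB; [exact: cvg_id|exact: cvg_cst]|exact: cvg_cst].
Qed.

Let rsteer' : regular_mx c (fun s _ => steer' p ((s - c) / dl)).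
Proof.
move=> l i; apply: (regular_eq (f := fun s _ => (p l)^`(n).[(s - c) / dl])).
  by move=> s w; rewrite mxE.
apply: regular_det => s.
apply: (@continuous_comp _ _ _ (fun s => (s - c) / dl) (horner _)); last exact: continuous_horner.
by apply: cvgM; [apply: cvgB; [exact: cvg_id|exact: cvg_cst]|exact: cvg_cst].
Qed.

Let rmxMr q r t (X : R -> Omega -> 'M[R]_(q, r)) (M : 'M[R]_(r, t)) : regular_mx c X ->
  regular_mx c (fun s w => X s w *m M).
Proof. by move=> h; apply: rmxM => //; exact: rmx_cst. Qed.

Let rmxMl q r t (X : R -> Omega -> 'M[R]_(q, r)) (M : 'M[R]_(t, q)) : regular_mx c X ->
  regular_mx c (fun s w => M *m X s w).
Proof. by move=> h; apply: rmxM => //; exact: rmx_cst. Qed.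

Let rmxZc q r (X : R -> Omega -> 'M[R]_(q, r)) (k : R) : regular_mx c X ->
  regular_mx c (fun s w => k *: X s w).
Proof. by move=> h; apply: (@rmxZ _ _ _ _ _ _ _ _ (fun _ _ => k)) => //; exact: regular_cst. Qed.

Let rrho W : regular_mx c (fun s w => st_rho a A B K (pt s w (W s w))).
Proof.
change (regular_mx c (fun s w => U w + (a%:R *: (K *m clift (U w *m (scale_mx dl *m kill0)))) *m row0)).
apply: rmxD; first exact: rU.
by apply: rmxMr; apply: rmxZc; apply: rmxMl; apply: rmx_lift; apply: rmxMr; exact: rU.
Qed.

Let rR W : regular_mx c (fun s w => st_R a A B K p (pt s w (W s w))).
Proof.
change (regular_mx c (fun s w => st_rho a A B K (pt s w (W s w)) *m steer p ((s - c) / dl))).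
by apply: rmxM; [exact: rrho|exact: rsteer].
Qed.

Let rV W : regular_mx c W -> regular_mx c (fun s w => st_V a A B K p (pt s w (W s w))).
Proof.
change (regular_mx c W -> regular_mx c (fun s w => st_R a A B K p (pt s w (W s w)) + W s w)).
by move=> h; apply: rmxD => //; exact: rR.
Qed.

Let rzeta W : regular_mx c W -> regular_mx c (fun s w => st_zeta a A B K p (pt s w (W s w))).
Proof.
move=> h; change (regular_mx c (fun s w => clift (st_V a A B K p (pt s w (W s w)) *m (scale_mx dl *m kill0)))).
by apply: rmx_lift; apply: rmxMr; exact: rV.
Qed.

Let reta W : regular_mx c W -> regular_mx c (fun s w => st_eta a A B K p (pt s w (W s w))).
Proof.
move=> h; change (regular_mx c (fun s w => g c s w *: (K *m B *m (st_R a A B K p (pt s w (W s w)) *m col0)) +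
  pkap c s w *: (K *m st_zeta a A B K p (pt s w (W s w))))).
apply: rmxD.
  by apply: rmxZ; [exact: regular_pgain|apply: rmxMl; apply: rmxMr; exact: rR].
by apply: rmxZ; [exact: regular_pkap|apply: rmxMl; exact: rzeta].
Qed.

Let rZ W : regular_mx c W -> regular_mx c (fun s w => st_Z a A B K p (pt s w (W s w))).
Proof.
move=> h; change (regular_mx c (fun s w => (st_V a A B K p (pt s w (W s w)) + st_eta a A B K p (pt s w (W s w)) *m row0) *m scale_mx dl)).
apply: rmxMr; apply: rmxD; first exact: rV.
by apply: rmxMr; exact: reta.
Qed.

Let rPhi W : regular_mx c W -> regular_mx c (fun s w => Phi s w (W s w)).
Proof.
move=> h; change (regular_mx c (fun s w => dl^-1 *: (W s w *m S + st_eta a A B K p (pt s w (W s w)) *m row1))).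
apply: rmxZc; apply: rmxD; first exact: rmxMr.
by apply: rmxMr; exact: reta.
Qed.

Let ry W : regular_mx c W -> regular_mx c (fun s w => st_y a A B K p (pt s w (W s w))).
Proof.
move=> h; change (regular_mx c (fun s w => st_R a A B K p (pt s w (W s w)) *m col0 +
  - (a%:R *: (K *m st_zeta a A B K p (pt s w (W s w)))))).
apply: rmxD; first by apply: rmxMr; exact: rR.
have -> : (fun s w => - (a%:R *: (K *m st_zeta a A B K p (pt s w (W s w))))) =
   (fun s w => (- a%:R) *: (K *m st_zeta a A B K p (pt s w (W s w)))).
  by apply/funext => s; apply/funext => w; rewrite scaleNr.
by apply: rmxZc; apply: rmxMl; exact: rzeta.
Qed.

Let rdy W : regular_mx c W -> regular_mx c (fun s w => st_dy a A B K p (pt s w (W s w))).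
Proof.
move=> h; change (regular_mx c (fun s w => dl^-1 *: (st_rho a A B K (pt s w (W s w)) *m
  steer' p ((s - c) / dl)) + - (a%:R *: (K *m clift (st_Z a A B K p (pt s w (W s w)) *m S))))).
apply: rmxD.
  by apply: rmxZc; apply: rmxM; [exact: rrho|exact: rsteer'].
have -> : (fun s w => - (a%:R *: (K *m clift (st_Z a A B K p (pt s w (W s w)) *m S)))) =
   (fun s w => (- a%:R) *: (K *m clift (st_Z a A B K p (pt s w (W s w)) *m S))).
  by apply/funext => s; apply/funext => w; rewrite scaleNr.
by apply: rmxZc; apply: rmxMl; apply: rmx_lift; apply: rmxMr; exact: rZ.
Qed.

Let rpsi W : regular_mx c W -> regular_mx c (fun s w => st_psi a A B K p (pt s w (W s w))).
Proof.
move=> h; change (regular_mx c (fun s w => B *m st_dy a A B K p (pt s w (W s w)) + clift (st_Z a A B K p (pt s w (W s w)) *m S))).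
apply: rmxD; first by apply: rmxMl; exact: rdy.
by apply: rmx_lift; apply: rmxMr; exact: rZ.
Qed.

Let lam0 s w : 0 <= lam s w.
Proof. by rewrite mulr_ge0// addr_ge0// invr_ge0 ltW. Qed.

Let clam w : continuous (fun s => lam s w).
Proof.
move=> s; apply: cvgM; first exact: cvg_cst.
by apply: cvgD; [exact: cvg_cst|exact: (cvg_norm (@continuous_pkap c w s))].
Qed.

Let Phi_lip s w x y : mx1norm (Phi s w x - Phi s w y) <= lam s w * mx1norm (x - y).
Proof. by apply: hCL; rewrite dl0. Qed.

Definition stage_W := picard_limit c Phi.

Let rW : regular_mx c stage_W.
Proof. exact: (picard_limit_regular clam lam0 Phi_lip rPhi). Qed.

Let WE s w : stage_W s w = mx_integral c s (fun r => Phi r w (stage_W r w)).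
Proof. exact: (picard_limitE clam lam0 Phi_lip rPhi). Qed.

Definition stage_pt s w := pt s w (stage_W s w).
Local Notation xp := stage_pt.

Lemma stage_W_col0 s w : stage_W s w *m col0 = 0.
Proof.
rewrite -colE; apply/colP => i; rewrite mxE WE !mxE.
have E r : Phi r w (stage_W r w) i ord0 = 0.
  rewrite /Phi /st_Phi mxE; apply/eqP; rewrite mulf_eq0; apply/orP; right; rewrite mxE.
  have /(congr1 (fun v : 'cV[R]_m => v i 0)) := col_shift0 (stage_W r w).
  rewrite mxE => ->; rewrite !mxE big_ord1 !mxE /=.
  by rewrite mulr0 addr0.
by under eq_Rintegral do rewrite E; rewrite Rintegral_cst// mul0r.
Qed.

Lemma stage_W_rate w : has_rate c (stage_W^~ w) (fun s => Phi s w (stage_W s w)).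
Proof.
split=> [i j|s cs]; first exact: (rPhi rW i j).1.
rewrite WE (WE c) -[LHS]add0r; congr (_ + _); apply/matrixP => i j.
by rewrite !mxE Rintegral_oo_ge.
Qed.

(** The chain relation for the columns after column 0: the steering polynomials satisfy their share
    of it, and the equation of [W] supplies the rest, including the effect of [eta] on column 1. *)
Lemma stage_VK_rate w : has_rate c
  (fun s => st_V a A B K p (xp s w) *m (scale_mx dl *m kill0))
  (fun s => st_Z a A B K p (xp s w) *m S).
Proof.
have h1 : has_rate c (fun s => st_R a A B K p (xp s w) *m kill0)
    (fun s => dl^-1 *: (st_R a A B K p (xp s w) *m S)).
  have := has_rate_mull (st_rho a A B K (xp c w)) (steer_rate p c dl0).
  apply: has_rate_eq => s; first by rewrite mulmxA.
  by rewrite -scalemxAr mulmxA.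
have h2 := has_rate_mulr kill0 (stage_W_rate w).
have := has_rate_mulr (scale_mx dl) (has_rateD h1 h2).
apply: has_rate_eq => s.
  by rewrite -mulmxDl -mulmxA scale_kill.
rewrite -st_shift_scale ?gt_eqF// /Phi /st_Phi -[in LHS]scalemxAl -scalerDr -scalemxAl.
congr (_ *: (_ *m _)); rewrite mulmxDl -[_ *m S *m kill0]mulmxA shift_kill.
by rewrite -[_ *m row1 *m kill0]mulmxA row1_kill addrA -mulmxDl.
Qed.

Lemma stage_Y_rate w : has_rate c (fun s => st_Y a A B K p (xp s w))
  (fun s => st_psi a A B K p (xp s w)).
Proof.
have hz := has_rate_lift A B (stage_VK_rate w).
have h1 := has_rate_mull (st_rho a A B K (xp c w)) (steer_col0_rate p c dl0).
have h2 := has_rate_mull (- a%:R *: K) hz.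
have := has_rateD (has_rate_mull B (has_rateD h1 h2)) hz.
apply: has_rate_eq => s.
  by rewrite /st_Y /st_y mulmxA -scalemxAl scaleNr.
by rewrite /st_psi /st_dy -scalemxAr -scalemxAl scaleNr.
Qed.

Lemma stage_Y_start w : st_Y a A B K p (xp c w) = clift (U w *m scale_mx dl).
Proof.
have W0 : stage_W c w = 0.
  by rewrite WE; apply/matrixP => i j; rewrite !mxE Rintegral_oo_ge.
have RE : st_R a A B K p (xp c w) = st_rho a A B K (xp c w).
  by rewrite /st_R /= subrr mul0r steer0// mulmx1.
have VE : st_V a A B K p (xp c w) = st_rho a A B K (xp c w).
  by rewrite /st_V RE /= W0 addr0.
have zE : st_zeta a A B K p (xp c w) = st_zin A B (xp c w).
  rewrite /st_zeta VE /st_rho mulmxDl -[X in _ + X]mulmxA [row0 *m _]mulmxA.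
  by rewrite row0_scale row0_kill mulmx0 addr0.
rewrite /st_Y /st_y RE zE /st_rho mulmxDl -[X in _ + X - _]mulmxA row0_col0 mulmx1 addrK /=.
rewrite [in RHS](kill0E (U w *m scale_mx dl)) chain_liftD chain_lift_B.
by rewrite -[_ *m _ *m col0]mulmxA scale_col0 /st_zin /= -mulmxA.
Qed.

Lemma stage_kE s w : sp_k (xp s w) = - a%:R + (1 - a%:R) * sp_g (xp s w).
Proof. by rewrite /= /pkap kapE. Qed.

Lemma stage_XE s w : clift (st_Z a A B K p (xp s w)) = st_Y a A B K p (xp s w) +
  g c s w *: (sigma *m st_Y a A B K p (xp s w)).
Proof. by apply: (st_liftE _ _ KBK (stage_kE s w)); exact: stage_W_col0. Qed.

Lemma stage_X_end w : clift (st_Z a A B K p (xp (c + dl) w)) =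
  clift (st_out a A B K p (xp (c + dl) w) *m scale_mx (dl / 2)).
Proof.
congr (chain_lift _ _ _); rewrite /st_out /st_Z -mulmxA scale_mxM mulrC divfK ?pnatr_eq0//.
congr ((_ + _) *m _); rewrite /st_V /st_R /= [c + dl]addrC addrK divff ?gt_eqF//.
by rewrite steer1// mulmx0 add0r.
Qed.

Lemma stage_ok s w : c <= s <= c + dl -> st_ok T (xp s w).
Proof.
move=> /andP[cs sd]; split=> /=; first by rewrite dl0.
split; last exact: kap_le.
rewrite divr_ge0 ?subr_ge0//=; last exact: ltW.
by rewrite ler_pdivrMr// mul1r lerBlDl.
Qed.

Variable CS : R.
Hypotheses (CS0 : 0 <= CS) (hCS : forall x, st_ok T x -> sp_W x = 0 ->
  mx1norm (st_Phi a A B K p x) <=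
    CS * ((sp_dl x)^-1 * (`|sp_g x| + sp_dl x * `|sp_k x|)) * mx1norm (sp_U x)).

(** The part [CL / dl] of the Lipschitz rate integrates to [CL] over the stage, whence the factor
    [expR CL]; the source is controlled by [hCS]. *)
Lemma stage_W_bound s w : c <= s <= c + dl ->
  mx1norm (stage_W s w) <= CS * expR CL * (mx1norm (U w) * stage_size CL c dl w).
Proof.
move=> /andP[cs sd].
have cg : continuous (fun r => dl^-1 * (`|g c r w| + dl * `|pkap c r w|)).
  move=> r; apply: cvgM; first exact: cvg_cst.
  apply: cvgD; first exact: (cvg_norm (@continuous_pgain_r _ _ _ _ _ _ hb a c w r)).
  by apply: cvgM; [exact: cvg_cst|exact: (cvg_norm (@continuous_pkap c w r))].
have ck : continuous (fun r => `|pkap c r w|).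
  by move=> r; exact: (cvg_norm (@continuous_pkap c w r)).
have src : picard_src c Phi s w <= CS * mx1norm (U w) *
    \int[mu]_(r in `]c, (c + dl)%R[) (dl^-1 * (`|g c r w| + dl * `|pkap c r w|)).
  rewrite -continuous_RintegralZ//.
  have cP0 : continuous (fun r => mx1norm (Phi r w 0)).
    apply: continuous_mx1norm => i j.
    exact: (@rPhi (fun _ _ => 0) (@rmx_cst _ _ _ _ _ _ _ _ 0) i j).1.
  apply: (@le_trans _ _ (\int[mu]_(r in `]c, (c + dl)%R[) mx1norm (Phi r w 0))).
    by apply: path_integral_homo => // r; exact: mx1norm_ge0.
  apply: continuous_le_Rintegral => //.
    by move=> r; apply: cvgM; [exact: cvg_cst|exact: cg].
  move=> r /andP[cr rd].
  have ok : st_ok T (pt r w 0).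
    by have := @stage_ok r w; rewrite (ltW cr) (ltW rd) => /(_ isT).
  by apply: le_trans (hCS ok erefl) _; rewrite mulrAC.
have lip : picard_lip c lam s w <= CL + CL * \int[mu]_(r in `]c, (c + dl)%R[) `|pkap c r w|.
  apply: (@le_trans _ _ (\int[mu]_(r in `]c, (c + dl)%R[) lam r w)).
    by apply: path_integral_homo.
  rewrite continuous_RintegralZ; last first.
    by move=> r; apply: cvgD; [exact: cvg_cst|exact: ck].
  rewrite RintegralD//; last 2 first.
  - by apply: continuous_integrable => r; exact: cvg_cst.
  - exact: continuous_integrable.
  rewrite Rintegral_cst//= lebesgue_measure_oo; last by rewrite lerDl ltW.
  by rewrite /= [c + dl]addrC addrK mulVf ?gt_eqF// mulrDr mulr1.
apply: le_trans (picard_limit_le clam lam0 Phi_lip rPhi s w) _.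
apply: (@le_trans _ _ ((CS * mx1norm (U w) * \int[mu]_(r in `]c, (c + dl)%R[)
    (dl^-1 * (`|g c r w| + dl * `|pkap c r w|))) *
    expR (CL + CL * \int[mu]_(r in `]c, (c + dl)%R[) `|pkap c r w|))).
  apply: ler_pM => //; last by rewrite ler_expR.
  by apply: Rintegral_ge0 => r _; exact: mx1norm_ge0.
rewrite expRD /stage_size le_eqVlt; apply/orP; left; apply/eqP.
by rewrite !mulrA; congr (_ * _); ring.
Qed.

Lemma stage_regulars : [/\ regular_mx c (fun s w => st_Y a A B K p (xp s w)),
  regular_mx c (fun s w => st_psi a A B K p (xp s w)),
  regular_mx c (fun s w => st_u a A B K p (xp s w)) &
  regular_mx c (fun s w => st_out a A B K p (xp s w))].
Proof.
split.
- change (regular_mx c (fun s w => B *m st_y a A B K p (pt s w (stage_W s w)) + st_zeta a A B K p (pt s w (stage_W s w)))).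
  by apply: rmxD; [apply: rmxMl; exact: ry|exact: rzeta].
- exact: (rpsi rW).
- change (regular_mx c (fun s w => st_dy a A B K p (pt s w (stage_W s w)) + g c s w *: (K *m st_psi a A B K p (pt s w (stage_W s w))) +
    st_Z a A B K p (pt s w (stage_W s w)) *m chain_ctrl A)).
  apply: rmxD; last by apply: rmxMr; exact: rZ.
  apply: rmxD; first exact: rdy.
  by apply: rmxZ; [exact: regular_pgain|apply: rmxMl; exact: rpsi].
- change (regular_mx c (fun s w => (stage_W s w + st_eta a A B K p (pt s w (stage_W s w)) *m row0) *m scale_mx 2)).
  by apply: rmxMr; apply: rmxD => //; apply: rmxMr; exact: reta.
Qed.

End OneStage.

(** The constant is fixed before the stage: [c], [dl] and [U] come after it. This uniformity lets
    the contraction act along infinitely many shrinking stages. *)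
Lemma stage_exists : exists2 C, 0 <= C & forall c dl (U : Omega -> 'M[R]_(m, n)), 0 <= c -> 0 < dl <= T ->
  (forall i j, wrt_measurable (F c) (fun w => U w i j)) ->
  exists U' Y psi u, stage_solution C c dl U U' Y psi u.
Proof.
have [CL CL0 hCL] := st_Phi_lipschitz a A B K p T0.
have [CS CS0 hCS] := st_Phi_source a A B K p T0.
have [CX CX0 hCX] := dom_lift_Z a A B K p T0.
have [CU CU0 hCU] := dom_u a A B K p T0.
have [CP CP0 hCP] := dom_gpsi a A B K p T0.
have [CO CO0 hCO] := st_out_bound a A B K p T0.
pose CW := CS * expR CL.
have CW0 : 0 <= CW by rewrite mulr_ge0// expR_ge0.
(* [CL <= C] lets [stage_size C] dominate [stage_size CL], and [1 + CW] pays for replacing the norm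
   of [W] by its bound in terms of [U]. *)
pose C := CL + (CX + CU + CP + CO) * (1 + CW).
have C1 : CL <= C by rewrite lerDl mulr_ge0// ?addr_ge0.
have Cle D : 0 <= D -> D <= CX + CU + CP + CO -> D * (1 + CW) <= C.
  move=> D0 DC; apply: (@le_trans _ _ ((CX + CU + CP + CO) * (1 + CW))).
    by rewrite ler_wpM2r// addr_ge0.
  by rewrite lerDr.
have C0 : 0 <= C by exact: le_trans C1.
exists C => // c dl U c0 /andP[dl0 dlT] aU.
have [rY rpsi ru rout] := stage_regulars c0 dl0 dlT aU CL0 hCL.
pose xp := stage_pt c dl U.
exists (fun w => st_out a A B K p (xp (c + dl) w)), (fun s w => st_Y a A B K p (xp s w)),
  (fun s w => st_psi a A B K p (xp s w)), (fun s w => st_u a A B K p (xp s w)).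
have int0 (f : R -> R) w : 0 <= \int[mu]_(r in `]c, (c + dl)%R[) `|f r|.
  exact: Rintegral_ge0.
have size0 k w : 0 <= stage_size k c dl w.
  rewrite mulr_ge0 ?expR_ge0//; apply: Rintegral_ge0 => r _.
  by rewrite mulr_ge0 ?invr_ge0 ?addr_ge0 ?mulr_ge0// ltW.
have sizeC w : stage_size CL c dl w <= stage_size C c dl w.
  rewrite ler_wpM2l ?ler_expR ?ler_wpM2r//; last exact: int0.
  apply: Rintegral_ge0 => r _.
  by rewrite mulr_ge0 ?invr_ge0 ?addr_ge0 ?mulr_ge0// ltW.
have Wb s w : c <= s <= c + dl ->
    mx1norm (sp_W (xp s w)) <= CW * (mx1norm (U w) * stage_size C c dl w).
  move=> cs; apply: le_trans (stage_W_bound c0 dl0 dlT aU CL0 hCL hCS w cs) _.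
  by rewrite -/CW ler_wpM2l// ler_wpM2l ?mx1norm_ge0.
have key D q (f : stage_point m N -> 'M[R]_(q, 1)) s w : 0 <= D -> D <= CX + CU + CP + CO ->
    (forall x, st_ok T x -> mx1norm (f x) <=
      D * ((sp_dl x)^-1 * (1 + `|sp_g x|) ^+ 2 * (mx1norm (sp_U x) + mx1norm (sp_W x)))) ->
    c <= s <= c + dl -> mx1norm (f (xp s w)) <=
      C * (dl^-1 * (1 + `|g c s w|) ^+ 2 * (mx1norm (U w) * (1 + stage_size C c dl w))).
  move=> D0 DC hf cs; apply: le_trans (hf _ (stage_ok U dl0 dlT w cs)) _.
  have q0 : 0 <= dl^-1 * (1 + `|g c s w|) ^+ 2 by rewrite mulr_ge0 ?exprn_ge0 ?addr_ge0 ?invr_ge0// ltW.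
  apply: (@le_trans _ _ ((D * (1 + CW)) * (dl^-1 * (1 + `|g c s w|) ^+ 2 *
      (mx1norm (U w) * (1 + stage_size C c dl w))))); last first.
    by rewrite ler_wpM2r ?Cle// mulr_ge0// mulr_ge0 ?mx1norm_ge0// addr_ge0.
  have Wsw := Wb s w cs.
  have U0 := mx1norm_ge0 (U w); have T1 := size0 C w.
  have UT := mulr_ge0 U0 T1; have CU1 := mulr_ge0 CW0 U0.
  have main : mx1norm (U w) + mx1norm (sp_W (xp s w)) <=
      (1 + CW) * (mx1norm (U w) * (1 + stage_size C c dl w)).
    by apply: (le_trans (lerD (lexx _) Wsw)); nra.
  apply: le_trans (ler_wpM2l D0 (ler_wpM2l q0 main)) _.
  by rewrite le_eqVlt; apply/orP; left; apply/eqP; ring.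
split => //.
- by move=> i j; apply: (rout i j).2; rewrite lerDl ltW.
- by move=> w; exact: (stage_Y_rate c0 dl0 dlT aU CL0 hCL).
- by move=> w; exact: (stage_Y_start c0 dl0 dlT aU CL0 hCL).
- move=> w; rewrite -(stage_X_end c U dl0).
  by rewrite (stage_XE c0 dl0 dlT aU CL0 hCL).
- move=> s w; rewrite -(stage_XE c0 dl0 dlT aU CL0 hCL); exact: st_driftE.
- move=> s w cs; split.
  + rewrite -(stage_XE c0 dl0 dlT aU CL0 hCL).
    apply: (key CX _ (fun x => clift (st_Z a A B K p x))) => //.
    by rewrite -!addrA lerDl !addr_ge0.
  + apply: (key CU _ (fun x => st_u a A B K p x)) => //.
    by rewrite -!addrA addrCA lerDl !addr_ge0.
  + have := key CP _ (fun x => (1 + `|sp_g x|) *: st_psi a A B K p x) s w CP0 _ hCP cs.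
    rewrite mx1normZ ger0_norm ?addr_ge0//; apply.
    by rewrite [_ + CP]addrC -!addrA lerDl !addr_ge0.
- move=> w; have cd : c <= c + dl <= c + dl by rewrite lexx lerDl ltW.
  have ok := stage_ok U dl0 dlT w cd.
  have s0 : steer p (sp_t (xp (c + dl) w)) = 0.
    by rewrite /= [c + dl]addrC addrK divff ?gt_eqF// steer1.
  apply: le_trans (hCO _ ok s0) _.
  apply: (@le_trans _ _ (CO * (1 + `|g c (c + dl) w|) * (CW * (mx1norm (U w) * stage_size C c dl w)))).
    by rewrite ler_wpM2l ?mulr_ge0 ?addr_ge0 ?Wb.
  have CC : CO * CW <= C.
    apply: le_trans (Cle _ CO0 _); last by rewrite lerDr !addr_ge0.
    by rewrite ler_wpM2l// lerDr.
  set X := mx1norm (U w) * _; have X0 : 0 <= X by rewrite mulr_ge0 ?mx1norm_ge0.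
  have -> : CO * (1 + `|g c (c + dl) w|) * (CW * X) = CO * CW * ((1 + `|g c (c + dl) w|) * X).
    by ring.
  by rewrite -[leRHS]mulrA ler_wpM2r// mulr_ge0// addr_ge0.
Qed.

End StageProcess.

(** * Jensen's inequality and moments of a stage *)

Section Jensen.
Context {R : realType}.
Local Notation mu := (@lebesgue_measure R).
Variables (c dl : R).
Hypothesis dl0 : 0 < dl.
Local Notation mean f := (\int[mu]_(r in `]c, (c + dl)%R[) (dl^-1 * f r)).

Lemma mean_cst k : mean (fun=> k) = k.
Proof.
rewrite Rintegral_cst//= lebesgue_measure_oo; last by rewrite lerDl ltW.
by rewrite /= [c + dl]addrC addrK mulrAC mulVf ?gt_eqF// mul1r.
Qed.

(** The supporting line of [phi] at the mean, of slope [k], is integrated over the stage. *)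
Lemma jensen (f : R -> R) (phi : R -> R) k : continuous f -> continuous phi ->
  (forall r, phi (mean f) + k * (f r - mean f) <= phi (f r)) ->
  phi (mean f) <= mean (fun r => phi (f r)).
Proof.
set M := mean f => cf cphi h.
have ccf (g : R -> R) (x : R) : continuous g -> continuous (fun r => x * g r).
  by move=> cg r; apply: cvgM; [exact: cvg_cst|exact: cg].
have E : phi M = \int[mu]_(r in `]c, (c + dl)%R[) (dl^-1 * (phi M - k * M) + k * (dl^-1 * f r)).
  rewrite RintegralD//; last 2 first.
  - by apply: continuous_integrable => r; exact: cvg_cst.
  - by apply: continuous_integrable; apply: (ccf); exact: ccf.
  rewrite (@continuous_RintegralZ _ _ _ (fun r => dl^-1 * f r) k); last exact: ccf.
  by rewrite (mean_cst (phi M - k * M)) subrK.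
rewrite [leLHS]E; apply: continuous_le_Rintegral.
- move=> r; apply: cvgD; first exact: cvg_cst.
  exact: (ccf (fun r => dl^-1 * f r) k (ccf f dl^-1 cf)).
- have cpf : continuous (fun r => phi (f r)).
    by move=> r; apply: (@continuous_comp _ _ _ f phi); [exact: cf|exact: cphi].
  exact: (ccf (fun r => phi (f r)) dl^-1 cpf).
- move=> r _; have -> : dl^-1 * (phi M - k * M) + k * (dl^-1 * f r) =
    dl^-1 * (phi M + k * (f r - M)) by ring.
  by rewrite ler_wpM2l ?invr_ge0 ?h// ltW.
Qed.

Lemma jensen_expR (f : R -> R) : continuous f -> expR (mean f) <= mean (fun r => expR (f r)).
Proof.
move=> cf; apply: (@jensen f expR (expR (mean f))) => //; first exact: continuous_expR.
move=> r; rewrite -[X in X + _]mulr1 -mulrDr.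
rewrite -[X in _ <= expR X](subrK (mean f)) expRD mulrC ler_wpM2r ?expR_ge0//.
by rewrite expR_ge1Dx.
Qed.

Lemma jensen_sqr (f : R -> R) : continuous f -> mean f ^+ 2 <= mean (fun r => f r ^+ 2).
Proof.
move=> cf; apply: (@jensen f (fun x => x ^+ 2) (2 * mean f)) => //.
  exact: exprn_continuous.
move=> r; move: (mean f) => M; rewrite /= -subr_ge0.
have -> : f r ^+ 2 - (M ^+ 2 + 2 * M * (f r - M)) = (f r - M) ^+ 2 by ring.
exact: sqr_ge0.
Qed.

Lemma jensen_cube (f : R -> R) : continuous f -> (forall r, 0 <= f r) ->
  mean f ^+ 3 <= mean (fun r => f r ^+ 3).
Proof.
move=> cf f0; apply: (@jensen f (fun x => x ^+ 3) (3 * mean f ^+ 2)) => //.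
  exact: exprn_continuous.
have : 0 <= mean f by apply: Rintegral_ge0 => r _; rewrite mulr_ge0 ?invr_ge0// ltW.
move: (mean f) => M M0 r; rewrite /= -subr_ge0.
have -> : f r ^+ 3 - (M ^+ 3 + 3 * M ^+ 2 * (f r - M)) = (f r - M) ^+ 2 * (f r + 2 * M) by ring.
by rewrite mulr_ge0 ?sqr_ge0// addr_ge0// mulr_ge0.
Qed.

Lemma jensen_pow6 (f : R -> R) : continuous f -> (forall r, 0 <= f r) ->
  mean f ^+ 6 <= mean (fun r => f r ^+ 6).
Proof.
move=> cf f0; have c2 : continuous (fun r => f r ^+ 2).
  by move=> r; apply: (@continuous_comp _ _ _ f (fun x => x ^+ 2)); [exact: cf|exact: exprn_continuous].
have -> : (fun r => dl^-1 * f r ^+ 6) = (fun r => dl^-1 * (f r ^+ 2) ^+ 3).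
  by apply/funext => r; rewrite -exprM.
apply: le_trans (jensen_cube c2 (fun r => sqr_ge0 _)).
rewrite -[6%N]/(2 * 3)%N exprM; apply: lerXn2r; last exact: jensen_sqr.
  by rewrite nnegrE sqr_ge0.
by rewrite nnegrE; apply: Rintegral_ge0 => r _; rewrite mulr_ge0 ?invr_ge0 ?sqr_ge0// ltW.
Qed.

End Jensen.

Lemma mul3_le_cubes {R : realType} (x y z : R) : 0 <= x -> 0 <= y -> 0 <= z ->
  x * y * z <= x ^+ 3 + y ^+ 3 + z ^+ 3.
Proof.
move=> x0 y0 z0; pose t := Num.max x (Num.max y z).
have xt : x <= t by rewrite le_max lexx.
have yt : y <= t by rewrite !le_max lexx orbT.
have zt : z <= t by rewrite !le_max lexx !orbT.
apply: (@le_trans _ _ (t ^+ 3)).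
  by rewrite exprS expr2 mulrA; apply: ler_pM => //; [rewrite mulr_ge0|apply: ler_pM].
have x3 := exprn_ge0 3 x0; have y3 := exprn_ge0 3 y0; have z3 := exprn_ge0 3 z0.
by rewrite /t /Num.max; case: ifP => _; [case: ifP => _|]; lra.
Qed.

Section StageMoments.
Context {R : realType} {d : measure_display} {Omega : measurableType d}.
Variables (P : probability Omega R) (beta b : R -> {RV P >-> R}).
Hypotheses (hbeta : brownian_motion beta) (hb : regular_modification beta b).
Local Notation F := (augmented_filtration P (fun r => beta r)).
Local Notation mu := (@lebesgue_measure R).
Local Notation RT := (measurableTypeR R).
Variables (a : bool) (C T : R).
Hypotheses (C0 : 0 <= C) (T0 : 0 <= T).
Local Notation g c s w := (pgain b a c s w).

(** A common majorant of the factors in the stage bounds: powers of the gain, the source, and the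
    exponential. The weight [dl^-1 ^+ 3] keeps its mean bounded, because a gain over a stage is of
    order [sqrt dl]. *)
Definition jfun (dl h x : R) : R := (1 + `|gain a h x|) ^+ 12 +
  dl^-1 ^+ 3 * (`|gain a h x| + dl * `|kap a h x|) ^+ 6 + expR (6 * C * dl * `|kap a h x|).
Definition jproc c dl s w := jfun dl (s - c) (b s w - b c w).

Lemma jfun_ge0 dl h x : 0 < dl -> 0 <= jfun dl h x.
Proof.
move=> dl0; rewrite addr_ge0 ?expR_ge0// addr_ge0 ?exprn_ge0 ?addr_ge0//.
by rewrite mulr_ge0 ?exprn_ge0 ?invr_ge0 ?addr_ge0 ?mulr_ge0// ltW.
Qed.

Lemma continuous_jproc c dl w : continuous (fun s => jproc c dl s w).
Proof.
have cg : continuous (fun s => `|g c s w|).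
  by move=> s; exact: (cvg_norm (@continuous_pgain_r _ _ _ _ _ _ hb a c w s)).
have ck : continuous (fun s => `|pkap b a c s w|).
  by move=> s; exact: (cvg_norm (@continuous_pkap _ _ _ _ _ _ hb a c w s)).
have cX (f : R -> R) k : continuous f -> continuous (fun s => f s ^+ k).
  by move=> cf s; apply: (@continuous_comp _ _ _ f (fun x => x ^+ k)); [exact: cf|exact: exprn_continuous].
have cZ (f : R -> R) x : continuous f -> continuous (fun s => x * f s).
  by move=> cf s; apply: cvgM; [exact: cvg_cst|exact: cf].
have cD (f f' : R -> R) : continuous f -> continuous f' -> continuous (fun s => f s + f' s).
  by move=> cf cf' s; apply: cvgD; [exact: cf|exact: cf'].
apply: (cD); [apply: (cD)|].
- by apply: cX; apply: cD => // s; exact: cvg_cst.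
- by apply: (cZ); apply: cX; apply: (cD) => //; exact: cZ.
- move=> s; apply: (@continuous_comp _ _ _ (fun s => 6 * C * dl * `|pkap b a c s w|) expR).
    exact: cZ.
  exact: continuous_expR.
Qed.

Lemma measurable_jfun dl h : measurable_fun setT (jfun dl h).
Proof.
have mg := @measurable_gain R a h.
have mk : measurable_fun setT (kap a h).
  have -> : kap a h = (fun x => - a%:R + (1 - a%:R) * gain a h x) by apply/funext => x; rewrite kapE.
  by meas.
have m1 := measurable_fun_norm mg; have m2 := measurable_fun_norm mk.
rewrite /jfun; apply: measurable_funD; last by apply: measurable_fun_expR; meas.
by apply: measurable_funD; meas.
Qed.

Lemma jproc_mean : exists2 D, 0 <= D & forall c dl s, 0 <= c -> 0 < dl <= T ->
  c <= s <= c + dl -> (\int[P]_w (jproc c dl s w)%:E <= D%:E)%E.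
Proof.
have [D6 D60 h6] := gain_moment (rm_bm hb) a 6 T0.
have [D3 D30 h3] := gain_moment (rm_bm hb) a 3 T0.
have T60 : 0 <= 6 * C * T by rewrite !mulr_ge0.
have [De De0 he] := kap_exp (rm_bm hb) a T0 T60.
pose D := 2 ^+ 12 * (1 + D6 * T ^+ 6) + 2 ^+ 6 * ((1 + T) ^+ 6 * D3 + T ^+ 3) + De.
have D0 : 0 <= D by rewrite !addr_ge0 ?mulr_ge0 ?addr_ge0 ?mulr_ge0 ?exprn_ge0 ?addr_ge0.
exists D => // c dl s c0 /andP[dl0 dlT] /andP[cs sd].
have sc : s - c <= dl by rewrite lerBlDl.
have sT : s - c <= T by exact: le_trans dlT.
have cs0 : 0 <= c <= s by rewrite c0.
have mg : measurable_fun setT (fun w => g c s w) by exact: measurable_pgain.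
have mk : measurable_fun setT (fun w => pkap b a c s w).
  by have -> : (fun w => pkap b a c s w) = (fun w => - a%:R + (1 - a%:R) * g c s w);
    [apply/funext => w; rewrite /pkap kapE|meas].
have mgn := measurable_fun_norm mg; have mkn := measurable_fun_norm mk.
pose X w := 2 ^+ 12 * (1 + `|g c s w| ^+ 12).
pose Y w := 2 ^+ 6 * ((1 + T) ^+ 6 * (dl^-1 ^+ 3 * `|g c s w| ^+ 6) + T ^+ 3).
pose Z w := expR (6 * C * T * `|pkap b a c s w|).
have mX : measurable_fun setT X by rewrite /X; meas.
have mY : measurable_fun setT Y by rewrite /Y; meas.
have mZ : measurable_fun setT Z by apply: measurable_fun_expR; meas.
have idl : 0 <= dl^-1 by rewrite invr_ge0 ltW.
have X0 w : 0 <= X w by rewrite mulr_ge0 ?addr_ge0 ?exprn_ge0.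
have Y0 w : 0 <= Y w.
  by rewrite mulr_ge0 ?exprn_ge0// addr_ge0 ?exprn_ge0// mulr_ge0 ?exprn_ge0 ?addr_ge0// mulr_ge0 ?exprn_ge0.
have Z0 w : 0 <= Z w by exact: expR_ge0.
apply: (@le_trans _ _ (\int[P]_w (X w + Y w + Z w)%:E)%E).
  apply: ge0_le_integral_EFin => //.
  - by apply: measurableT_comp; [exact: measurable_jfun|exact: measurable_increment].
  - by meas.
  - by move=> w _; exact: jfun_ge0.
  - move=> w _; apply: lerD; [apply: lerD|].
    + by apply: le_trans (exprD_le _ _ _) _ => //; rewrite expr1n.
    (* As [|kap| <= 1 + |gain|], the source is at most [(1 + T) |gain| + dl], whose sixth power has
       mean of order [dl ^+ 3]. *)
    + have k1 := kap_le a (s - c) (b s w - b c w); have dk := ler_wpM2l (ltW dl0) k1.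
      set G := `|gain _ _ _| in k1 dk *; have G0 : 0 <= G by exact: normr_ge0.
      set k := `|kap _ _ _| in k1 dk *; have k0 : 0 <= k by exact: normr_ge0.
      apply: (@le_trans _ _ (dl^-1 ^+ 3 * ((1 + T) * G + dl) ^+ 6)).
        rewrite ler_wpM2l ?exprn_ge0// lerXn2r ?nnegrE//.
        * by rewrite addr_ge0// mulr_ge0// ltW.
        * by rewrite addr_ge0// ?mulr_ge0 ?addr_ge0// ltW.
        * by have h : dl * G <= T * G; [rewrite ler_wpM2r|move: dk h; clear; lra].
      apply: (@le_trans _ _ (dl^-1 ^+ 3 * (2 ^+ 6 * (((1 + T) * G) ^+ 6 + dl ^+ 6)))).
        by rewrite ler_wpM2l ?exprn_ge0// exprD_le// ?mulr_ge0 ?addr_ge0// ltW.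
      rewrite mulrCA ler_wpM2l ?exprn_ge0// mulrDr exprMn mulrCA lerD2l.
      have -> : dl^-1 ^+ 3 * dl ^+ 6 = dl ^+ 3 by field; rewrite gt_eqF.
      by rewrite lerXn2r// nnegrE// ltW.
    + by rewrite ler_expR ler_wpM2r// ler_wpM2l// mulr_ge0.
have mG6 : measurable_fun setT (fun w => `|g c s w| ^+ 6) by meas.
have mG12 : measurable_fun setT (fun w => `|g c s w| ^+ 12) by meas.
have iX : (\int[P]_w (X w)%:E <= (2 ^+ 12 * (1 + D6 * T ^+ 6))%:E)%E.
  rewrite /X ge0_integralZ_EFin//; try by [meas|move=> w _; rewrite addr_ge0 ?exprn_ge0].
  rewrite (EFinM (2 ^+ 12)) lee_pmul2l//= ?lte_fin ?exprn_gt0//.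
  rewrite ge0_integralD_EFin//; try by move=> w _; rewrite exprn_ge0.
  rewrite integral_cst//= probability_setT mule1 (EFinD 1) leeD2l//.
  apply: le_trans (h6 _ _ cs0 sT) _; rewrite lee_fin ler_wpM2l// lerXn2r ?nnegrE ?subr_ge0//.
have iY : (\int[P]_w (Y w)%:E <= (2 ^+ 6 * ((1 + T) ^+ 6 * D3 + T ^+ 3))%:E)%E.
  have q0 w : 0 <= dl^-1 ^+ 3 * `|g c s w| ^+ 6 by rewrite mulr_ge0 ?exprn_ge0.
  have mq : measurable_fun setT (fun w => dl^-1 ^+ 3 * `|g c s w| ^+ 6) by meas.
  have mq' : measurable_fun setT (fun w => (1 + T) ^+ 6 * (dl^-1 ^+ 3 * `|g c s w| ^+ 6)) by meas.
  have q'0 w : 0 <= (1 + T) ^+ 6 * (dl^-1 ^+ 3 * `|g c s w| ^+ 6).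
    by rewrite mulr_ge0// exprn_ge0// addr_ge0.
  rewrite /Y ge0_integralZ_EFin//; try by [meas|move=> w _; rewrite addr_ge0 ?exprn_ge0].
  rewrite (EFinM (2 ^+ 6)) lee_pmul2l//= ?lte_fin ?exprn_gt0//.
  rewrite ge0_integralD_EFin//; try by move=> w _; rewrite exprn_ge0.
  rewrite integral_cst//= probability_setT mule1 (EFinD ((1 + T) ^+ 6 * D3)) leeD2r//.
  rewrite ge0_integralZ_EFin//; try by rewrite exprn_ge0// addr_ge0.
  rewrite (EFinM ((1 + T) ^+ 6) D3) lee_wpmul2l ?lee_fin ?exprn_ge0 ?addr_ge0//.
  rewrite ge0_integralZ_EFin ?exprn_ge0//.
  apply: (@le_trans _ _ ((dl^-1 ^+ 3)%:E * (D3 * (s - c) ^+ 3)%:E)%E).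
    by apply: lee_wpmul2l; [rewrite lee_fin exprn_ge0|exact: h3].
  rewrite -EFinM lee_fin mulrCA -[leRHS]mulr1 ler_wpM2l// -exprMn -[leRHS](expr1n _ 3).
  rewrite lerXn2r ?nnegrE ?mulr_ge0 ?subr_ge0//.
  by rewrite ler_pdivrMl// mulr1.
have mXY : measurable_fun setT (fun w => X w + Y w) by meas.
rewrite (ge0_integralD_EFin P measurableT mXY mZ)//; last by move=> w _; rewrite addr_ge0.
rewrite ge0_integralD_EFin// /D 2!EFinD; apply: leeD; first exact: leeD.
exact: he.
Qed.

Variables (m n : nat).

(** [V] is known at time [c] and [jproc] depends on an increment after [c], so the means multiply;
    the time average is handled by Tonelli. Thanks to independence the second moment of [V]
    suffices. *)
Lemma jproc_weighted : exists2 D, 0 <= D & forall c dl s (V : Omega -> R), 0 <= c -> 0 < dl <= T ->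
  c <= s <= c + dl -> wrt_measurable (F c) V ->
  (\int[P]_w (V w ^+ 2 * (jproc c dl s w +
     \int[mu]_(r in `]c, (c + dl)%R[) (dl^-1 * jproc c dl r w)))%:E
   <= D%:E * \int[P]_w (V w ^+ 2)%:E)%E.
Proof.
have [D D0 hD] := jproc_mean; exists (2 * D); first by rewrite mulr_ge0.
move=> c dl s V c0 /[dup] dlT /andP[dl0 _] cs aV.
have mV : measurable_fun setT V by exact: wrt_measurable_fun aV.
have idl : 0 <= dl^-1 by rewrite invr_ge0 ltW.
have cd : c <= c + dl by rewrite lerDl ltW.
have one r : c <= r <= c + dl -> (\int[P]_w (V w ^+ 2 * jproc c dl r w)%:E <=
    D%:E * \int[P]_w (V w ^+ 2)%:E)%E.
  move=> /[dup] cr /andP[cr1 _]; have cr0 : 0 <= c <= r by rewrite c0.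
  rewrite (expect_indep_rm hbeta hb cr0 aV (f := fun x => x ^+ 2)); last 4 first.
  - exact: exprn_measurable.
  - exact: measurable_jfun.
  - by move=> x; exact: sqr_ge0.
  - by move=> x; exact: jfun_ge0.
  rewrite muleC lee_wpmul2r//; last exact: hD.
  by apply: integral_ge0_EFin => w _; exact: sqr_ge0.
have mJ : measurable_fun setT (fun z : RT * Omega => jproc c dl z.1 z.2).
  apply: (@measurable_continuous_process _ _ _ (jproc c dl)) => [w|r].
    exact: continuous_jproc.
  by apply: measurableT_comp; [exact: measurable_jfun|exact: measurable_increment].
have mJs r : measurable_fun setT (jproc c dl r).
  by apply: measurableT_comp; [exact: measurable_jfun|exact: measurable_increment].
pose f r w := V w ^+ 2 * (dl^-1 * jproc c dl r w).
have mf : measurable_fun setT (fun z : RT * Omega => f z.1 z.2).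
  have mV2 : measurable_fun setT (fun z : RT * Omega => V z.2) by exact: measurableT_comp.
  by rewrite /f; meas.
have f0 r w : 0 <= f r w by rewrite mulr_ge0 ?sqr_ge0// mulr_ge0// jfun_ge0.
have mI : measurable (`]c, (c + dl)%R[%classic : set RT) by exact: measurable_itv.
have fE w : V w ^+ 2 * \int[mu]_(r in `]c, (c + dl)%R[) (dl^-1 * jproc c dl r w) =
    \int[mu]_(r in `]c, (c + dl)%R[) f r w.
  rewrite /f (@continuous_RintegralZ _ _ _ (fun r => dl^-1 * jproc c dl r w) (V w ^+ 2))//.
  by move=> r; apply: cvgM; [exact: cvg_cst|exact: continuous_jproc].
have mfi : measurable_fun setT (fun w => \int[mu]_(r in `]c, (c + dl)%R[) f r w).
  exact: measurable_Rintegral.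
under eq_integral do rewrite mulrDr fE.
rewrite ge0_integralD_EFin//; first last.
- by move=> w _; apply: Rintegral_ge0 => r _.
- by move=> w _; rewrite mulr_ge0 ?sqr_ge0// jfun_ge0.
- by apply: measurable_funM; [exact: measurable_funX|exact: mJs].
have -> : 2 * D = D + D by ring.
rewrite EFinD ge0_muleDl ?lee_fin//; apply: leeD; first exact: one.
have -> : (\int[P]_w (\int[mu]_(r in `]c, (c + dl)%R[) f r w)%:E =
    \int[P]_w \int[mu]_(r in `]c, (c + dl)%R[) (f r w)%:E)%E.
  apply: eq_integral => w _; rewrite Rintegral_EFin//.
  apply: continuous_integrable => r; apply: cvgM; first exact: cvg_cst.
  by apply: cvgM; [exact: cvg_cst|exact: continuous_jproc].
have mfD : measurable_fun (`]c, (c + dl)%R[ `*` [set: Omega]) (fun z : RT * Omega => f z.1 z.2).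
  exact: measurable_funTS.
rewrite -(@tonelli_cylinder _ _ _ P _ f mI mfD)//.
have V0 : (0 <= \int[P]_w (V w ^+ 2)%:E)%E by apply: integral_ge0_EFin => w _; exact: sqr_ge0.
apply: (@le_trans _ _ (\int[mu]_(r in `]c, (c + dl)%R[) ((dl^-1)%:E * (D%:E * \int[P]_w (V w ^+ 2)%:E)))%E).
  apply: ge0_le_integral => //.
  - by move=> r _; apply: integral_ge0_EFin.
  - exact: (@measurable_section_integral _ _ _ P _ f mI mfD).
  - move=> r; rewrite /= in_itv/= => /andP[cr rd].
    have := one r; rewrite (ltW cr) (ltW rd) => /(_ isT) h.
    have -> : (\int[P]_w (f r w)%:E = (dl^-1)%:E * \int[P]_w (V w ^+ 2 * jproc c dl r w)%:E)%E.
      rewrite -ge0_integralZ_EFin//; first by under eq_integral do rewrite /f mulrCA.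
        by apply: measurable_funM; [exact: measurable_funX|exact: mJs].
      by move=> w _; rewrite mulr_ge0 ?sqr_ge0// jfun_ge0.
    by apply: lee_wpmul2l => //; rewrite lee_fin.
rewrite integral_cst//= lebesgue_measure_oo// [c + dl]addrC addrK.
by rewrite muleAC -EFinM mulVf ?gt_eqF// mul1e.
Qed.


(** A product of three factors is at most the sum of their cubes, and Jensen moves the sixth powers
    inside the time averages. In the first bound the source is divided by [sqrt dl], which releases
    the factor [dl] of the contraction. *)
Lemma stage_size_bounds : exists2 D, 0 <= D & forall c dl w, 0 < dl <= T ->
  let J s := jproc c dl s w + \int[mu]_(r in `]c, (c + dl)%R[) (dl^-1 * jproc c dl r w) in
  (1 + `|g c (c + dl) w|) ^+ 2 * stage_size b a C c dl w ^+ 2 <= dl * J (c + dl) /\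
  forall s, (1 + `|g c s w|) ^+ 4 * (1 + stage_size b a C c dl w) ^+ 2 <= D * J s.
Proof.
have T30 : 0 <= T ^+ 3 by exact: exprn_ge0.
exists (4 + 2 * T ^+ 3); first by rewrite addr_ge0// mulr_ge0.
move=> c dl w /andP[dl0 dlT] J.
have idl : 0 <= dl^-1 by rewrite invr_ge0 ltW.
pose h r := `|g c r w| + dl * `|pkap b a c r w|.
have h0 r : 0 <= h r by rewrite addr_ge0// mulr_ge0// ltW.
have ck : continuous (fun s => `|pkap b a c s w|).
  by move=> s; exact: (cvg_norm (@continuous_pkap _ _ _ _ _ _ hb a c w s)).
have ch : continuous h.
  move=> s; apply: cvgD; first exact: (cvg_norm (@continuous_pgain_r _ _ _ _ _ _ hb a c w s)).
  by apply: cvgM; [exact: cvg_cst|exact: ck].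
pose x := \int[mu]_(r in `]c, (c + dl)%R[) (dl^-1 * h r).
pose y := expR (C * \int[mu]_(r in `]c, (c + dl)%R[) `|pkap b a c r w|).
pose mj := \int[mu]_(r in `]c, (c + dl)%R[) (dl^-1 * jproc c dl r w).
have sE : stage_size b a C c dl w = x * y by [].
have x0 : 0 <= x by apply: Rintegral_ge0 => r _; rewrite mulr_ge0.
have y0 : 0 <= y by exact: expR_ge0.
have j0 r : 0 <= jproc c dl r w by exact: jfun_ge0.
have mj0 : 0 <= mj by apply: Rintegral_ge0 => r _; rewrite mulr_ge0.
have cZ (f : R -> R) z : continuous f -> continuous (fun s => z * f s).
  by move=> cf s; apply: cvgM; [exact: cvg_cst|exact: cf].
have cX (f : R -> R) k : continuous f -> continuous (fun s => f s ^+ k).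
  by move=> cf s; apply: (@continuous_comp _ _ _ f (fun x => x ^+ k)); [exact: cf|exact: exprn_continuous].
pose e r := expR (6 * C * dl * `|pkap b a c r w|).
have ce : continuous e.
  move=> s; apply: (@continuous_comp _ _ _ (fun s => 6 * C * dl * `|pkap b a c s w|) expR).
    exact: cZ.
  exact: continuous_expR.
(* Jensen for the sixth power of the averaged source and for the exponential; the rate [6 * C * dl]
   in [jfun] is chosen for this. *)
have mxy : dl^-1 ^+ 3 * x ^+ 6 + y ^+ 6 <= mj.
  have m1 : x ^+ 6 <= \int[mu]_(r in `]c, (c + dl)%R[) (dl^-1 * h r ^+ 6) by exact: jensen_pow6.
  have m2 : y ^+ 6 <= \int[mu]_(r in `]c, (c + dl)%R[) (dl^-1 * e r).
    have -> : y ^+ 6 = expR (\int[mu]_(r in `]c, (c + dl)%R[)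
        (dl^-1 * (6 * C * dl * `|pkap b a c r w|))).
      rewrite /y -expRM_natl; congr expR; rewrite mulrA -continuous_RintegralZ//.
      by apply: eq_Rintegral => r _; field; rewrite gt_eqF.
    by apply: jensen_expR => //; exact: cZ.
  apply: (@le_trans _ _ (dl^-1 ^+ 3 * \int[mu]_(r in `]c, (c + dl)%R[) (dl^-1 * h r ^+ 6) +
      \int[mu]_(r in `]c, (c + dl)%R[) (dl^-1 * e r))).
    by apply: lerD => //; rewrite ler_wpM2l// exprn_ge0.
  have c6 : continuous (fun r => dl^-1 * h r ^+ 6) by apply: cZ; exact: cX.
  have cee : continuous (fun r => dl^-1 * e r) by exact: cZ.
  rewrite -continuous_RintegralZ// -RintegralD//; last 2 first.
  - by apply: continuous_integrable; exact: cZ.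
  - exact: continuous_integrable.
  apply: continuous_le_Rintegral.
  - by move=> r; apply: cvgD; [exact: (cZ _ (dl^-1 ^+ 3) c6 r)|exact: cee].
  - by apply: cZ; exact: continuous_jproc.
  - move=> r _; rewrite mulrCA -mulrDr ler_wpM2l// /jproc /jfun -addrA lerDr.
    by rewrite exprn_ge0// addr_ge0.
have i30 : 0 <= dl^-1 ^+ 3 by exact: exprn_ge0.
have x60 : 0 <= x ^+ 6 by exact: exprn_ge0.
have y60 : 0 <= y ^+ 6 by exact: exprn_ge0.
have G12 s : (1 + `|g c s w|) ^+ 12 <= jproc c dl s w.
  rewrite /jproc /jfun -addrA lerDl addr_ge0 ?expR_ge0// mulr_ge0// exprn_ge0//.
  exact: (h0 s).
have x6 : x ^+ 6 <= T ^+ 3 * (dl^-1 ^+ 3 * x ^+ 6).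
  rewrite mulrA ler_peMl// -exprMn exprn_ege1// ler_pdivlMr// mul1r//.
split.
  rewrite sE exprMn mulrA; set G := 1 + _; have G1 : 1 <= G by rewrite lerDl.
  have G0 : 0 <= G by exact: le_trans G1.
  have := mul3_le_cubes (sqr_ge0 G) (mulr_ge0 idl (sqr_ge0 x)) (sqr_ge0 y).
  rewrite -!exprM => m3.
  have -> : G ^+ 2 * x ^+ 2 * y ^+ 2 = dl * (G ^+ 2 * (dl^-1 * x ^+ 2) * y ^+ 2).
    by field; rewrite gt_eqF.
  rewrite ler_pM2l//; apply: le_trans m3 _.
  have G6 : G ^+ (2 * 3) <= jproc c dl (c + dl) w.
    by apply: le_trans (G12 _); rewrite ler_weXn2l.
  rewrite -addrA exprMn -[(x ^+ 2) ^+ 3]exprM; exact: (lerD G6 mxy).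
move=> s; rewrite sE /J -/mj; set G := 1 + _; have G1 : 1 <= G by rewrite lerDl.
have G0 : 0 <= G by exact: le_trans G1.
have q : (1 + x * y) ^+ 2 <= 2 * (1 + x ^+ 2 * y ^+ 2).
  have := sqr_ge0 (1 - x * y); rewrite sqrrB sqrrD expr1n mul1r exprMn; lra.
apply: le_trans (ler_wpM2l (exprn_ge0 4 G0) q) _.
have := mul3_le_cubes (exprn_ge0 4 G0) (sqr_ge0 x) (sqr_ge0 y); rewrite -!exprM => m3.
have G4 : G ^+ 4 <= G ^+ 12 by rewrite ler_weXn2l.
have := G12 s; rewrite -/G => Gj.
have T3j := mulr_ge0 T30 (j0 s); have T3m := mulr_ge0 T30 mj0.
have T3y := mulr_ge0 T30 y60.
have T3mxy := ler_wpM2l T30 mxy; rewrite mulrDr in T3mxy.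
have ix := mulr_ge0 i30 x60.
have -> : G ^+ 4 * (2 * (1 + x ^+ 2 * y ^+ 2)) = 2 * G ^+ 4 + 2 * (G ^+ 4 * x ^+ 2 * y ^+ 2) by ring.
have -> : (4 + 2 * T ^+ 3) * (jproc c dl s w + mj) =
   4 * jproc c dl s w + 4 * mj + 2 * (T ^+ 3 * jproc c dl s w) + 2 * (T ^+ 3 * mj) by ring.
move: m3 G4 Gj T3j T3m T3y T3mxy ix x6 mxy j0 mj0; rewrite /=.
move: (G ^+ 4 * x ^+ 2 * y ^+ 2) (G ^+ (4 * 3)) (G ^+ 12) (G ^+ 4).
move=> *; lra.
Qed.

End StageMoments.

Lemma measurable_mx1norm {R : realType} {d : measure_display} {Omega : measurableType d}
    (p q : nat) (D : set Omega) (X : Omega -> 'M[R]_(p, q)) :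
  (forall i j, measurable_fun D (fun w => X w i j)) ->
  measurable_fun D (fun w => mx1norm (X w)).
Proof.
move=> mX; apply: measurable_sum => i; apply: measurable_sum => j.
exact: measurable_fun_norm.
Qed.

Section Moments.
Context {R : realType} {d : measure_display} {Omega : measurableType d}.
Variables (P : probability Omega R) (beta b : R -> {RV P >-> R}).
Hypotheses (hbeta : brownian_motion beta) (hb : regular_modification beta b).
Local Notation F := (augmented_filtration P (fun r => beta r)).
Local Notation mu := (@lebesgue_measure R).
Local Notation RT := (measurableTypeR R).
Variables (a : bool) (m N : nat).
Local Notation n := N.+2.
Variables (A : 'M[R]_n) (B : 'M[R]_(n, m)) (K : 'M[R]_(m, n)) (C T : R).
Hypotheses (C0 : 0 <= C) (T0 : 0 <= T).
Local Notation g c s w := (pgain b a c s w).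
Local Notation sigma := (B *m K).

(** The squared pathwise bounds are the squared norm of [U] times functions of increments after [c],
    so [jproc_weighted] applies. The first estimate is the contraction, the others record the price
    [dl^-1 ^+ 2] of the stage. *)
Lemma stage_moments : exists2 D, 0 <= D & forall c dl (U U' : Omega -> 'M[R]_(m, n))
    (Y psi : R -> Omega -> 'cV[R]_n) (u : R -> Omega -> 'cV[R]_m),
  0 <= c -> 0 < dl <= T -> (forall i j, wrt_measurable (F c) (fun w => U w i j)) ->
  stage_solution beta b a A B K C c dl U U' Y psi u ->
  (\int[P]_w (mx1norm (U' w) ^+ 2)%:E <= (D * dl)%:E * \int[P]_w (mx1norm (U w) ^+ 2)%:E)%E /\
  forall s, c <= s <= c + dl ->
  [/\ (\int[P]_w (mx1norm (Y s w + g c s w *: (sigma *m Y s w)) ^+ 2)%:E <=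
       (D * dl^-1 ^+ 2)%:E * \int[P]_w (mx1norm (U w) ^+ 2)%:E)%E,
      (\int[P]_w (mx1norm (u s w) ^+ 2)%:E <=
       (D * dl^-1 ^+ 2)%:E * \int[P]_w (mx1norm (U w) ^+ 2)%:E)%E &
      (\int[P]_w (((1 + `|g c s w|) * mx1norm (psi s w)) ^+ 2)%:E <=
       (D * dl^-1 ^+ 2)%:E * \int[P]_w (mx1norm (U w) ^+ 2)%:E)%E].
Proof.
have [D1 D10 hD1] := jproc_weighted hbeta hb a C0 T0.
have [D2 D20 hD2] := stage_size_bounds hb a C T0.
exists (C ^+ 2 * (1 + D2) * D1).
  by rewrite !mulr_ge0 ?addr_ge0 ?sqr_ge0.
move=> c dl U U' Y psi u c0 /[dup] dlT /andP[dl0 _] aU S.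
pose V w := mx1norm (U w).
have aV : wrt_measurable (F c) V.
  by apply/wrt_measurableP; apply: measurable_mx1norm => i j; apply/wrt_measurableP.
have mV : measurable_fun setT V by exact: wrt_measurable_fun aV.
have V0 w : 0 <= V w by exact: mx1norm_ge0.
have cd : c <= c + dl by rewrite lerDl ltW.
pose J s w := jproc b a C c dl s w +
  \int[mu]_(r in `]c, (c + dl)%R[) (dl^-1 * jproc b a C c dl r w).
have idl : 0 <= dl^-1 by rewrite invr_ge0 ltW.
have J0 s w : 0 <= J s w.
  rewrite addr_ge0 ?jfun_ge0//; apply: Rintegral_ge0 => r _.
  by rewrite mulr_ge0// jfun_ge0.
have mJs s : measurable_fun setT (jproc b a C c dl s).
  by apply: measurableT_comp; [exact: measurable_jfun|exact: measurable_increment].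
have mJ s : measurable_fun setT (J s).
  apply: measurable_funD; first exact: mJs.
  apply: (@measurable_Rintegral _ _ _ _ (fun r w => dl^-1 * jproc b a C c dl r w)).
    exact: measurable_itv.
  have mj : measurable_fun setT (fun z : RT * Omega => jproc b a C c dl z.1 z.2).
    apply: (@measurable_continuous_process _ _ _ (jproc b a C c dl)) => [w|r]; last exact: mJs.
    exact: (@continuous_jproc _ _ _ _ _ _ hb a C c dl w).
  by meas.
have mg s : measurable_fun setT (fun w => g c s w) by exact: measurable_pgain.
have key k (f : Omega -> R) s : 0 <= k -> c <= s <= c + dl -> measurable_fun setT f ->
    (forall w, f w ^+ 2 <= k * (V w ^+ 2 * J s w)) ->
    (\int[P]_w (f w ^+ 2)%:E <= (k * D1)%:E * \int[P]_w (V w ^+ 2)%:E)%E.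
  move=> k0 cs mf hf.
  have mVJ : measurable_fun setT (fun w => V w ^+ 2 * J s w).
    by apply: measurable_funM; [exact: measurable_funX|exact: mJ].
  apply: (@le_trans _ _ (\int[P]_w (k * (V w ^+ 2 * J s w))%:E)%E).
    apply: ge0_le_integral_EFin => //; [by meas|by meas|].
    by move=> w _; exact: sqr_ge0.
  rewrite ge0_integralZ_EFin//; last by move=> w _; rewrite mulr_ge0 ?sqr_ge0.
  by rewrite EFinM -muleA lee_wpmul2l ?lee_fin//; exact: hD1.
have size0 w : 0 <= stage_size b a C c dl w.
  rewrite mulr_ge0 ?expR_ge0//; apply: Rintegral_ge0 => r _.
  by rewrite mulr_ge0// addr_ge0// mulr_ge0// ltW.
split.
  have -> : C ^+ 2 * (1 + D2) * D1 * dl = (C ^+ 2 * (1 + D2) * dl) * D1 by ring.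
  apply: (key _ _ (c + dl)).
  - by rewrite !mulr_ge0 ?addr_ge0 ?sqr_ge0// ltW.
  - by rewrite lexx andbT.
  - apply: measurable_mx1norm => i j.
    by apply: (wrt_measurable_fun (stage_out_measurable S i j)).
  - move=> w; have hU := stage_out_bound S w; have [h1 _] := hD2 c dl w dlT.
    apply: (@le_trans _ _ ((C * (1 + `|g c (c + dl) w|) * (V w * stage_size b a C c dl w)) ^+ 2)).
      apply: lerXn2r; rewrite ?nnegrE ?mx1norm_ge0//.
      exact: le_trans (mx1norm_ge0 _) hU.
    have -> : (C * (1 + `|g c (c + dl) w|) * (V w * stage_size b a C c dl w)) ^+ 2 =
      C ^+ 2 * V w ^+ 2 * ((1 + `|g c (c + dl) w|) ^+ 2 * stage_size b a C c dl w ^+ 2) by ring.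
    have CV : 0 <= C ^+ 2 * V w ^+ 2 by rewrite mulr_ge0 ?sqr_ge0.
    apply: le_trans (ler_wpM2l CV h1) _; rewrite -/(J (c + dl) w).
    have -> : C ^+ 2 * (1 + D2) * dl * (V w ^+ 2 * J (c + dl) w) =
      C ^+ 2 * V w ^+ 2 * (dl * J (c + dl) w) * (1 + D2) by ring.
    by rewrite ler_peMr ?lerDl// !mulr_ge0 ?sqr_ge0// ltW.
move=> s cs.
have DE : C ^+ 2 * (1 + D2) * D1 * dl^-1 ^+ 2 = (C ^+ 2 * (1 + D2) * dl^-1 ^+ 2) * D1 by ring.
have key2 (f : Omega -> R) : measurable_fun setT f -> (forall w, 0 <= f w) ->
    (forall w, f w <= C * (dl^-1 * (1 + `|g c s w|) ^+ 2 * (V w * (1 + stage_size b a C c dl w)))) ->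
    (\int[P]_w (f w ^+ 2)%:E <= (C ^+ 2 * (1 + D2) * D1 * dl^-1 ^+ 2)%:E * \int[P]_w (V w ^+ 2)%:E)%E.
  move=> mf f0 hf; rewrite DE; apply: (key _ _ s) => //.
    by rewrite !mulr_ge0 ?addr_ge0 ?sqr_ge0 ?exprn_ge0.
  move=> w; have [_ /(_ s) h1] := hD2 c dl w dlT.
  apply: (@le_trans _ _ ((C * (dl^-1 * (1 + `|g c s w|) ^+ 2 * (V w * (1 + stage_size b a C c dl w)))) ^+ 2)).
    apply: lerXn2r; rewrite ?nnegrE//; exact: le_trans (f0 w) (hf w).
  have -> : (C * (dl^-1 * (1 + `|g c s w|) ^+ 2 * (V w * (1 + stage_size b a C c dl w)))) ^+ 2 =
    C ^+ 2 * dl^-1 ^+ 2 * V w ^+ 2 * ((1 + `|g c s w|) ^+ 4 * (1 + stage_size b a C c dl w) ^+ 2) by ring.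
  have CV : 0 <= C ^+ 2 * dl^-1 ^+ 2 * V w ^+ 2 by rewrite !mulr_ge0 ?sqr_ge0 ?exprn_ge0.
  apply: le_trans (ler_wpM2l CV h1) _; rewrite -/(J s w).
  have -> : C ^+ 2 * (1 + D2) * dl^-1 ^+ 2 * (V w ^+ 2 * J s w) =
    C ^+ 2 * dl^-1 ^+ 2 * V w ^+ 2 * ((1 + D2) * J s w) by ring.
  by rewrite ler_wpM2l// ler_wpM2r// lerDr.
have sc : c <= s by case/andP: cs.
have mreg q (X : R -> Omega -> 'M[R]_(q, 1)) : regular_matrix (P := P) beta c X ->
    measurable_fun setT (fun w => mx1norm (X s w)).
  by move=> rX; apply: measurable_mx1norm => i j; apply: wrt_measurable_fun ((rX i j).2 s sc).
have rY := stage_Y_regular S; have rp := stage_psi_regular S; have ru := stage_u_regular S.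
split; apply: key2.
- apply: (mreg _ (fun s w => Y s w + g c s w *: (sigma *m Y s w))).
  apply: rmxD => //; apply: rmxZ; first exact: regular_pgain.
  by apply: rmxM => //; exact: rmx_cst.
- by move=> w; exact: mx1norm_ge0.
- by move=> w; have [h _ _] := stage_bound S w cs.
- exact: mreg.
- by move=> w; exact: mx1norm_ge0.
- by move=> w; have [_ h _] := stage_bound S w cs.
- apply: measurable_funM; last exact: mreg.
  by have := measurable_fun_norm (mg s) => h; meas.
- by move=> w; rewrite mulr_ge0 ?addr_ge0 ?mx1norm_ge0.
- by move=> w; have [_ _ h] := stage_bound S w cs.
Qed.

End Moments.

(** * The dyadic time grid and the gluing of stages *)

Section Grid.
Context {R : realType}.
Variable T : R.
Hypothesis T0 : 0 < T.

Definition stage_len (k : nat) : R := T / 2 ^+ k.+1.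
(** Dyadic times accumulating at [T]. Each stage is half as long as the preceding one, in agreement
    with [scale_mx 2] in [st_out]. *)
Definition stage_time (k : nat) : R := T - T / 2 ^+ k.

Lemma stage_len_gt0 k : 0 < stage_len k.
Proof. by rewrite divr_gt0// exprn_gt0. Qed.

Lemma stage_len_le k : stage_len k <= T.
Proof.
rewrite ler_pdivrMr ?exprn_gt0//; apply: ler_peMr; first exact: ltW.
by apply: exprn_ege1; lra.
Qed.

Lemma stage_lenS k : stage_len k.+1 = stage_len k / 2.
Proof. by rewrite /stage_len [in LHS]exprSr invfM mulrA. Qed.

Lemma stage_time0 : stage_time 0 = 0.
Proof. by rewrite /stage_time expr0 divr1 subrr. Qed.

Lemma stage_timeS k : stage_time k + stage_len k = stage_time k.+1.
Proof.
rewrite /stage_time /stage_len exprS; have p0 : 2 ^+ k != 0 :> R by rewrite expf_neq0.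
by field; rewrite p0.
Qed.

Lemma stage_time_lt k : stage_time k < T.
Proof. by rewrite ltrBlDr ltrDl divr_gt0// exprn_gt0. Qed.

Lemma stage_time_le k : stage_time k <= stage_time k.+1.
Proof. by rewrite -stage_timeS lerDl ltW// stage_len_gt0. Qed.

Lemma stage_time_homo : {homo stage_time : k l / (k <= l)%N >-> k <= l}.
Proof. by apply: homo_leq => //; [exact: le_trans|exact: stage_time_le]. Qed.

Lemma stage_time_ge0 k : 0 <= stage_time k.
Proof. by rewrite -stage_time0; exact: stage_time_homo. Qed.

Lemma stage_time_cofinal s : s < T -> exists k, s < stage_time k.
Proof.
move=> sT; have Ts : 0 < T - s by rewrite subr_gt0.
exists (Num.truncn (T / (T - s))).+1; rewrite /stage_time ltrBrDr -ltrBrDl.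
rewrite ltr_pdivrMr ?exprn_gt0// mulrC -ltr_pdivrMr//.
apply: lt_trans (truncnS_gt _) _; rewrite -natrX ltr_nat; exact: ltn_expl.
Qed.

Lemma stage_find s : 0 <= s < T -> exists k, stage_time k <= s < stage_time k.+1.
Proof.
move=> /andP[s0 sT]; have ex := stage_time_cofinal sT.
have [[|k] ks min] := ex_minnP ex; first by move: ks; rewrite stage_time0 ltNge s0.
exists k; rewrite ks andbT leNgt; apply/negP => /min; by rewrite ltnn.
Qed.

Lemma stage_uniq s k l : stage_time k <= s < stage_time k.+1 ->
  stage_time l <= s < stage_time l.+1 -> k = l.
Proof.
move=> /andP[k1 k2] /andP[l1 l2]; apply/eqP; rewrite eqn_leq; apply/andP; split;
  rewrite leqNgt; apply/negP => /stage_time_homo h.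
- by have := lt_le_trans l2 (le_trans h k1); rewrite ltxx.
- by have := lt_le_trans k2 (le_trans h l1); rewrite ltxx.
Qed.

Definition stage_index s : nat := xget 0%N [set k | stage_time k <= s < stage_time k.+1].

Lemma stage_indexE s k : stage_time k <= s < stage_time k.+1 -> stage_index s = k.
Proof.
rewrite /stage_index => ks; case: xgetP => [l _ /= ls|/(_ k)]; first exact: stage_uniq ls ks.
by move=> /(_ ks).
Qed.

Lemma stage_indexP s : 0 <= s < T -> stage_time (stage_index s) <= s < stage_time (stage_index s).+1.
Proof. by move=> /stage_find[k ks]; rewrite (stage_indexE ks). Qed.

End Grid.

Section Glue.
Context {R : realType} {d : measure_display} {Omega : measurableType d}.
Variables (P : probability Omega R) (beta b : R -> {RV P >-> R}).
Local Notation F := (augmented_filtration P (fun r => beta r)).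
Local Notation FT t := (g_sigma_algebraType
  (natural_filtration (fun r => beta r) t `|` [set N | measurable N /\ P N = 0%E])).
Local Notation RT := (measurableTypeR R).
Local Notation mu := (@lebesgue_measure R).
Variable T : R.
Hypothesis T0 : 0 < T.
Local Notation tk := (stage_time T).

(** The value 0 outside []0, T[] makes path integrals over any interval meaningful and constant
    after [T]. *)
Definition glue (f : nat -> R -> Omega -> R) (s : R) (w : Omega) : R :=
  if 0 < s < T then f (stage_index T s) s w else 0.

Lemma glueE f k s w : 0 < s -> tk k <= s < tk k.+1 -> glue f s w = f k s w.
Proof.
move=> s0 ks; rewrite /glue s0 (stage_indexE T0 ks) /=.
by case/andP: ks => _ /lt_trans -> //; exact: stage_time_lt.
Qed.

Variable f : nat -> R -> Omega -> R.
Hypothesis rf : forall k, regular_process (P := P) beta (tk k) (f k).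

Lemma glue_adapted s : 0 <= s -> wrt_measurable (F s) (glue f s).
Proof.
move=> s0; have [sT|sT] := boolP (0 < s < T); last first.
  have -> : glue f s = (fun=> 0) by apply/funext => w; rewrite /glue (negPf sT).
  exact: wrt_measurable_cst.
have -> : glue f s = f (stage_index T s) s by apply/funext => w; rewrite /glue sT.
have /(stage_indexP T0) /andP[h _] : 0 <= s < T by case/andP: sT => _ ->; rewrite s0.
exact: (rf _).2.
Qed.

Let stage_cover t : t <= T -> (`]0, t[%classic : set RT) =
  \bigcup_k (`]0, t[%classic `&` `[tk k, tk k.+1[%classic : set RT).
Proof.
move=> tT; apply/seteqP; split => [s /= st|s [k _ []]//].
have sT : 0 <= s < T.
  by move: st; rewrite in_itv/= => /andP[/ltW -> /lt_le_trans ->].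
exists (stage_index T s) => //; split=> //=.
by rewrite in_itv/=; exact: stage_indexP.
Qed.

Lemma glue_progressive t : t <= T ->
  measurable_fun (`]0, t[%classic `*` [set: FT t]) (fun z : RT * FT t => glue f z.1 z.2).
Proof.
move=> tT; rewrite (stage_cover tT) setX_bigcupl.
apply/measurable_fun_bigcup => k.
  by apply: measurableX => //; apply: measurableI; exact: measurable_itv.
have [tkt|ttk] := leP (tk k) t.
  have sub : `]0, t[%classic `&` `[tk k, tk k.+1[%classic `<=` `[tk k, t]%classic.
    by move=> s [] /=; rewrite !in_itv/= => /andP[_ /ltW ->] /andP[-> _].
  apply: eq_measurable_fun (regular_progressive tkt sub (rf k)) => -[s w] /set_mem[[/= + ks] _].
  rewrite in_itv/= => /andP[s0 _].
  by rewrite (@glueE f k) //; move: ks; rewrite in_itv.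
have -> : (`]0, t[%classic `&` `[tk k, tk k.+1[%classic : set RT) = set0.
  apply/seteqP; split => // s [] /=; rewrite !in_itv/= => /andP[_ st] /andP[ks _].
  by have := lt_le_trans (lt_trans st ttk) ks; rewrite ltxx.
by rewrite set0X; exact: measurable_fun_set0.
Qed.

Lemma glue_measurable : measurable_fun setT (fun z : RT * Omega => glue f z.1 z.2).
Proof.
have h : measurable_fun (`]0, T[%classic `*` [set: Omega]) (fun z : RT * Omega => glue f z.1 z.2).
  rewrite (stage_cover (lexx T)) setX_bigcupl; apply/measurable_fun_bigcup => k.
    by apply: measurableX => //; apply: measurableI; exact: measurable_itv.
  have sub : `]0, T[%classic `&` `[tk k, tk k.+1[%classic `<=` `[tk k, T]%classic.
    by move=> s [] /=; rewrite !in_itv/= => /andP[_ /ltW ->] /andP[-> _].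
  have tT : tk k <= T by exact/ltW/stage_time_lt.
  apply: eq_measurable_fun (regular_measurable tT sub (rf k)) => -[s w] /set_mem[[/= + ks] _].
  rewrite in_itv/= => /andP[s0 _].
  by rewrite (@glueE f k) //; move: ks; rewrite in_itv.
have mD : measurable (`]0, T[%classic `*` [set: Omega] : set (RT * Omega)) by exact: measurableX.
have := (measurable_restrictT _ mD).1 h; congr (measurable_fun _ _).
apply/funext => -[s w]; rewrite patchE /glue.
case: ifPn => //; rewrite notin_setE => hs; case: ifP => // sT; exfalso; apply: hs.
by split=> //=; rewrite in_itv.
Qed.

Lemma glue_path_adapted t : 0 <= t <= T ->
  wrt_measurable (F t) (fun w => \int[mu]_(s in `]0, t[) glue f s w).
Proof.
move=> /andP[t0 tT]; apply/wrt_measurableP.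
have mD : measurable (`]0, t[%classic `*` [set: FT t] : set (RT * FT t)) by exact: measurableX.
have mI : measurable (`]0, t[%classic : set RT) by exact: measurable_itv.
pose h (s : RT) (w : FT t) := ((fun z : RT * FT t => glue f z.1 z.2) \_
  (`]0, t[%classic `*` [set: FT t])) (s, w).
have mh : measurable_fun setT (fun z : RT * FT t => h z.1 z.2).
  have := (measurable_restrictT _ mD).1 (glue_progressive tT).
  by congr (measurable_fun _ _); apply/funext => -[].
have := measurable_Rintegral mI mh; congr (measurable_fun _ _).
apply/funext => w; apply: eq_Rintegral => s sI; rewrite /h patchE mem_set//.
by split=> //; exact: set_mem.
Qed.

End Glue.

Section SupportedIntegral.
Context {R : realType}.
Local Notation mu := (@lebesgue_measure R).
Variables (T : R) (f : R -> R).
Hypotheses (T0 : 0 < T) (f0 : forall s, ~~ (0 < s < T) -> f s = 0)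
  (fi : mu.-integrable `]0, T[ (fun s => (f s)%:E)).

Lemma supported_integrable D : measurable D -> mu.-integrable D (fun s => (f s)%:E).
Proof.
move=> mD; apply: (@integrableS _ _ _ mu setT) => //.
have mI : measurable (`]0, T[%classic : set (measurableTypeR R)) by exact: measurable_itv.
have := (integrable_mkcond _ mI).1 fi.
congr (mu.-integrable _ _); apply/funext => s; rewrite patchE.
case: ifPn => //; rewrite notin_setE/= in_itv/= => /negP h.
by rewrite f0.
Qed.

Lemma supported_path_continuous : continuous (fun t : R => \int[mu]_(s in `]0, t[) f s).
Proof.
have E t : \int[mu]_(s in `]0, t[) f s =
    (parameterized_integral mu 0 (Num.max 0 (Num.min t T)) f).
  rewrite /parameterized_integral.
  have bound t' : 0 <= t' -> \int[mu]_(s in `]0, t'[) f s = \int[mu]_(s in `[0, t']) f s.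
    move=> t0; rewrite Rintegral_oo_oc; last exact: supported_integrable.
    by rewrite Rintegral_itv_obnd_cbnd//; exact: supported_integrable.
  have [t0|t0] := leP t 0.
    rewrite Rintegral_oo_ge// (min_idPl (le_trans t0 (ltW T0))) (max_idPl t0).
    by rewrite -bound// Rintegral_oo_ge.
  have [tT|Tt] := leP t T; first by rewrite (max_idPr (ltW t0)) bound// ltW.
  rewrite (max_idPr (ltW T0)) -bound ?(ltW T0)//.
  rewrite (@Rintegral_cat _ 0 T t)//; [|exact: ltW|exact: ltW|exact: supported_integrable].
  rewrite -[RHS]addr0; congr (_ + _).
  under eq_Rintegral => s /set_mem.
    rewrite /= in_itv/= => /andP[Ts _]; rewrite f0; last first.
      by rewrite negb_and -!leNgt (ltW Ts) orbT.
    over.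
  by rewrite Rintegral_cst// mul0r.
rewrite (funext E).
apply: (@within_continuous_clamp _ `[0, T]%classic
  (fun x => parameterized_integral mu 0 x f) (fun t => Num.max 0 (Num.min t T))).
- apply: parameterized_integral_continuous; first exact: ltW.
  exact: supported_integrable.
- move=> r; apply: (@continuous_comp _ _ _ (fun r => Num.min r T) (fun r => Num.max 0 r)).
    by apply: continuous_min; [exact: cvg_id|exact: cvg_cst].
  by apply: continuous_max; [exact: cvg_cst|exact: cvg_id].
- by move=> t; rewrite /= in_itv/= le_max lexx ge_max (ltW T0) ge_min lexx orbT.
Qed.

End SupportedIntegral.

Section Prelim.
Context {R : realType} {d : measure_display} {Omega : measurableType d}.
Variables (P : probability Omega R) (beta : R -> Omega -> R).
Local Notation mu := (@lebesgue_measure R).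
Local Notation RT := (measurableTypeR R).

Lemma ito_integral_eq t (f f' : R -> Omega -> R) I :
  (forall s w, 0 < s < t -> f s w = f' s w) ->
  is_ito_integral P beta t f I -> is_ito_integral P beta t f' I.
Proof.
move=> ff [af [mf f2] I2 [S [S1 S2]]].
have ffs s : 0 < s < t -> f s = f' s by move=> st; apply/funext => w; exact: ff.
have E (h : R -> R -> R) : (\int[(mu \x P)%E]_(z in cylinder t) (h (f z.1 z.2) z.1)%:E =
    \int[(mu \x P)%E]_(z in cylinder t) (h (f' z.1 z.2) z.1)%:E)%E.
  apply: eq_integral => -[s w] /set_mem[/= + _]; rewrite in_itv/= => st.
  by rewrite ffs.
split => //.
- by move=> s st; rewrite -ffs; [exact: af|rewrite in_itv/= in st].
- split; last by rewrite -(E (fun x _ => x ^+ 2)).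
  apply: eq_measurable_fun mf => -[s w] /set_mem[/= + _]; rewrite in_itv/= => st.
  by rewrite ffs.
- exists S; split=> //.
  have -> : (fun k => \int[(mu \x P)%E]_(z in cylinder t)
       ((sp_val (S k) z.1 z.2 - f' z.1 z.2) ^+ 2)%:E)%E =
     (fun k => \int[(mu \x P)%E]_(z in cylinder t)
       ((sp_val (S k) z.1 z.2 - f z.1 z.2) ^+ 2)%:E)%E; last by [].
  apply/funext => k; apply: eq_integral => -[s w] /set_mem[/= + _]; rewrite in_itv/= => st.
  by rewrite ffs.
Qed.

Lemma bounded_process_L2 T M (f : R -> Omega -> R) : 0 <= T ->
  measurable_fun (cylinder T) (fun z : RT * Omega => f z.1 z.2) ->
  (forall s, 0 < s < T -> (\int[P]_w (f s w ^+ 2)%:E <= M%:E)%E) -> process_L2 P T f.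
Proof.
move=> T0 mf fM; split => //.
have mD : measurable (`]0, T[%classic : set RT) by exact: measurable_itv.
have m2 : measurable_fun (cylinder T) (fun z : RT * Omega => f z.1 z.2 ^+ 2) by meas.
rewrite (@integral_cylinder1 _ _ _ P _ (fun s w => f s w ^+ 2) mD m2); last first.
  by move=> *; exact: sqr_ge0.
apply: (@le_lt_trans _ _ (\int[mu]_(s in `]0%R, T[) M%:E)%E); last first.
  by rewrite integral_cst//= lebesgue_measure_oo// -EFinM ltry.
have m1 := @measurable_section_integral _ _ _ P _ (fun s w => f s w ^+ 2) mD m2
  (fun _ _ _ => sqr_ge0 _).
have [T00|T00] := leP T 0.
  have -> : (`]0, T[%classic : set RT) = set0.
    by apply/seteqP; split => // s /=; rewrite in_itv/= => /andP[/lt_trans h /h]; rewrite ltNge T00.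
  by rewrite !integral_set0.
have M0 : 0 <= M.
  have h : 0 < T / 2 < T by rewrite divr_gt0//=; lra.
  rewrite -lee_fin; apply: le_trans (fM _ h); apply: integral_ge0_EFin => w _; exact: sqr_ge0.
apply: ge0_le_integral => //.
by move=> s _; apply: integral_ge0_EFin => w _; exact: sqr_ge0.
Qed.

Lemma sqr_integral_le_of (f h : Omega -> R) (M : R) k : 0 <= k ->
  measurable_fun setT f -> measurable_fun setT h ->
  (forall w, `|f w| <= k * h w) -> (\int[P]_w (h w ^+ 2)%:E <= M%:E)%E ->
  (\int[P]_w (f w ^+ 2)%:E <= (k ^+ 2 * M)%:E)%E.
Proof.
move=> k0 mf mh fh hM.
apply: (@le_trans _ _ (\int[P]_w (k ^+ 2 * h w ^+ 2)%:E)%E).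
  apply: ge0_le_integral_EFin => //; [by meas|by meas|by move=> w _; exact: sqr_ge0|].
  move=> w _; rewrite -exprMn -real_normK ?num_real//.
  by apply: lerXn2r; rewrite ?nnegrE//; exact: le_trans (fh w).
rewrite ge0_integralZ_EFin ?sqr_ge0//; [|by meas|by move=> w _; exact: sqr_ge0].
by rewrite (EFinM _ M) lee_wpmul2l// lee_fin sqr_ge0.
Qed.

End Prelim.

(** * The glued process solves the equation and vanishes at T *)

Section GlueSDE.
Context {R : realType} {d : measure_display} {Omega : measurableType d}.
Variables (P : probability Omega R) (beta b : R -> {RV P >-> R}).
Hypotheses (hbeta : brownian_motion beta) (hb : regular_modification beta b).
Local Notation F := (augmented_filtration P (fun r => beta r)).
Local Notation RT := (measurableTypeR R).
Local Notation mu := (@lebesgue_measure R).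
Variables (a : bool) (m n : nat) (A : 'M[R]_n) (B : 'M[R]_(n, m)) (sigma : 'M[R]_n).
Hypothesis sigma2 : sigma *m sigma = a%:R *: sigma.
Variable T : R.
Hypothesis T0 : 0 < T.
Local Notation tk := (stage_time T).
Variables (Y psi : nat -> R -> Omega -> 'cV[R]_n) (u : nat -> R -> Omega -> 'cV[R]_m)
  (xx : Omega -> 'cV[R]_n) (x : 'cV[R]_n) (M : R).
Local Notation G k s w := (pgain b a (tk k) s w).
Local Notation g0 s w := (pgain b a 0 s w).
Local Notation e0 s w := (pegain b a 0 s w).
Local Notation Xst k s w := (Y k s w + G k s w *: (sigma *m Y k s w)).
Hypotheses (rY : forall k, regular_matrix (P := P) beta (tk k) (Y k))
  (rpsi : forall k, regular_matrix (P := P) beta (tk k) (psi k))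
  (ru : forall k, regular_matrix (P := P) beta (tk k) (u k))
  (hrate : forall k w, has_rate (tk k) ((Y k)^~ w) ((psi k)^~ w))
  (hstart : forall w, Y 0 0 w = xx w)
  (hjoin : forall k w, Xst k (tk k.+1) w = Y k.+1 (tk k.+1) w)
  (hdrift : forall k s w, psi k s w + G k s w *: (sigma *m psi k s w) =
     - (A *m Xst k s w) + B *m u k s w)
  (hX2 : forall k s, tk k <= s <= tk k.+1 -> (\int[P]_w (mx1norm (Xst k s w) ^+ 2)%:E <= M%:E)%E)
  (hu2 : forall k s, tk k <= s <= tk k.+1 -> (\int[P]_w (mx1norm (u k s w) ^+ 2)%:E <= M%:E)%E)
  (hpsi2 : forall k s, tk k <= s <= tk k.+1 ->
     (\int[P]_w (((1 + `|G k s w|) * mx1norm (psi k s w)) ^+ 2)%:E <= M%:E)%E)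
  (hend : forall k, (\int[P]_w (mx1norm (Y k (tk k) w) ^+ 2)%:E <= (M * stage_len T k ^+ 2)%:E)%E)
  (hint : forall w i, mu.-integrable `]0, T[
     (fun s => (glue T (fun k s w => psi k s w i 0) s w)%:E))
  (hxx : {ae P, forall w, xx w = x}).

(** [ph] and [nu] are the rates, on a stage, of [glue_q] and [glue_N]. They come from inserting
    [G = (g0 s - g0 t_k) / e0 t_k] into [Y + G sigma Y]. *)
Let ph k s w : 'cV[R]_n := (e0 (tk k) w)^-1 *: (sigma *m psi k s w).
Let nu k s w : 'cV[R]_n := psi k s w + (- (g0 (tk k) w * (e0 (tk k) w)^-1)) *: (sigma *m psi k s w).
Definition glue_phi i := glue T (fun k s w => ph k s w i 0).
Definition glue_nu i := glue T (fun k s w => nu k s w i 0).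
(** The state is represented as [N + g0 q], with [N] and [q] absolutely continuous across all stages
    and the roughness only in the gain since time 0: the shape that [ito_product] handles. On stage
    [k], [q] is [sigma Y / e0 t_k]. *)
Definition glue_q i s w := (sigma *m xx w) i 0 + \int[mu]_(r in `]0, s[) glue_phi i r w.
Definition glue_N i s w := xx w i 0 + \int[mu]_(r in `]0, s[) glue_nu i r w.
Definition glue_X s w : 'cV[R]_n := \col_i (glue_N i s w + g0 s w * glue_q i s w).
Definition glue_u s w : 'cV[R]_m := \col_j glue T (fun k s w => u k s w j 0) s w.

Let e0n s w : e0 s w != 0.
Proof. by rewrite gt_eqF// pegain_gt0. Qed.

Let regular_e k : regular_process (P := P) beta (tk k) (fun _ w => (e0 (tk k) w)^-1).
Proof.
apply: (@regular_init _ _ _ _ _ (tk k) (fun w => (e0 (tk k) w)^-1)).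
have tk0 := stage_time_ge0 T0 k.
have -> : (fun w => (e0 (tk k) w)^-1) = (fun w => (e0 (tk k) w) `^ (-1)).
  by apply/funext => w; rewrite powR_inv1// ltW// pegain_gt0.
apply: (@wrt_measurable_comp _ _ _ _ _ _ (fun x => x `^ (-1))).
  exact: (wrt_measurable_pegain hb).
exact: measurable_powR.
Qed.

Let regular_g k : regular_process (P := P) beta (tk k) (fun _ w => g0 (tk k) w).
Proof.
apply: (@regular_init _ _ _ _ _ (tk k) (fun w => g0 (tk k) w)).
have tk0 := stage_time_ge0 T0 k.
exact: (wrt_measurable_pgain hb).
Qed.

Let rsp k : regular_matrix (P := P) beta (tk k) (fun s w => sigma *m psi k s w).
Proof. by apply: rmxM; [exact: rmx_cst|exact: rpsi]. Qed.

Let rph k : regular_matrix (P := P) beta (tk k) (ph k).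
Proof. by apply: (@rmxZ _ _ _ _ _ _ _ _ (fun _ w => (e0 (tk k) w)^-1)). Qed.

Let rnu k : regular_matrix (P := P) beta (tk k) (nu k).
Proof.
apply: rmxD => //; apply: (@rmxZ _ _ _ _ _ _ _ _ (fun _ w => - (g0 (tk k) w * (e0 (tk k) w)^-1))) => //.
apply: (@regular_eq _ _ _ _ _ _ (fun _ w => -1 * (g0 (tk k) w * (e0 (tk k) w)^-1))).
  by move=> s w; rewrite mulN1r.
by apply: regularM; [exact: regular_cst|exact: regularM].
Qed.

Let glue0 (f : nat -> R -> Omega -> R) s w : ~~ (0 < s < T) -> glue T f s w = 0.
Proof. by move=> h; rewrite /glue (negPf h). Qed.

(* The stage constants e0(t_k)^-1 and g0(t_k) e0(t_k)^-1 are values of a continuous path, hence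
   bounded. *)
Let factor_integrable (h : R -> R) (c : 'I_n -> R) (f : nat -> R -> Omega -> R) w :
  continuous h -> (forall k, regular_process (P := P) beta (tk k) (f k)) ->
  (forall k s, f k s w = h (tk k) * \sum_j c j * psi k s w j 0) ->
  mu.-integrable `]0, T[ (fun s => (glue T f s w)%:E).
Proof.
move=> ch rf fE.
have cah : {within `[0, T], continuous (fun s => `|h s|)}.
  by apply: continuous_subspaceT => s; exact: (cvg_norm (ch s)).
have [z _ hz] := EVT_max (ltW T0) cah.
have mg := glue_measurable T0 rf.
have mp : measurable_fun setT (fun s : RT => (s, w)) by exact: measurable_fun_pair.
have mgw := measurableT_comp mg mp.
pose D s := \sum_j c j * glue T (fun k s w => psi k s w j 0) s w.
have iD : mu.-integrable `]0, T[ (fun s => (D s)%:E).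
  by apply: integrable_sum_EFin => // j; apply: integrableZ_EFin => //; exact: hint.
apply: (@le_integrable _ _ _ mu _ _ _ (fun s => (`|h z| * D s)%:E)).
- exact: measurable_itv.
- by apply/measurable_EFinP; apply: measurable_funTS; exact: mgw.
- move=> s; rewrite /= in_itv/= => sT; rewrite lee_fin /D /glue sT fE normrM normrM normr_id.
  rewrite ler_wpM2r//; apply: hz; rewrite in_itv/= stage_time_ge0//.
  by rewrite ltW// stage_time_lt.
- exact: integrableZ_EFin.
Qed.

Let iphi w i : mu.-integrable `]0, T[ (fun s => (glue_phi i s w)%:E).
Proof.
apply: (@factor_integrable (fun s => (e0 s w)^-1) (fun j => sigma i j)).
- by move=> s; apply: cvgV; [exact: e0n|exact: (continuous_pegain_r hb)].
- by move=> k; exact: (rph k i 0).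
- by move=> k s; rewrite /ph !mxE.
Qed.

Let inu w i : mu.-integrable `]0, T[ (fun s => (glue_nu i s w)%:E).
Proof.
pose f k s w := - (g0 (tk k) w * (e0 (tk k) w)^-1) * (sigma *m psi k s w) i 0.
have rf k : regular_process (P := P) beta (tk k) (f k).
  apply: (@regular_eq _ _ _ _ _ _ (fun s w => nu k s w i 0 + -1 * psi k s w i 0)).
    by move=> s v; rewrite /nu /f !mxE; ring.
  apply: regularD; first exact: (rnu k i 0).
  by apply: regularM; [exact: regular_cst|exact: (rpsi k i 0)].
have h1 : mu.-integrable `]0, T[ (fun s => (glue T f s w)%:E).
  apply: (@factor_integrable (fun s => - (g0 s w * (e0 s w)^-1)) (fun j => sigma i j)) => //.
  - move=> s; apply: cvgN; apply: cvgM; first exact: (continuous_pgain_r hb).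
    by apply: cvgV; [exact: e0n|exact: (continuous_pegain_r hb)].
  - by move=> k s; rewrite /f mxE.
have -> : (fun s => (glue_nu i s w)%:E) = (fun s =>
    (glue T (fun k s w => psi k s w i 0) s w + glue T f s w)%:E).
  apply/funext => s; congr EFin; rewrite /glue_nu /glue; case: ifP => _; last by rewrite addr0.
  by rewrite /nu /f mxE [X in _ + X]mxE.
by apply: integrableD_EFin => //; exact: hint.
Qed.

Let cq w i : continuous (fun s => glue_q i s w).
Proof.
move=> s; apply: cvgD; first exact: cvg_cst.
by apply: (@supported_path_continuous _ T (fun r => glue_phi i r w)) => // r; exact: glue0.
Qed.

Let cN w i : continuous (fun s => glue_N i s w).
Proof.
move=> s; apply: cvgD; first exact: cvg_cst.
by apply: (@supported_path_continuous _ T (fun r => glue_nu i r w)) => // r; exact: glue0.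
Qed.

Let path_step (f : nat -> R -> Omega -> R) k s w : tk k <= s <= tk k.+1 ->
  mu.-integrable `]0, T[ (fun s => (glue T f s w)%:E) ->
  \int[mu]_(r in `]0, s[) glue T f r w =
  \int[mu]_(r in `]0, (tk k)%R[) glue T f r w + \int[mu]_(r in `](tk k)%R, s[) f k r w.
Proof.
move=> /andP[ks sk] fi; have tk0 := stage_time_ge0 T0 k.
have fi' : mu.-integrable `]0, s[ (fun s => (glue T f s w)%:E).
  by apply: (supported_integrable (T := T) (f := fun r => glue T f r w)) => // r;
    exact: glue0.
rewrite (Rintegral_cat tk0 ks fi'); congr (_ + _); apply: eq_Rintegral => r /set_mem.
rewrite /= in_itv/= => /andP[kr rs]; apply: glueE => //; first exact: le_lt_trans kr.
by rewrite (ltW kr) (lt_le_trans rs).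
Qed.

Let g0_split k s w : g0 s w = g0 (tk k) w + e0 (tk k) w * G k s w.
Proof. exact: pgain_flow. Qed.

Let qst k s w : 'cV[R]_n := (e0 (tk k) w)^-1 *: (sigma *m Y k s w).
Let Nst k s w : 'cV[R]_n := Y k s w + (- (g0 (tk k) w * (e0 (tk k) w)^-1)) *: (sigma *m Y k s w).

Let stage_step k s w : tk k <= s <= tk k.+1 ->
  (forall i, glue_q i (tk k) w = qst k (tk k) w i 0 /\ glue_N i (tk k) w = Nst k (tk k) w i 0) ->
  forall i, glue_q i s w = qst k s w i 0 /\ glue_N i s w = Nst k s w i 0.
Proof.
move=> ks h i; have [hq hN] := h i; have ks1 : tk k <= s by case/andP: ks.
have rq : has_rate (tk k) ((qst k)^~ w) ((ph k)^~ w).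
  have := has_rate_mull ((e0 (tk k) w)^-1 *: sigma) (hrate k w).
  by apply: has_rate_eq => r; rewrite -scalemxAl.
have rN : has_rate (tk k) ((Nst k)^~ w) ((nu k)^~ w).
  have := has_rateD (hrate k w)
    (has_rate_mull ((- (g0 (tk k) w * (e0 (tk k) w)^-1)) *: sigma) (hrate k w)).
  by apply: has_rate_eq => r; rewrite -scalemxAl.
split.
  rewrite /glue_q (path_step ks (iphi w i)) addrA -/(glue_q i (tk k) w) hq.
  have := congr1 (fun v : 'cV[R]_n => v i 0) (rq.2 s ks1).
  by rewrite [X in _ = X -> _]mxE [X in _ = _ + X -> _]mxE => ->.
rewrite /glue_N (path_step ks (inu w i)) addrA -/(glue_N i (tk k) w) hN.
have := congr1 (fun v : 'cV[R]_n => v i 0) (rN.2 s ks1).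
by rewrite [X in _ = X -> _]mxE [X in _ = _ + X -> _]mxE => ->.
Qed.

(** Induction over the stages. At a junction the restarted [Y] is the old [Y + G sigma Y], and the
    flow laws for [e0] and [g0] show that [q] and [N] do not jump. *)
Let stage_value k w i : glue_q i (tk k) w = qst k (tk k) w i 0 /\
  glue_N i (tk k) w = Nst k (tk k) w i 0.
Proof.
elim: k i => [|k IH] i.
  rewrite /qst /Nst stage_time0 pgain_refl pegain_refl mul0r oppr0 scale0r addr0 invr1 scale1r hstart.
  by rewrite /glue_q /glue_N Rintegral_oo_ge// addr0 Rintegral_oo_ge// addr0.
have ks : tk k <= tk k.+1 <= tk k.+1 by rewrite lexx stage_time_le.
have [-> ->] := stage_step ks IH i.
have YE := hjoin k w; set y := Y k (tk k.+1) w in YE *.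
have sYE : sigma *m Y k.+1 (tk k.+1) w = pegain b a (tk k) (tk k.+1) w *: (sigma *m y).
  rewrite -YE mulmxDr -scalemxAr mulmxA sigma2 -scalemxAl pegainE scalerDl scale1r scalerA.
  by rewrite [_ * a%:R]mulrC.
have eE : e0 (tk k.+1) w = e0 (tk k) w * pegain b a (tk k) (tk k.+1) w by exact: pegain_flow.
have gE := g0_split k (tk k.+1) w.
have e1 := e0n (tk k) w; have e2 : pegain b a (tk k) (tk k.+1) w != 0 by rewrite gt_eqF// pegain_gt0.
rewrite /qst /Nst sYE eE gE -YE -/y; move: (sigma *m y) e1 e2 => sy e1 e2.
by split; rewrite !mxE; field; rewrite e1 e2.
Qed.

Let stage_qE k s w i : tk k <= s <= tk k.+1 -> glue_q i s w = qst k s w i 0.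
Proof. by move=> ks; have [] := stage_step ks (stage_value k w) i. Qed.

Lemma glue_XE k s w : tk k <= s <= tk k.+1 -> glue_X s w = Xst k s w.
Proof.
move=> ks; apply/colP => i; have [hq hN] := stage_step ks (stage_value k w) i.
rewrite mxE hq hN (g0_split k) /qst /Nst; have e1 := e0n (tk k) w.
by move: (sigma *m Y k s w) => sy; rewrite !mxE; field.
Qed.

Let in_stage s : 0 < s < T -> exists2 k, tk k <= s < tk k.+1 & tk k <= s <= tk k.+1.
Proof.
move=> /andP[s0 sT]; have /stage_find[k ks] : 0 <= s < T by rewrite ltW.
by exists k => //; case/andP: ks => -> /ltW ->.
Qed.

(** On a stage [sigma (1 + G sigma)] is [pegain] times [sigma], and [e0] is multiplicative along the
    flow. The noise integrand thus takes the form asked by [ito_product]. *)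
Lemma glue_sigmaE s w i : 0 < s < T -> (sigma *m glue_X s w) i 0 = e0 s w * glue_q i s w.
Proof.
move=> /in_stage[k _ ks]; rewrite (glue_XE _ ks) (stage_qE _ _ ks) /qst.
have -> : sigma *m Xst k s w = pegain b a (tk k) s w *: (sigma *m Y k s w).
  rewrite mulmxDr -scalemxAr mulmxA sigma2 -scalemxAl pegainE scalerDl scale1r scalerA.
  by rewrite [_ * a%:R]mulrC.
have -> : e0 s w = e0 (tk k) w * pegain b a (tk k) s w by exact: pegain_flow.
have e1 := e0n (tk k) w; move: (sigma *m Y k s w) => sy; rewrite !mxE; by field.
Qed.

Let e0phi s w i k : 0 < s -> tk k <= s < tk k.+1 ->
  e0 s w * glue_phi i s w = pegain b a (tk k) s w * (sigma *m psi k s w) i 0.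
Proof.
move=> s0 ks; rewrite /glue_phi (glueE T0 _ _ s0 ks) /ph.
have -> : e0 s w = e0 (tk k) w * pegain b a (tk k) s w by exact: pegain_flow.
by have e1 := e0n (tk k) w; rewrite [in LHS]mxE; field.
Qed.

Lemma glue_drift s w i : 0 < s < T ->
  glue_nu i s w + (A *m glue_X s w) i 0 = - (g0 s w * glue_phi i s w) + (B *m glue_u s w) i 0.
Proof.
move=> /[dup] /andP[s0 _] /in_stage[k ks' ks]; rewrite (glue_XE _ ks).
have uE : glue_u s w = u k s w.
  by apply/colP => j; rewrite mxE (glueE T0 _ _ s0 ks').
rewrite uE /glue_nu /glue_phi !(glueE T0 _ _ s0 ks') (g0_split k) /nu /ph.
have /(congr1 (fun v : 'cV[R]_n => v i 0)) := hdrift k s w.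
have e1 := e0n (tk k) w; move: (sigma *m psi k s w) (A *m _) (B *m _) => v1 v2 v3.
rewrite !mxE => hd; apply/eqP; rewrite -subr_eq0; apply/eqP.
have -> : v3 i 0 = psi k s w i 0 + G k s w * v1 i 0 + v2 i 0 by rewrite hd; ring.
by field.
Qed.

Let within_stage s k : 0 < s -> tk k <= s < tk k.+1 -> 0 < s < T.
Proof. by move=> s0 /andP[_ h]; rewrite s0 (lt_trans h)// stage_time_lt. Qed.

Lemma glue_X_continuous w i : continuous (fun s => glue_X s w i 0).
Proof.
have -> : (fun s => glue_X s w i 0) = (fun s => glue_N i s w + g0 s w * glue_q i s w).
  by apply/funext => s; rewrite mxE.
move=> s; apply: cvgD; first exact: cN.
by apply: cvgM; [exact: (continuous_pgain_r hb)|exact: cq].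
Qed.

Let xxm i s : 0 <= s -> wrt_measurable (F s) (fun w => xx w i 0).
Proof.
move=> s0; have := (rY 0 i 0).2 0; rewrite stage_time0 lexx => /(_ isT) h.
apply: (wrt_measurableS s0); move: h; congr (wrt_measurable _ _).
by apply/funext => w; rewrite hstart.
Qed.

Lemma glue_q_adapted i s : 0 <= s <= T -> wrt_measurable (F s) (glue_q i s).
Proof.
move=> /[dup] sT /andP[s0 _]; apply: wrt_measurableD; last first.
  by apply: (glue_path_adapted T0) => // k; exact: (rph k i 0).
have -> : (fun w => (sigma *m xx w) i 0) = (fun w => \sum_j sigma i j * xx w j 0).
  by apply/funext => w; rewrite mxE.
apply/wrt_measurableP; apply: measurable_sum => j; apply: measurable_funM; first exact: measurable_cst.
by apply/wrt_measurableP; exact: xxm.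
Qed.

Lemma glue_X_adapted i s : 0 <= s <= T -> wrt_measurable (F s) (fun w => glue_X s w i 0).
Proof.
move=> /[dup] sT /andP[s0 _].
have -> : (fun w => glue_X s w i 0) = (fun w => glue_N i s w + g0 s w * glue_q i s w).
  by apply/funext => w; rewrite mxE.
apply: wrt_measurableD; last first.
  by apply: wrt_measurableM; [exact: (wrt_measurable_pgain hb)|exact: glue_q_adapted].
apply: wrt_measurableD; first exact: xxm.
by apply: (glue_path_adapted T0) => // k; exact: (rnu k i 0).
Qed.


Lemma glue_X_moment s : 0 < s < T -> (\int[P]_w (mx1norm (glue_X s w) ^+ 2)%:E <= M%:E)%E.
Proof.
move=> /in_stage[k _ ks]; under eq_integral do rewrite (glue_XE _ ks).
exact: hX2.
Qed.

Let M_ge0 : 0 <= M.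
Proof.
have h : 0 < T / 2 < T by rewrite divr_gt0//=; have := T0; lra.
rewrite -lee_fin; apply: le_trans (glue_X_moment h).
by apply: integral_ge0_EFin => w _; exact: sqr_ge0.
Qed.

Let clamp s := Num.max 0 (Num.min s T).
Let clampE s : 0 <= s <= T -> clamp s = s.
Proof. by move=> /andP[s0 sT]; rewrite /clamp (min_idPl sT) (max_idPr s0). Qed.
Let clamp_in s : 0 <= clamp s <= T.
Proof. by rewrite /clamp le_max lexx ge_max (ltW T0) ge_min lexx orbT. Qed.

Let clamped_measurable (f : R -> Omega -> R) : (forall w, continuous (fun s => f s w)) ->
  (forall s, 0 <= s <= T -> wrt_measurable (F s) (f s)) ->
  measurable_fun setT (fun z : RT * Omega => f (clamp z.1) z.2).
Proof.
move=> cf af; apply: (@measurable_continuous_process _ _ _ (fun s w => f (clamp s) w)) => [w|s].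
  exact: (@clamp_continuous _ 0 T (fun s => f s w) (cf w)).
by apply: wrt_measurable_fun (af _ (clamp_in s)).
Qed.

Let glue_X_measurable t i : t <= T ->
  measurable_fun (cylinder t) (fun z : RT * Omega => glue_X z.1 z.2 i 0).
Proof.
move=> tT; have h := clamped_measurable (fun w => @glue_X_continuous w i) (@glue_X_adapted i).
have : measurable_fun (cylinder t) (fun z : RT * Omega => glue_X (clamp z.1) z.2 i 0).
  exact: measurable_funTS.
apply: eq_measurable_fun => -[s w] /set_mem[/= + _]; rewrite in_itv/= => /andP[s0 st].
by rewrite clampE// (ltW s0) (le_trans (ltW st)).
Qed.

Lemma glue_X_square_integrable : square_integrable P T glue_X.
Proof.
move=> i; apply: (@bounded_process_L2 _ _ _ _ T (1 ^+ 2 * M)); first exact: ltW.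
  exact: glue_X_measurable.
move=> s sT; have sT' : 0 <= s <= T by case/andP: sT => /ltW -> /ltW ->.
have mXs j : measurable_fun setT (fun w => glue_X s w j 0).
  exact: wrt_measurable_fun (glue_X_adapted j sT').
apply: (@sqr_integral_le_of _ _ _ _ _ (fun w => mx1norm (glue_X s w))) => //.
- by apply: measurable_mx1norm => j k; rewrite ord1.
- by move=> w; rewrite mul1r mx1norm_entry.
- exact: glue_X_moment.
Qed.

Lemma glue_u_admissible : admissible_control P beta T glue_u.
Proof.
have ruj j k : regular_process (P := P) beta (tk k) (fun s w => u k s w j 0) by exact: ru.
have uE j : (fun s w => glue_u s w j 0) = glue T (fun k s w => u k s w j 0).
  by apply/funext => s; apply/funext => w; rewrite mxE.
split=> [s j|j].
  rewrite /= in_itv/= => /andP[s0 _].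
  have -> : (fun w => glue_u s w j 0) = glue T (fun k s w => u k s w j 0) s.
    by apply/funext => w; rewrite mxE.
  by apply: (glue_adapted T0 (ruj j)); exact: ltW.
apply: (@bounded_process_L2 _ _ _ _ T (1 ^+ 2 * M)); first exact: ltW.
  have mu_j := glue_measurable T0 (ruj j); rewrite -uE in mu_j.
  exact: measurable_funTS.
move=> s /[dup] /andP[s0 sT] /in_stage[k ks' ks].
have E w : glue_u s w j 0 = u k s w j 0 by rewrite mxE (glueE T0 _ _ s0 ks').
under eq_integral do rewrite E.
have ksl : tk k <= s by case/andP: ks.
have mus l : measurable_fun setT (fun w => u k s w l 0).
  by apply: wrt_measurable_fun ((ru k l 0).2 s ksl).
apply: (@sqr_integral_le_of _ _ _ _ _ (fun w => mx1norm (u k s w))) => //.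
- by apply: measurable_mx1norm => l l'; rewrite ord1.
- by move=> w; rewrite mul1r mx1norm_entry.
- exact: hu2.
Qed.

(** The value that [ito_product] gives to the stochastic integral of [sigma X]; it is defined path
    by path. *)
Definition glue_M t w : 'cV[R]_n := \col_i (g0 t w * glue_q i t w -
  \int[mu]_(s in `]0, t[) (g0 s w * glue_phi i s w)).

Let rphi i k : regular_process (P := P) beta (tk k) (fun s w => ph k s w i 0).
Proof. exact: rph. Qed.

Let iphi_t w i t : mu.-integrable `]0, t[ (fun s => (glue_phi i s w)%:E).
Proof.
by apply: (supported_integrable (T := T) (f := fun r => glue_phi i r w)) => // r; exact: glue0.
Qed.

Let inu_t w i t : mu.-integrable `]0, t[ (fun s => (glue_nu i s w)%:E).
Proof.
by apply: (supported_integrable (T := T) (f := fun r => glue_nu i r w)) => // r; exact: glue0.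
Qed.

Let e0phi_L2 i t : 0 <= t <= T -> process_L2 P t (fun s w => e0 s w * glue_phi i s w).
Proof.
move=> /andP[t0 tT]; apply: (@bounded_process_L2 _ _ _ _ t (mx1norm sigma ^+ 2 * M)) => //.
  have m1 := glue_measurable T0 (rphi i).
  have m2 : measurable_fun setT (fun z : RT * Omega => e0 z.1 z.2).
    exact: (measurable_egain_process hb).
  by apply: measurable_funTS; apply: measurable_funM.
move=> s /andP[s0 st]; have sT : 0 < s < T by rewrite s0 (lt_le_trans st).
have [k ks' ks] := in_stage sT; have ksl : tk k <= s by case/andP: ks.
have E w := @e0phi s w i k s0 ks'.
under eq_integral do rewrite E.
have mps l : measurable_fun setT (fun w => psi k s w l 0).
  by apply: wrt_measurable_fun ((rpsi k l 0).2 s ksl).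
have mg : measurable_fun setT (fun w => `|G k s w|).
  by apply: measurable_fun_norm; exact: measurable_pgain.
have mn : measurable_fun setT (fun w => mx1norm (psi k s w)).
  by apply: measurable_mx1norm => l l'; rewrite ord1.
apply: (@sqr_integral_le_of _ _ _ _ _ (fun w => (1 + `|G k s w|) * mx1norm (psi k s w))) => //.
- exact: mx1norm_ge0.
- apply: measurable_funM; first exact: measurable_pegain.
  by apply: wrt_measurable_fun ((rsp k i 0).2 s ksl).
- by meas.
- move=> w; rewrite normrM (ger0_norm (ltW (pegain_gt0 _ _ _ _ _))) mulrCA.
  apply: ler_pM => //; [exact: ltW (pegain_gt0 _ _ _ _ _)|exact: egain_le|].
  by apply: le_trans (mx1normM _ _); exact: mx1norm_entry.
- exact: hpsi2.
Qed.

Lemma glue_ito t i : 0 <= t <= T ->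
  is_ito_integral P beta t (fun s w => (sigma *m glue_X s w) i 0) (fun w => glue_M t w i 0).
Proof.
move=> /[dup] tT /andP[t0 tT'].
have inT s : 0 <= s <= t -> 0 <= s <= T by move=> /andP[-> /le_trans ->].
(* [ito_product] asks for joint measurability over all times; clamping the time to [[0, T]] provides
   it and changes nothing there. *)
pose qc s w := glue_q i (clamp s) w.
have qcE s w : 0 <= s <= T -> qc s w = glue_q i s w by move=> sT; rewrite /qc clampE.
have h0 : 0 <= (0 : R) <= T by rewrite lexx ltW.
have mD : measurable (`]0, t[%classic : set RT) by exact: measurable_itv.
have := @ito_product _ _ _ P beta b hbeta hb a t (glue_phi i) qc t0.
have -> : (fun w => g0 t w * qc t w - \int[mu]_(v in `]0, t[) (g0 v w * glue_phi i v w)) =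
    (fun w => glue_M t w i 0).
  by apply/funext => w; rewrite mxE qcE.
move=> H; apply: (@ito_integral_eq _ _ _ _ _ t (fun s w => e0 s w * qc s w)).
  move=> s w /andP[s0 st]; have sT : 0 < s < T by rewrite s0 (lt_le_trans st).
  by rewrite glue_sigmaE// qcE// (ltW s0) ltW//; case/andP: sT.
apply: H.
- exact: (glue_measurable T0 (rphi i)).
- by move=> r /andP[r0 _]; apply: (glue_adapted T0 (rphi i)); exact: ltW.
- by move=> w; exact: iphi_t.
- exact: (clamped_measurable (fun w => @cq w i) (@glue_q_adapted i)).
- move=> s /inT sT; have -> : qc s = glue_q i s by apply/funext => w; exact: qcE.
  exact: glue_q_adapted.
- move=> s w /inT sT; rewrite !qcE// /glue_q; congr (_ + _).
  by rewrite Rintegral_oo_ge// addr0.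
- have -> : qc 0 = (fun w => (sigma *m Y 0 0 w) i 0).
    by apply/funext => w; rewrite qcE// /glue_q Rintegral_oo_ge// addr0 hstart.
  have k0 : tk 0 <= 0 by rewrite stage_time0.
  have mY0 l : measurable_fun setT (fun w => Y 0 0 w l 0).
    by apply: wrt_measurable_fun ((rY 0 l 0).2 0 k0).
  have msY : measurable_fun setT (fun w => (sigma *m Y 0 0 w) i 0).
    have -> : (fun w => (sigma *m Y 0 0 w) i 0) = (fun w => \sum_l sigma i l * Y 0 0 w l 0).
      by apply/funext => w; rewrite mxE.
    by apply: measurable_sum => l; apply: measurable_funM.
  split => //.
  have hE := hend 0; rewrite stage_time0 in hE.
  apply: (@le_lt_trans _ _ (mx1norm sigma ^+ 2 * (M * stage_len T 0 ^+ 2))%:E); last exact: ltry.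
  apply: (@sqr_integral_le_of _ _ _ _ _ (fun w => mx1norm (Y 0 0 w))) => //.
  + exact: mx1norm_ge0.
  + by apply: measurable_mx1norm => l l'; rewrite ord1.
  + by move=> w; apply: le_trans (mx1normM _ _); exact: mx1norm_entry.
- have [mz fz] := @e0phi_L2 i t tT.
  have m2 : measurable_fun (cylinder t) (fun z : RT * Omega => (e0 z.1 z.2 * glue_phi i z.1 z.2) ^+ 2).
    by meas.
  have := @integral_cylinder1 _ _ _ P _ (fun s w => (e0 s w * glue_phi i s w) ^+ 2) mD m2
    (fun _ _ _ => sqr_ge0 _).
  by rewrite /ephi_sqr => <-.
Qed.

(** The stochastic terms cancel by the definition of [glue_M], and the time integrals match because
    the rate of [N], the drift and the term [g0 phi] add up to the control term ([glue_drift]). *)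
Lemma glue_equation t w : 0 <= t <= T -> xx w = x ->
  glue_X t w + time_integral t (fun s => A *m glue_X s w) =
  x + glue_M t w + time_integral t (fun s => B *m glue_u s w).
Proof.
move=> /[dup] tT /andP[t0 tT'] xE; apply/colP => i; rewrite !mxE -xE.
have iA : mu.-integrable `]0, t[ (fun s => ((A *m glue_X s w) i 0)%:E).
  apply: continuous_integrable.
  have -> : (fun s => (A *m glue_X s w) i 0) = (fun s => \sum_j A i j * glue_X s w j 0).
    by apply/funext => s; rewrite mxE.
  apply: continuous_sum => j s; apply: cvgM; [exact: cvg_cst|exact: glue_X_continuous].
have igp : mu.-integrable `]0, t[ (fun s => (g0 s w * glue_phi i s w)%:E).
  by apply: continuous_mul_integrable => //; exact: (continuous_pgain_r hb).
have E : \int[mu]_(s in `]0, t[) (B *m glue_u s w) i 0 =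
    \int[mu]_(s in `]0, t[) glue_nu i s w + \int[mu]_(s in `]0, t[) (A *m glue_X s w) i 0 +
    \int[mu]_(s in `]0, t[) (g0 s w * glue_phi i s w).
  have mI : measurable (`]0, t[%classic : set RT) by exact: measurable_itv.
  rewrite -(RintegralD mI (inu_t w i t) iA).
  rewrite -(RintegralD mI (integrableD_EFin mI (inu_t w i t) iA) igp).
  apply: eq_Rintegral => s /set_mem; rewrite /= in_itv/= => /andP[s0 st].
  have sT : 0 < s < T by rewrite s0 (lt_le_trans st).
  by rewrite glue_drift//; ring.
by rewrite E /glue_N; ring.
Qed.

Lemma glue_solution : sde_solution P beta A B sigma T x glue_u glue_X.
Proof.
split.
- by move=> t i; rewrite /= in_itv/=; exact: glue_X_adapted.
- exact: glue_X_square_integrable.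
- apply/aeW => w; apply: continuous_subspaceT => s; apply/cvg_ballP => e e0.
  have h i : \forall r \near nbhs s, ball (glue_X s w i 0) e (glue_X r w i 0).
    by have /cvg_ballP/(_ _ e0) := @glue_X_continuous w i s.
  have H := @filter_forall R 'I_n (fun i r => ball (glue_X s w i 0) e (glue_X r w i 0)) (nbhs s) (nbhs_filter s) h.
  by apply: filterS H => r hr; split=> // i j; rewrite ord1; exact: hr.
- have ks : tk 0 <= 0 <= tk 1 by rewrite (stage_time_ge0 T0) stage_time0 lexx.
  move: hxx; apply: filterS => w <-.
  by rewrite (glue_XE w ks) stage_time0 pgain_refl scale0r addr0 hstart.
- exists glue_M => t; rewrite in_itv/= => tT; split=> [i|]; first exact: glue_ito.
  by move: hxx; apply: filterS => w; exact: glue_equation.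
Qed.

(** At time [t_k] the state is the starting value of stage [k], whose second moment is at most [M]
    times the squared stage length. Path continuity at [T] and Fatou pass to the limit. *)
Lemma glue_terminal : {ae P, forall w, glue_X T w = 0}.
Proof.
have TT : 0 <= T <= T by rewrite lexx ltW.
have mX s : 0 <= s <= T -> measurable_fun setT (fun w => (mx1norm (glue_X s w) ^+ 2)%:E).
  move=> sT; apply/measurable_EFinP; apply: measurable_funX; apply: measurable_mx1norm => i j.
  by rewrite ord1; exact: wrt_measurable_fun (glue_X_adapted i sT).
have tkT k : 0 <= tk k <= T by rewrite stage_time_ge0// ltW// stage_time_lt.
have ctk : tk k @[k --> \oo] --> T.
  have h : T * (2^-1) ^+ k @[k --> \oo] --> T * 0.
    by apply: cvgM; [exact: cvg_cst|apply: cvg_expr; rewrite ger0_norm ?invr_ge0//; lra].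
  rewrite -[X in _ --> X]subr0 -(mulr0 T); under eq_fun do rewrite /stage_time -exprVn.
  by apply: cvgB => //; exact: cvg_cst.
have cX w : mx1norm (glue_X (tk k) w) ^+ 2 @[k --> \oo] --> mx1norm (glue_X T w) ^+ 2.
  rewrite expr2; under eq_fun do rewrite expr2.
  have h : mx1norm (glue_X (tk k) w) @[k --> \oo] --> mx1norm (glue_X T w).
    apply: cvg_mx1norm => i j; rewrite ord1.
    exact: (@continuous_cvg _ R R \oo _ tk (fun s => glue_X s w i 0) T (glue_X_continuous (i := i) (x := T)) ctk).
  exact: cvgM.
have le0 : (\int[P]_w (mx1norm (glue_X T w) ^+ 2)%:E <= 0)%E.
  have f0 k w : [set: Omega] w -> (0 <= (mx1norm (glue_X (tk k) w) ^+ 2)%:E)%E.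
    by move=> _; rewrite lee_fin sqr_ge0.
  have := @fatou _ _ _ P setT measurableT (fun k w => (mx1norm (glue_X (tk k) w) ^+ 2)%:E)
    (fun k => mX _ (tkT k)) f0.
  have u0 : (\int[P]_w (mx1norm (glue_X (tk k) w) ^+ 2)%:E)%E @[k --> \oo] --> 0%E.
    (* The geometric decay is weakened to the rate [1 / (k + 1)] that [cvge_div_nat] expects. *)
    apply: (@cvge_div_nat _ (M * T ^+ 2)) => k; apply/andP; split.
      by apply: integral_ge0_EFin => w _; exact: sqr_ge0.
    have ks : tk k <= tk k <= tk k.+1 by rewrite lexx stage_time_le.
    under eq_integral do rewrite (glue_XE _ ks) pgain_refl scale0r addr0.
    apply: le_trans (hend k) _; rewrite lee_fin -mulrA ler_wpM2l ?M_ge0//.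
    rewrite /stage_len exprMn ler_wpM2l ?sqr_ge0// exprVn lef_pV2 ?posrE ?exprn_gt0 ?ltr0n//.
    apply: (@le_trans _ _ (2 ^+ k.+1)); first by rewrite -natrX ler_nat ltnW// ltn_expl.
    by rewrite expr2 ler_peMr ?exprn_ge0// exprn_ege1//; lra.
  rewrite (cvg_limn_einf_sup u0).1; congr (_ <= _)%E.
  apply: eq_integral => w _; apply: (cvg_limn_einf_sup _).1.
  by apply/fine_cvgP; split; [exact: nearW|exact: cX].
have i0 : (\int[P]_w `|(mx1norm (glue_X T w) ^+ 2)%:E| = 0)%E.
  apply/eqP; rewrite eq_le; apply/andP; split; last exact: integral_ge0.
  apply: le_trans le0; rewrite le_eqVlt; apply/orP; left; apply/eqP.
  by apply: eq_integral => w _; rewrite gee0_abs// lee_fin sqr_ge0.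
move: i0 => /(ae_eq_integral_abs P measurableT (mX _ TT)); apply: filterS => w /(_ Logic.I) /= /eqP.
by rewrite eqe sqrf_eq0 => /eqP; exact: mx1norm_eq0.
Qed.

End GlueSDE.

(* The contraction factor D * stage_len T k tends to 0, so it eventually beats the factor 1/4 by
   which the square of the stage length decreases. *)
Lemma contraction_bound {R : realType} (T D c : R) (v : nat -> \bar R) : 0 < T -> 0 <= D -> 0 <= c ->
  (v 0%N <= c%:E)%E -> (forall k, v k.+1 <= (D * stage_len T k)%:E * v k)%E ->
  exists2 V, 0 <= V & forall k, (v k <= (V * stage_len T k ^+ 2)%:E)%E.
Proof.
(* The 4 is the square of the ratio of consecutive stage lengths. *)
move=> T0 D0 c0 v0 vS; pose z := 4 * D * T.
have z0 : 0 <= z by rewrite !mulr_ge0// ltW.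
pose K := (Num.truncn z).+1.
have zK : z <= 2 ^+ K.
  apply: le_trans (ltW (truncnS_gt z)) _; rewrite -natrX ler_nat; exact/ltnW/ltn_expl.
pose V0 := c / stage_len T 0 ^+ 2.
have l0 k := stage_len_gt0 T0 k.
have V00 : 0 <= V0 by rewrite divr_ge0// sqr_ge0.
(* From index [K] on, [4 * D * stage_len T k <= 1] and the constant no longer grows; before that,
   each step costs at most a factor [1 + z]. *)
have main k : (v k <= (V0 * (1 + z) ^+ minn k K * stage_len T k ^+ 2)%:E)%E.
  elim: k => [|k IH].
    by rewrite min0n expr0 mulr1 divfK// expf_neq0// gt_eqF.
  set W := V0 * (1 + z) ^+ minn k K in IH.
  have W0 : 0 <= W by rewrite mulr_ge0// exprn_ge0// addr_ge0.
  have Dl0 : 0 <= D * stage_len T k by rewrite mulr_ge0// ltW.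
  apply: le_trans (vS k) _; apply: le_trans (lee_wpmul2l _ IH) _; first by rewrite lee_fin.
  rewrite -EFinM lee_fin stage_lenS.
  suff h : 4 * D * stage_len T k * W <= V0 * (1 + z) ^+ minn k.+1 K.
    have -> : D * stage_len T k * (W * stage_len T k ^+ 2) =
      (4 * D * stage_len T k * W) * (stage_len T k / 2) ^+ 2 by field.
    by rewrite ler_wpM2r// sqr_ge0.
  have [kK|Kk] := ltnP k K.
    rewrite /W (minn_idPl kK) (minn_idPl (ltnW kK)) exprS [leRHS]mulrCA.
    have zl : 4 * D * stage_len T k <= 1 + z.
      have h : 4 * D * stage_len T k <= z by rewrite /z ler_wpM2l ?mulr_ge0 ?stage_len_le.
      by apply: le_trans h _; rewrite lerDr.
    by apply: ler_wpM2r => //; rewrite mulr_ge0// exprn_ge0// addr_ge0.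
  have h1 : 4 * D * stage_len T k <= 1.
    rewrite /stage_len mulrA ler_pdivrMr ?exprn_gt0// mul1r; apply: le_trans zK _.
    by apply: ler_weXn2l; [lra|exact: leqW].
  rewrite /W (minn_idPr Kk) (minn_idPr (leqW Kk)); apply: ler_piMl => //.
  by rewrite mulr_ge0// exprn_ge0// addr_ge0.
exists (V0 * (1 + z) ^+ K); first by rewrite mulr_ge0// exprn_ge0// addr_ge0.
move=> k; apply: le_trans (main k) _; rewrite lee_fin ler_wpM2r ?sqr_ge0// ler_wpM2l//.
by apply: ler_weXn2l; [rewrite lerDl|exact: geq_minr].
Qed.

Lemma scale_mx1 {R : realType} N : @scale_mx R N 1 = 1%:M.
Proof. by apply/matrixP => i j; rewrite !mxE expr1n. Qed.

Lemma regular_modification_exists {R : realType} {d : measure_display} {Omega : measurableType d}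
  (P : probability Omega R) (beta : R -> {RV P >-> R}) : brownian_motion beta ->
  exists b : R -> {RV P >-> R}, regular_modification beta b.
Proof.
by move=> /continuous_modification[b [cb b0 ab bN bb]]; exists b.
Qed.

Lemma mx1norm_weighted {R : realType} p q (c : R) (X : 'M[R]_(p, q)) : 0 <= c <= 1 ->
  mx1norm (c *: X) <= mx1norm X.
Proof.
by move=> /andP[c0 c1]; rewrite mx1normZ ger0_norm// ler_piMl// mx1norm_ge0.
Qed.

(** * Assembly of the stages into a control *)

Section Assembly.
Context {R : realType} {d : measure_display} {Omega : measurableType d}.
Variables (P : probability Omega R) (beta b : R -> {RV P >-> R}).
Hypotheses (hbeta : brownian_motion beta) (hb : regular_modification beta b).
Local Notation F := (augmented_filtration P (fun r => beta r)).
Local Notation RT := (measurableTypeR R).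
Local Notation mu := (@lebesgue_measure R).
Variables (a : bool) (m N : nat).
Local Notation n := N.+2.
Variables (A : 'M[R]_n) (B : 'M[R]_(n, m)) (K : 'M[R]_(m, n)).
Hypothesis KBK : K *m B *m K = a%:R *: K.
Local Notation sigma := (B *m K).
Variable T : R.
Hypothesis T0 : 0 < T.
Local Notation tk := (stage_time T).
Local Notation dk := (stage_len T).

(** Each stage starts from the random coordinates left by the previous one, so a choice function on
    pairs of an index and coordinates is iterated. *)
Lemma stage_sequence (C : R) (U0 : 'M[R]_(m, n)) :
  (forall c dl (U : Omega -> 'M[R]_(m, n)), 0 <= c -> 0 < dl <= T ->
    (forall i j, wrt_measurable (F c) (fun w => U w i j)) ->
    exists U' Y psi u, stage_solution beta b a A B K C c dl U U' Y psi u) ->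
  exists (U : nat -> Omega -> 'M[R]_(m, n)) Y psi u, [/\ U 0%N = (fun=> U0),
    forall k i j, wrt_measurable (F (tk k)) (fun w => U k w i j) &
    forall k, stage_solution beta b a A B K C (tk k) (dk k) (U k) (U k.+1) (Y k) (psi k) (u k)].
Proof.
move=> hC; pose ad k (U : Omega -> 'M[R]_(m, n)) :=
  forall i j, wrt_measurable (F (tk k)) (fun w => U w i j).
pose Q : Type := ((Omega -> 'M[R]_(m, n)) * (R -> Omega -> 'cV[R]_n) *
  (R -> Omega -> 'cV[R]_n) * (R -> Omega -> 'cV[R]_m))%type.
(* Adaptedness is kept inside the implication to make the choice total; the recursion supplies it
   afterwards. *)
have step (kU : nat * (Omega -> 'M[R]_(m, n))) : exists q : Q, ad kU.1 kU.2 ->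
    stage_solution beta b a A B K C (tk kU.1) (dk kU.1) kU.2 q.1.1.1 q.1.1.2 q.1.2 q.2.
  have [h|h] := pselect (ad kU.1 kU.2); last first.
    by exists ((fun=> 0), (fun _ _ => 0), (fun _ _ => 0), (fun _ _ => 0)) => /h.
  have lk : 0 < dk kU.1 <= T by rewrite stage_len_gt0// stage_len_le.
  have [U' [Y [psi [u S]]]] := hC (tk kU.1) (dk kU.1) kU.2 (stage_time_ge0 T0 _) lk h.
  by exists (U', Y, psi, u).
have [f hf] := choice step.
pose U := fix U k := if k is k'.+1 then (f (k', U k')).1.1.1 else (fun=> U0).
have aU k : ad k (U k).
  elim: k => [|k IH] i j; first exact: wrt_measurable_cst.
  by rewrite -stage_timeS; exact: (stage_out_measurable (hf (k, U k) IH)).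
exists U, (fun k => (f (k, U k)).1.1.2), (fun k => (f (k, U k)).1.2), (fun k => (f (k, U k)).2).
by split=> // k; exact: (hf (k, U k) (aU k)).
Qed.

(** The contraction makes the second moments of the coordinates at most [V] times the squared stage
    lengths, which cancels the price of the stages in [stage_moments]. State and control are then
    bounded in mean square up to [T], which is what the gluing needs. *)
Lemma steering_exists (x : 'cV[R]_n) : \rank (kalman_matrix A B) = n ->
  exists u, admissible_control P beta T u /\ exists X,
    sde_solution P beta A B sigma T x u X /\ {ae P, forall w, X T w = 0}.
Proof.
move=> rk.
have sigma2 : sigma *m sigma = a%:R *: sigma.
  by rewrite -mulmxA [K *m _]mulmxA KBK -scalemxAr.
have T0' : 0 <= T by exact: ltW.
have pex (l : 'I_n) := steering_poly (R := R) n (N.+1 - l).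
have [p hp] := choice pex.
have p0 (l : 'I_n) i : (i < n)%N -> (p l)^`(i).[0] = (i == N.+1 - l)%N%:R by have [h _] := hp l; exact: h.
have p1 (l : 'I_n) i : (i < n)%N -> (p l)^`(i).[1] = 0 by have [_ h] := hp l; exact: h.
have [C C0 hC] := stage_exists hb A KBK p0 p1 T0'.
have [D D0 hD] := stage_moments hbeta hb a A B K C0 T0'.
have [Z ZE] := chain_lift_surj x rk.
(* The inverse scaling makes the first stage start at [x]. *)
pose U0 := Z *m scale_mx (dk 0)^-1.
have l0 k := stage_len_gt0 T0 k; have lT k := stage_len_le T0 k.
have [U [Y [psi [u [U00 aU S]]]]] := stage_sequence U0 hC.
pose v k := (\int[P]_w (mx1norm (U k w) ^+ 2)%:E)%E.
have lk k : 0 < dk k <= T by rewrite l0 lT.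
have v0 : (v 0%N <= (mx1norm U0 ^+ 2)%:E)%E.
  rewrite /v U00 (eq_integral (fun=> (mx1norm U0 ^+ 2)%:E))//.
  by rewrite integral_cst//= probability_setT mule1.
have vS k : (v k.+1 <= (D * dk k)%:E * v k)%E.
  by have [h _] := hD _ _ _ _ _ _ _ (stage_time_ge0 T0 k) (lk k) (aU k) (S k).
have [V V0 hV] := contraction_bound T0 D0 (sqr_ge0 _) v0 vS.
have moment k : ((D * (dk k)^-1 ^+ 2)%:E * v k <= (D * V)%:E)%E.
  apply: le_trans (lee_wpmul2l _ (hV k)) _.
    by rewrite lee_fin mulr_ge0// exprn_ge0// invr_ge0 ltW.
  rewrite -EFinM lee_fin le_eqVlt; apply/orP; left; apply/eqP.
  by field; rewrite gt_eqF.
have Sm k s : tk k <= s <= tk k.+1 -> tk k <= s <= tk k + dk k by rewrite stage_timeS.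
have mom k s (ks : tk k <= s <= tk k.+1) :=
  (hD _ _ _ _ _ _ _ (stage_time_ge0 T0 k) (lk k) (aU k) (S k)).2 s (Sm _ _ ks).
have rpsi k := stage_psi_regular (S k); have rY k := stage_Y_regular (S k).
have ru k := stage_u_regular (S k).
have mreg q r k s (X : R -> Omega -> 'M[R]_(q, r)) : tk k <= s ->
    regular_matrix (P := P) beta (tk k) X -> forall i j, measurable_fun setT (fun w => X s w i j).
  by move=> ks rX i j; apply: wrt_measurable_fun ((rX i j).2 s ks).
pose ps i := glue T (fun k s w => psi k s w i 0).
have rps i k : regular_process (P := P) beta (tk k) (fun s w => psi k s w i 0) by exact: rpsi.
have mps i : measurable_fun setT (fun z : RT * Omega => ps i z.1 z.2).
  exact: (glue_measurable T0 (rps i)).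
have mI : measurable (`]0, T[%classic : set RT) by exact: measurable_itv.
have psL i : process_L2 P T (ps i).
  apply: (@bounded_process_L2 _ _ _ _ T (1 ^+ 2 * (D * V))) => //; first by apply: measurable_funTS; exact: mps.
  move=> s /andP[s0 sT]; have /stage_find[k ks] : 0 <= s < T by rewrite ltW.
  have ks' : tk k <= s <= tk k.+1 by case/andP: ks => -> /ltW.
  have ksl : tk k <= s by case/andP: ks.
  under eq_integral do rewrite /ps (glueE T0 _ _ s0 ks).
  apply: (@sqr_integral_le_of _ _ _ _ _
    (fun w => (1 + `|pgain b a (tk k) s w|) * mx1norm (psi k s w))) => //.
  - exact: (mreg _ _ k).
  - apply: measurable_funM.
      by apply: measurable_funD => //; apply: measurable_fun_norm; exact: measurable_pgain.
    by apply: measurable_mx1norm; exact: (mreg _ _ k).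
  - move=> w; rewrite mul1r; apply: le_trans (mx1norm_entry _ i 0) _.
    by rewrite ler_peMl ?mx1norm_ge0// lerDl.
  - by have [_ _ h] := mom k s ks'; apply: le_trans h (moment k).
have m2 i : measurable_fun (cylinder T) (fun z : RT * Omega => ps i z.1 z.2 ^+ 2).
  by have mi := mps i; apply: measurable_funTS; meas.
pose E i w := (\int[mu]_(s in `]0%R, T[) (ps i s w ^+ 2)%:E)%E.
have E0 i w : (0 <= E i w)%E by apply: integral_ge0_EFin => s _; exact: sqr_ge0.
have Ei i : P.-integrable setT (E i).
  apply/integrableP; split.
    exact: (@measurable_path_integral _ _ _ _ (fun s w => ps i s w ^+ 2) mI (m2 i)
      (fun _ _ _ => sqr_ge0 _)).
  under eq_integral do rewrite gee0_abs//.
  rewrite -(@integral_cylinder2 _ _ _ P _ (fun s w => ps i s w ^+ 2) mI (m2 i)); last first.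
    by move=> *; exact: sqr_ge0.
  exact: (psL i).2.
have : {ae P, forall w, forall i, setT w -> E i w \is a fin_num}.
  by apply: filter_forall => i; exact: integrable_ae (Ei i).
(* [Nl] is a null set off which every coordinate of the glued rate [psi] is square integrable in
   time. *)
move=> [Nl [mN N0 hN]].
have finE w i : ~ Nl w -> (E i w < +oo)%E.
  move=> Nw; apply: contrapT => h; apply: Nw; apply: hN => /= H; apply: h.
  by have := H i Logic.I; rewrite ge0_fin_numE.
(* The gluing asks for integrable rates on every path, so all processes are multiplied by the
   indicator of the good set. The stage identities survive by linearity, adaptedness because [Nl] is
   null, and the initial value stays [x] almost surely. *)
pose ind w : R := \1_(~` Nl) w.
have ind01 w : 0 <= ind w <= 1 by rewrite /ind indicE; case: (_ \in _); rewrite !lexx ler01.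
have mind : measurable_fun setT ind by apply: measurable_indic; exact: measurableC.
have aind k : regular_process (P := P) beta (tk k) (fun _ => ind).
  apply: regular_init; apply: (@wrt_measurable_null _ _ _ P beta (tk k) Nl (fun=> 1)) => //.
    by move=> w Nw; rewrite /ind indicE mem_set.
  exact: wrt_measurable_cst.
have rind q r k (X : R -> Omega -> 'M[R]_(q, r)) : regular_matrix (P := P) beta (tk k) X ->
    regular_matrix (P := P) beta (tk k) (fun s w => ind w *: X s w).
  by move=> rX; apply: (@rmxZ _ _ _ _ _ _ _ _ (fun _ => ind)).
pose Y' k s w := ind w *: Y k s w; pose psi' k s w := ind w *: psi k s w.
pose u' k s w := ind w *: u k s w; pose xx w := ind w *: x.
have XE k s w : Y' k s w + pgain b a (tk k) s w *: (sigma *m Y' k s w) =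
    ind w *: (Y k s w + pgain b a (tk k) s w *: (sigma *m Y k s w)).
  by rewrite /Y' -scalemxAr scalerDr !scalerA mulrC.
pose cl := (\sum_(i < n) mx1norm (chain_mx A B i)) * (\sum_(i < n) T ^+ i).
have cl0 : 0 <= cl.
  rewrite mulr_ge0// sumr_ge0// => i _; [exact: mx1norm_ge0|exact: exprn_ge0].
(* The first summand bounds state, control and rate; the second bounds the starting values of the
   stages, whose lift costs [cl]. *)
pose M := D * V + cl ^+ 2 * V.
have DM : ((D * V)%:E <= M%:E)%E by rewrite lee_fin lerDl mulr_ge0// sqr_ge0.
have wmom q r (X : Omega -> 'M[R]_(q, r)) : (forall i j, measurable_fun setT (fun w => X w i j)) ->
    (\int[P]_w (mx1norm (X w) ^+ 2)%:E <= M%:E)%E ->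
    (\int[P]_w (mx1norm (ind w *: X w) ^+ 2)%:E <= M%:E)%E.
  move=> mX hX; rewrite -[M]mul1r -(expr1n R 2).
  have mn := measurable_mx1norm mX.
  apply: (@sqr_integral_le_of _ _ _ _ _ (fun w => mx1norm (X w))) => //.
    by under eq_fun do rewrite mx1normZ; apply: measurable_funM => //; exact: measurable_fun_norm.
  by move=> w; rewrite mul1r ger0_norm ?mx1norm_ge0// mx1norm_weighted.
have rXst k : regular_matrix (P := P) beta (tk k)
    (fun s w => Y k s w + pgain b a (tk k) s w *: (sigma *m Y k s w)).
  apply: rmxD; first exact: rY.
  apply: rmxZ; first by apply: regular_pgain => //; exact: stage_time_ge0.
  by apply: rmxM; [exact: rmx_cst|exact: rY].
have rY' k : regular_matrix (P := P) beta (tk k) (Y' k) by exact: rind.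
have rpsi' k : regular_matrix (P := P) beta (tk k) (psi' k) by exact: rind.
have ru' k : regular_matrix (P := P) beta (tk k) (u' k) by exact: rind.
have hrate k w : has_rate (tk k) ((Y' k)^~ w) ((psi' k)^~ w).
  have := has_rate_mull ((ind w)%:M) (stage_rate (S k) w).
  by apply: has_rate_eq => s; rewrite mul_scalar_mx.
have hstart w : Y' 0%N 0 w = xx w.
  have := stage_start (S 0%N) w; rewrite stage_time0 /Y' /xx => ->; congr (_ *: _).
  rewrite U00 /U0 -mulmxA scale_mxM mulVf ?gt_eqF// scale_mx1 mulmx1.
  exact: ZE.
have hjoin k w : Y' k (tk k.+1) w + pgain b a (tk k) (tk k.+1) w *: (sigma *m Y' k (tk k.+1) w) =
    Y' k.+1 (tk k.+1) w.
  rewrite XE /Y' -stage_timeS (stage_end (S k) w) stage_timeS (stage_start (S k.+1) w).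
  by rewrite stage_lenS.
have hdrift k s w : psi' k s w + pgain b a (tk k) s w *: (sigma *m psi' k s w) =
    - (A *m (Y' k s w + pgain b a (tk k) s w *: (sigma *m Y' k s w))) + B *m u' k s w.
  rewrite XE /psi' /u' -!scalemxAr scalerA [_ * ind w]mulrC -scalerA -scalerDr.
  by rewrite (stage_drift (S k)) scalerDr scalerN.
have hX2 k s : tk k <= s <= tk k.+1 -> (\int[P]_w (mx1norm (Y' k s w +
    pgain b a (tk k) s w *: (sigma *m Y' k s w)) ^+ 2)%:E <= M%:E)%E.
  move=> /[dup] ks /andP[ksl _]; under eq_integral do rewrite XE.
  apply: wmom; first exact: (mreg _ _ k _ _ ksl (rXst k)).
  by have [h _ _] := mom k s ks; apply: le_trans h (le_trans (moment k) DM).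
have hu2 k s : tk k <= s <= tk k.+1 -> (\int[P]_w (mx1norm (u' k s w) ^+ 2)%:E <= M%:E)%E.
  move=> /[dup] ks /andP[ksl _]; apply: wmom; first exact: (mreg _ _ k).
  by have [_ h _] := mom k s ks; apply: le_trans h (le_trans (moment k) DM).
have hpsi2 k s : tk k <= s <= tk k.+1 ->
    (\int[P]_w (((1 + `|pgain b a (tk k) s w|) * mx1norm (psi' k s w)) ^+ 2)%:E <= M%:E)%E.
  move=> /[dup] ks /andP[ksl _].
  have E1 w : (1 + `|pgain b a (tk k) s w|) * mx1norm (psi' k s w) =
      mx1norm (ind w *: ((1 + `|pgain b a (tk k) s w|) *: psi k s w)).
    have G0 : 0 <= 1 + `|pgain b a (tk k) s w| by rewrite addr_ge0.
    by rewrite /psi' !mx1normZ (ger0_norm G0); ring.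
  have E2 w : mx1norm ((1 + `|pgain b a (tk k) s w|) *: psi k s w) =
      (1 + `|pgain b a (tk k) s w|) * mx1norm (psi k s w).
    by rewrite mx1normZ ger0_norm// addr_ge0.
  under eq_integral do rewrite E1.
  apply: wmom.
    move=> i j; under eq_fun do rewrite mxE.
    apply: measurable_funM; last exact: (mreg _ _ k).
    by apply: measurable_funD => //; apply: measurable_fun_norm; exact: measurable_pgain.
  under eq_integral do rewrite E2.
  by have [_ _ h] := mom k s ks; apply: le_trans h (le_trans (moment k) DM).
have hend k : (\int[P]_w (mx1norm (Y' k (tk k) w) ^+ 2)%:E <= (M * dk k ^+ 2)%:E)%E.
  have bd w : `|mx1norm (Y' k (tk k) w)| <= cl * mx1norm (U k w).
    rewrite ger0_norm ?mx1norm_ge0//; apply: le_trans (mx1norm_weighted _ (ind01 w)) _.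
    rewrite (stage_start (S k)); apply: le_trans (chain_lift_norm _ _ _) _.
    rewrite /cl -mulrA ler_wpM2l//; first by apply: sumr_ge0 => i _; exact: mx1norm_ge0.
    apply: le_trans (mx1normM _ _) _; rewrite mulrC ler_wpM2r ?mx1norm_ge0//.
    by apply: scale_mx_norm; rewrite lT ltW.
  have mU : measurable_fun setT (fun w => mx1norm (U k w)).
    by apply: measurable_mx1norm => i j; apply: wrt_measurable_fun (aU k i j).
  have mY : measurable_fun setT (fun w => mx1norm (Y' k (tk k) w)).
    by apply: measurable_mx1norm; exact: (mreg _ _ k).
  apply: le_trans (@sqr_integral_le_of _ _ _ P _ _ _ cl cl0 mY mU bd (hV k)) _.
  rewrite lee_fin mulrA ler_wpM2r ?sqr_ge0// lerDr mulr_ge0//.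
have hint w i : mu.-integrable `]0, T[ (fun s => (glue T (fun k s w => psi' k s w i 0) s w)%:E).
  have gE : (fun s => (glue T (fun k s w => psi' k s w i 0) s w)%:E) = (fun s => (ind w * ps i s w)%:E).
    apply/funext => s; rewrite /ps /glue; case: ifP => _; last by rewrite mulr0.
    by rewrite /psi' mxE.
  rewrite gE; have [Nw|Nw] := pselect (Nl w).
    have -> : (fun s => (ind w * ps i s w)%:E) = (fun=> 0%E).
      apply/funext => s; have -> : ind w = 0 by rewrite /ind indicE memNset// => /(_ Nw).
      by rewrite mul0r.
    exact: integrable0.
  have -> : (fun s => (ind w * ps i s w)%:E) = (fun s => (ps i s w)%:E).
    apply/funext => s; have -> : ind w = 1 by rewrite /ind indicE mem_set.
    by rewrite mul1r.
  apply: (@sqr_integrable _ _ _ mu _ T) => //.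
  - by rewrite -[in RHS](subr0 T); exact: lebesgue_measure_oo.
  - have mp : measurable_fun setT (fun s : RT => (s, w)) by exact: measurable_fun_pair.
    by apply: measurable_funTS; exact: (measurableT_comp (mps i) mp).
  - exact: finE.
have hxx : {ae P, forall w, xx w = x}.
  exists Nl; split=> // w /=; apply: contra_notP => Nw.
  by rewrite /xx /ind indicE mem_set// scale1r.
exists (glue_u T u'); split; first exact: (glue_u_admissible T0 ru' hu2).
exists (glue_X b a sigma T psi' xx); split.
  exact: (glue_solution hbeta hb sigma2 T0 rY' rpsi' hrate hstart hjoin hdrift hX2 hpsi2 hend hint hxx).
exact: (glue_terminal hb sigma2 T0 rY' rpsi' hrate hstart hjoin hX2 hend hint).
Qed.

End Assembly.

Theorem theorem4p3 (R : realType) (d : measure_display)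
  (Omega : measurableType d) (P : probability Omega R)
  (beta : R -> {RV P >-> R}) (hbeta : brownian_motion beta)
  (m n : nat) (hm : (1 <= m)%N) (hmn : (m < n)%N)
  (A : 'M[R]_n) (B : 'M[R]_(n, m)) (sigma : 'M[R]_n)
  (kalman : \rank (kalman_matrix A B) = n)
  (sigma_pow : exists a : R, forall k : nat, (2 <= k)%N ->
     sigma ^+ k = a *: sigma)
  (sigma_B : forall y : 'cV[R]_n, exists v : 'cV[R]_m,
     sigma *m y = B *m v)
  (T : R) (hT : 0 < T) (x : 'cV[R]_n) :
  exists u : R -> Omega -> 'cV[R]_m,
    [/\ admissible_control P beta T u,
        exists X : R -> Omega -> 'cV[R]_n,
          sde_solution P beta A B sigma T x u X &
        forall X : R -> Omega -> 'cV[R]_n,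
          sde_solution P beta A B sigma T x u X ->
          {ae P, forall w, X T w = 0}].
Proof.
have [a sigma2] := power_eigen_bool sigma_pow.
have [K [sigmaE KBK]] := range_factor sigma_B sigma2.
have [b hb] := regular_modification_exists hbeta.
have [u [hu [X [hX XT]]]] : exists u, admissible_control P beta T u /\ exists X,
    sde_solution P beta A B sigma T x u X /\ {ae P, forall w, X T w = 0}.
  have n2 : (1 < n)%N by exact: leq_ltn_trans hm hmn.
  rewrite -sigmaE; clear sigmaE sigma2 sigma_B sigma_pow hmn.
  (* A stage uses a column 1 besides column 0, hence the dimension [N.+2]; smaller dimensions are
     excluded by [1 <= m < n]. *)
  case: n n2 A B sigma kalman x K KBK => [|[|N]] // _ A' B' _ rk x' K' KBK'.
  exact: (steering_exists hbeta hb KBK' hT x' rk).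
exists u; split => //; first by exists X.
move=> X' hX'; have TT : 0 <= T <= T by rewrite lexx ltW.
(* Uniqueness carries the terminal value 0 from the constructed solution to every solution with the
   same control. *)
have XX := sde_unique hbeta hb (ltW hT) hX hX' TT.
by apply: filterS2 XX XT => w -> .
Qed.
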